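(* Let $\tfrac12\le\theta<1$, let $A:\mathbb{R}^m\to\mathbb{R}^d$ be a linear map with transpose ${}^tA$, and let $\Gamma\subset\mathbb{R}^{2d}\setminus\{0\}$ be a closed cone such that $$\Gamma\cap\{(0,\xi)\,:\,{}^tA\xi=0\}=\emptyset.$$ Then the pull-back $A^*:\mathcal{S}_\theta(\mathbb{R}^d)\to\mathcal{S}_\theta(\mathbb{R}^m)$, $A^*f=f\circ A$, can be uniquely extended to a continuous map $\mathcal{S}'_{\theta,\Gamma}(\mathbb{R}^d)\to\mathcal{S}'_{\theta,A^*\Gamma}(\mathbb{R}^m)$, where $$A^*\Gamma=\{(x,{}^tA\xi)\,:\,(Ax,\xi)\in\Gamma\}.$$
   Context: The following definitions apply in every dimension $d$. $\mathcal{S}_\theta(\mathbb{R}^d)$ is the union over $C>0$ of the Banach spaces of all $f\in C^\infty(\mathbb{R}^d)$ with $\sup_{\alpha,\beta\in\mathbb{N}^d}\sup_{x\in\mathbb{R}^d} C^{-|\alpha|-|\beta|}(\alpha!\,\beta!)^{-\theta}|x^\alpha\partial^\beta f(x)|<\infty$, with the inductive limit topology. $\mathcal{S}_\theta'(\mathbb{R}^d)$ is its topological dual with the weak topology; $\langle\cdot,\cdot\rangle$ is the bilinear duality pairing, and elements of $\mathcal{S}_\theta$ are regarded as elements of $\mathcal{S}_\theta'$ by integration. $T^*\mathbb{R}^d$ is identified with $\mathbb{R}^{2d}$; a subset of $\mathbb{R}^{2d}\setminus\{0\}$ is conic (a cone) if it is invariant under multiplication of all $2d$ coordinates by positive reals;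 closed means closed in $\mathbb{R}^{2d}\setminus\{0\}$. Global wave front set: for $u\in\mathcal{S}_\theta'(\mathbb{R}^d)$, a point $(x_0,\xi_0)\in\mathbb{R}^{2d}\setminus\{0\}$ is not in $\mathrm{WF}^\theta_{\mathrm{gl}}(u)$ iff there are an open conic neighbourhood $\Gamma'$ of $(x_0,\xi_0)$ and $C,\varepsilon>0$ with $|\langle u_y, e^{-i\langle y,\xi\rangle-\frac12|y-x|^2}\rangle|\le C e^{-\varepsilon(|x|^{1/\theta}+|\xi|^{1/\theta})}$ for all $(x,\xi)\in\Gamma'$. For a closed cone $\Gamma\subset\mathbb{R}^{2d}\setminus\{0\}$, $\mathcal{S}'_{\theta,\Gamma}(\mathbb{R}^d)=\{u\in\mathcal{S}'_\theta(\mathbb{R}^d):\mathrm{WF}^\theta_{\mathrm{gl}}(u)\subset\Gamma\}$, with the following notion of convergence: $u_n\to0$ in $\mathcal{S}'_{\theta,\Gamma}$ if (1) $u_n\to 0$ in $\mathcal{S}'_\theta$, and (2) every $z\in(\mathbb{R}^{2d}\setminus\{0\})\setminus\Gamma$ has a conic neighbourhood $L$ and constants $C,\varepsilon>0$ such that $|\langle (u_n)_y,e^{-i\langle y,\xi\rangle-\frac12|y-x|^2}\rangle|\le Ce^{-\varepsilon(|x|^{1/\theta}+|\xi|^{1/\theta})}$ for all $n$ and all $(x,\xi)\in L$; $u_n\to u$ means $u_n-u\to0$. Continuity is with respect to this convergence.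
   Formalization: It is assumed that f∘A lies in S_θ(R^m) for all f in S_θ(R^d), which forces A to be injective; for non-injective A, f∘A is constant along ker A, A^* does not map into S_θ(R^m), and the claim fails. *)

(* Defs.v *)
From HB Require Import structures.
From mathcomp Require Import all_boot all_order all_algebra.
From mathcomp Require Import all_classical all_reals all_analysis.
From mathcomp Require Import complex.

Set Implicit Arguments.
Unset Strict Implicit.
Unset Printing Implicit Defensive.

Import Order.TTheory GRing.Theory Num.Theory.
Import numFieldNormedType.Exports.

Local Open Scope classical_set_scope.
Local Open Scope complex_scope.
Local Open Scope ring_scope.

(* The library norm `|z| of z : R[i] has values in R[i]; cabs is the real-valued
   modulus. *)
Definition cabs (R : realType) (z : R[i]) : R := ComplexField.Normc.normc z.

Definition partial (R : realType) (d : nat) (j : 'I_d) (f : 'cV[R]_d -> R) :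
  'cV[R]_d -> R := fun x => 'D_(delta_mx j 0) f x.

Definition iter_partial (R : realType) (d : nat) (s : seq 'I_d)
  (f : 'cV[R]_d -> R) : 'cV[R]_d -> R := foldr (@partial R d) f s.

(* C^oo: partial derivatives of all orders exist and are continuous. *)
Definition smooth (R : realType) (d : nat) (f : 'cV[R]_d -> R) : Prop :=
  forall s : seq 'I_d, continuous (iter_partial s f) /\
    forall (j : 'I_d) (x : 'cV[R]_d),
      derivable (iter_partial s f) x (delta_mx j 0).

Definition re_part (R : realType) (d : nat) (f : 'cV[R]_d -> R[i]^o) :
  'cV[R]_d -> R := fun x => complex.Re (f x).

Definition im_part (R : realType) (d : nat) (f : 'cV[R]_d -> R[i]^o) :
  'cV[R]_d -> R := fun x => complex.Im (f x).

Definition csmooth (R : realType) (d : nat) (f : 'cV[R]_d -> R[i]^o) : Prop :=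
  smooth (re_part f) /\ smooth (im_part f).

Definition mi_size (d : nat) (a : 'I_d -> nat) : nat := (\sum_j a j)%N.

Definition mi_fact (d : nat) (a : 'I_d -> nat) : nat := (\prod_j (a j)`!)%N.

Definition mi_seq (d : nat) (a : 'I_d -> nat) : seq 'I_d :=
  flatten [seq nseq (a j) j | j <- enum 'I_d].

Definition mi_power (R : realType) (d : nat) (x : 'cV[R]_d)
  (a : 'I_d -> nat) : R := \prod_j x j 0 ^+ a j.

Definition cpartial (R : realType) (d : nat) (b : 'I_d -> nat)
  (f : 'cV[R]_d -> R[i]^o) (x : 'cV[R]_d) : R[i] :=
  iter_partial (mi_seq b) (re_part f) x +i*
  iter_partial (mi_seq b) (im_part f) x.

Definition gs_norm (R : realType) (theta c : R) (d : nat)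
  (f : 'cV[R]_d -> R[i]^o) : \bar R :=
  ereal_sup [set r : \bar R |
    exists (a b : 'I_d -> nat) (x : 'cV[R]_d),
      r = (c ^- (mi_size a + mi_size b) *
           (mi_fact a * mi_fact b)%N%:R `^ (- theta) *
           cabs ((mi_power x a)%:C * cpartial b f x))%:E].

Definition gs_step (R : realType) (theta c : R) (d : nat) :
  set ('cV[R]_d -> R[i]^o) :=
  [set f | csmooth f /\ (gs_norm theta c f < +oo)%E].

Definition gs_set (R : realType) (theta : R) (d : nat) :
  set ('cV[R]_d -> R[i]^o) :=
  \bigcup_(c in [set c : R | 0 < c]) gs_step theta c (d := d).

Definition gs_pred (R : realType) (theta : R) (d : nat) :
  {pred ('cV[R]_d -> R[i]^o)} := mem (gs_set theta (d := d)).

Section gs_submod.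
Context {R : realType} {d : nat}.
Implicit Types (f g : 'cV[R]_d -> R) (F G : 'cV[R]_d -> R[i]^o).

Lemma smooth0 : smooth (fun _ : 'cV[R]_d => 0 : R).
Proof.
have H s : iter_partial s (fun _ : 'cV[R]_d => 0 : R) = fun=> 0.
  elim: s => //= j s ->; apply/funext => x; rewrite /partial.
  exact: derive_cst.
by move=> s; rewrite H; split=> [|j x];
  [exact: cst_continuous|exact: derivable_cst].
Qed.

Lemma smooth_lin (a b : R) f g : smooth f -> smooth g ->
  (forall s, iter_partial s (fun x => a * f x + b * g x) =
     fun x => a * iter_partial s f x + b * iter_partial s g x) /\
  smooth (fun x => a * f x + b * g x).
Proof.
move=> sf sg.
have E s : iter_partial s (fun x => a * f x + b * g x) =
     fun x => a * iter_partial s f x + b * iter_partial s g x.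
  elim: s => //= j s ->; apply/funext => x; rewrite /partial.
  have [_ df] := sf s; have [_ dg] := sg s.
  rewrite (_ : (fun _ => _) = a \*: iter_partial s f + b \*: iter_partial s g)//.
  rewrite deriveD; [|exact: derivableZ|exact: derivableZ].
  by rewrite !deriveZ.
split=> // s; rewrite E.
have [cf df] := sf s; have [cg dg] := sg s; split.
  move=> x.
  exact: (cvgD (cvgM (cvg_cst a) (cf x)) (cvgM (cvg_cst b) (cg x))).
move=> j x.
rewrite (_ : (fun _ => _) = a \*: iter_partial s f + b \*: iter_partial s g)//.
by apply: derivableD; apply: derivableZ.
Qed.

Lemma re_part_lin (k : R[i]) F G : re_part (k *: F + G) =
  fun x => 1 * (complex.Re k * re_part F x + - complex.Im k * im_part F x)
           + 1 * re_part G x.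
Proof.
apply/funext => x; rewrite /re_part /im_part/= [in LHS]/GRing.scale/=.
rewrite [(_ + _) x]/GRing.add/= /GRing.scale/= !mul1r.
by case: k (F x) (G x) => [a b] [p q] [s t] /=; rewrite mulNr.
Qed.

Lemma im_part_lin (k : R[i]) F G : im_part (k *: F + G) =
  fun x => 1 * (complex.Re k * im_part F x + complex.Im k * re_part F x)
           + 1 * im_part G x.
Proof.
apply/funext => x; rewrite /re_part /im_part/= [in LHS]/GRing.scale/=.
rewrite [(_ + _) x]/GRing.add/= /GRing.scale/= !mul1r.
by case: k (F x) (G x) => [a b] [p q] [s t].
Qed.

Lemma csmooth_lin (k : R[i]) F G : csmooth F -> csmooth G ->
  csmooth (k *: F + G) /\
  forall b x, cpartial b (k *: F + G) x = k * cpartial b F x + cpartial b G x.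
Proof.
move=> [rF iF] [rG iG].
have [E1 S1] := smooth_lin (complex.Re k) (- complex.Im k) rF iF.
have [E2 S2] := smooth_lin (complex.Re k) (complex.Im k) iF rF.
have [E3 S3] := smooth_lin 1 1 S1 rG.
have [E4 S4] := smooth_lin 1 1 S2 iG.
split; first by rewrite /csmooth re_part_lin im_part_lin.
move=> b x; rewrite /cpartial re_part_lin im_part_lin E3 E4 E1 E2.
clear E1 E2 E3 E4 S1 S2 S3 S4.
by rewrite !mul1r mulNr; case: k.
Qed.

Definition gs_term (theta c : R) F a b x : R :=
  c ^- (mi_size a + mi_size b) * (mi_fact a * mi_fact b)%N%:R `^ (- theta) *
  cabs ((mi_power x a)%:C * cpartial b F x).

Lemma gs_norm_ltP (theta c : R) F : (gs_norm theta c F < +oo)%E <->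
  exists M : R, forall a b x, gs_term theta c F a b x <= M.
Proof.
split=> [Foo|[M FM]]; last first.
  apply: (@le_lt_trans _ _ M%:E); last by rewrite ltry.
  by apply: ge_ereal_sup => _ [a [b [x ->]]]; rewrite lee_fin; exact: FM.
have H a b x : ((gs_term theta c F a b x)%:E <= gs_norm theta c F)%E.
  by apply: ereal_sup_ubound; exists a, b, x.
case: (gs_norm theta c F) Foo H => [r _ H|//|_ H].
  by exists r => a b x; rewrite -lee_fin; exact: H.
by exists 0 => a b x; have := H a b x; rewrite leeNy_eq.
Qed.

Lemma gs_submod_closed (theta : R) : submod_closed (gs_pred theta (d := d)).
Proof.
split.
  rewrite inE; exists 1 => /=; first exact: ltr01.
  split; first by split; exact: smooth0.
  apply/gs_norm_ltP; exists 0 => a b x; rewrite /gs_term.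
  have E0 s : iter_partial s (fun _ : 'cV[R]_d => 0 : R) = fun=> 0.
    elim: s => //= j s ->; apply/funext => y; rewrite /partial.
    exact: derive_cst.
  rewrite /cpartial (_ : re_part _ = fun=> 0)// (_ : im_part _ = fun=> 0)// !E0.
  by rewrite /cabs mulr0 ComplexField.Normc.normc0 mulr0.
move=> k F G; rewrite !inE => -[c1 /= c1_gt0 [sF /gs_norm_ltP[M1 F1]]].
move=> [c2 /= c2_gt0 [sG /gs_norm_ltP[M2 G2]]].
have [sFG EFG] := csmooth_lin k sF sG.
have c_gt0 : 0 < Num.max c1 c2 by rewrite lt_max c1_gt0.
exists (Num.max c1 c2) => //=; split=> //.
apply/gs_norm_ltP; exists (cabs k * M1 + M2) => a b x.
have normc_ge0 (z : R[i]) : 0 <= cabs z by case: z => p q; exact: sqrtr_ge0.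
have mono c H : 0 < c -> c <= Num.max c1 c2 ->
    gs_term theta (Num.max c1 c2) H a b x <= gs_term theta c H a b x.
  move=> c0 cm; rewrite /gs_term ler_wpM2r// ler_wpM2r ?powR_ge0//.
  rewrite lef_pV2 ?posrE ?exprn_gt0//.
  by rewrite lerXn2r// nnegrE ltW.
apply: (@le_trans _ _ (cabs k * gs_term theta (Num.max c1 c2) F a b x +
                       gs_term theta (Num.max c1 c2) G a b x)); last first.
  apply: lerD.
    by apply: ler_wpM2l => //; apply: le_trans (F1 a b x); apply: mono;
      rewrite ?le_max ?lexx.
  by apply: le_trans (G2 a b x); apply: mono; rewrite ?le_max ?lexx ?orbT.
rewrite /gs_term EFG mulrCA -mulrDr; apply: ler_wpM2l.
  by rewrite mulr_ge0 ?powR_ge0// invr_ge0 exprn_ge0// ltW.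
by rewrite /cabs -ComplexField.Normc.normcM mulrDr mulrCA; exact: le_normcD.
Qed.

End gs_submod.

HB.instance Definition _ (R : realType) (theta : R) (d : nat) :=
  GRing.isSubmodClosed.Build R[i] ('cV[R]_d -> R[i]^o) (gs_pred theta (d := d))
    (gs_submod_closed theta).

Record gs (R : realType) (theta : R) (d : nat) := GS {
  gs_fun :> 'cV[R]_d -> R[i]^o;
  gs_funP : gs_fun \in gs_pred theta (d := d) }.

HB.instance Definition _ (R : realType) (theta : R) (d : nat) :=
  [isSub for @gs_fun R theta d].
HB.instance Definition _ (R : realType) (theta : R) (d : nat) :=
  [Choice of gs theta d by <:].
HB.instance Definition _ (R : realType) (theta : R) (d : nat) :=
  [SubChoice_isSubLmodule of gs theta d by <:].

(* Neighbourhoods of 0 for the inductive limit topology, i.e. the finest locally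
   convex topology making every inclusion of a Banach step continuous: a base is
   given by the absolutely convex sets whose trace on each step is a
   neighbourhood of 0. *)
Definition abs_convex (R : realType) (E : lmodType R[i]) (V : set E) : Prop :=
  forall (f g : E) (a b : R[i]), V f -> V g -> cabs a + cabs b <= 1 ->
    V (a *: f + b *: g).

Definition gs_nbhs0 (R : realType) (theta : R) (d : nat)
  (U : set (gs theta d)) : Prop :=
  exists V : set (gs theta d), [/\ V `<=` U, abs_convex V &
    forall c : R, 0 < c -> exists2 r : R, 0 < r &
      forall f : gs theta d, (gs_norm theta c f < r%:E)%E -> V f].

Record gs_dual (R : realType) (theta : R) (d : nat) := GSDual {
  gs_dual_fun :> {linear gs theta d -> R[i]^o};
  gs_dual_continuous : forall (f : gs theta d) (e : R), 0 < e ->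
    gs_nbhs0 [set h | cabs (gs_dual_fun (f + h) - gs_dual_fun f) < e] }.

(* The value 0 is a default outside the Gelfand-Shilov space.  It is never used
   on wave packets when 1/2 <= theta, because they belong to that space. *)
Definition pairing (R : realType) (theta : R) (d : nat) (u : gs_dual theta d)
  (f : 'cV[R]_d -> R[i]^o) : R[i] :=
  if insub f : option (gs theta d) is Some g then u g else 0.

Definition gs_dual_cvg (R : realType) (theta : R) (d : nat)
  (u_ : nat -> gs_dual theta d) (u : gs_dual theta d) : Prop :=
  forall f : gs theta d, cabs (u_ n f - u f) @[n --> \oo] --> (0 : R).

(* Lebesgue integral over R^d as an iterated integral; used only for products
   of two functions of a Gelfand-Shilov space, for which Fubini applies. *)
Fixpoint integralRd (R : realType) (d : nat) : ('cV[R]_d -> R) -> R :=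
  match d with
  | 0 => fun f => f 0
  | d'.+1 => fun f => \int[lebesgue_measure]_(t in setT)
      integralRd (fun y : 'cV[R]_d' => f (col_mx (const_mx t : 'cV[R]_1) y))
  end.

Definition cintegralRd (R : realType) (d : nat) (f : 'cV[R]_d -> R[i]^o) :
  R[i] := integralRd (re_part f) +i* integralRd (im_part f).

Definition is_embedding (R : realType) (theta : R) (d : nat)
  (f : gs theta d) (u : gs_dual theta d) : Prop :=
  forall g : gs theta d, u g = cintegralRd (fun x => f x * g x).

Definition dotp (R : realType) (d : nat) (x y : 'cV[R]_d) : R :=
  \sum_j x j 0 * y j 0.

(* Euclidean norm; the library norm on matrices is the sup norm. *)
Definition enorm (R : realType) (d : nat) (x : 'cV[R]_d) : R :=
  Num.sqrt (dotp x x).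

(* exp (- i <y, xi> - |y - x|^2 / 2) *)
Definition wave_packet (R : realType) (d : nat) (z : 'cV[R]_d * 'cV[R]_d)
  (y : 'cV[R]_d) : R[i]^o :=
  let r := expR (- (enorm (y - z.1) ^+ 2 / 2)) in
  (r * cos (- dotp y z.2)) +i* (r * sin (- dotp y z.2)).

Definition decay_weight (R : realType) (theta eps : R) (d : nat)
  (z : 'cV[R]_d * 'cV[R]_d) : R :=
  expR (- (eps * (enorm z.1 `^ theta^-1 + enorm z.2 `^ theta^-1))).

Definition conic (R : realType) (d : nat) (G : set ('cV[R]_d * 'cV[R]_d)) :
  Prop :=
  ~ G 0 /\ forall (t : R) z, 0 < t -> G z -> G (t *: z.1, t *: z.2).

(* Closed relative to the complement of 0. *)
Definition closed_cone (R : realType) (d : nat)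
  (G : set ('cV[R]_d * 'cV[R]_d)) : Prop :=
  conic G /\ exists2 F : set ('cV[R]_d * 'cV[R]_d),
    closed F & G = F `\ (0 : 'cV[R]_d * 'cV[R]_d).

Definition WF (R : realType) (theta : R) (d : nat) (u : gs_dual theta d) :
  set ('cV[R]_d * 'cV[R]_d) :=
  [set z0 | z0 <> 0 /\ ~ exists G : set ('cV[R]_d * 'cV[R]_d),
    [/\ open G, conic G, G z0 &
      exists C eps : R, [/\ 0 < C, 0 < eps & forall z, G z ->
        cabs (pairing u (wave_packet z)) <= C * decay_weight theta eps z]]].

Definition gs_dual_WF (R : realType) (theta : R) (d : nat)
  (G : set ('cV[R]_d * 'cV[R]_d)) : Type :=
  {u : gs_dual theta d | WF u `<=` G}.

Definition gs_dual_WF_cvg (R : realType) (theta : R) (d : nat)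
  (G : set ('cV[R]_d * 'cV[R]_d)) (u_ : nat -> gs_dual_WF theta G)
  (u : gs_dual_WF theta G) : Prop :=
  gs_dual_cvg (fun n => sval (u_ n)) (sval u) /\
  forall z0, z0 <> 0 -> ~ G z0 -> exists L : set ('cV[R]_d * 'cV[R]_d),
    [/\ conic L, nbhs z0 L &
      exists C eps : R, [/\ 0 < C, 0 < eps & forall n z, L z ->
        cabs (pairing (sval (u_ n)) (wave_packet z) -
              pairing (sval u) (wave_packet z))
          <= C * decay_weight theta eps z]].

Definition WF_continuous (R : realType) (theta : R) (d m : nat)
  (G : set ('cV[R]_d * 'cV[R]_d)) (G' : set ('cV[R]_m * 'cV[R]_m))
  (T : gs_dual_WF theta G -> gs_dual_WF theta G') : Prop :=
  forall (u_ : nat -> gs_dual_WF theta G) (u : gs_dual_WF theta G),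
    gs_dual_WF_cvg u_ u -> gs_dual_WF_cvg (fun n => T (u_ n)) (T u).

Definition pullback_cone (R : realType) (d m : nat) (A : 'M[R]_(d, m))
  (G : set ('cV[R]_d * 'cV[R]_d)) : set ('cV[R]_m * 'cV[R]_m) :=
  [set z | exists x xi, G (A *m x, xi) /\ z = (x, A^T *m xi)].

(* Main.v *)
(* Let V u z be the pairing of u with the wave packet at the phase space point z = (x', xi). By
   Fourier inversion u is a superposition of conjugate wave packets with coefficients V u z, and
   the pull-back of u is the same superposition of the packets composed with A. Paired with a test
   function g, such a packet gives kern A g x' (A^T xi), which decays like
   exp (- e (|x'|^(1/theta) + |A^T xi|^(1/theta))); in the directions where x' = 0 and A^T xi = 0
   the coefficient V u itself decays, because these directions are not in the cone, so by
   compactness of the sphere the integral over phase space converges. The same dichotomy with g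
   a wave packet at w bounds the wave front set: where x' - A w.1 and A^T xi - w.2 are both small
   compared with |z| + |w|, either V u decays or w is close to A^* Gamma. All the estimates hold
   uniformly for a convergent sequence, whose transforms grow uniformly by a gliding hump argument,
   so the pull-back is continuous. Damping V u by exp (- |z|^(1/theta) / k) gives elements of the
   Gelfand-Shilov space that converge to u with control of the wave front sets, hence
   uniqueness. *)
From HB Require Import structures.
Require Import Defs.
From mathcomp Require Import all_boot all_order all_algebra.
From mathcomp Require Import all_classical all_reals all_analysis.
From mathcomp Require Import measurable_realfun complex ring lra.
Import Order.TTheory GRing.Theory Num.Theory.
Import numFieldNormedType.Exports.
Local Open Scope classical_set_scope.
Local Open Scope ring_scope.

Set Implicit Arguments.
Unset Strict Implicit.
Unset Printing Implicit Defensive.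

(** A functional is bounded only on each Banach step, with a constant depending on the step. Hence
    packets are estimated as follows: for every k > 0 a single step c contains all of them, with
    norm at most C exp (k q(z)). This gives V u growth below every exp (k q) and lets u be exchanged
    with superpositions. Here q is the sum of the |coordinate|^(1/theta); exponentials of q factor
    over coordinates, and q (x + y) <= 4 (q x + q y). Most factors in the rates come from this
    inequality or from reserving part of a rate for integrability. The condition theta >= 1/2 puts
    the Gaussian below a multiple of exp (- q / 2). That the pull-back maps into the Gelfand-Shilov
    space forces A to be injective, and this keeps the origin of phase space out of the wave front
    estimate. The estimates concern families V over an arbitrary index type with uniform constants,
    so that one argument serves single functionals (existence) and sequences (continuity). *)

Local Notation Re := complex.Re.
Local Notation Im := complex.Im.
Local Open Scope complex_scope.

(** * Modulus and unit phases of complex numbers *)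

Section cabs.
Context {R : realType}.
Implicit Types (z w : R[i]) (r : R).

Lemma cabsE (a b : R) : cabs (a +i* b) = Num.sqrt (a ^+ 2 + b ^+ 2).
Proof. by []. Qed.

Lemma cabs_ge0 z : 0 <= cabs z.
Proof. by case: z => a b; exact: sqrtr_ge0. Qed.

#[global] Arguments cabs {R} z : simpl never.

Lemma cabs0 : cabs (0 : R[i]) = 0.
Proof. exact: ComplexField.Normc.normc0. Qed.

Lemma cabs_eq0 z : cabs z = 0 -> z = 0.
Proof. exact: ComplexField.Normc.eq0_normc. Qed.

Lemma cabsM z w : cabs (z * w) = cabs z * cabs w.
Proof. exact: ComplexField.Normc.normcM. Qed.

Lemma cabsN z : cabs (- z) = cabs z.
Proof. by case: z => a b; rewrite /cabs/= !sqrrN. Qed.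

Lemma cabsD z w : cabs (z + w) <= cabs z + cabs w.
Proof. exact: (@le_normcD R). Qed.

Lemma cabsB z w : cabs (z - w) <= cabs z + cabs w.
Proof. by rewrite (le_trans (cabsD _ _))// cabsN. Qed.

Lemma cabs_dist z w : cabs (z - w) = cabs (w - z).
Proof. by rewrite -cabsN opprB. Qed.

Lemma cabs_trans (w z t : R[i]) : cabs (z - t) <= cabs (z - w) + cabs (w - t).
Proof. by apply: le_trans (cabsD _ _); rewrite addrA subrK. Qed.

Lemma cabsR r : cabs r%:C = `|r|.
Proof. by rewrite /cabs/= expr0n addr0 sqrtr_sqr. Qed.

Lemma cabs1 : cabs (1 : R[i]) = 1.
Proof. exact: ComplexField.Normc.normc1. Qed.

Lemma cabs_Re z : `|Re z| <= cabs z.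
Proof. by case: z => a b; rewrite cabsE -sqrtr_sqr ler_wsqrtr//= lerDl sqr_ge0. Qed.

Lemma cabs_Im z : `|Im z| <= cabs z.
Proof. by case: z => a b; rewrite cabsE -sqrtr_sqr ler_wsqrtr//= lerDr sqr_ge0. Qed.

Lemma cabs_le z : cabs z <= `|Re z| + `|Im z|.
Proof.
case: z => a b; have -> : a +i* b = a%:C + 'i * b%:C by simpc.
apply: le_trans (cabsD _ _) _; rewrite cabsM !cabsR cabsE.
by rewrite expr0n expr1n add0r sqrtr1 mul1r /= !(mulr0, mul0r, mul1r, addr0, add0r, subr0).
Qed.

Lemma cabs_sqr z : cabs z ^+ 2 = Re z ^+ 2 + Im z ^+ 2.
Proof. by case: z => a b; rewrite cabsE sqr_sqrtr// addr_ge0 ?sqr_ge0. Qed.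

Lemma cabs_prod (I : Type) (s : seq I) (P : pred I) (F : I -> R[i]) :
  cabs (\prod_(i <- s | P i) F i) = \prod_(i <- s | P i) cabs (F i).
Proof. by apply: (big_morph _ cabsM cabs1). Qed.

Lemma cabs_conj z : cabs z^* = cabs z.
Proof. by case: z => a b; rewrite /cabs/= sqrrN. Qed.

Definition cis (t : R) : R[i] := cos t +i* sin t.

Lemma cabs_cis t : cabs (cis t) = 1.
Proof. by rewrite cabsE cos2Dsin2 sqrtr1. Qed.

Lemma cisD s t : cis (s + t) = cis s * cis t.
Proof. by rewrite /cis cosD sinD; apply/eqP; rewrite eq_complex/= eqxx/= addrC eqxx. Qed.

Lemma cis0 : cis 0 = 1.
Proof. by rewrite /cis cos0 sin0. Qed.

Lemma cisN t : cis (- t) = (cis t)^*.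
Proof. by rewrite /cis cosN sinN. Qed.

Lemma cis_sum (I : Type) (s : seq I) (P : pred I) (F : I -> R) :
  cis (\sum_(i <- s | P i) F i) = \prod_(i <- s | P i) cis (F i).
Proof. exact: (big_morph _ cisD cis0). Qed.

Lemma Re_add z w : Re (z + w) = Re z + Re w. Proof. by case: z w => ? ? []. Qed.
Lemma Im_add z w : Im (z + w) = Im z + Im w. Proof. by case: z w => ? ? []. Qed.
Lemma Re_opp z : Re (- z) = - Re z. Proof. by case: z. Qed.
Lemma Im_opp z : Im (- z) = - Im z. Proof. by case: z. Qed.
Lemma Re_mul z w : Re (z * w) = Re z * Re w - Im z * Im w.
Proof. by case: z w => ? ? []. Qed.
Lemma Im_mul z w : Im (z * w) = Re z * Im w + Im z * Re w.
Proof. by case: z w => ? ? []. Qed.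

Lemma real_complexM (r s : R) : (r * s)%:C = r%:C * s%:C.
Proof. by apply/eqP; rewrite eq_complex/= !mulr0 !mul0r subr0 addr0 !eqxx. Qed.

End cabs.

Lemma ceq {R : realType} (z w : R[i]) : Re z = Re w -> Im z = Im w -> z = w.
Proof. by case: z w => ? ? [? ?] /= -> ->. Qed.

(** * Measurability and integration of complex functions *)

Section cint.
Context {R : realType} {dX : measure_display} {X : measurableType dX}.
Implicit Types (mu : {measure set X -> \bar R}) (f g : X -> R[i]) (w : X -> R).

Definition cmeas f := measurable_fun setT (fun x => Re (f x)) /\
  measurable_fun setT (fun x => Im (f x)).

Definition rintegrable mu w := mu.-integrable setT (EFin \o w).

Definition cintegrable mu f := rintegrable mu (fun x => Re (f x)) /\
  rintegrable mu (fun x => Im (f x)).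

Definition cint mu f : R[i] :=
  (\int[mu]_(x in setT) Re (f x)) +i* (\int[mu]_(x in setT) Im (f x)).

Lemma cmeasD f g : cmeas f -> cmeas g -> cmeas (fun x => f x + g x).
Proof.
move=> [f1 f2] [g1 g2]; split.
  under eq_fun do rewrite Re_add; exact: measurable_funD.
under eq_fun do rewrite Im_add; exact: measurable_funD.
Qed.

Lemma cmeasN f : cmeas f -> cmeas (fun x => - f x).
Proof.
move=> [f1 f2]; split.
  by under eq_fun do rewrite Re_opp; exact: measurableT_comp.
by under eq_fun do rewrite Im_opp; exact: measurableT_comp.
Qed.

Lemma cmeasB f g : cmeas f -> cmeas g -> cmeas (fun x => f x - g x).
Proof. by move=> mf mg; apply: cmeasD => //; exact: cmeasN. Qed.

Lemma cmeasM f g : cmeas f -> cmeas g -> cmeas (fun x => f x * g x).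
Proof.
move=> [f1 f2] [g1 g2]; split.
  under eq_fun do rewrite Re_mul; apply: measurable_funB; exact: measurable_funM.
under eq_fun do rewrite Im_mul; apply: measurable_funD; exact: measurable_funM.
Qed.

Lemma cmeas_cst (c : R[i]) : cmeas (fun=> c).
Proof. by split; exact: measurable_cst. Qed.

Lemma cmeas_real w : measurable_fun setT w -> cmeas (fun x => (w x)%:C).
Proof. by move=> mw; split => //; exact: measurable_cst. Qed.

Lemma cmeas_cis w : measurable_fun setT w -> cmeas (fun x => cis (w x)).
Proof.
move=> mw; split; apply: measurableT_comp mw.
  by apply: continuous_measurable_fun; exact: continuous_cos.
by apply: continuous_measurable_fun; exact: continuous_sin.
Qed.

Lemma cmeas_conj f : cmeas f -> cmeas (fun x => (f x)^*).
Proof.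
move=> [f1 f2]; split => /=.
  by rewrite (_ : (fun _ => _) = fun x => Re (f x))//; apply/funext => x; case: (f x).
rewrite (_ : (fun _ => _) = fun x => - Im (f x)); first exact: measurableT_comp.
by apply/funext => x; case: (f x).
Qed.

Lemma measurable_cabs f : cmeas f -> measurable_fun setT (fun x => cabs (f x)).
Proof.
move=> [f1 f2].
rewrite (_ : (fun _ => _) = fun x => Num.sqrt (Re (f x) ^+ 2 + Im (f x) ^+ 2)).
  apply: measurableT_comp => //; first by apply: continuous_measurable_fun; exact: sqrt_continuous.
  by apply: measurable_funD; exact: measurable_funX.
by apply/funext => x; case: (f x).
Qed.

Lemma rintegrable_dom mu w w' : measurable_fun setT w -> rintegrable mu w' ->
  (forall x, `|w x| <= w' x) -> rintegrable mu w.
Proof.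
move=> mw iw' h; apply: le_integrable iw' => //; first exact/measurable_EFinP.
by move=> x _; rewrite /= lee_fin (le_trans (h x))// ler_norm.
Qed.

Lemma cintegrable_dom mu f w : cmeas f -> rintegrable mu w ->
  (forall x, cabs (f x) <= w x) -> cintegrable mu f.
Proof.
move=> [m1 m2] iw h; split; apply: (rintegrable_dom _ iw) => // x.
  exact: le_trans (cabs_Re _) (h x).
exact: le_trans (cabs_Im _) (h x).
Qed.

Lemma cintegrable_cmeas mu f : cintegrable mu f -> cmeas f.
Proof. by move=> [/measurable_int/measurable_EFinP ? /measurable_int/measurable_EFinP ?]. Qed.

Lemma rintegrableD mu w w' : rintegrable mu w -> rintegrable mu w' ->
  rintegrable mu (fun x => w x + w' x).
Proof. by move=> i1 i2; exact: (integrableD measurableT i1 i2). Qed.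

Lemma rintegrableZ mu w c : rintegrable mu w -> rintegrable mu (fun x => c * w x).
Proof. by move=> i1; exact: (integrableZl measurableT c i1). Qed.

Lemma rintegrable_norm mu w : rintegrable mu w -> rintegrable mu (fun x => `|w x|).
Proof.
move=> iw; apply: (le_integrable measurableT _ _ iw) => /=.
  apply/measurable_EFinP; apply: measurableT_comp => //.
  by move: iw => /measurable_int/measurable_EFinP.
by move=> x _; rewrite /= normr_id.
Qed.

Lemma cintegrable_abs mu f : cintegrable mu f -> rintegrable mu (fun x => cabs (f x)).
Proof.
move=> [i1 i2]; apply: (@rintegrable_dom _ _ (fun x => `|Re (f x)| + `|Im (f x)|)).
- exact: measurable_cabs (cintegrable_cmeas (conj i1 i2)).
- by apply: rintegrableD; exact: rintegrable_norm.
- by move=> x; rewrite ger0_norm ?cabs_ge0// cabs_le.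
Qed.

Lemma cintegrableM mu f g (c : R) : cintegrable mu f -> cmeas g ->
  (forall x, cabs (g x) <= c) -> cintegrable mu (fun x => g x * f x).
Proof.
move=> fi mg gc; apply: (@cintegrable_dom _ _ (fun x => c * cabs (f x))).
- exact: cmeasM mg (cintegrable_cmeas fi).
- by apply: rintegrableZ; exact: cintegrable_abs.
- by move=> x; rewrite cabsM ler_wpM2r ?cabs_ge0.
Qed.

Lemma cintegrableZ mu f c : cintegrable mu f -> cintegrable mu (fun x => c * f x).
Proof. by move=> fi; apply: (cintegrableM fi (cmeas_cst c) (fun=> lexx _)). Qed.

Lemma cintD mu f g : cintegrable mu f -> cintegrable mu g ->
  cint mu (fun x => f x + g x) = cint mu f + cint mu g.
Proof.
move=> [f1 f2] [g1 g2]; apply: ceq => /=.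
  by under eq_Rintegral do rewrite Re_add; rewrite RintegralD.
by under eq_Rintegral do rewrite Im_add; rewrite RintegralD.
Qed.

Lemma cintZ mu f c : cintegrable mu f -> cint mu (fun x => c * f x) = c * cint mu f.
Proof.
move=> [f1 f2]; case: c => a b; apply: ceq => /=.
  under eq_Rintegral do rewrite Re_mul.
  by rewrite RintegralB ?RintegralZl//; exact: (rintegrableZ).
under eq_Rintegral do rewrite Im_mul.
by rewrite RintegralD ?RintegralZl//; exact: (rintegrableZ).
Qed.

Lemma cintB mu f g : cintegrable mu f -> cintegrable mu g ->
  cint mu (fun x => f x - g x) = cint mu f - cint mu g.
Proof.
move=> fi gi; have -> : (fun x => f x - g x) = fun x => f x + (- 1) * g x.
  by apply/funext => x; rewrite mulN1r.
by rewrite cintD ?cintZ ?mulN1r//; exact: cintegrableZ.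
Qed.

Lemma eq_cint mu f g : (forall x, f x = g x) -> cint mu f = cint mu g.
Proof. by move=> /funext ->. Qed.

Lemma cint_conj mu f : cintegrable mu f -> cint mu (fun x => (f x)^*) = (cint mu f)^*.
Proof.
move=> [f1 f2]; apply: ceq => /=.
  by apply: eq_Rintegral => x _; case: (f x).
rewrite -mulN1r -RintegralZl//; apply: eq_Rintegral => x _.
by rewrite mulN1r; case: (f x).
Qed.

(* Rotating the value of the integral onto the positive real axis. *)
Lemma cabs_cint mu f : cintegrable mu f ->
  cabs (cint mu f) <= \int[mu]_(x in setT) cabs (f x).
Proof.
move=> fi; set I := cint mu f.
have [I0|I0] := eqVneq (cabs I) 0.
  by rewrite I0; apply: Rintegral_ge0 => x _; exact: cabs_ge0.
have Ip : 0 < cabs I by rewrite lt_neqAle eq_sym I0 cabs_ge0.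
rewrite -(ler_pM2l Ip) -expr2.
have -> : cabs I ^+ 2 = Re (cint mu (fun x => I^* * f x)).
  by rewrite cintZ// -/I cabs_sqr; case: (I) => a b /=; ring.
rewrite -RintegralZl//; last exact: cintegrable_abs.
have [h1 h2] := cintegrableZ (I^*) fi.
apply: le_Rintegral => //; first exact: (rintegrableZ _ (cintegrable_abs fi)).
by move=> x _; rewrite (le_trans (ler_norm _))// (le_trans (cabs_Re _))// cabsM cabs_conj.
Qed.

Lemma cabs_cint_dom mu f w : cmeas f -> rintegrable mu w ->
  (forall x, cabs (f x) <= w x) -> cabs (cint mu f) <= \int[mu]_(x in setT) w x.
Proof.
move=> mf iw h; have fi := cintegrable_dom mf iw h.
apply: le_trans (cabs_cint fi) _; apply: le_Rintegral => //.
exact: cintegrable_abs.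
Qed.

Lemma cmeas_cvg (f_ : nat -> X -> R[i]) f : (forall n, cmeas (f_ n)) ->
  (forall x, cabs (f_ n x - f x) @[n --> \oo] --> (0 : R)) -> cmeas f.
Proof.
move=> mf cf; split.
  apply: (measurable_fun_cvg (fun n => (mf n).1)) => x _.
  apply/cvgrPdist_le => e e0; near=> n.
  rewrite -Re_opp -Re_add (le_trans (cabs_Re _))// cabs_dist.
  near: n; move/cvgrPdist_le : (cf x) => /(_ e e0); apply: filterS => n.
  by rewrite sub0r normrN ger0_norm ?cabs_ge0.
apply: (measurable_fun_cvg (fun n => (mf n).2)) => x _.
apply/cvgrPdist_le => e e0; near=> n.
rewrite -Im_opp -Im_add (le_trans (cabs_Im _))// cabs_dist.
near: n; move/cvgrPdist_le : (cf x) => /(_ e e0); apply: filterS => n.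
by rewrite sub0r normrN ger0_norm ?cabs_ge0.
Unshelve. all: by end_near. Qed.

Lemma cint_dct mu (f_ : nat -> X -> R[i]) f w : (forall n, cmeas (f_ n)) ->
  rintegrable mu w -> (forall n x, cabs (f_ n x) <= w x) ->
  (forall x, cabs (f_ n x - f x) @[n --> \oo] --> (0 : R)) ->
  cabs (cint mu (f_ n) - cint mu f) @[n --> \oo] --> (0 : R).
Proof.
move=> mf iw h cf; have mF := cmeas_cvg mf cf.
(* Neither measurability nor a bound is assumed of the limit: the first is [cmeas_cvg], the second
   passes to the limit pointwise. *)
have fw x : cabs (f x) <= w x.
  apply/ler_addgt0Pr => e e0.
  have /cvgrPdist_le/(_ e e0)[N _ /(_ N (leqnn _))/=] := cf x.
  rewrite sub0r normrN ger0_norm ?cabs_ge0// cabs_dist => k.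
  rewrite -(subrK (f_ N x) (f x)) (le_trans (cabsD _ _))// addrC lerD//.
have fi := cintegrable_dom mF iw fw.
have mD n := measurable_cabs (cmeasB (mf n) mF).
have cE x : (cabs (f_ n x - f x))%:E @[n --> \oo] --> 0%E.
  by apply: cvg_EFin; [exact: nearW|exact: cf].
have dn x n : (`|(cabs (f_ n x - f x))%:E| <= (w x + w x)%:E)%E.
  by rewrite /= lee_fin ger0_norm ?cabs_ge0// (le_trans (cabsB _ _))// lerD.
have [|||||_ _ H] := @dominated_convergence _ X R mu setT measurableT
  (fun n x => (cabs (f_ n x - f x))%:E) (fun=> 0%E) (fun x => (w x + w x)%:E).
- by move=> n; exact/measurable_EFinP.
- exact: measurable_cst.
- by apply: aeW => x _; exact: cE.
- exact: (rintegrableD iw iw).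
- by apply: aeW => x n _; exact: dn.
have fni n := cintegrable_dom (mf n) iw (h n).
have di n : rintegrable mu (fun x => cabs (f_ n x - f x)).
  apply: (rintegrable_dom (mD n) (rintegrableD iw iw)) => x.
  by rewrite ger0_norm ?cabs_ge0// (le_trans (cabsB _ _))// lerD.
have {}H : \int[mu]_(x in setT) cabs (f_ n x - f x) @[n --> \oo] --> (0 : R).
  move: H; rewrite integral0 => /fine_cvgP[_]; exact.
apply: (squeeze_cvgr _ (cvg_cst 0) H); near=> n; rewrite cabs_ge0 andTb.
have -> : cint mu (f_ n) - cint mu f = cint mu (fun x => f_ n x - f x) by rewrite cintB.
apply: cabs_cint; apply: (cintegrable_dom (cmeasB (mf n) mF) (rintegrableD iw iw)) => x.
by rewrite (le_trans (cabsB _ _))// lerD.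
Unshelve. all: by end_near. Qed.

End cint.

(** * Fubini's theorem with a majorant of product form *)

Section fubini.
Context {R : realType} {dX dY : measure_display} {X : measurableType dX}
  {Y : measurableType dY}.
Variables (mu : {sigma_finite_measure set X -> \bar R})
  (nu : {sigma_finite_measure set Y -> \bar R}).

Lemma rintegrable_prod (g : X -> R) (h : Y -> R) :
  rintegrable mu g -> rintegrable nu h -> (forall x, 0 <= g x) ->
  (forall y, 0 <= h y) ->
  rintegrable (mu \x nu)%E (fun p => g p.1 * h p.2).
Proof.
move=> ig ih g0 h0.
have mg : measurable_fun setT g by move: ig => /measurable_int/measurable_EFinP.
have mh : measurable_fun setT h by move: ih => /measurable_int/measurable_EFinP.
have mp : measurable_fun setT (fun p : X * Y => g p.1 * h p.2).
  by apply: measurable_funM; exact: measurableT_comp.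
apply/integrable12ltyP; first exact/measurable_EFinP.
under eq_integral => x _.
  under eq_integral => y _ do
    rewrite /= ger0_norm ?mulr_ge0// EFinM.
  rewrite integralZl//.
  over.
have Ih : (\int[nu]_y (h y)%:E = (\int[nu]_(y in setT) h y)%:E)%E.
  by rewrite fineK//; exact: integrable_fin_num.
rewrite /= Ih; under eq_integral do rewrite -EFinM mulrC EFinM.
by rewrite integralZl// -[X in (_ * X)%E]fineK ?ltry//; exact: integrable_fin_num.
Qed.

(** A majorant of product form bounds every section, so the inner integrals are finite at every
    point, not only almost everywhere, and the real-valued integrals agree with the extended
    ones. *)
Lemma Rint_fubini (f : X * Y -> R) (g : X -> R) (h : Y -> R) :
  measurable_fun setT f -> rintegrable mu g -> rintegrable nu h ->
  (forall x y, `|f (x, y)| <= g x * h y) ->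
  [/\ rintegrable mu (fun x => \int[nu]_(y in setT) f (x, y)),
     \int[(mu \x nu)%E]_(p in setT) f p =
       \int[mu]_(x in setT) \int[nu]_(y in setT) f (x, y) &
     \int[(mu \x nu)%E]_(p in setT) f p =
       \int[nu]_(y in setT) \int[mu]_(x in setT) f (x, y)].
Proof.
move=> mf ig ih fgh.
have fgh' x y : `|f (x, y)| <= `|g x| * `|h y|.
  by rewrite -normrM (le_trans (fgh _ _))// ler_norm.
have igh := rintegrable_prod (rintegrable_norm ig) (rintegrable_norm ih)
  (fun=> normr_ge0 _) (fun=> normr_ge0 _).
have fi : rintegrable (mu \x nu)%E f by apply: (rintegrable_dom mf igh) => -[x y] /=.
have ix x : rintegrable nu (fun y => f (x, y)).
  apply: (rintegrable_dom _ (rintegrableZ `|g x| (rintegrable_norm ih))) => //.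
  exact: measurableT_comp mf (measurable_pair1 _).
have iy y : rintegrable mu (fun x => f (x, y)).
  apply: (rintegrable_dom _ (rintegrableZ `|h y| (rintegrable_norm ig))) => [|x].
    exact: measurableT_comp mf (measurable_pair2 _).
  by rewrite mulrC.
have Ex x : ((\int[nu]_(y in setT) f (x, y))%:E = fubini_F nu (EFin \o f) x)%E.
  by rewrite fineK//; exact: (integrable_fin_num _ (ix x)).
have Ey y : ((\int[mu]_(x in setT) f (x, y))%:E = fubini_G mu (EFin \o f) y)%E.
  by rewrite fineK//; exact: (integrable_fin_num _ (iy y)).
split.
- rewrite /rintegrable (_ : _ \o _ = fubini_F nu (EFin \o f)); first exact: integrable_fubini_F.
  by apply/funext => x /=; rewrite Ex.
- congr fine; under [RHS]eq_integral do rewrite Ex.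
  by rewrite (integral12_prod_meas1 fi).
- congr fine; under [RHS]eq_integral do rewrite Ey.
  by rewrite (integral21_prod_meas1 fi).
Qed.

Lemma cint_fubini (f : X * Y -> R[i]) (g : X -> R) (h : Y -> R) :
  cmeas f -> rintegrable mu g -> rintegrable nu h ->
  (forall x y, cabs (f (x, y)) <= g x * h y) ->
  [/\ cintegrable mu (fun x => cint nu (fun y => f (x, y))),
     cint (mu \x nu)%E f = cint mu (fun x => cint nu (fun y => f (x, y))) &
     cint (mu \x nu)%E f = cint nu (fun y => cint mu (fun x => f (x, y)))].
Proof.
move=> [m1 m2] ig ih fgh.
have [a1 b1 c1] := Rint_fubini m1 ig ih (fun x y => le_trans (cabs_Re _) (fgh x y)).
have [a2 b2 c2] := Rint_fubini m2 ig ih (fun x y => le_trans (cabs_Im _) (fgh x y)).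
by split => //; apply: ceq.
Qed.

End fubini.

(** * The weight |t|^p and its sum over coordinates *)

Section weight.
Context {R : realType} (p : R) (hp : 1 <= p <= 2).

Definition pw (t : R) : R := `|t| `^ p.

Definition qv (n : nat) (x : 'cV[R]_n) : R := \sum_j pw (x j 0).

Let p1 : 1 <= p. Proof. by case/andP: hp. Qed.
Let p2 : p <= 2. Proof. by case/andP: hp. Qed.
Let p0 : 0 < p. Proof. exact: lt_le_trans ltr01 p1. Qed.

Lemma pw_ge0 t : 0 <= pw t. Proof. exact: powR_ge0. Qed.

Lemma pw0 : pw 0 = 0. Proof. by rewrite /pw normr0 powR0// gt_eqF. Qed.

Lemma pwN t : pw (- t) = pw t. Proof. by rewrite /pw normrN. Qed.

Lemma pwM s t : pw (s * t) = pw s * pw t.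
Proof. by rewrite /pw normrM powRM. Qed.

Lemma pw_mono s t : `|s| <= `|t| -> pw s <= pw t.
Proof. by move=> st; apply: ge0_ler_powR; rewrite ?nnegrE// ltW. Qed.

(** The larger of |s| and |t| bounds |s + t| up to the factor 2, and 2^p <= 4. *)
Lemma pw_add s t : pw (s + t) <= 4 * (pw s + pw t).
Proof.
have H a : pw (2 * a) <= 4 * pw a.
  rewrite pwM ler_wpM2r ?pw_ge0// /pw ger0_norm//.
  apply: (@le_trans _ _ (2 `^ 2)); first by rewrite ler_powR// ler1n.
  by rewrite powR_mulrn//; lra.
have [st|ts] := leP `|s| `|t|.
  apply: (@le_trans _ _ (pw (2 * t))).
    by apply: pw_mono; rewrite normrM (le_trans (ler_normD _ _))// (ger0_norm (x := 2))//; lra.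
  by apply: le_trans (H t) _; rewrite ler_pM2l// lerDr pw_ge0.
apply: (@le_trans _ _ (pw (2 * s))).
  by apply: pw_mono; rewrite normrM (le_trans (ler_normD _ _))// (ger0_norm (x := 2))//; lra.
by apply: le_trans (H s) _; rewrite ler_pM2l// lerDl pw_ge0.
Qed.

Lemma pw_ge_norm t : `|t| - 1 <= pw t.
Proof.
have [t1|t1] := leP 1 `|t|; last by rewrite (@le_trans _ _ 0) ?pw_ge0//; lra.
rewrite (@le_trans _ _ `|t|)//; first lra.
by rewrite /pw -[leLHS]powRr1// ler_powR.
Qed.

Lemma pw_le_sqr t : pw t <= 1 + t ^+ 2.
Proof.
have [t1|t1] := leP 1 `|t|.
  rewrite (@le_trans _ _ (`|t| `^ 2))//; first by rewrite /pw ler_powR.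
  by rewrite powR_mulrn// real_normK ?num_real// lerDr.
rewrite (@le_trans _ _ 1)//; last by rewrite lerDl sqr_ge0.
apply: (@le_trans _ _ (pw 1)); first by apply: pw_mono; rewrite normr1 ltW.
by rewrite /pw normr1 powR1.
Qed.

Lemma qv_ge0 n (x : 'cV[R]_n) : 0 <= qv x.
Proof. by apply: sumr_ge0 => j _; exact: pw_ge0. Qed.

Lemma qv0 n : qv (0 : 'cV[R]_n) = 0.
Proof. by rewrite /qv big1// => j _; rewrite mxE pw0. Qed.

Lemma qvN n (x : 'cV[R]_n) : qv (- x) = qv x.
Proof. by apply: eq_bigr => j _; rewrite mxE pwN. Qed.

Lemma qv_add n (x y : 'cV[R]_n) : qv (x + y) <= 4 * (qv x + qv y).
Proof.
rewrite /qv -big_split/= mulr_sumr; apply: ler_sum => j _; rewrite mxE; exact: pw_add.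
Qed.

Lemma qv_sub n (x y : 'cV[R]_n) : qv (x - y) <= 4 * (qv x + qv y).
Proof. by rewrite -[qv y]qvN qv_add. Qed.

Lemma qvZ n s (x : 'cV[R]_n) : qv (s *: x) = pw s * qv x.
Proof. by rewrite /qv mulr_sumr; apply: eq_bigr => j _; rewrite mxE pwM. Qed.

Lemma pw_le_qv n (x : 'cV[R]_n) j : pw (x j 0) <= qv x.
Proof. by rewrite /qv (bigD1 j)//= lerDl sumr_ge0// => i _; exact: pw_ge0. Qed.

End weight.

(** * Continuity and measurability of vector-valued maps *)

Section mx_continuous.
Context {R : realType}.

Lemma mxnorm_coord m n (M : 'M[R]_(m, n)) i j : `|M i j| <= `|M|.
Proof.
have -> : `|M| = mx_norm M by [].
rewrite mx_normrE.
exact: (le_bigmax _ (fun ij : 'I_m * 'I_n => `|M ij.1 ij.2|) (i, j)).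
Qed.

Lemma mxnorm_le m n (M : 'M[R]_(m, n)) (e : R) : 0 <= e ->
  (forall i j, `|M i j| <= e) -> `|M| <= e.
Proof. by move=> e0 H; have -> : `|M| = mx_norm M by []; rewrite mx_normrE bigmax_le. Qed.

Context (T : topologicalType).

Lemma continuous_mx m n (F : T -> 'M[R]_(m, n)) :
  (forall i j, continuous (fun x => F x i j)) -> continuous F.
Proof.
move=> cF x; apply/cvgrPdist_le => e e0.
have H : \forall y \near x, forall i j, `|F x i j - F y i j| <= e.
  apply: filter_forall => i; apply: filter_forall => j.
  by move: (cF i j x) => /cvgrPdist_le/(_ e e0).
apply: filterS H => y H; apply: mxnorm_le; first exact: ltW.
by move=> i j; rewrite !mxE.
Qed.

End mx_continuous.

(** The same term as in [integralRd], so that splitting off the first coordinate follows the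
    recursion of that integral. *)
Definition vcons (R : realType) n (t : R) (y : 'cV[R]_n) : 'cV[R]_n.+1 :=
  col_mx (const_mx t : 'cV[R]_1) y.

Section vcons.
Context {R : realType} (n : nat).
Implicit Types (t : R) (y : 'cV[R]_n).

Lemma vconsE t y (j : 'I_n.+1) : vcons t y j 0 =
  if unlift ord0 j is Some k then y k 0 else t.
Proof.
rewrite /vcons mxE; case: splitP => k jk.
  have -> : j = ord0 by apply/val_inj; rewrite /= jk ord1.
  by rewrite unlift_none mxE.
have -> : j = lift ord0 k by exact/val_inj.
by rewrite liftK.
Qed.

Lemma vcons0 t y : vcons t y ord0 0 = t.
Proof. by rewrite vconsE unlift_none. Qed.

Lemma vconsS t y k : vcons t y (lift ord0 k) 0 = y k 0.
Proof. by rewrite vconsE liftK. Qed.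

Lemma vcons_sum (F : R -> R) t y :
  \sum_j F (vcons t y j 0) = F t + \sum_j F (y j 0).
Proof.
by rewrite big_ord_recl vcons0; under eq_bigr do rewrite vconsS.
Qed.

Lemma vcons_sum2 (F : R -> R -> R) t y s z :
  \sum_j F (vcons t y j 0) (vcons s z j 0) = F t s + \sum_j F (y j 0) (z j 0).
Proof.
by rewrite big_ord_recl !vcons0; under eq_bigr do rewrite !vconsS.
Qed.

Lemma vcons_lin (a b : R) t y s z :
  a *: vcons t y + b *: vcons s z = vcons (a * t + b * s) (a *: y + b *: z).
Proof.
by apply/matrixP => i j; rewrite ord1 !mxE; case: splitP => k _; rewrite !mxE.
Qed.

Lemma continuous_vconsl y : continuous (fun t => vcons t y).
Proof.
apply: continuous_mx => i j x; rewrite ord1.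
under eq_fun do rewrite vconsE.
by case: unlift => [k|]; [exact: cvg_cst|exact: cvg_id].
Qed.

Lemma continuous_vconsr t : continuous (fun y => vcons t y).
Proof.
apply: continuous_mx => i j; rewrite ord1.
under eq_fun do rewrite vconsE.
case: unlift => [k|]; last exact: cst_continuous.
exact: coord_continuous.
Qed.

End vcons.

Section measurable_continuous.
Context {R : realType} {dX : measure_display} {X : measurableType dX} (n : nat).

(** Plays the role of measurability of a vector-valued map, stated through real functions only. *)
Definition mcoord (v : X -> 'cV[R]_n) := forall j, measurable_fun setT (fun x => v x j 0).

Definition grid (N : nat) (v : 'cV[R]_n) : 'cV[int]_n :=
  \col_j Num.floor (N.+1%:R * v j 0).

Definition ungrid (N : nat) (c : 'cV[int]_n) : 'cV[R]_n :=
  \col_j ((c j 0)%:~R / N.+1%:R).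

Lemma measurable_grid N (v : X -> 'cV[R]_n) c : mcoord v ->
  measurable [set x | grid N (v x) = c].
Proof.
move=> mv; rewrite (_ : [set x | _] = \bigcap_(j in [set: 'I_n])
   ((fun x => N.+1%:R * v x j 0) @^-1` `[(c j 0)%:~R, (c j 0 + 1)%:~R[%classic)).
  apply: fin_bigcap_measurable => // j _; rewrite -[X in measurable X]setTI.
  have : measurable_fun setT (fun x => N.+1%:R * v x j 0 : R) by apply: measurable_funM.
  by apply => //; exact: measurable_itv.
apply/seteqP; split => x /=.
  move=> <- j _ /=; rewrite in_itv/= !mxE floor_le_tmp//=.
  by rewrite floorD1_gt.
move=> H; apply/matrixP => i j; rewrite ord1 !mxE.
by apply: floor_def; have := H i I; rewrite /= in_itv.
Qed.

Lemma grid_dist N (v : 'cV[R]_n) j : `|v j 0 - ungrid N (grid N v) j 0| <= N.+1%:R^-1.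
Proof.
rewrite !mxE; set t := v j 0.
have N0 : (0 : R) < N.+1%:R by [].
rewrite -(ler_pM2l N0) -[X in X * `|_|](gtr0_norm N0) -normrM mulrBr mulrCA divff ?gt_eqF// mulr1.
have /andP[h1 h2] := floor_itv (N.+1%:R * t).
by rewrite ger0_norm ?subr_ge0// lerBlDl ltW// -[1]/(1%:~R) -intrD.
Qed.

(* A continuous function is the pointwise limit of its values on finer and finer grids. *)
Lemma measurable_continuous (f : 'cV[R]_n -> R) (v : X -> 'cV[R]_n) :
  continuous f -> mcoord v -> measurable_fun setT (fun x => f (v x)).
Proof.
move=> cf mv.
have mg N : measurable_fun setT (fun x => f (ungrid N (grid N (v x)))).
  move=> _ B mB; rewrite setTI.
  rewrite (_ : _ @^-1` B = \bigcup_c (if f (ungrid N c) \in B then [set x | grid N (v x) = c] else set0)).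
    apply: countable_bigcupT_measurable => [|c]; first exact: countableP.
    by case: ifP => // _; exact: measurable_grid.
  apply/seteqP; split => x /=.
    by move=> Bx; exists (grid N (v x)) => //; rewrite mem_set.
  by case=> c _; case: ifPn => // /set_mem cB /= ->.
apply: (measurable_fun_cvg mg) => x _.
apply: (@cvg_comp _ _ _ (fun N => ungrid N (grid N (v x))) f _ (nbhs (v x))); last exact: cf.
apply/cvgrPdist_le => e e0; near=> N.
apply: mxnorm_le => [|i j]; first exact: ltW.
rewrite ord1 mxE [X in _ + X]mxE (le_trans (grid_dist _ _ _))//.
have N0 : (0 : R) < N.+1%:R by [].
rewrite invf_ple ?posrE// (@le_trans _ _ N%:R) ?ler_nat//; near: N.
exact: nbhs_infty_ger.
Unshelve. all: by end_near. Qed.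

End measurable_continuous.

(** * Integrability and affine substitution on the line *)

Section integrable_line.
Context {R : realType}.
Notation leb := (@lebesgue_measure R).

Lemma rintegrable_oneDsqrV : rintegrable leb (fun t : R => (1 + t ^+ 2)^-1).
Proof.
have c1 : continuous (fun t : R => (1 + t ^+ 2)^-1) by exact: continuous_oneDsqrV.
have g0 (t : R) : 0 <= (1 + t ^+ 2)^-1 by rewrite invr_ge0 addr_ge0// sqr_ge0.
apply/integrableP; split.
  by apply/measurable_EFinP; exact: continuous_measurable_fun.
under eq_integral do rewrite /= ger0_norm//.
rewrite ge0_symfun_integralT//; last by move=> t /=; rewrite sqrrN.
rewrite (_ : [set x | _] = `[0%R, +oo[%classic); last first.
  by apply/seteqP; split => x/=; rewrite in_itv/= andbT.
by rewrite integral0y_oneDsqr -EFinM ltry.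
Qed.

Lemma fineZ (s : R) (x : \bar R) : 0 < s -> fine (s%:E * x)%E = s * fine x.
Proof.
by move=> s0; case: x => [x| |] //=; rewrite ?gt0_muley ?gt0_muleNy ?lte_fin//= mulr0.
Qed.

(** Substitution is first done for nonnegative functions. With M the majorant C / (1 + t^2), both f
    + M and M are nonnegative and integrable, and f is their difference. *)
Lemma Rint_affine_line (f : R -> R) (a s C : R) : 0 < s -> continuous f ->
  (forall t, `|f t| <= C * (1 + t ^+ 2)^-1) ->
  \int[leb]_(t in setT) f (a + s * t) = s^-1 * \int[leb]_(t in setT) f t.
Proof.
move=> s0 cf fC; pose F t : R := a + s * t.
have dF t : is_derive t (1 : R) F s.
  have -> : F = cst a + s \*: id by apply/funext.
  have E : is_derive t (1 : R) (cst a + s \*: (id : R -> R^o)) (0 + s *: (1 : R^o)).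
    exact: is_deriveD.
  by apply: is_derive_eq E _; rewrite add0r /GRing.scale/= mulr1.
have dFE : derive1 F = fun=> s.
  by apply/funext => t; rewrite derive1E; exact: (@derive_val _ _ _ _ _ _ _ (dF t)).
have comp (G : R -> R) : continuous G -> continuous (G \o F).
  move=> cG t; apply: continuous_comp; last exact: cG.
  by apply: cvgD; [exact: cvg_cst|apply: cvgM; [exact: cvg_cst|exact: cvg_id]].
have ge0 (G : R -> R) : continuous G -> (forall t, 0 <= G t) ->
    (\int[leb]_t (G (F t))%:E = s^-1%:E * \int[leb]_t (G t)%:E)%E.
  move=> cG G0; have mGF := continuous_measurable_fun (comp _ cG).
  rewrite (@increasing_ge0_integration_by_substitutionT R F G)//.
  - rewrite dFE; under [in RHS]eq_integral do rewrite /= EFinM muleC.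
    rewrite ge0_integralZl//.
    + by rewrite muleA -EFinM mulVf ?gt_eqF// mul1e.
    + exact/measurable_EFinP.
    + by move=> x _; rewrite lee_fin; exact: G0.
    + by rewrite lee_fin ltW.
  - by move=> x y xy; rewrite /F ltrD2l ltr_pM2l.
  - by rewrite dFE => t; exact: cvg_cst.
  - by rewrite dFE; exact: is_cvg_cst.
  - by rewrite dFE; exact: is_cvg_cst.
  - apply/cvgrNyPle => M; exists (s^-1 * (M - a)); split; first exact: num_real.
    by move=> t /ltW; rewrite ler_pdivlMl// lerBrDl.
  - apply/cvgryPge => M; exists (s^-1 * (M - a)); split; first exact: num_real.
    by move=> t /ltW; rewrite ler_pdivrMl// lerBlDl.
pose M t : R := C * (1 + t ^+ 2)^-1.
have cM : continuous M.
  by move=> t; apply: cvgM; [exact: cvg_cst|exact: continuous_oneDsqrV].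
have iM : rintegrable leb M by exact: rintegrableZ rintegrable_oneDsqrV.
have fi : rintegrable leb f.
  by apply: (rintegrable_dom _ iM) => //; exact: continuous_measurable_fun.
have cfM : continuous (fun t => f t + M t) by move=> t; exact: cvgD (cf t) (cM t).
have M0 t : 0 <= M t by rewrite (le_trans _ (fC t)).
have fM0 t : 0 <= f t + M t.
  by have := fC t; rewrite -/(M t) ler_norml -subr_ge0 opprK addrC => /andP[].
have iF (G : R -> R) : continuous G -> (forall t, 0 <= G t) -> rintegrable leb G ->
    rintegrable leb (G \o F).
  move=> cG G0 iG; apply/integrableP; split.
    apply/measurable_EFinP; apply: continuous_measurable_fun; exact: comp cG.
  under eq_integral do rewrite /= ger0_norm//.
  rewrite ge0// -[X in (_ * X)%E]fineK ?ltry//.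
  exact: (integrable_fin_num measurableT iG).
have R0 (G : R -> R) : continuous G -> (forall t, 0 <= G t) ->
    \int[leb]_(t in setT) G (F t) = s^-1 * \int[leb]_(t in setT) G t.
  by move=> cG G0; rewrite /Rintegral ge0// fineZ// invr_gt0.
have ifM : rintegrable leb (fun t => f t + M t) by exact: rintegrableD.
transitivity (\int[leb]_(t in setT) ((f (F t) + M (F t)) - M (F t))).
  by apply: eq_Rintegral => t _; rewrite addrK.
have iFM := iF _ cfM fM0 ifM; have iFMM := iF _ cM M0 iM.
rewrite (RintegralB measurableT iFM iFMM).
rewrite (R0 _ cfM fM0) (R0 _ cM M0) -mulrBr -RintegralB//; congr (_ * _).
by apply: eq_Rintegral => t _; rewrite addrK.
Qed.

End integrable_line.

(** * Lebesgue measure in n dimensions and affine changes of variables *)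

Section euclidean_measure.
Context {R : realType}.

Section sigma_finite_product.
Context d1 d2 (T1 : measurableType d1) (T2 : measurableType d2)
  (m1 : {sigma_finite_measure set T1 -> \bar R})
  (m2 : {sigma_finite_measure set T2 -> \bar R}).

Lemma product_measure_sigma_finite : sigma_finite setT (m1 \x m2)%E.
Proof.
have /sigma_finiteP[F [TF ndF Foo]] := sigma_finiteT m1.
have /sigma_finiteP[G [TG ndG Goo]] := sigma_finiteT m2.
exists (fun n => F n `*` G n).
  rewrite -setXTT TF TG predeqE => -[x y]; split.
    move=> [/= [n _ Fnx] [k _ Gky]]; exists (maxn n k) => //; split.
    - by move: x Fnx; exact/subsetPset/ndF/leq_maxl.
    - by move: y Gky; exact/subsetPset/ndG/leq_maxr.
  by move=> [n _ []/= ? ?]; split; exists n.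
move=> k; have [? ?] := Foo k; have [? ?] := Goo k.
split; first exact: measurableX.
by rewrite product_measure1E// lte_mul_pinfty// ge0_fin_numE.
Qed.

(** The product measure together with its sigma-finiteness, so that products can be iterated and
    Fubini's theorem used at each stage. *)
Definition sfprod : {sigma_finite_measure set (T1 * T2)%type -> \bar R} :=
  HB.pack (m1 \x m2)%E (Measure_isSigmaFinite.Build _ _ _ (m1 \x m2)%E
    product_measure_sigma_finite).

End sigma_finite_product.

(* Stands for the image of vs_mu under vs_vec, so that no sigma-algebra on 'cV_n is needed. *)
Record vspace (n : nat) := VSpace {
  vs_disp : measure_display;
  vs_car :> measurableType vs_disp;
  vs_mu : {sigma_finite_measure set vs_car -> \bar R};
  vs_vec : vs_car -> 'cV[R]_n }.

(** In dimension 0 the Dirac mass makes the integral the value at the empty vector, as in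
    [integralRd]. *)
Fixpoint lebv (n : nat) : vspace n :=
  match n with
  | 0 => @VSpace 0 _ _ (dirac tt : {sigma_finite_measure set unit -> \bar R}) (fun=> 0)
  | n'.+1 => @VSpace n'.+1 _ _ (sfprod (@lebesgue_measure R) (vs_mu (lebv n')))
      (fun z => vcons z.1 (vs_vec z.2))
  end.

End euclidean_measure.

Section lebv.
Context {R : realType}.
Notation leb := (@lebesgue_measure R).
Local Notation X := (@lebv R).
Local Notation mu n := (vs_mu (X n)).
Local Notation vec := vs_vec.

Lemma mcoord_vec n : mcoord (@vs_vec R n (X n)).
Proof.
elim: n => [|n IH] j; first by case: j.
rewrite /= ; under eq_fun do rewrite vconsE.
case: unlift => [k|]; last exact: measurable_fst.
exact: measurableT_comp (IH k) measurable_snd.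
Qed.

Context (p : R) (hp : 1 <= p <= 2).
Local Notation pw := (pw p).
Local Notation qv := (qv p).

Definition rapid n (f : 'cV[R]_n -> R) := exists C e : R, 0 < e /\
  forall x, `|f x| <= C * expR (- (e * qv x)).

(** Since p >= 1 gives |t|^p >= |t| - 1, the factor exp e reduces the claim to exp (- e |t|), and
    exp (e |t|) dominates its quadratic Taylor term. *)
Lemma expR_pw_le (e : R) : 0 < e -> exists2 C, 0 <= C & forall t,
  expR (- (e * pw t)) <= C * (1 + t ^+ 2)^-1.
Proof.
move=> e0; exists (expR e * (1 + e^-1 ^+ 2 * 2)).
  by rewrite mulr_ge0 ?expR_ge0// addr_ge0// mulr_ge0// sqr_ge0.
move=> t; have t2 : 0 < 1 + t ^+ 2 by rewrite ltr_pwDl// sqr_ge0.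
rewrite ler_pdivlMr// mulrC -ler_pdivlMr ?expR_gt0// -expRN opprK.
have h1 : expR (e * `|t|) <= expR e * expR (e * pw t).
  rewrite -expRD ler_expR -[X in X + _]mulr1 -mulrDr ler_pM2l// -lerBlDl.
  exact: pw_ge_norm.
have et0 : 0 <= e * `|t| by rewrite mulr_ge0// ltW.
have h2 := @expR_ge1Dxn R (e * `|t|) 1 et0.
have h3 : 1 + t ^+ 2 <= (1 + e^-1 ^+ 2 * 2) * expR (e * `|t|).
  rewrite mulrDl mul1r lerD//; first by rewrite (le_trans _ (expR_ge1Dx _))// lerDl.
  have -> : t ^+ 2 = e^-1 ^+ 2 * 2 * ((e * `|t|) ^+ 2 / 2).
    rewrite exprMn real_normK ?num_real// exprVn; field.
    by rewrite gt_eqF.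
  apply: ler_wpM2l; first by rewrite mulr_ge0// sqr_ge0.
  by apply: le_trans h2; rewrite lerDr.
apply: le_trans h3 _; rewrite [leRHS]mulrAC mulrC ler_wpM2r//.
by rewrite addr_ge0// mulr_ge0// sqr_ge0.
Qed.

Lemma measurable_pw : measurable_fun setT pw.
Proof.
apply: (measurableT_comp (measurable_powR p)); exact: normr_measurable.
Qed.

Lemma qv_vcons n t (y : 'cV[R]_n) : qv (vcons t y) = pw t + qv y.
Proof. exact: vcons_sum. Qed.

Lemma rintegrable_pw (e : R) : 0 < e -> rintegrable leb (fun t => expR (- (e * pw t))).
Proof.
move=> e0; have [C C0 H] := expR_pw_le e0.
apply: (rintegrable_dom _ (rintegrableZ C rintegrable_oneDsqrV)).
  apply: measurableT_comp; first exact: measurable_expR.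
  by apply: measurableT_comp => //; apply: measurable_funM => //; exact: measurable_pw.
by move=> t; rewrite ger0_norm ?expR_ge0.
Qed.

Lemma rintegrable_qv n (e : R) : 0 < e ->
  rintegrable (mu n) (fun x => expR (- (e * qv (vec x)))).
Proof.
move=> e0; elim: n => [|n IH] /=.
  apply/integrableP; split; first exact: measurable_cst.
  by rewrite integral_dirac//= diracE in_setT mul1e ltry.
have := rintegrable_prod (rintegrable_pw e0) IH (fun=> expR_ge0 _) (fun=> expR_ge0 _).
congr (rintegrable _ _); apply/funext => z.
by rewrite -expRD qv_vcons -opprD -mulrDr.
Qed.

Lemma measurable_vec n (f : 'cV[R]_n -> R) : continuous f ->
  measurable_fun setT (fun x : X n => f (vec x)).
Proof. by move=> cf; apply: measurable_continuous => //; exact: mcoord_vec. Qed.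

Lemma rintegrable_rapid n (f : 'cV[R]_n -> R) : continuous f -> rapid f ->
  rintegrable (mu n) (fun x => f (vec x)).
Proof.
move=> cf [C [e [e0 fC]]].
apply: (rintegrable_dom (measurable_vec cf) (rintegrableZ C (rintegrable_qv n e0))) => x.
exact: fC.
Qed.

Lemma rapid_vconsr n (f : 'cV[R]_n.+1 -> R) t : rapid f -> rapid (fun y => f (vcons t y)).
Proof.
move=> [C [e [e0 fC]]]; exists (C * expR (- (e * pw t))), e; split => // y.
by rewrite -mulrA -expRD -opprD -mulrDr -qv_vcons.
Qed.

Lemma continuous_comp2 (T1 T2 T3 : topologicalType) (f : T1 -> T2) (g : T2 -> T3) :
  continuous f -> continuous g -> continuous (fun x => g (f x)).
Proof. by move=> cf cg x; exact: continuous_comp (cf x) (cg (f x)). Qed.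

Lemma Rint_vcons n (f : 'cV[R]_n.+1 -> R) : continuous f -> rapid f ->
  \int[mu n.+1]_(z in setT) f (vec z) =
    \int[leb]_(t in setT) \int[mu n]_(y in setT) f (vcons t (vec y)) /\
  \int[mu n.+1]_(z in setT) f (vec z) =
    \int[mu n]_(y in setT) \int[leb]_(t in setT) f (vcons t (vec y)).
Proof.
move=> cf [C [e [e0 fC]]].
have [] := @Rint_fubini _ _ _ _ _ leb (mu n) (fun z => f (vcons z.1 (vec z.2))) _ _
  (measurable_vec cf) (rintegrableZ C (rintegrable_pw e0)) (rintegrable_qv n e0).
  by move=> t y /=; rewrite -mulrA -expRD -opprD -mulrDr -qv_vcons.
by [].
Qed.

(** Carries the iterated integral of [is_embedding] over to a measure, where Fubini's theorem and
    dominated convergence apply. *)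
Lemma integralRd_lebv n (f : 'cV[R]_n -> R) : continuous f -> rapid f ->
  integralRd f = \int[mu n]_(x in setT) f (vec x).
Proof.
elim: n f => [|n IH] f cf rf /=.
  by rewrite /Rintegral integral_dirac// diracE in_setT mul1e.
rewrite (Rint_vcons cf rf).1; apply: eq_Rintegral => t _.
rewrite (IH (fun y => f (vcons t y)))//.
  exact: (continuous_comp2 (@continuous_vconsr _ _ t) cf).
exact: rapid_vconsr.
Qed.

Lemma rapid_ge0 n (f : 'cV[R]_n -> R) : rapid f -> exists C e : R,
  [/\ 0 <= C, 0 < e & forall x, `|f x| <= C * expR (- (e * qv x))].
Proof.
move=> [C [e [e0 fC]]]; exists C, e; split => //.
have := le_trans (normr_ge0 _) (fC 0); rewrite qv0// mulr0 oppr0 expR0 mulr1//.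
Qed.

Lemma rapidZ n (f : 'cV[R]_n -> R) (c : R) : rapid f -> rapid (fun x => c * f x).
Proof.
move=> [C [e [e0 fC]]]; exists (`|c| * C), e; split => // x.
by rewrite normrM -mulrA ler_wpM2l.
Qed.

Lemma continuousZ (T : topologicalType) (f : T -> R) (c : R) : continuous f ->
  continuous (fun x => c * f x).
Proof. by move=> cf x; apply: cvgM; [exact: cvg_cst|exact: cf]. Qed.

Lemma rapid_comp m n (f : 'cV[R]_n -> R) (D : 'cV[R]_m -> 'cV[R]_n) (K L : R) :
  0 < K -> (forall x, qv x <= K * qv (D x) + L) -> rapid f -> rapid (fun x => f (D x)).
Proof.
move=> K0 DK [C [e [e0 fC]]]; exists (`|C| * expR (e / K * L)), (e / K); split.
  by rewrite divr_gt0.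
move=> x; apply: le_trans (fC _) _; apply: (@le_trans _ _ (`|C| * expR (- (e * qv (D x))))).
  by rewrite ler_wpM2r ?expR_ge0// ler_norm.
rewrite -[leRHS]mulrA -expRD ler_wpM2l ?normr_ge0// ler_expR.
have : e / K * qv x <= e / K * (K * qv (D x) + L) by rewrite ler_pM2l ?divr_gt0.
rewrite mulrDr mulrA divfK ?gt_eqF// => h; lra.
Qed.

Lemma pw_affine (a s : R) : 0 < s ->
  forall t, pw t <= 4 / pw s * pw (a + s * t) + 4 / pw s * pw a.
Proof.
move=> s0 t; have ps : 0 < pw s by rewrite powR_gt0// normr_gt0 gt_eqF.
rewrite -mulrDr -mulrAC ler_pdivlMr// mulrC -pwM -[pw a]pwN.
by rewrite (le_trans _ (pw_add hp _ _))// [a + _]addrC addrK.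
Qed.

Lemma qv_affine n (a : 'cV[R]_n) (s : R) : 0 < s ->
  forall x, qv x <= 4 / pw s * qv (a + s *: x) + 4 / pw s * qv a.
Proof.
move=> s0 x; rewrite /qv -mulrDr -big_split/= mulr_sumr.
by apply: ler_sum => j _; rewrite !mxE mulrDr pw_affine.
Qed.

Lemma rapid_affine n (f : 'cV[R]_n -> R) a s : 0 < s -> rapid f ->
  rapid (fun x => f (a + s *: x)).
Proof.
move=> s0; apply: rapid_comp (qv_affine a s0).
by rewrite divr_gt0// powR_gt0// normr_gt0 gt_eqF.
Qed.

Lemma continuous_affine n (a : 'cV[R]_n) (s : R) :
  continuous (fun x : 'cV[R]_n => a + s *: x).
Proof.
apply: continuous_mx => i j.
have -> : (fun x : 'cV[R]_n => (a + s *: x) i j) = fun x => a i j + s * x i j.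
  by apply/funext => x; rewrite !mxE.
by move=> x; exact: (cvgD (cvg_cst _) (cvgM (cvg_cst _) (@coord_continuous R n 1 i j x))).
Qed.

(** The induction hypothesis treats the last n coordinates and yields s^-n; exchanging the order of
    integration then leaves a substitution on the line for the first coordinate. *)
Lemma Rint_affine n (f : 'cV[R]_n -> R) a (s : R) : 0 < s -> continuous f -> rapid f ->
  \int[mu n]_(x in setT) f (a + s *: vec x) =
  s ^- n * \int[mu n]_(x in setT) f (vec x).
Proof.
move=> s0; elim: n f a => [|n IH] f a cf rf.
  rewrite /Rintegral !integral_dirac// diracE in_setT !mul1e expr0 invr1 mul1r/=.
  by congr f; apply/matrixP => -[].
pose g (x : 'cV[R]_n.+1) := f (a + s *: x).
have caff := @continuous_affine n.+1 a s.
have cg : continuous g by move=> x; exact: (continuous_comp (caff x) (cf _)).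
have rg : rapid g by exact: rapid_affine.
have aE : a = vcons (a ord0 0) (\col_k a (lift ord0 k) 0).
  apply/matrixP => i j; rewrite ord1 vconsE; case: unliftP => [k|] ->//.
  by rewrite mxE.
set a1 := a ord0 0 in aE; set a' := (\col__ _) in aE.
have gE t y : g (vcons t y) = f (vcons (a1 + s * t) (a' + s *: y)).
  by rewrite /g {1}aE -[vcons a1 _]scale1r vcons_lin mul1r scale1r.
have IHt t : \int[mu n]_(y in setT) g (vcons t (vec y)) =
    s ^- n * \int[mu n]_(y in setT) f (vcons (a1 + s * t) (vec y)).
  under eq_Rintegral do rewrite gE.
  apply: (IH (fun y => f (vcons (a1 + s * t) y))).
    exact: (continuous_comp2 (@continuous_vconsr _ _ _) cf).
  exact: rapid_vconsr.
(* [D] moves the first coordinate only. Passing through f o D separates the two substitutions. *)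
pose D (x : 'cV[R]_n.+1) := vcons (a1 + s * x ord0 0) (\col_k x (lift ord0 k) 0).
have DE t y : D (vcons t y) = vcons (a1 + s * t) y.
  rewrite /D vcons0; congr vcons; apply/matrixP => i j.
  by rewrite ord1 mxE vconsS.
pose h (x : 'cV[R]_n.+1) := f (D x).
have cD : continuous D.
  apply: continuous_mx => i j.
  have -> : (fun x => D x i j) = fun x : 'cV[R]_n.+1 =>
      if unlift ord0 i is Some k then x (lift ord0 k) 0 else a1 + s * x ord0 0.
    apply/funext => x; rewrite ord1 vconsE.
    by case: unlift => [k|]//; rewrite mxE.
  case: unlift => [k|] x; first exact: coord_continuous.
  exact: (cvgD (cvg_cst _) (cvgM (cvg_cst _) (@coord_continuous R n.+1 1 ord0 0 x))).
have ch : continuous h by exact: (continuous_comp2 cD cf).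
have ps : 0 < pw s by rewrite powR_gt0// normr_gt0 gt_eqF.
have rh : rapid h.
  apply: (@rapid_comp _ _ f D (1 + 4 / pw s) (4 / pw s * pw a1)) => //.
    by rewrite addr_gt0// divr_gt0.
  move=> x; have -> : x = vcons (x ord0 0) (\col_k x (lift ord0 k) 0).
    by apply/matrixP => i j; rewrite ord1 vconsE; case: unliftP => [k|] ->//; rewrite mxE.
  rewrite DE !qv_vcons; set y := \col__ _; set t := x _ _.
  have h1 := pw_affine a1 s0 t; have h2 := qv_ge0 p y; have h3 := pw_ge0 p (a1 + s * t).
  have h4 : 0 <= 4 / pw s * qv y by rewrite mulr_ge0// divr_ge0// ltW.
  by rewrite !mulrDr !mulrDl !mul1r; lra.
have icn : continuous (fun x => s ^- n * h x) /\ rapid (fun x => s ^- n * h x).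
  by split; [exact: continuousZ|exact: rapidZ].
have ic1 : continuous (fun x => s^-1 * f x) /\ rapid (fun x => s^-1 * f x).
  by split; [exact: continuousZ|exact: rapidZ].
transitivity (\int[mu n.+1]_(z in setT) (s ^- n * h (vec z))).
  rewrite (Rint_vcons cg rg).1 (Rint_vcons icn.1 icn.2).1.
  apply: eq_Rintegral => t _; rewrite IHt RintegralZl//.
    by congr (_ * _); apply: eq_Rintegral => y _; rewrite /h DE.
  apply: (rintegrable_rapid (f := fun y => h (vcons t y))).
    exact: (continuous_comp2 (@continuous_vconsr _ _ _) ch).
  exact: rapid_vconsr.
rewrite (RintegralZl _ measurableT (rintegrable_rapid ch rh)).
transitivity (s ^- n * \int[mu n.+1]_(z in setT) (s^-1 * f (vec z))); last first.
  by rewrite (RintegralZl _ measurableT (rintegrable_rapid cf rf)) mulrA exprS invfM [s^-1 * _]mulrC.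
congr (_ * _); rewrite (Rint_vcons ch rh).2 (Rint_vcons ic1.1 ic1.2).2.
apply: eq_Rintegral => y _; rewrite /h; under eq_Rintegral do rewrite DE.
have [C [e [C0 e0 fC]]] := rapid_ge0 rf; have [C' C'0 H] := expR_pw_le e0.
have cfy : continuous (fun t => f (vcons t (vec y))).
  exact: (continuous_comp2 (@continuous_vconsl _ _ _) cf).
have fy t : `|f (vcons t (vec y))| <= C * C' * (1 + t ^+ 2)^-1.
  apply: le_trans (fC _) _; rewrite qv_vcons -mulrA ler_wpM2l//.
  by apply: le_trans (H t); rewrite ler_expR lerN2 ler_pM2l// lerDl qv_ge0.
rewrite (Rint_affine_line (f := fun t => f (vcons t (vec y))) a1 s0 cfy fy) RintegralZl//.
suff : rintegrable leb (fun t => f (vcons t (vec y))) by [].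
by apply: (rintegrable_dom _ (rintegrableZ (C * C') rintegrable_oneDsqrV));
  first exact: continuous_measurable_fun.
Qed.

End lebv.

(** * Continuous real and complex functions, and measurable parameter integrals *)

Section real_continuous.
Context {R : realType} (T : topologicalType).
Implicit Types (f g : T -> R).

Lemma contD f g : continuous f -> continuous g -> continuous (fun x => f x + g x).
Proof. by move=> cf cg x; exact: (cvgD (cf x) (cg x)). Qed.

Lemma contM f g : continuous f -> continuous g -> continuous (fun x => f x * g x).
Proof. by move=> cf cg x; exact: (cvgM (cf x) (cg x)). Qed.

Lemma contN f : continuous f -> continuous (fun x => - f x).
Proof. by move=> cf x; apply: cvgN; exact: (cf x). Qed.

Lemma cont_comp f (h : R -> R) : continuous h -> continuous f ->
  continuous (fun x => h (f x)).
Proof. by move=> ch cf x; exact: (continuous_comp (cf x) (ch (f x))). Qed.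

Lemma cont_cst (c : R) : continuous (fun _ : T => c).
Proof. exact: cst_continuous. Qed.

End real_continuous.

Section complex_continuous.
Context {R : realType} (T : topologicalType).
Implicit Types (f g : T -> R[i]).

Definition ccont f := continuous (fun x => Re (f x)) /\ continuous (fun x => Im (f x)).

Lemma ccontD f g : ccont f -> ccont g -> ccont (fun x => f x + g x).
Proof.
move=> [f1 f2] [g1 g2]; split.
  under eq_fun do rewrite Re_add; move=> x; exact: cvgD (f1 x) (g1 x).
under eq_fun do rewrite Im_add; move=> x; exact: cvgD (f2 x) (g2 x).
Qed.

Lemma ccontM f g : ccont f -> ccont g -> ccont (fun x => f x * g x).
Proof.
move=> [f1 f2] [g1 g2]; split.
  under eq_fun do rewrite Re_mul; move=> x.
  exact: cvgB (cvgM (f1 x) (g1 x)) (cvgM (f2 x) (g2 x)).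
under eq_fun do rewrite Im_mul; move=> x.
exact: cvgD (cvgM (f1 x) (g2 x)) (cvgM (f2 x) (g1 x)).
Qed.

Lemma ccont_cst (c : R[i]) : ccont (fun=> c).
Proof. by split=> x; exact: cvg_cst. Qed.

Lemma ccont_real (r : T -> R) : continuous r -> ccont (fun x => (r x)%:C).
Proof. by move=> cr; split => // x; exact: cvg_cst. Qed.

Lemma ccont_cis (r : T -> R) : continuous r -> ccont (fun x => cis (r x)).
Proof.
move=> cr; split => x /=.
  exact: (continuous_comp (cr x) (@continuous_cos R (r x))).
exact: (continuous_comp (cr x) (@continuous_sin R (r x))).
Qed.

Lemma ccont_conj f : ccont f -> ccont (fun x => (f x)^*).
Proof.
move=> [f1 f2]; split.
  by rewrite (_ : (fun _ => _) = fun x => Re (f x))//; apply/funext => y; case: (f y).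
rewrite (_ : (fun _ => _) = fun x => - Im (f x)); last by apply/funext => y; case: (f y).
by move=> x; apply: cvgN; exact: f2.
Qed.

Lemma ccont_prod (I : Type) (s : seq I) (F : I -> T -> R[i]) :
  (forall i, ccont (F i)) -> ccont (fun x => \prod_(i <- s) F i x).
Proof.
move=> cF; elim: s => [|i s IH].
  by under eq_fun do rewrite big_nil; exact: ccont_cst.
under eq_fun do rewrite big_cons.
exact: (ccontM (cF i) IH).
Qed.

Lemma continuous_sum_real (I : Type) (s : seq I) (F : I -> T -> R) :
  (forall i, continuous (F i)) -> continuous (fun x => \sum_(i <- s) F i x).
Proof.
move=> cF; elim: s => [|i s IH].
  by under eq_fun do rewrite big_nil; exact: cst_continuous.
by under eq_fun do rewrite big_cons; move=> x; exact: cvgD (cF i x) (IH x).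
Qed.

End complex_continuous.

Lemma ccont_comp {R : realType} (T U : topologicalType) (f : U -> R[i]) (g : T -> U) :
  ccont f -> continuous g -> ccont (fun x => f (g x)).
Proof.
move=> [f1 f2] cg; split => x.
  exact: (continuous_comp (cg x) (f1 _)).
exact: (continuous_comp (cg x) (f2 _)).
Qed.

Lemma cmeas_ccont {R : realType} {dX : measure_display} {X : measurableType dX} n
  (f : 'cV[R]_n -> R[i]) (v : X -> 'cV[R]_n) : ccont f -> mcoord v ->
  cmeas (fun x => f (v x)).
Proof.
move=> [f1 f2] mv; split.
  exact: (measurable_continuous f1 mv).
exact: (measurable_continuous f2 mv).
Qed.

Section parametric.
Context {R : realType} {dX dY : measure_display} {X : measurableType dX}
  {Y : measurableType dY} (nu : {sigma_finite_measure set Y -> \bar R}).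

(** Tonelli's theorem gives measurability for nonnegative integrands; f is written as (|f| + f) -
    |f|. *)
Lemma measurable_Rint (f : X * Y -> R) : measurable_fun setT f ->
  (forall x, rintegrable nu (fun y => f (x, y))) ->
  measurable_fun setT (fun x => \int[nu]_(y in setT) f (x, y)).
Proof.
move=> mf fi.
have mp (g : X * Y -> R) : measurable_fun setT g -> (forall z, 0 <= g z) ->
    measurable_fun setT (fun x => \int[nu]_(y in setT) g (x, y)).
  move=> mg g0; have -> : (fun x => \int[nu]_(y in setT) g (x, y)) =
      fine \o (fun x => \int[nu]_y (g (x, y))%:E)%E by [].
  apply: measurableT_comp; first exact: fine_measurable.
  apply: (@measurable_fun_fubini_tonelli_F _ _ _ _ _ nu (EFin \o g)).
    exact/measurable_EFinP.
  by move=> z; rewrite lee_fin; exact: g0.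
have mabs : measurable_fun setT (fun z => `|f z|) by exact: measurableT_comp.
have -> : (fun x => \int[nu]_(y in setT) f (x, y)) = fun x =>
    \int[nu]_(y in setT) (`|f (x, y)| + f (x, y)) - \int[nu]_(y in setT) `|f (x, y)|.
  apply/funext => x.
  by rewrite (RintegralD measurableT (rintegrable_norm (fi x)) (fi x)) addrAC subrr add0r.
have m1 := mp _ (measurable_funD mabs mf) (fun z => _).
have m2 := mp _ mabs (fun z => normr_ge0 _).
apply: measurable_funB m2; apply: m1 => z /=.
by have := ler_norm (- f z); rewrite normrN; lra.
Qed.

Lemma cmeas_cint (f : X * Y -> R[i]) : cmeas f ->
  (forall x, cintegrable nu (fun y => f (x, y))) ->
  cmeas (fun x => cint nu (fun y => f (x, y))).
Proof.
move=> [m1 m2] fi; split => /=.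
  by apply: (measurable_Rint m1) => x; case: (fi x).
by apply: (measurable_Rint m2) => x; case: (fi x).
Qed.

End parametric.

Lemma is_derive_line {R : realType} n (f : 'cV[R]_n -> R) (f' : R) x v (h : R) :
  is_derive (x + h *: v) v f f' -> is_derive h (1 : R) (fun k => f (x + k *: v)) f'.
Proof.
move=> [df Df].
have E : (fun k : R => k^-1 *: (((fun k => f (x + k *: v)) \o shift h) (k *: (1 : R)) -
    f (x + h *: v))) = (fun k : R => k^-1 *: ((f \o shift (x + h *: v)) (k *: v) - f (x + h *: v))).
  apply/funext => k /=; congr (_ *: (f _ - _)).
  by rewrite [k *: (1 : R)]mulr1 scalerDl addrCA.
split.
  by rewrite /derivable E.
by rewrite /derive E.
Qed.

(** * Integrals of rapidly decreasing functions, integration by parts *)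

Section rapid_integral.
Context {R : realType} (p : R) (hp : 1 <= p <= 2).
Local Notation X := (@lebv R).
Local Notation mu n := (vs_mu (X n)).
Local Notation vec := vs_vec.
Local Notation qv := (qv p).
Local Notation rapid := (rapid p).

Definition crapid n (f : 'cV[R]_n -> R[i]) := exists C e : R, [/\ 0 <= C, 0 < e &
  forall x, cabs (f x) <= C * expR (- (e * qv x))].

Lemma crapid_ReIm n (f : 'cV[R]_n -> R[i]) : crapid f ->
  rapid (fun x => Re (f x)) /\ rapid (fun x => Im (f x)).
Proof.
move=> [C [e [_ e0 fC]]]; split; exists C, e; split => // x.
  exact: le_trans (cabs_Re _) (fC x).
exact: le_trans (cabs_Im _) (fC x).
Qed.

Lemma cintegrable_crapid n (f : 'cV[R]_n -> R[i]) : ccont f -> crapid f ->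
  cintegrable (mu n) (fun x => f (vec x)).
Proof.
move=> [f1 f2] /crapid_ReIm[r1 r2].
by split; [exact: (rintegrable_rapid hp f1 r1)|exact: (rintegrable_rapid hp f2 r2)].
Qed.

Lemma cint_affine n (f : 'cV[R]_n -> R[i]) a (s : R) : 0 < s -> ccont f -> crapid f ->
  cint (mu n) (fun x => f (a + s *: vec x)) =
  (s ^- n)%:C * cint (mu n) (fun x => f (vec x)).
Proof.
move=> s0 [f1 f2] /crapid_ReIm[r1 r2]; apply: ceq.
  by rewrite Re_mul/= mul0r subr0 (Rint_affine hp a s0 f1 r1).
by rewrite Im_mul/= mul0r addr0 (Rint_affine hp a s0 f2 r2).
Qed.

Lemma cintegralRd_lebv n (f : 'cV[R]_n -> R[i]) : ccont f -> crapid f ->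
  cintegralRd f = cint (mu n) (fun x => f (vec x)).
Proof.
move=> [f1 f2] /crapid_ReIm[r1 r2].
by apply: ceq => /=; [exact: (integralRd_lebv hp f1 r1)|exact: (integralRd_lebv hp f2 r2)].
Qed.

Lemma poly_exp (e y : R) : 0 < e -> 0 <= y -> 1 + y <= (1 + e^-1) * expR (e * y).
Proof.
move=> e0 y0; rewrite mulrDl mul1r lerD//.
  by rewrite (le_trans _ (expR_ge1Dx _))// lerDl mulr_ge0// ltW.
by rewrite ler_pdivlMl// (le_trans _ (expR_ge1Dx _))// lerDr.
Qed.

Lemma rapid_poly n (f g : 'cV[R]_n -> R) (K : R) : rapid f ->
  (forall x, `|g x| <= K * (1 + qv x) * `|f x|) -> rapid g.
Proof.
move=> /(rapid_ge0 hp)[C [e [C0 e0 fC]]] gf.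
have e20 : 0 < e / 2 by rewrite divr_gt0.
exists (`|K| * (1 + (e / 2)^-1) * C), (e / 2); split => // x.
apply: le_trans (gf x) _.
apply: (@le_trans _ _ (`|K| * ((1 + (e / 2)^-1) * expR (e / 2 * qv x)) * (C * expR (- (e * qv x))))).
  have q0 := qv_ge0 p x.
  apply: (@le_trans _ _ (`|K| * (1 + qv x) * `|f x|)).
    by rewrite ler_wpM2r// ler_wpM2r ?ler_norm// addr_ge0.
  apply: ler_pM => //; first by rewrite mulr_ge0// addr_ge0.
  by rewrite ler_wpM2l// poly_exp.
rewrite -!mulrA ler_wpM2l// ler_wpM2l//.
  by rewrite addr_ge0// invr_ge0 ltW.
by rewrite mulrCA ler_wpM2l// -expRD ler_expR; lra.
Qed.

(* The translates of an integrable function have the same integral; differentiate in the translation. *)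
Lemma Rint_partial n (v : 'cV[R]_n) (f f' : 'cV[R]_n -> R) : continuous f -> rapid f ->
  rapid f' -> (forall x, is_derive x v f (f' x)) ->
  \int[mu n]_(x in setT) f' (vec x) = 0.
Proof.
move=> cf rf /(rapid_ge0 hp)[C [e [C0 e0 fC]]] df.
pose F (h : R) (x : X n) := f (vec x + h *: v).
have dF h x : is_derive h (1 : R) (fun h => F h x) (f' (vec x + h *: v)).
  exact: is_derive_line.
have FE h : \int[mu n]_(x in setT) F h x = \int[mu n]_(x in setT) f (vec x).
  transitivity (\int[mu n]_(x in setT) f (h *: v + 1 *: vec x)).
    by apply: eq_Rintegral => x _; rewrite scale1r addrC.
  by rewrite (Rint_affine hp _ ltr01 cf rf) expr1n invr1 mul1r.
have qhv (h : R) : `|h| <= 1 -> qv (h *: v) <= qv v.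
  move=> h1; rewrite qvZ -[leRHS]mul1r; apply: ler_wpM2r; first exact: qv_ge0.
  apply: (@le_trans _ _ (pw p 1)); last by rewrite /pw normr1 powR1.
  by apply: pw_mono => //; rewrite normr1.
have iF h : rintegrable (mu n) (F h).
  have cg : continuous (fun x : 'cV[R]_n => f (h *: v + 1 *: x)).
    by move=> x; exact: (continuous_comp (@continuous_affine _ _ (h *: v) 1 x) (cf _)).
  have := rintegrable_rapid hp cg (rapid_affine hp (h *: v) ltr01 rf).
  by congr rintegrable; apply/funext => x; rewrite /F scale1r addrC.
have I0 : `]-1, 1[%classic (0 : R) by rewrite /= in_itv/=; apply/andP; split.
(* A majorant for all |h| <= 1: from q x <= 4 (q (x + h v) + q (h v)) follows e q (x + h v) >= (e /
   4) q x - e q v. *)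
pose G (x : X n) := C * expR (e * qv v) * expR (- (e / 4 * qv (vec x))).
have GE h x : `|h| <= 1 -> `|f' (vec x + h *: v)| <= G x.
  move=> h1; apply: le_trans (fC _) _; rewrite /G -mulrA ler_wpM2l// -expRD ler_expR.
  have := qv_sub hp (vec x + h *: v) (h *: v); rewrite addrK => hq.
  have := qhv _ h1; nra.
have G0 x : 0 <= G x by rewrite !mulr_ge0// expR_ge0.
have iG : rintegrable (mu n) G.
  by apply: rintegrableZ; apply: rintegrable_qv => //; rewrite divr_gt0.
have D1 h x : partial1of2 F h x = f' (vec x + h *: v).
  by rewrite partial1of2E; exact: (@derive_val _ _ _ _ _ _ _ (dF h x)).
have Gub h x : `]-1, 1[%classic h -> setT x -> `|partial1of2 F h x| <= G x.
  rewrite /= in_itv/= => /andP[h1 h2] _; rewrite D1; apply: GE.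
  by rewrite ler_norml !ltW.
have := @cvg_differentiation_under_integral R _ _ (mu n) F setT measurableT 0 (-1) 1 I0
  (fun h _ => iF h) (fun h x _ _ => @ex_derive _ _ _ _ _ _ _ (dF h x)) G G0 iG Gub.
under eq_fun do rewrite !FE subrr scaler0.
move=> /(cvg_unique (@norm_hausdorff _ _) (cvg_cst _)) H.
rewrite [RHS]H; apply: eq_Rintegral => x _.
by rewrite D1 scale0r addr0.
Qed.

End rapid_integral.

Section derivation_rules.
Context {R : realType}.
Implicit Types (f g : R -> R) (t a b : R).

Lemma der_add f g t a b : is_derive t (1 : R) f a -> is_derive t (1 : R) g b ->
  is_derive t (1 : R) (fun x => f x + g x) (a + b).
Proof. by move=> df dg; exact: is_deriveD. Qed.

Lemma der_mul f g t a b : is_derive t (1 : R) f a -> is_derive t (1 : R) g b ->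
  is_derive t (1 : R) (fun x => f x * g x) (a * g t + f t * b).
Proof.
move=> df dg; apply: (is_derive_eq (is_deriveM df dg)).
by rewrite /GRing.scale/= addrC mulrC.
Qed.

Lemma der_comp f g t a b : is_derive (g t) (1 : R) f a -> is_derive t (1 : R) g b ->
  is_derive t (1 : R) (fun x => f (g x)) (a * b).
Proof. by move=> df dg; exact: is_derive1_comp. Qed.

Lemma der_cst (c : R) t : is_derive t (1 : R) (fun=> c) 0.
Proof. exact: is_derive_cst. Qed.

Lemma der_id t : is_derive t (1 : R) (fun x => x) 1.
Proof. exact: is_derive_id. Qed.

Lemma der_scale f (c : R) t a : is_derive t (1 : R) f a ->
  is_derive t (1 : R) (fun x => c * f x) (c * a).
Proof. by move=> df; apply: is_derive_eq (der_mul (der_cst c t) df) _; rewrite mul0r add0r. Qed.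

Lemma der_lin (b c : R) t : is_derive t (1 : R) (fun x => b + x * c) c.
Proof.
apply: is_derive_eq (der_add (der_cst b t) (der_mul (der_id t) (der_cst c t))) _.
by rewrite mul1r mulr0 addr0 add0r.
Qed.

Lemma is_derive_along n (f : 'cV[R]_n -> R) (f' : R) x v :
  is_derive (0 : R) (1 : R) (fun k => f (x + k *: v)) f' -> is_derive x v f f'.
Proof.
move=> [df Df].
have E : (fun k : R => k^-1 *: (((fun k => f (x + k *: v)) \o shift 0) (k *: (1 : R)) -
    f (x + 0 *: v))) = (fun k : R => k^-1 *: ((f \o shift x) (k *: v) - f x)).
  apply/funext => k /=; rewrite scale0r !addr0; congr (_ *: (f _ - _)).
  by rewrite [k *: (1 : R)]mulr1 addrC.
split.
  by rewrite /derivable -E.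
by rewrite /derive -E.
Qed.

End derivation_rules.

(** * The Gaussian, its Fourier transform, and Fourier inversion *)

Section gauss.
Context {R : realType}.
Local Notation X := (@lebv R).
Local Notation mu n := (vs_mu (X n)).
Local Notation vec := vs_vec.
Notation leb := (@lebesgue_measure R).
Implicit Types (n : nat).

Definition gauss n (x : 'cV[R]_n) : R := expR (- (dotp x x / 2)).

(** The number (2 pi)^(n/2), kept as a symbol; it is a constant to divide by, so what gets proved
    about it is positivity. *)
Definition gauss_mass n : R := \int[mu n]_(x in setT) gauss (vec x).

Lemma dotpC n (x y : 'cV[R]_n) : dotp x y = dotp y x.
Proof. by apply: eq_bigr => j _; rewrite mulrC. Qed.

Lemma dotpDl n (x y z : 'cV[R]_n) : dotp (x + y) z = dotp x z + dotp y z.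
Proof. by rewrite /dotp -big_split/=; apply: eq_bigr => j _; rewrite mxE mulrDl. Qed.

Lemma dotpZl n s (x z : 'cV[R]_n) : dotp (s *: x) z = s * dotp x z.
Proof. by rewrite /dotp mulr_sumr; apply: eq_bigr => j _; rewrite mxE mulrA. Qed.

Lemma dotpDr n (x y z : 'cV[R]_n) : dotp z (x + y) = dotp z x + dotp z y.
Proof. by rewrite dotpC dotpDl !(dotpC z). Qed.

Lemma dotpZr n s (x z : 'cV[R]_n) : dotp z (s *: x) = s * dotp z x.
Proof. by rewrite dotpC dotpZl (dotpC z). Qed.

Lemma dotpNl n (x z : 'cV[R]_n) : dotp (- x) z = - dotp x z.
Proof. by rewrite -scaleN1r dotpZl mulN1r. Qed.

Lemma dotpNr n (x z : 'cV[R]_n) : dotp z (- x) = - dotp z x.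
Proof. by rewrite dotpC dotpNl dotpC. Qed.

Lemma dotp0l n (x : 'cV[R]_n) : dotp 0 x = 0.
Proof. by rewrite -(scale0r x) dotpZl mul0r. Qed.

Lemma dotp_ge0 n (x : 'cV[R]_n) : 0 <= dotp x x.
Proof. by apply: sumr_ge0 => j _; rewrite -expr2 sqr_ge0. Qed.

Lemma enorm_sqr n (x : 'cV[R]_n) : enorm x ^+ 2 = dotp x x.
Proof. by rewrite sqr_sqrtr// dotp_ge0. Qed.

Lemma gaussN n (x : 'cV[R]_n) : gauss (- x) = gauss x.
Proof. by rewrite /gauss dotpNl dotpNr opprK. Qed.

Lemma gauss_ge0 n (x : 'cV[R]_n) : 0 <= gauss x. Proof. exact: expR_ge0. Qed.

Lemma gauss_le1 n (x : 'cV[R]_n) : gauss x <= 1.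
Proof. by rewrite /gauss expR_le1 oppr_le0 divr_ge0// dotp_ge0. Qed.

Lemma continuous_dotp n (T : topologicalType) (f g : T -> 'cV[R]_n) : continuous f ->
  continuous g -> continuous (fun x => dotp (f x) (g x)).
Proof.
move=> cf cg; apply: continuous_sum_real => j x; apply: cvgM.
  exact: (continuous_comp (cf x) (@coord_continuous R n 1 j 0 _)).
exact: (continuous_comp (cg x) (@coord_continuous R n 1 j 0 _)).
Qed.

Lemma continuous_dotpl n (w : 'cV[R]_n) : continuous (fun x : 'cV[R]_n => dotp x w).
Proof.
apply: continuous_sum_real => j.
exact: (contM (@coord_continuous R n 1 j 0) (@cont_cst R _ (w j 0))).
Qed.

Lemma continuous_dotpr n (w : 'cV[R]_n) : continuous (fun x : 'cV[R]_n => dotp w x).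
Proof.
apply: continuous_sum_real => j.
exact: (contM (@cont_cst R _ (w j 0)) (@coord_continuous R n 1 j 0)).
Qed.

Lemma measurable_dotp d (Y : measurableType d) n (f g : Y -> 'cV[R]_n) : mcoord f ->
  mcoord g -> measurable_fun setT (fun y => dotp (f y) (g y)).
Proof.
move=> mf mg; rewrite /dotp; elim: (index_enum _) => [|j s IH].
  by under eq_fun do rewrite big_nil; exact: measurable_cst.
under eq_fun do rewrite big_cons; apply: measurable_funD => //.
exact: measurable_funM.
Qed.

Lemma mcoord_comp d d' (Y : measurableType d) (Z : measurableType d') n
  (f : Y -> 'cV[R]_n) (g : Z -> Y) : mcoord f -> measurable_fun setT g ->
  mcoord (fun z => f (g z)).
Proof. by move=> mf mg j; exact: measurableT_comp (mf j) mg. Qed.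

Lemma continuous_scale n (s : R) : continuous (fun x : 'cV[R]_n => s *: x).
Proof.
have := @continuous_affine _ n 0 s.
by rewrite (_ : (fun x : 'cV_n => 0 + s *: x) = (fun x => s *: x))//; apply/funext => x; rewrite add0r.
Qed.

Lemma continuous_gauss n : continuous (@gauss n).
Proof.
apply: (cont_comp (@continuous_expR R)); apply: contN.
apply: (contM _ (@cont_cst R _ 2^-1)).
by apply: continuous_dotp => x; exact: cvg_id.
Qed.

Lemma gauss_vcons n t (y : 'cV[R]_n) :
  gauss (vcons t y) = expR (- (t ^+ 2 / 2)) * gauss y.
Proof.
rewrite /gauss /dotp (vcons_sum2 (fun a b => a * b)) -expRD; congr expR.
by rewrite -expr2 mulrDl opprD.
Qed.

Section rapid_gauss.
Context (p : R) (hp : 1 <= p <= 2).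
Local Notation qv := (qv p).
Local Notation rapid := (rapid p).

(** Here p <= 2, that is theta >= 1/2, enters through |t|^p <= 1 + t^2; each coordinate contributes
    a factor e^(1/2). *)
Lemma gauss_le_qv n (x : 'cV[R]_n) : gauss x <= expR (n%:R / 2) * expR (- (2^-1 * qv x)).
Proof.
rewrite -expRD ler_expR.
have : qv x <= n%:R + dotp x x; last lra.
rewrite -[n in n%:R]card_ord -sum1_card natr_sum /qv /dotp -big_split/=.
by apply: ler_sum => j _; rewrite -expr2 pw_le_sqr.
Qed.

Lemma rapid_gauss n : rapid (@gauss n).
Proof.
exists (expR (n%:R / 2)), 2^-1; split; first by rewrite invr_gt0.
by move=> x; rewrite ger0_norm ?gauss_ge0 ?gauss_le_qv.
Qed.

Lemma dotp_le_qv n (w x : 'cV[R]_n) : `|dotp x w| <= `|w| * n.+1%:R * (1 + qv x).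
Proof.
apply: le_trans (ler_norm_sum _ _ _) _.
apply: (@le_trans _ _ (\sum_(j < n) `|w| * (1 + pw p (x j 0)))).
  apply: ler_sum => j _; rewrite normrM mulrC ler_pM//; first exact: mxnorm_coord.
  by rewrite -lerBlDl pw_ge_norm.
rewrite -mulr_sumr -mulrA ler_wpM2l// big_split/= sumr_const card_ord.
have q0 := qv_ge0 p x; rewrite -natr1 mulrDl mul1r mulrDr mulr1.
have : 0 <= n%:R * qv x by rewrite mulr_ge0.
by rewrite /qv; lra.
Qed.

Let c_scale n (w : 'cV[R]_n) s a : continuous (fun x : 'cV[R]_n => s * dotp x w + a).
Proof.
apply: (contD _ (@cont_cst R _ a)); apply: (contM (@cont_cst R _ s)).
exact: continuous_dotpl.
Qed.

Section gauss_phase.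
Variables (n : nat) (w : 'cV[R]_n) (a : R).
Let F (s : R) (x : 'cV[R]_n) := gauss x * cos (s * dotp x w + a).
Let F' (s : R) (x : 'cV[R]_n) := gauss x * (- sin (s * dotp x w + a) * dotp x w).
Let I s := \int[mu n]_(x in setT) F s (vec x).

Let cF s : continuous (F s).
Proof.
exact: (contM (@continuous_gauss n) (cont_comp (@continuous_cos R) (@c_scale _ w s a))).
Qed.

Let rF s : rapid (F s).
Proof.
have [C [e [e0 h]]] := rapid_gauss n; exists C, e; split => // x.
apply: le_trans (h x); rewrite normrM ler_piMr//.
by rewrite ler_norml cos_geN1 cos_le1.
Qed.

Let absF' s x : `|F' s x| <= `|w| * n.+1%:R * (1 + qv x) * `|gauss x|.
Proof.
rewrite !normrM normrN mulrC ler_wpM2r// (le_trans _ (dotp_le_qv w x))//.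
by rewrite ler_piMl// ler_norml sin_geN1 sin_le1.
Qed.

Let dF s x : is_derive s (1 : R) (fun s => F s x) (F' s x).
Proof.
apply: der_scale; apply: der_comp.
apply: is_derive_eq (der_add (der_mul (der_id s) (der_cst (dotp x w) s)) (der_cst a s)) _.
by rewrite mul1r mulr0 !addr0.
Qed.

(** Differentiation under the integral produces a factor x.w. An integration by parts along w turns
    it back into a multiple of the same integral, so I solves I' = - s |w|^2 I. *)
Lemma gauss_phase_derive s : is_derive s (1 : R) I (- (s * dotp w w) * I s).
Proof.
have iF t : rintegrable (mu n) (fun x => F t (vec x)).
  exact: (rintegrable_rapid hp (@cF t) (rF t)).
have rG : rapid (fun x : 'cV[R]_n => `|w| * n.+1%:R * (1 + qv x) * `|gauss x|).
  apply: (@rapid_poly _ _ hp _ _ _ (`|w| * n.+1%:R) (rapid_gauss n)) => x.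
  by rewrite ger0_norm// !mulr_ge0// addr_ge0// qv_ge0.
have [C [e [e0 hG]]] := rG.
pose G (x : X n) := C * expR (- (e * qv (vec x))).
have absG t (x : X n) : `|F' t (vec x)| <= G x.
  by apply: le_trans (absF' t (vec x)) _; apply: le_trans (ler_norm _) (hG _).
have G0 x : 0 <= G x by apply: le_trans (absG 0 x).
have iG : rintegrable (mu n) G by apply: rintegrableZ; exact: rintegrable_qv.
have Is : `]s - 1, s + 1[%classic s by rewrite /= in_itv/=; apply/andP; split; lra.
have D1 t (x : X n) : partial1of2 (fun s (x : X n) => F s (vec x)) t x = F' t (vec x).
  by rewrite partial1of2E; exact: (@derive_val _ _ _ _ _ _ _ (dF t (vec x))).
have Gub t (x : X n) : `]s - 1, s + 1[%classic t -> setT x ->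
    `|partial1of2 (fun s (x : X n) => F s (vec x)) t x| <= G x.
  by move=> _ _; rewrite D1.
have dI := @derivable_under_integral R _ _ (mu n) (fun s (x : X n) => F s (vec x)) setT
  measurableT s _ _ Is (fun t _ => iF t)
  (fun t x _ _ => @ex_derive _ _ _ _ _ _ _ (dF t (vec x))) G G0 iG Gub.
have DI := @differentiation_under_integral R _ _ (mu n) (fun s (x : X n) => F s (vec x)) setT
  measurableT s _ _ Is (fun t _ => iF t)
  (fun t x _ _ => @ex_derive _ _ _ _ _ _ _ (dF t (vec x))) G G0 iG Gub.
have E : \int[mu n]_(x in setT) F' s (vec x) = - (s * dotp w w) * I s.
  (* The derivative of this [f] along w is F' s + s |w|^2 F s, and its integral vanishes. *)
  pose f (x : 'cV[R]_n) := gauss x * sin (s * dotp x w + a).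
  pose f' (x : 'cV[R]_n) := F' s x + s * dotp w w * F s x.
  have cf : continuous f.
    exact: (contM (@continuous_gauss n) (cont_comp (@continuous_sin R) (@c_scale _ w s a))).
  have rf : rapid f.
    have [C1 [e1 [e10 h]]] := rapid_gauss n; exists C1, e1; split => // x.
    apply: le_trans (h x); rewrite normrM ler_piMr//.
    by rewrite ler_norml sin_geN1 sin_le1.
  have rf' : rapid f'.
    apply: (@rapid_poly _ _ hp _ (@gauss n) _ (`|w| * n.+1%:R + `|s * dotp w w|) (rapid_gauss n)) => x.
    apply: le_trans (ler_normD _ _) _; rewrite [_ + `|s * _|]addrC 2!mulrDl addrC lerD//.
    rewrite normrM -mulrA ler_wpM2l// normrM mulrC.
    apply: ler_pM => //; rewrite (@le_trans _ _ 1)//; last by rewrite lerDl qv_ge0.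
    by rewrite ler_norml cos_geN1 cos_le1.
  have df x : is_derive x w f (f' x).
    apply: is_derive_along.
    pose A := dotp x x; pose B := dotp x w; pose D := dotp w w.
    have -> : (fun k : R => f (x + k *: w)) = fun k : R =>
        expR (- ((A + 2 * k * B + k ^+ 2 * D) / 2)) * sin (s * (B + k * D) + a).
      apply/funext => k; rewrite /f /gauss !(dotpDl, dotpDr, dotpZl, dotpZr) -/B -/D.
      by rewrite [dotp w x]dotpC -/B -/A; congr (expR _ * sin _); ring.
    have d1 : is_derive (0 : R) (1 : R) (fun k => - ((A + 2 * k * B + k ^+ 2 * D) / 2)) (- B).
      have -> : (fun k : R => - ((A + 2 * k * B + k ^+ 2 * D) / 2)) =
          fun k => (- (A / 2) + k * (- B)) + (k * k) * (- (D / 2)).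
        by apply/funext => k; field.
      apply: is_derive_eq (der_add (der_lin _ _ _) (der_mul (der_mul (der_id _) (der_id _)) (der_cst _ _))) _.
      by ring.
    have d2 : is_derive (0 : R) (1 : R) (fun k => s * (B + k * D) + a) (s * D).
      apply: is_derive_eq (der_add (der_scale s (der_lin B D 0)) (der_cst a 0)) _.
      by rewrite addr0.
    apply: is_derive_eq (der_mul (der_comp (is_derive_expR _) d1) (der_comp (is_derive_sin _) d2)) _.
    rewrite /f' /F' /F /gauss -/A -/B -/D expr0n/= !(mulr0, mul0r, addr0).
    by ring.
  have := Rint_partial hp cf rf rf' df.
  have rF' : rapid (F' s) by apply: (rapid_poly hp (rapid_gauss n)) => x; exact: absF'.
  have iF' : rintegrable (mu n) (fun x => F' s (vec x)).
    apply: (rintegrable_dom _ iG) => [|x]; last exact: absG.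
    apply: (measurable_vec (f := F' s)).
    apply: (contM (@continuous_gauss n)); apply: contM.
      exact: contN (cont_comp (@continuous_sin R) (@c_scale _ w s a)).
    exact: continuous_dotpl.
  rewrite (RintegralD measurableT iF' (rintegrableZ (s * dotp w w) (iF s))) (RintegralZl _ measurableT (iF s)).
  by move=> /eqP; rewrite addr_eq0 => /eqP ->; rewrite mulNr.
split; first exact: dI.
rewrite -E -derive1E [LHS]DI; apply: eq_Rintegral => x _; exact: D1.
Qed.

(** The differential equation makes I s exp (s^2 |w|^2 / 2) constant; its value at s = 0 is cos a
    times the mass. The phase a lets one computation serve for both cosine and sine. *)
Lemma gauss_phase : I 1 = gauss w * cos a * gauss_mass n.
Proof.
pose E (s : R) := expR (s * s * (dotp w w / 2)).
have dE s : is_derive s (1 : R) E (E s * (s * dotp w w)).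
  apply: is_derive_eq (der_comp (is_derive_expR _)
    (der_mul (der_mul (der_id s) (der_id s)) (der_cst (dotp w w / 2) s))) _.
  by rewrite mulr0 addr0 mulr1 mul1r; congr (_ * _); field.
have dIE s : is_derive s (1 : R) (fun s => I s * E s) 0.
  apply: is_derive_eq (der_mul (gauss_phase_derive s) (dE s)) _.
  by ring.
have := @is_derive_0_is_cst R (fun s => I s * E s) 1 0 dIE.
rewrite /E !mul1r !mul0r expR0 mulr1 => H.
have -> : I 1 = I 0 * gauss w.
  by rewrite -H /gauss -mulrA -expRD subrr expR0 mulr1.
rewrite mulrC -mulrA; congr (_ * _).
rewrite /I /gauss_mass mulrC -RintegralZr//; last exact: (rintegrable_rapid hp (@continuous_gauss n) (rapid_gauss n)).
by apply: eq_Rintegral => x _; rewrite /F mul0r add0r.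
Qed.

End gauss_phase.

Lemma gauss_fourier n (w : 'cV[R]_n) :
  cint (mu n) (fun x => (gauss (vec x))%:C * cis (dotp (vec x) w)) =
  (gauss_mass n * gauss w)%:C.
Proof.
apply: ceq => /=.
  transitivity (\int[mu n]_(x in setT) (gauss (vec x) * cos (1 * dotp (vec x) w + 0))).
    by apply: eq_Rintegral => x _; rewrite mul0r subr0 mul1r addr0.
  by rewrite gauss_phase cos0 mulr1 mulrC.
(* With a = - pi / 2 the cosine becomes a sine, and the factor cos a of the result vanishes. *)
transitivity (\int[mu n]_(x in setT) (gauss (vec x) * cos (1 * dotp (vec x) w + - (pi / 2)))).
  by apply: eq_Rintegral => x _; rewrite mul0r addr0 mul1r cosB cos_pihalf sin_pihalf mulr0 add0r mulr1.
by rewrite gauss_phase cosN cos_pihalf mulr0 mul0r.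
Qed.

(** The mass factors over the coordinates. On the line, rescaling exp (- t^2) by 1 / sqrt 2 gives
    the value sqrt 2 sqrt pi. *)
Lemma gauss_mass_gt0 n : 0 < gauss_mass n.
Proof.
rewrite /gauss_mass; elim: n => [|n IH].
  by rewrite /Rintegral integral_dirac// diracE in_setT mul1e/= expR_gt0.
have c1 : continuous (fun t : R => expR (- (t ^+ 2 / 2))).
  apply: (cont_comp (@continuous_expR R)); apply: contN.
  by apply: (contM _ (@cont_cst R _ 2^-1)); exact: exprn_continuous.
pose G : R := \int[leb]_(t in setT) expR (- (t ^+ 2 / 2)).
have bG (t : R) : `|gauss_fun t| <= 1 * (1 + t ^+ 2)^-1.
  have t2 : 0 < 1 + t ^+ 2 by rewrite ltr_pwDl// sqr_ge0.
  rewrite ger0_norm ?gauss_fun_ge0// mul1r /gauss_fun expRN lef_pV2 ?posrE ?expR_gt0//.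
  exact: expR_ge1Dx.
have s0 : (0 : R) < (Num.sqrt 2)^-1 by rewrite invr_gt0 sqrtr_gt0.
have G0 : 0 < G.
  have := Rint_affine_line 0 s0 (@continuous_gauss_fun R) bG.
  rewrite /Rintegral integralT_gauss/= invrK => H.
  have -> : G = Num.sqrt 2 * Num.sqrt pi.
    rewrite -H; congr fine; apply: eq_integral => t _; rewrite /gauss_fun.
    by rewrite add0r exprMn exprVn sqr_sqrtr// mulrC.
  by rewrite mulr_gt0// sqrtr_gt0// pi_gt0.
rewrite (Rint_vcons hp (@continuous_gauss n.+1) (rapid_gauss _)).1.
have ig := rintegrable_rapid hp (@continuous_gauss n) (rapid_gauss n).
under eq_Rintegral => t _.
  under eq_Rintegral do rewrite gauss_vcons.
  rewrite RintegralZl//; over.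
rewrite /= RintegralZr//; first by rewrite mulr_gt0.
suff : rintegrable leb (fun t : R => expR (- (t ^+ 2 / 2))) by [].
have h2 : (0 : R) < 2^-1 by rewrite invr_gt0.
apply: (rintegrable_dom _ (rintegrableZ (expR 2^-1) (rintegrable_pw hp h2))).
- exact: continuous_measurable_fun.
- move=> t; rewrite ger0_norm ?expR_ge0// -expRD ler_expR.
  have := pw_le_sqr hp t; lra.
Qed.

Lemma rapid0 n : rapid (fun _ : 'cV[R]_n => 0).
Proof. by exists 0, 1; split => // x; rewrite normr0 mul0r. Qed.

Lemma ccont_cvg (T : topologicalType) (h : T -> R[i]) (u : nat -> T) y : ccont h ->
  u k @[k --> \oo] --> y -> cabs (h (u k) - h y) @[k --> \oo] --> (0 : R).
Proof.
move=> [h1 h2] uy.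
have c1 := cvg_comp _ _ uy (h1 y); have c2 := cvg_comp _ _ uy (h2 y).
have H : `|Re (h (u k)) - Re (h y)| + `|Im (h (u k)) - Im (h y)| @[k --> \oo] --> (0 : R).
  rewrite -[0]addr0; apply: cvgD.
    rewrite -[0](normr0 R) -[X in `|X|](subrr (Re (h y))).
    by apply: cvg_norm; apply: cvgB => //; exact: cvg_cst.
  rewrite -[0](normr0 R) -[X in `|X|](subrr (Im (h y))).
  by apply: cvg_norm; apply: cvgB => //; exact: cvg_cst.
apply: (squeeze_cvgr _ (cvg_cst 0) H); apply: nearW => k; rewrite cabs_ge0 andTb.
by rewrite (le_trans (cabs_le _))// Re_add Im_add Re_opp Im_opp.
Qed.

Lemma ccvg_unique (u : nat -> R[i]) a b : cabs (u k - a) @[k --> \oo] --> (0 : R) ->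
  cabs (u k - b) @[k --> \oo] --> (0 : R) -> a = b.
Proof.
move=> ua ub; apply/eqP; rewrite -subr_eq0; apply/eqP/cabs_eq0/eqP.
rewrite eq_le cabs_ge0 andbT.
have H : cabs (u k - a) + cabs (u k - b) @[k --> \oo] --> (0 : R).
  by rewrite -[0]addr0; exact: cvgD.
have : (cabs (a - b) @[_ --> \oo] --> cabs (a - b)) by exact: cvg_cst.
move=> c; apply: (ler_cvg_to c H); apply: nearW => k.
by rewrite (cabs_dist _ a); exact: cabs_trans.
Qed.

Section inversion.
Variable n : nat.
Local Notation crapid := (crapid p).

Let eps (k : nat) : R := k.+1%:R^-1.
Let eps_gt0 k : 0 < eps k. Proof. by rewrite invr_gt0. Qed.
Let eps_cvg : eps k @[k --> \oo] --> (0 : R).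
Proof. exact: cvg_harmonic. Qed.

Lemma cvg_gauss_scale (x : 'cV[R]_n) : gauss (eps k *: x) @[k --> \oo] --> (1 : R).
Proof.
have -> : (1 : R) = expR (- (0 * 0 * (dotp x x / 2))) by rewrite !mul0r oppr0 expR0.
under eq_fun do rewrite /gauss dotpZl dotpZr mulrA -mulrA.
apply: (@cvg_comp _ _ _ (fun k => - (eps k * eps k * (dotp x x / 2))) expR _ _ _ _ (@continuous_expR R _)).
apply: cvgN; apply: cvgM; last exact: cvg_cst.
exact: cvgM.
Qed.

Lemma cmeas_gauss_scale s : cmeas (fun x : X n => (gauss (s *: vec x))%:C).
Proof.
apply: cmeas_real; apply: (measurable_vec (f := fun x => gauss (s *: x))).
by move=> x; exact: (continuous_comp (@continuous_scale n s x) (@continuous_gauss n _)).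
Qed.

(* Insert the factor gauss (s x), use the Fourier transform of the Gaussian and let s tend to 0. *)
Lemma fourier_inversion (h : 'cV[R]_n -> R[i]) (hhat : 'cV[R]_n -> R[i]) :
  ccont h -> crapid h -> cmeas (fun xi : X n => hhat (vec xi)) -> crapid hhat ->
  (forall xi, hhat xi = cint (mu n) (fun x => h (vec x) * cis (dotp (vec x) xi))) ->
  forall y, cint (mu n) (fun xi => hhat (vec xi) * cis (- dotp y (vec xi))) =
    (gauss_mass n ^+ 2)%:C * h y.
Proof.
move=> ch rh mhh rhh hhE y.
have ih := cintegrable_crapid hp ch rh.
have [Ch [eh [Ch0 eh0 hC]]] := rh.
have [Ck [ek [Ck0 ek0 kC]]] := rhh.
have mcis : cmeas (fun x : X n => cis (- dotp y (vec x))).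
  apply: cmeas_cis; apply: (measurable_vec (f := fun x => - dotp y x)).
  exact: (contN (@continuous_dotpr n y)).
(* [L k] is the inversion integral damped by a wide Gaussian and [M k] a Gaussian average of h
   around y at scale eps k. They agree up to the mass, and dominated convergence gives both
   limits. *)
pose L k := cint (mu n) (fun xi => hhat (vec xi) * cis (- dotp y (vec xi)) *
   (gauss (eps k *: vec xi))%:C).
pose M k := cint (mu n) (fun t => (gauss (vec t))%:C * h (y + eps k *: vec t)).
have LE k : L k = (gauss_mass n)%:C * M k.
  set s := eps k; have s0 : 0 < s by exact: eps_gt0.
  pose F (z : X n * X n) := h (vec z.2) * cis (dotp (vec z.2) (vec z.1)) *
    cis (- dotp y (vec z.1)) * (gauss (s *: vec z.1))%:C.
  have m1 : mcoord (fun z : X n * X n => vec z.1).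
    exact: mcoord_comp (@mcoord_vec _ n) measurable_fst.
  have m2 : mcoord (fun z : X n * X n => vec z.2).
    exact: mcoord_comp (@mcoord_vec _ n) measurable_snd.
  have cgs : continuous (fun x : 'cV[R]_n => gauss (s *: x)).
    by move=> x; exact: (continuous_comp (@continuous_scale n s x) (@continuous_gauss n _)).
  have mF : cmeas F.
    apply: cmeasM; [apply: cmeasM; [apply: cmeasM|]|].
    - exact: cmeas_ccont.
    - by apply: cmeas_cis; exact: measurable_dotp.
    - apply: cmeas_cis; apply: measurableT_comp => //.
      by apply: measurable_dotp => // j; exact: measurable_cst.
    - by apply: cmeas_real; exact: (measurable_continuous cgs m1).
  have ig : rintegrable (mu n) (fun x => gauss (s *: vec x)).
    apply: (rintegrable_rapid hp cgs).
    have := rapid_affine hp 0 s0 (rapid_gauss n).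
    by under eq_fun do rewrite add0r.
  have [] := cint_fubini mF ig (cintegrable_abs ih).
    move=> xi x; rewrite /F/= !cabsM !cabs_cis !mulr1 cabsR ger0_norm ?gauss_ge0//.
    by rewrite mulrC.
  move=> _ E1 E2; transitivity (cint (mu n \x mu n)%E F).
    rewrite E1; apply: eq_cint => xi; rewrite hhE -mulrA.
    rewrite mulrC -cintZ; first by apply: eq_cint => x; rewrite /F/=; ring.
    apply: (cintegrable_dom (w := fun x => Ch * expR (- (eh * qv (vec x))))).
    + apply: cmeasM; first exact: (cmeas_ccont ch (@mcoord_vec _ n)).
      apply: cmeas_cis; apply: (measurable_vec (f := fun x => dotp x (vec xi))).
      exact: continuous_dotpl.
    + by apply: rintegrableZ; exact: rintegrable_qv.
    + by move=> x; rewrite cabsM cabs_cis mulr1.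
  rewrite E2.
  (* For fixed x the frequency integral is the transform of a Gaussian dilated by s; it concentrates
     at x = y, and the substitution x = y + s t later absorbs s^-n. *)
  have inner (x : X n) : cint (mu n) (fun xi => F (xi, x)) =
     (s ^- n)%:C * ((gauss_mass n)%:C * (h (vec x) * (gauss (s^-1 *: (vec x - y)))%:C)).
    pose f (t : 'cV[R]_n) := (gauss t)%:C * cis (dotp t (s^-1 *: (vec x - y))).
    have cf : ccont f.
      apply: ccontM; first by apply: ccont_real; exact: continuous_gauss.
      by apply: ccont_cis; exact: continuous_dotpl.
    have rf : crapid f.
      have [C [e [C0 e0 gC]]] := rapid_ge0 hp (rapid_gauss n).
      by exists C, e; split => // t; rewrite cabsM cabs_cis mulr1 cabsR.
    transitivity (cint (mu n) (fun xi => h (vec x) * f (0 + s *: vec xi))).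
      apply: eq_cint => xi; rewrite /F/= /f add0r.
      have -> : dotp (s *: vec xi) (s^-1 *: (vec x - y)) = dotp (vec x) (vec xi) - dotp y (vec xi).
        by rewrite dotpZl dotpZr mulrA divff ?gt_eqF// mul1r dotpDr dotpNr !(dotpC (vec xi)).
      by rewrite cisD; ring.
    rewrite cintZ; last first.
      have cfs : ccont (fun t : 'cV[R]_n => f (0 + s *: t)).
        exact: (ccont_comp cf (@continuous_affine _ n 0 s)).
      have rfs : crapid (fun t : 'cV[R]_n => f (0 + s *: t)).
        have [C [e [C0 e0 gC]]] := rapid_ge0 hp (rapid_affine hp 0 s0 (rapid_gauss n)).
        by exists C, e; split => // t; rewrite cabsM cabs_cis mulr1 cabsR; exact: gC.
      exact: (cintegrable_crapid hp cfs rfs).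
    by rewrite (cint_affine hp 0 s0 cf rf) gauss_fourier real_complexM; ring.
  under eq_cint do rewrite inner.
  pose g (x : 'cV[R]_n) := h x * (gauss (s^-1 *: (x - y)))%:C.
  have cg : ccont g.
    apply: ccontM => //; apply: ccont_real.
    have E : (fun x : 'cV[R]_n => gauss (s^-1 *: (x - y))) = fun x => gauss (- (s^-1 *: y) + s^-1 *: x).
      by apply/funext => x; rewrite scalerBr addrC.
    rewrite E => x.
    exact: (continuous_comp (@continuous_affine _ n _ _ x) (@continuous_gauss n _)).
  have rg : crapid g.
    exists Ch, eh; split => // x; rewrite cabsM cabsR ger0_norm ?gauss_ge0//.
    by rewrite (le_trans _ (hC _))// ler_piMr ?cabs_ge0 ?gauss_le1.
  have igx := cintegrable_crapid hp cg rg.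
  rewrite cintZ; last exact: cintegrableZ.
  rewrite cintZ// mulrCA; congr (_ * _).
  rewrite -(cint_affine hp y s0 cg rg); apply: eq_cint => t; rewrite /g.
  by rewrite addrAC subrr add0r scalerA mulVf ?gt_eqF// scale1r mulrC.
have L1 : cabs (L k - cint (mu n) (fun xi => hhat (vec xi) * cis (- dotp y (vec xi))))
    @[k --> \oo] --> (0 : R).
  apply: (@cint_dct _ _ _ (mu n) _ _ (fun x => Ck * expR (- (ek * qv (vec x))))).
  - by move=> k; apply: cmeasM (cmeas_gauss_scale _); apply: cmeasM.
  - by apply: rintegrableZ; exact: rintegrable_qv.
  - move=> k x; rewrite !cabsM cabs_cis mulr1 cabsR ger0_norm ?gauss_ge0//.
    by rewrite (le_trans _ (kC _))// ler_piMr ?cabs_ge0 ?gauss_le1.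
  - move=> x; set c := _ * cis _.
    have -> : (fun k => cabs (c * (gauss (eps k *: vec x))%:C - c)) =
        fun k => cabs c * `|gauss (eps k *: vec x) - 1|.
      by apply/funext => k; rewrite -cabsR -cabsM; congr cabs; rewrite rmorphB rmorph1 mulrBr mulr1.
    rewrite -[0](mulr0 (cabs c)); apply: cvgM; first exact: cvg_cst.
    rewrite -[0](normr0 R) -[X in `|X|](subrr (1 : R)).
    by apply: cvg_norm; apply: cvgB; [exact: cvg_gauss_scale|exact: cvg_cst].
have L2 : cabs (M k - cint (mu n) (fun t => (gauss (vec t))%:C * h y)) @[k --> \oo] --> (0 : R).
  apply: (@cint_dct _ _ _ (mu n) _ _ (fun x => Ch * gauss (vec x))).
  - move=> k; apply: cmeasM.
      by apply: cmeas_real; apply: measurable_vec; exact: continuous_gauss.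
    apply: (cmeas_ccont (f := fun t => h (y + eps k *: t))); last exact: mcoord_vec.
    exact: (ccont_comp ch (@continuous_affine _ n y (eps k))).
  - by apply: rintegrableZ; exact: (rintegrable_rapid hp (@continuous_gauss n) (rapid_gauss n)).
  - move=> k x; rewrite cabsM cabsR ger0_norm ?gauss_ge0// mulrC ler_wpM2r ?gauss_ge0//.
    by rewrite (le_trans (hC _))// ler_piMr// expR_le1 oppr_le0 mulr_ge0 ?qv_ge0// ltW.
  - move=> t.
    have -> : (fun k => cabs ((gauss (vec t))%:C * h (y + eps k *: vec t) - (gauss (vec t))%:C * h y)) =
        fun k => cabs (gauss (vec t))%:C * cabs (h (y + eps k *: vec t) - h y).
      by apply/funext => k; rewrite -cabsM mulrBr.
    rewrite -[0](mulr0 (cabs (gauss (vec t))%:C)); apply: cvgM; first exact: cvg_cst.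
    apply: ccont_cvg => //.
    have cs : continuous (fun s : R => y + s *: vec t).
      apply: continuous_mx => i j.
      have -> : (fun s : R => (y + s *: vec t) i j) = fun s => y i j + s * vec t i j.
        by apply/funext => s; rewrite !mxE.
      by move=> s; exact: (cvgD (cvg_cst _) (cvgM cvg_id (cvg_cst _))).
    have := @cvg_comp _ _ _ eps (fun s : R => y + s *: vec t) _ _ _ eps_cvg (cs 0).
    by rewrite scale0r addr0.
have L3 : cint (mu n) (fun t => (gauss (vec t))%:C * h y) = (gauss_mass n)%:C * h y.
  under eq_cint do rewrite mulrC.
  rewrite cintZ.
    rewrite mulrC; congr (_ * _); apply: ceq => //=.
    by rewrite /Rintegral integral0.
  split; first exact: (rintegrable_rapid hp (@continuous_gauss n) (rapid_gauss n)).
  exact: (rintegrable_rapid hp (@cont_cst R _ 0) (rapid0 n)).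
apply: (ccvg_unique L1); rewrite real_complexM -mulrA -L3.
under eq_fun do rewrite LE -mulrBr cabsM.
by rewrite -[0](mulr0 (cabs (gauss_mass n)%:C)); apply: cvgM; [exact: cvg_cst|].
Qed.

End inversion.
End rapid_gauss.
End gauss.

(** * Bounds on the Gelfand-Shilov space and on its dual *)

Section gs_bounds.
Context {R : realType} (theta : R) (d : nat).
Implicit Types (f : 'cV[R]_d -> R[i]^o) (a b : 'I_d -> nat) (x : 'cV[R]_d) (c B : R).

Definition gs_weight c a b : R :=
  c ^+ (mi_size a + mi_size b) * (mi_fact a * mi_fact b)%N%:R `^ theta.

(** The inequality [gs_norm theta c f <= B] in real numbers, for functions that need not be bundled
    ([gs_leP]). *)
Definition gs_le c B f := forall a b x,
  cabs ((mi_power x a)%:C * cpartial b f x) <= B * gs_weight c a b.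

Lemma mi_fact_gt0 a : (0 < mi_fact a)%N.
Proof. by rewrite /mi_fact prodn_gt0// => j; exact: fact_gt0. Qed.

Lemma gs_weight_gt0 c a b : 0 < c -> 0 < gs_weight c a b.
Proof.
by move=> c0; rewrite mulr_gt0 ?exprn_gt0// powR_gt0// ltr0n muln_gt0 !mi_fact_gt0.
Qed.

Lemma gs_termE c f a b x : 0 < c ->
  gs_term theta c f a b x = cabs ((mi_power x a)%:C * cpartial b f x) / gs_weight c a b.
Proof.
move=> c0; rewrite /gs_term /gs_weight invfM powRN.
by rewrite mulrC.
Qed.

Lemma gs_leP c B f : 0 < c -> gs_le c B f <-> (gs_norm theta c f <= B%:E)%E.
Proof.
move=> c0; split=> [H|H a b x].
  apply: ge_ereal_sup => _ [a [b [x ->]]]; rewrite lee_fin.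
  by rewrite -/(gs_term theta c f a b x) gs_termE// ler_pdivrMr ?gs_weight_gt0.
rewrite -ler_pdivrMr ?gs_weight_gt0// -gs_termE// -lee_fin.
by apply: le_trans H; apply: ereal_sup_ubound; exists a, b, x.
Qed.

Lemma gs_le_ge0 c B f : 0 < c -> gs_le c B f -> 0 <= B.
Proof.
move=> c0 H; have := le_trans (cabs_ge0 _) (H (fun=> 0%N) (fun=> 0%N) 0).
by rewrite pmulr_lge0// gs_weight_gt0.
Qed.

Lemma gs_mem c B f : 0 < c -> csmooth f -> gs_le c B f -> f \in gs_pred theta (d := d).
Proof.
move=> c0 sf /(gs_leP _ _ c0) H; rewrite inE; exists c => //; split => //.
by apply: le_lt_trans H _; rewrite ltry.
Qed.

Lemma gs_bound (f : gs theta d) : exists c B, [/\ 0 < c, csmooth f & gs_le c B f].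
Proof.
have := gs_funP f; rewrite inE => -[c /= c0 [sf H]].
have /gs_norm_ltP[M HM] := H; exists c, M; split => //.
by move=> a b x; rewrite -ler_pdivrMr ?gs_weight_gt0// -gs_termE.
Qed.

Lemma gs_csmooth (f : gs theta d) : csmooth f.
Proof. by have [c [B []]] := gs_bound f. Qed.

Lemma gs_scaleE (k : R[i]) (f : gs theta d) x : (k *: f) x = k * f x.
Proof. by []. Qed.

Lemma gs_addE (f g : gs theta d) x : (f + g) x = f x + g x.
Proof. by []. Qed.

Lemma gs_ext (f g : gs theta d) : (forall x, f x = g x) -> f = g.
Proof. by move=> H; apply: val_inj; apply/funext. Qed.

Lemma csmooth0 : csmooth (fun=> 0 : R[i]^o) (d := d).
Proof. by split; exact: smooth0. Qed.

Lemma gs_le_scale c B (k : R[i]) f : csmooth f -> gs_le c B f -> gs_le c (cabs k * B) (k *: f).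
Proof.
move=> sf fB a b x.
have E : k *: f = k *: f + ((fun=> 0) : 'cV[R]_d -> R[i]^o).
  by apply/funext => y /=; rewrite [RHS]addr0.
have Z : ((fun=> 0) : 'cV[R]_d -> R[i]^o) = -1 *: f + f.
  by apply/funext => y; rewrite -[RHS]/(-1 * f y + f y) mulN1r addNr.
have c00 : cpartial b ((fun=> 0) : 'cV[R]_d -> R[i]^o) x = 0.
  by rewrite Z (csmooth_lin (-1) sf sf).2 mulN1r addNr.
by rewrite E (csmooth_lin k sf csmooth0).2 c00 addr0 mulrCA cabsM -mulrA ler_wpM2l ?cabs_ge0.
Qed.

Implicit Types (u : gs_dual theta d).

(** Continuity at 0 gives a ball of radius r in the step c on which |u| < 1; scaling f into this
    ball bounds u by 2 / r. *)
Lemma gs_dual_bounded u c : 0 < c -> exists2 M, 0 <= M &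
  forall (f : gs theta d) B, gs_le c B f -> cabs (u f) <= M * B.
Proof.
move=> c0; have [V [VU _ /(_ c c0)[r r0 rV]]] := gs_dual_continuous u 0 ltr01.
exists (2 / r) => [|f B fB]; first by rewrite divr_ge0// ltW.
have B0 := gs_le_ge0 c0 fB; apply/ler_addgt0Pr => e e0.
(* The slack e keeps the denominator positive when B = 0; 1 / t is exactly 2 B / r + e. *)
pose t := r / (2 * (B + e * r / 2)).
have er : 0 < e * r / 2 by rewrite divr_gt0// mulr_gt0.
have t0 : 0 < t by rewrite divr_gt0// mulr_gt0// ltr_wpDl.
have : V (t%:C *: f).
  apply: rV; apply: (@le_lt_trans _ _ (t * B)%:E).
    apply/gs_leP => //; have := gs_le_scale t%:C (gs_csmooth f) fB.
    by rewrite cabsR gtr0_norm.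
  rewrite lte_fin /t mulrAC ltr_pdivrMr ?mulr_gt0 ?ltr_wpDl//.
  by rewrite ltr_pM2l//; lra.
move=> /VU /=; rewrite add0r raddf0 subr0 linearZ/= => H.
have {}H : t * cabs (u f) < 1.
  by move: H; rewrite [X in cabs X](_ : _ = t%:C * u f)// cabsM cabsR gtr0_norm.
have -> : 2 / r * B + e = t^-1.
  have er' : 0 < B * 2 + e * r by rewrite ltr_wpDl ?mulr_ge0// mulr_gt0.
  by rewrite /t; field; rewrite !gt_eqF.
by rewrite -(ler_pM2l t0) mulfV ?gt_eqF// ltW.
Qed.

(** Boundedness on every step suffices: the set where |T h| < e is absolutely convex and contains a
    ball of each step, hence is a neighbourhood of 0 in the inductive limit. *)
Lemma gs_dual_mk (T : {linear gs theta d -> R[i]^o}) :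
  (forall c, 0 < c -> exists M, forall (f : gs theta d) B, gs_le c B f -> cabs (T f) <= M * B) ->
  exists u, forall f : gs theta d, u f = T f.
Proof.
move=> H.
suff C (f : gs theta d) (e : R) : 0 < e -> gs_nbhs0 [set h | cabs (T (f + h) - T f) < e].
  by exists (GSDual C).
move=> e0; exists [set h | cabs (T h) < e]; split.
- by move=> h /=; rewrite raddfD/= addrAC subrr add0r.
- move=> g h a b /= ga hb ab; rewrite raddfD/= !linearZ/=.
  apply: le_lt_trans (cabsD _ _) _.
  rewrite [X in cabs X + _](_ : _ = a * T g)// [X in _ + cabs X](_ : _ = b * T h)// !cabsM.
  have := cabs_ge0 a; have := cabs_ge0 b; have := cabs_ge0 (T g); have := cabs_ge0 (T h).
  move=> h1 h2 h3 h4; set m := Num.max (cabs (T g)) (cabs (T h)).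
  apply: (@le_lt_trans _ _ ((cabs a + cabs b) * m)).
    by rewrite mulrDl lerD// ler_wpM2l// le_max lexx ?orbT.
  apply: (@le_lt_trans _ _ m); last by rewrite gt_max ga hb.
  by rewrite ler_piMl// le_max h2.
- move=> c c0; have [M HM] := H c c0; exists (e / (`|M| + 1)).
    by rewrite divr_gt0// ltr_wpDl.
  move=> f' fr /=; pose B := e / (`|M| + 1).
  have [B0] : exists2 B', gs_le c B' f' & B' < e / (`|M| + 1).
    case: (gs_norm theta c f') fr (fun B => @gs_leP c B f' c0) => [s|//|] fr HH.
      by exists s; [apply/HH|move: fr; rewrite lte_fin].
    exists 0; first by apply/HH; rewrite leNye.
    by rewrite divr_gt0// ltr_wpDl.
  move=> fB Br; apply: le_lt_trans (HM f' B0 fB) _.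
  have B00 := gs_le_ge0 c0 fB.
  apply: (@le_lt_trans _ _ ((`|M| + 1) * B0)).
    by rewrite ler_wpM2r// (le_trans (ler_norm _))// lerDl.
  by rewrite mulrC -ltr_pdivlMr// ltr_wpDl.
Qed.

Lemma gs_dual_ext (u v : gs_dual theta d) : (forall f : gs theta d, u f = v f) -> u = v.
Proof.
case: u v => [u cu] [v cv] /= H.
have E : u = v.
  case: u v H {cu cv} => [u [[cu1] [cu2]]] [v [[cv1] [cv2]]] /= H.
  have E : u = v by apply/funext.
  subst v; congr GRing.Linear.Pack; congr GRing.Linear.Class.
    by rewrite (Prop_irrelevance cu1 cv1).
  by rewrite (Prop_irrelevance cu2 cv2).
by subst v; congr GSDual; exact: Prop_irrelevance.
Qed.

Lemma pairing_gs u (g : gs theta d) : pairing u g = u g.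
Proof. by rewrite /pairing valK. Qed.

Lemma pairingE u f (hf : f \in gs_pred theta (d := d)) : pairing u f = u (GS hf).
Proof. by rewrite -pairing_gs. Qed.

End gs_bounds.

(** * Families of functions that are the partial derivatives of their first member *)

Section towers.
Context {R : realType} (d : nat).
Implicit Types (b : 'I_d -> nat) (s : seq 'I_d).

Definition mi_incr (j : 'I_d) b : 'I_d -> nat := fun i => (b i + (i == j))%N.

Definition mi_count s : 'I_d -> nat := fun i => count_mem i s.

Lemma mi_count_seq b : mi_count (mi_seq b) = b.
Proof.
apply/funext => i; rewrite /mi_count /mi_seq count_flatten -map_comp sumnE big_map.
rewrite big_enum/= (bigD1 i)//= big1 ?addn0 => [|j ji]; rewrite count_nseq/=.
  by rewrite eqxx mul1n.
by rewrite (negPf ji).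
Qed.

(** Exhibiting all candidates for the derivatives at once yields smoothness and the value of each
    partial derivative together. The order of differentiation drops out, since F depends on the
    multi-index only. *)
Definition rtower (F : ('I_d -> nat) -> 'cV[R]_d -> R) := forall b, continuous (F b) /\
  forall j x, is_derive x (delta_mx j 0 : 'cV[R]_d) (F b) (F (mi_incr j b) x).

Lemma rtower_iter F s : rtower F -> iter_partial s (F (fun=> 0%N)) = F (mi_count s).
Proof.
move=> tF; elim: s => [//|j s IH] /=.
  rewrite [iter_partial _ _]/= /iter_partial/= -/(iter_partial s _) IH.
apply/funext => x; rewrite /partial.
have [_ /(_ j x) D] := tF (mi_count s).
rewrite (@derive_val _ _ _ _ _ _ _ D); congr F; apply/funext => i.
by rewrite /mi_incr /mi_count/= addnC eq_sym.
Qed.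

Lemma rtower_smooth F : rtower F -> smooth (F (fun=> 0%N)).
Proof.
move=> tF s; rewrite (rtower_iter s tF); by have [c D] := tF (mi_count s); split => // j x.
Qed.

Definition ctower (F : ('I_d -> nat) -> 'cV[R]_d -> R[i]) :=
  rtower (fun b x => Re (F b x)) /\ rtower (fun b x => Im (F b x)).

Lemma ctower_csmooth F (f : 'cV[R]_d -> R[i]^o) : ctower F ->
  (forall x, f x = F (fun=> 0%N) x) -> csmooth f /\ forall b, cpartial b f = F b.
Proof.
move=> [t1 t2] fF.
have E1 : re_part f = fun x => Re (F (fun=> 0%N) x) by apply/funext => x; rewrite /re_part fF.
have E2 : im_part f = fun x => Im (F (fun=> 0%N) x) by apply/funext => x; rewrite /im_part fF.
split; first by rewrite /csmooth E1 E2; split; [exact: rtower_smooth t1|exact: rtower_smooth t2].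
move=> b; apply/funext => x.
rewrite /cpartial E1 E2 (rtower_iter _ t1) (rtower_iter _ t2) mi_count_seq.
by case: (F b x).
Qed.

End towers.

Section complex_derivative.
Context {R : realType}.

Lemma der_opp (f : R -> R) t a : is_derive t (1 : R) f a ->
  is_derive t (1 : R) (fun x => - f x) (- a).
Proof. by move=> df; exact: is_deriveN. Qed.

Implicit Types (f g : R -> R[i]) (t : R) (a b : R[i]).

Definition cder t f a := is_derive t (1 : R) (fun x => Re (f x)) (Re a) /\
  is_derive t (1 : R) (fun x => Im (f x)) (Im a).

Lemma cder_eq t f a b : cder t f a -> a = b -> cder t f b.
Proof. by move=> h <-. Qed.

Lemma cder_add t f g a b : cder t f a -> cder t g b -> cder t (fun x => f x + g x) (a + b).
Proof.
move=> [f1 f2] [g1 g2]; split.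
  by under eq_fun do rewrite Re_add; rewrite Re_add; exact: der_add.
by under eq_fun do rewrite Im_add; rewrite Im_add; exact: der_add.
Qed.

Lemma cder_mul t f g a b : cder t f a -> cder t g b ->
  cder t (fun x => f x * g x) (a * g t + f t * b).
Proof.
move=> [f1 f2] [g1 g2]; split.
  under eq_fun do rewrite Re_mul.
  apply: is_derive_eq (der_add (der_mul f1 g1) (der_opp (der_mul f2 g2))) _.
  by rewrite Re_add !Re_mul; ring.
under eq_fun do rewrite Im_mul.
apply: is_derive_eq (der_add (der_mul f1 g2) (der_mul f2 g1)) _.
by rewrite Im_add !Im_mul; ring.
Qed.

Lemma cder_cst t a : cder t (fun=> a) 0.
Proof. by split; exact: der_cst. Qed.

Lemma cder_real t (r : R -> R) r' : is_derive t (1 : R) r r' ->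
  cder t (fun x => (r x)%:C) r'%:C.
Proof. by move=> h; split => //=; exact: der_cst. Qed.

Lemma cder_cis t (r : R -> R) r' : is_derive t (1 : R) r r' ->
  cder t (fun x => cis (r x)) ('i * r'%:C * cis (r t)).
Proof.
move=> h; split => /=.
  by apply: is_derive_eq (der_comp (is_derive_cos _) h) _; ring.
by apply: is_derive_eq (der_comp (is_derive_sin _) h) _; ring.
Qed.

End complex_derivative.

(** * Hermite polynomials and derivatives of one-dimensional packets *)

Section hermite.
Context {R : realType}.
Implicit Types (s : R[i]) (k : nat) (t a xi : R).

(* Derivatives of exp (- s^2 / 2) divided by exp (- s^2 / 2). *)
Fixpoint herm k s : R[i] :=
  match k with
  | 0 => 1
  | k'.+1 => match k' with
    | 0 => - s
    | k''.+1 => - s * herm k' s - k'%:R * herm k'' s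
    end
  end.

(** The derivative of [herm k]; for k = 0 the coefficient kills the truncated predecessor. *)
Definition herm' k s : R[i] := - k%:R * herm k.-1 s.

Lemma hermS k s : herm k.+1 s = herm' k s - s * herm k s.
Proof. by case: k => [|k] /=; rewrite /herm'/= ?mulr1 ?oppr0 ?sub0r; ring. Qed.

(** With Y = |s| + sqrt (k + 2), the recursion needs (k + 1) + |s| Y <= Y^2. The square root is what
    matters: k^(k/2) is of size k!^(1/2), which theta >= 1/2 allows. *)
Lemma herm_bound k s : cabs (herm k s) <= (cabs s + Num.sqrt k%:R) ^+ k.
Proof.
suff: cabs (herm k s) <= (cabs s + Num.sqrt k%:R) ^+ k /\
    cabs (herm k.+1 s) <= (cabs s + Num.sqrt k.+1%:R) ^+ k.+1 by case.
have s0 := cabs_ge0 s.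
elim: k => [|k [IH1 IH2]].
  by rewrite expr0 expr1 cabs1 cabsN lexx; split => //; rewrite lerDl sqrtr_ge0.
split => //; set q := Num.sqrt k.+2%:R.
have q1 : Num.sqrt k.+1%:R <= q by rewrite ler_sqrt ?ler_nat.
have q0 : Num.sqrt k%:R <= q by rewrite ler_sqrt ?ler_nat//; exact: (leqW (leqnSn k)).
have qq : q ^+ 2 = k.+2%:R by rewrite sqr_sqrtr.
have q00 : 0 <= q by exact: sqrtr_ge0.
set Y := cabs s + q; have Y0 : 0 <= Y by rewrite addr_ge0.
have h1 : cabs (herm k.+1 s) <= Y ^+ k.+1.
  by apply: le_trans IH2 _; rewrite lerXn2r// ?nnegrE ?addr_ge0 ?sqrtr_ge0// lerD2l.
have h0 : cabs (herm k s) <= Y ^+ k.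
  by apply: le_trans IH1 _; rewrite lerXn2r// ?nnegrE ?addr_ge0 ?sqrtr_ge0// lerD2l.
rewrite hermS /herm' (le_trans (cabsB _ _))// !cabsM cabsN [k.+1.-1]/=.
have -> : cabs (k.+1%:R : R[i]) = k.+1%:R.
  by rewrite -(rmorph_nat (real_complex R)) cabsR ger0_norm.
apply: (@le_trans _ _ (k.+1%:R * Y ^+ k + cabs s * Y ^+ k.+1)).
  by rewrite lerD// ler_wpM2l.
have -> : Y ^+ k.+2 = Y * Y * Y ^+ k by rewrite !exprS mulrA.
have -> : k.+1%:R * Y ^+ k + cabs s * Y ^+ k.+1 = (k.+1%:R + cabs s * Y) * Y ^+ k.
  by rewrite exprS; ring.
rewrite ler_wpM2r ?exprn_ge0//.
have k12 : (k.+1%:R : R) <= k.+2%:R by rewrite ler_nat.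
rewrite /Y; nra.
Qed.

(** A complex slope m covers all three uses: m = 1 for the space variable, m = -1 for the position
    and m = i for the frequency of the packet. *)
Lemma cder_herm k (m c : R[i]) t :
  cder t (fun x => herm k (x%:C * m + c)) (m * herm' k (t%:C * m + c)).
Proof.
have D1 : cder t (fun x => x%:C * m + c) m.
  apply: cder_eq (cder_add (cder_mul (cder_real (der_id t)) (cder_cst t m)) (cder_cst t c)) _.
  by rewrite addr0 mulr0 addr0 mul1r.
suff: cder t (fun x => herm k (x%:C * m + c)) (m * herm' k (t%:C * m + c)) /\
  cder t (fun x => herm k.+1 (x%:C * m + c)) (m * herm' k.+1 (t%:C * m + c)) by case.
elim: k => [|k [IH1 IH2]].
  split; first by apply: cder_eq (cder_cst t 1) _; rewrite /herm' oppr0 mul0r mulr0.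
  have E : (fun x => herm 1 (x%:C * m + c)) = fun x => -1 * (x%:C * m + c).
    by apply/funext => x; rewrite mulN1r.
  rewrite E; apply: cder_eq (cder_mul (cder_cst t (-1)) D1) _.
  by rewrite mul0r add0r /herm' /= mulr1 mulrC.
split => //.
pose z := t%:C * m + c.
have E : (fun x => herm k.+2 (x%:C * m + c)) = fun x =>
   (-1) * ((x%:C * m + c) * herm k.+1 (x%:C * m + c)) + (- k.+1%:R) * herm k (x%:C * m + c).
  by apply/funext => x; rewrite hermS /herm'/=; ring.
rewrite E; apply: cder_eq (cder_add (cder_mul (cder_cst t (-1)) (cder_mul D1 IH2))
  (cder_mul (cder_cst t (- k.+1%:R)) IH1)) _.
rewrite !mul0r !add0r -/z.
have -> : herm' k.+2 z = - k.+2%:R * herm k.+1 z by [].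
have -> : herm' k.+1 z = - k.+1%:R * herm k z by [].
have := hermS k z; set H0 := herm k z; set H1 := herm k.+1 z => ->.
by rewrite -!natr1; ring.
Qed.

Definition wp1 a xi t : R[i] := (expR (- ((t - a) ^+ 2 / 2)))%:C * cis (- (t * xi)).

(** Up to a factor free of t the packet is exp (- s^2 / 2) with s = (t - a) + i xi, so its k-th
    derivative carries the Hermite polynomial at that complex point. *)
Definition wpd1 k a xi t : R[i] := herm k ((t - a) +i* xi) * wp1 a xi t.

Lemma cder_wpd1 k a xi t : cder t (wpd1 k a xi) (wpd1 k.+1 a xi t).
Proof.
have sE (x : R) : (x - a) +i* xi = x%:C * 1 + ((- a) +i* xi).
  by rewrite mulr1; simpc.
have dg : is_derive t (1 : R) (fun x => expR (- ((x - a) ^+ 2 / 2)))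
    (expR (- ((t - a) ^+ 2 / 2)) * (- (t - a))).
  apply: der_comp.
  have -> : (fun x => - ((x - a) ^+ 2 / 2)) = fun x => - 2^-1 * ((x + - a) * (x + - a)).
    by apply/funext => x; field.
  have da := der_add (der_id t) (der_cst (- a) t).
  by apply: is_derive_eq (der_scale _ (der_mul da da)) _; field.
have dc : is_derive t (1 : R) (fun x => - (x * xi)) (- xi).
  have -> : (fun x => - (x * xi)) = fun x => - xi * x by apply/funext => x; ring.
  by apply: is_derive_eq (der_scale _ (der_id t)) _; rewrite mulr1.
have E : wpd1 k a xi = fun x => herm k (x%:C * 1 + ((- a) +i* xi)) * wp1 a xi x.
  by apply/funext => x; rewrite /wpd1 sE.
rewrite E; apply: cder_eq (cder_mul (cder_herm k _ _ t) (cder_mul (cder_real dg) (cder_cis dc))) _.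
rewrite /wpd1 hermS sE; set z := t%:C * 1 + _; rewrite mul1r; rewrite -/(wp1 a xi t).
have -> : (expR (- ((t - a) ^+ 2 / 2)) * - (t - a))%:C * cis (- (t * xi)) +
   (expR (- ((t - a) ^+ 2 / 2)))%:C * ('i * (- xi)%:C * cis (- (t * xi))) = - z * wp1 a xi t.
  have -> : - z = (- (t - a))%:C + 'i * (- xi)%:C.
    by rewrite /z; apply: ceq; simpc => /=; ring.
  by rewrite real_complexM /wp1; ring.
by ring.
Qed.

End hermite.

Section mean_value.
Context {R : realType}.

Lemma mvt_le (f f' : R -> R) (u v M : R) : (forall t, is_derive t (1 : R) f (f' t)) ->
  (forall t, Num.min u v <= t <= Num.max u v -> `|f' t| <= M) -> `|f v - f u| <= M * `|v - u|.
Proof.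
move=> df; wlog uv : u v / u < v => [wl|] M0.
  have [uv|vu|->] := ltgtP u v; first exact: wl.
    by rewrite distrC [`|v - u|]distrC; apply: wl => // t; rewrite minC maxC; exact: M0.
  by rewrite !subrr !normr0 mulr0.
have cf : {within `[u, v], continuous f}.
  apply: continuous_subspaceT => x; apply: differentiable_continuous.
  by apply/derivable1_diffP; exact: (@ex_derive _ _ _ _ _ _ _ (df x)).
have [t tuv ->] := MVT uv (fun t _ => df t) cf.
rewrite normrM ler_wpM2r//; apply: M0.
by move: tuv; rewrite in_itv/= (min_idPl (ltW uv)) (max_idPr (ltW uv)) => /andP[/ltW -> /ltW ->].
Qed.

Lemma cmvt_le (f f' : R -> R[i]) (u v M : R) : (forall t, cder t f (f' t)) ->
  (forall t, Num.min u v <= t <= Num.max u v -> cabs (f' t) <= M) ->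
  cabs (f v - f u) <= 2 * M * `|v - u|.
Proof.
move=> df M0; apply: le_trans (cabs_le _) _; rewrite Re_add Im_add Re_opp Im_opp.
rewrite -mulrA mulr2n mulrDl mul1r lerD//.
  apply: mvt_le (fun t => (df t).1) _ => t ht; exact: le_trans (cabs_Re _) (M0 t ht).
apply: mvt_le (fun t => (df t).2) _ => t ht; exact: le_trans (cabs_Im _) (M0 t ht).
Qed.

End mean_value.

(** * Size and Lipschitz estimates for one-dimensional packets *)

Section packet_bounds.
Context {R : realType} (theta : R) (htheta : 2^-1 <= theta < 1).
Local Notation p := (theta^-1).
Local Notation pw := (pw p).
Implicit Types (k a xi t x c C : R).

Let th0 : 0 < theta.
Proof. by case/andP: htheta => h _; apply: lt_le_trans h; rewrite invr_gt0. Qed.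

Lemma inv_theta_bounds : 1 <= p <= 2.
Proof.
case/andP: htheta => h1 h2; apply/andP; split; first by rewrite invf_ge1// ltW.
by rewrite -[leRHS]invrK lef_pV2 ?posrE ?invr_gt0.
Qed.

Let hp := inv_theta_bounds.

(** The inequality z^n <= n! exp z for z = l y^p, raised to the power theta; l = dl / theta makes
    the exponent come out as dl y^p, and D = l^-theta. *)
Lemma pow_fact_le (dl : R) : 0 < dl -> exists2 D : R, 0 < D & forall n (y : R), 0 <= y ->
  y ^+ n <= n`!%:R `^ theta * D ^+ n * expR (dl * pw y).
Proof.
move=> dl0; pose l := dl / theta; have l0 : 0 < l by rewrite divr_gt0.
exists (l `^ theta)^-1; first by rewrite invr_gt0 powR_gt0.
move=> n y y0; pose z := y `^ p.
have z0 : 0 <= z by exact: powR_ge0.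
have zy : z `^ theta = y by rewrite -powRrM mulVf ?gt_eqF// powRr1.
have lz0 : 0 <= l * z by rewrite mulr_ge0// ltW.
have h : (l * z) ^+ n <= n`!%:R * expR (l * z).
  case: n => [|n].
    by rewrite expr0 fact0 mul1r (le_trans _ (expR_ge1Dx _))// lerDl.
  rewrite -ler_pdivrMl ?ltr0n ?fact_gt0// mulrC.
  by apply: le_trans (expR_ge1Dxn n lz0); rewrite lerDr.
have e1 : ((l * z) ^+ n) `^ theta = (l `^ theta * y) ^+ n.
  rewrite -(powR_mulrn n lz0) -powRrM [n%:R * theta]mulrC powRrM (powRM _ (ltW l0) z0) zy powR_mulrn//.
  by rewrite mulr_ge0 ?powR_ge0.
have e2 : (n`!%:R * expR (l * z)) `^ theta = n`!%:R `^ theta * expR (dl * pw y).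
  rewrite (powRM _ (ler0n _ _) (expR_ge0 _)); congr (_ * _).
  rewrite /powR gt_eqF ?expR_gt0// expRK; congr expR.
  by rewrite /pw (ger0_norm y0) -/z /l; field; rewrite gt_eqF.
have h2 : ((l * z) ^+ n) `^ theta <= (n`!%:R * expR (l * z)) `^ theta.
  apply: ge0_ler_powR => //; first exact: ltW.
    by rewrite nnegrE exprn_ge0.
  by rewrite nnegrE mulr_ge0 ?expR_ge0.
move: h2; rewrite e1 e2 exprMn => h2.
have P0 : 0 < (l `^ theta) ^+ n by rewrite exprn_gt0// powR_gt0.
rewrite exprVn; move: (n`!%:R `^ theta) (expR _) ((l `^ theta) ^+ n) P0 h2 => F G P P0 h2.
by rewrite mulrAC ler_pdivlMr// mulrC.
Qed.

Definition wt1 c (i j : nat) : R := c ^+ (i + j) * (i`! * j`!)%N%:R `^ theta.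

(** Bound |x| by |x - a| + |a| and the Hermite factor by [herm_bound], turn both powers into
    factorials with [pow_fact_le], and let the Gaussian absorb the resulting terms in (x - a)^2. *)
Lemma wpd1_le k : 0 < k -> exists c C : R, [/\ 1 <= c, 0 < C & forall i j a xi x,
  `|x| ^+ i * cabs (wpd1 j a xi x) <= C * wt1 c i j * expR (k * (pw a + pw xi))].
Proof.
(* Two uses of [pw_add] cost a factor 16, whence the rate kp / 16 below. As kp <= 1/8, the terms 2
   kp s^2 fit under s^2 / 2 and the constants 4 kp under 1; the term kp j from sqrt j goes into c
   through exp kp. *)
move=> k0; pose kp := Num.min k 8^-1.
have kp0 : 0 < kp by rewrite lt_min; apply/andP; split => //; rewrite invr_gt0.
have kpk : kp <= k by rewrite ge_min lexx.
have kp8 : kp <= 8^-1 by rewrite ge_min lexx orbT.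
have dl0 : 0 < kp / 16 by rewrite divr_gt0.
have [D D0 HD] := pow_fact_le dl0.
pose c := Num.max 1 (D * expR kp).
have De0 : 0 < D * expR kp by rewrite mulr_gt0 ?expR_gt0.
have c1 : 1 <= c by rewrite le_max lexx.
have cD : D * expR kp <= c by rewrite le_max lexx orbT.
have c0 : 0 < c by exact: lt_le_trans c1.
exists c, (expR 1); split; rewrite ?expR_gt0// => i j a xi x.
pose s := x - a.
pose Y := `|s| + `|xi| + Num.sqrt j%:R; pose X := `|s| + `|a|.
have Y0 : 0 <= Y by rewrite !addr_ge0// sqrtr_ge0.
have X0 : 0 <= X by rewrite addr_ge0.
have pY : pw Y <= 16 * (2 + s ^+ 2 + pw xi + j%:R).
  have h1 := pw_add hp (`|s| + `|xi|) (Num.sqrt j%:R).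
  have h2 := pw_add hp `|s| `|xi|.
  have h3 := pw_le_sqr hp (Num.sqrt j%:R); have h4 := pw_le_sqr hp `|s|.
  move: h2 h3 h4; rewrite sqr_sqrtr ?ler0n// real_normK ?num_real//.
  have -> : pw `|xi| = pw xi by rewrite /pw normr_id.
  have := pw_ge0 p xi; have : (0 : R) <= j%:R by rewrite ler0n.
  have := sqr_ge0 s; rewrite -/Y in h1; lra.
have pX : pw X <= 16 * (2 + s ^+ 2 + pw a).
  have h2 := pw_add hp `|s| `|a|; have h4 := pw_le_sqr hp `|s|.
  move: h2 h4; rewrite real_normK ?num_real//.
  have -> : pw `|a| = pw a by rewrite /pw normr_id.
  have := pw_ge0 p a; have := sqr_ge0 s; rewrite -/X; lra.
have xX : `|x| ^+ i <= X ^+ i.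
  rewrite lerXn2r// ?nnegrE//; have -> : x = s + a by rewrite subrK.
  exact: ler_normD.
have hY : cabs (herm j ((x - a) +i* xi)) <= Y ^+ j.
  apply: le_trans (herm_bound _ _) _; rewrite lerXn2r// ?nnegrE ?addr_ge0 ?cabs_ge0 ?sqrtr_ge0//.
  by rewrite lerD2r; exact: cabs_le.
have E1 := le_trans xX (HD i X X0); have E2 := le_trans hY (HD j Y Y0).
rewrite /wpd1 cabsM /wp1 cabsM cabs_cis mulr1 cabsR (ger0_norm (expR_ge0 _)) mulrA.
apply: (@le_trans _ _ ((i`!%:R `^ theta * D ^+ i * expR (kp / 16 * pw X)) *
    (j`!%:R `^ theta * D ^+ j * expR (kp / 16 * pw Y)) * expR (- ((x - a) ^+ 2 / 2)))).
  apply: ler_wpM2r; first exact: expR_ge0.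
  by apply: (ler_pM _ (cabs_ge0 _) E1 E2); exact: exprn_ge0.
rewrite /wt1 natrM (powRM _ (ler0n _ _) (ler0n _ _)).
set F1 := _ `^ theta; set F2 := _ `^ theta.
have F10 : 0 <= F1 by exact: powR_ge0.
have F20 : 0 <= F2 by exact: powR_ge0.
have -> : F1 * D ^+ i * expR (kp / 16 * pw X) * (F2 * D ^+ j * expR (kp / 16 * pw Y)) *
    expR (- ((x - a) ^+ 2 / 2)) = F1 * F2 * (D ^+ (i + j) *
    expR (kp / 16 * pw X + kp / 16 * pw Y - (x - a) ^+ 2 / 2)).
  rewrite !expRD exprD; move: (expR _) (expR _) (expR _) (D ^+ _) (D ^+ _) => ? ? ? ? ?; ring.
have -> : expR 1 * (c ^+ (i + j) * (F1 * F2)) * expR (k * (pw a + pw xi)) =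
    F1 * F2 * (c ^+ (i + j) * expR (1 + k * (pw a + pw xi))) by rewrite expRD; ring.
apply: ler_wpM2l; first by rewrite mulr_ge0.
apply: (@le_trans _ _ ((D * expR kp) ^+ (i + j) * expR (1 + k * (pw a + pw xi)))); last first.
  by rewrite ler_wpM2r ?expR_ge0// lerXn2r// ?nnegrE ltW.
rewrite exprMn -expRM_natl -[leRHS]mulrA -expRD; apply: ler_wpM2l.
  by rewrite exprn_ge0 ?ltW.
rewrite ler_expR.
have i0 : (0 : R) <= i%:R by rewrite ler0n.
have j0 : (0 : R) <= j%:R by rewrite ler0n.
have s2 : 0 <= s ^+ 2 by rewrite sqr_ge0.
have q1 := pw_ge0 p a; have q2 := pw_ge0 p xi.
have h1 : kp / 16 * pw X <= kp * (2 + s ^+ 2 + pw a).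
  by rewrite -mulrA ler_pM2l// ler_pdivrMl.
have h2 : kp / 16 * pw Y <= kp * (2 + s ^+ 2 + pw xi + j%:R).
  by rewrite -mulrA ler_pM2l// ler_pdivrMl.
have h3 : kp * (pw a + pw xi) <= k * (pw a + pw xi) by rewrite ler_wpM2r// addr_ge0.
have h4 : kp * s ^+ 2 <= 8^-1 * s ^+ 2 by rewrite ler_wpM2r.
have h5 : 0 <= kp * i%:R by rewrite mulr_ge0// ltW.
rewrite natrD -/s; lra.
Qed.

Lemma wt1_ge0 c i j : 0 <= c -> 0 <= wt1 c i j.
Proof. by move=> c0; rewrite mulr_ge0 ?exprn_ge0 ?powR_ge0. Qed.

Let natS2 n : (n.+1%:R : R) <= 2 ^+ n.
Proof. by rewrite -natrX ler_nat; exact: ltn_expl. Qed.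

Let factS_le n : (n.+1`!%:R : R) `^ theta <= n.+1%:R * n`!%:R `^ theta.
Proof.
rewrite factS natrM (powRM _ (ler0n _ _) (ler0n _ _)) ler_wpM2r ?powR_ge0//.
rewrite -[leRHS]powRr1 ?ler0n// ler_powR ?ler1n//.
by case/andP: htheta => _ /ltW.
Qed.

Lemma wt1_mono c i j : 1 <= c -> wt1 c i j <= wt1 (2 * c) i j.
Proof.
move=> c1; rewrite ler_wpM2r ?powR_ge0// lerXn2r// ?nnegrE; lra.
Qed.

(** Raising an index costs a factor (i + 1)^theta <= i + 1 <= 2^i (as theta < 1), which doubling c
    absorbs. *)
Lemma wt1Sl c i j : 1 <= c -> wt1 c i.+1 j <= c * wt1 (2 * c) i j.
Proof.
move=> c1; have c0 : 0 <= c by lra.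
have h : (i.+1`!%:R : R) `^ theta <= 2 ^+ (i + j) * i`!%:R `^ theta.
  apply: le_trans (factS_le i) _; rewrite ler_wpM2r ?powR_ge0//.
  apply: le_trans (natS2 i) _; rewrite exprD ler_peMr ?exprn_ge0//.
  by rewrite exprn_ege1// ler1n.
have -> : wt1 c i.+1 j = c * (c ^+ (i + j) * (i.+1`!%:R `^ theta * j`!%:R `^ theta)).
  by rewrite /wt1 natrM (powRM _ (ler0n _ _) (ler0n _ _)) addSn exprS; ring.
have -> : wt1 (2 * c) i j = c ^+ (i + j) * (2 ^+ (i + j) * i`!%:R `^ theta * j`!%:R `^ theta).
  rewrite /wt1 natrM (powRM _ (ler0n _ _) (ler0n _ _)) exprMn; ring.
apply: ler_wpM2l => //; apply: ler_wpM2l; first exact: exprn_ge0.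
by rewrite ler_wpM2r ?powR_ge0.
Qed.

Lemma wt1C c i j : wt1 c i j = wt1 c j i.
Proof. by rewrite /wt1 addnC mulnC. Qed.

Lemma wt1Sr c i j : 1 <= c -> wt1 c i j.+1 <= c * wt1 (2 * c) i j.
Proof. by move=> c1; rewrite wt1C (wt1C _ i); exact: wt1Sl. Qed.

Lemma wt1P c i j : 1 <= c -> j%:R * wt1 c i j.-1 <= wt1 (2 * c) i j.
Proof.
move=> c1; have c0 : 0 <= c by lra.
case: j => [|j]; first by rewrite mul0r wt1_ge0//; lra.
rewrite [j.+1.-1]/= /wt1 mulrA.
apply: ler_pM; rewrite ?mulr_ge0 ?exprn_ge0 ?powR_ge0//.
  rewrite addnS exprMn; apply: ler_pM; rewrite ?exprn_ge0//.
    apply: le_trans (natS2 j) _; rewrite -addnS exprD exprS mulrCA.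
    rewrite mulrA ler_peMl ?exprn_ge0//.
    have := @exprn_ege1 R i 2 (ler1n _ 2); lra.
  by rewrite exprS ler_peMl ?exprn_ge0.
apply: ge0_ler_powR; rewrite ?nnegrE ?ler0n//; first exact: ltW.
by rewrite ler_nat leq_mul2l factS leq_pmull// orbT.
Qed.

Lemma pw_between (u v t : R) : Num.min u v <= t <= Num.max u v -> pw t <= pw u + pw v.
Proof.
wlog uv : u v / u <= v => [wl|].
  case/orP: (le_total u v) => [uv|vu]; first exact: wl.
  by rewrite addrC => h; apply: wl => //; rewrite minC maxC.
rewrite (min_idPl uv) (max_idPr uv) => /andP[ut tv].
have q1 := pw_ge0 p u; have q2 := pw_ge0 p v.
have [t0|t0] := leP 0 t.
  by apply: (@le_trans _ _ (pw v)); [apply: pw_mono => //; rewrite !ger0_norm//; lra|lra].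
by apply: (@le_trans _ _ (pw u)); [apply: pw_mono => //; rewrite !ler0_norm//; lra|lra].
Qed.

(** Apart from the phase, the packet depends on x - a only; so the derivative in a is minus the one
    in x, corrected by i xi for the phase. *)
Lemma cder_wpd1_pos j a xi x :
  cder a (fun a => wpd1 j a xi x) (- (wpd1 j.+1 a xi x + 'i * xi%:C * wpd1 j a xi x)).
Proof.
have sE (b : R) : (x - b) +i* xi = b%:C * (-1) + (x%:C + 'i * xi%:C).
  by apply: ceq; simpc => //=; ring.
have dg : is_derive a (1 : R) (fun a => expR (- ((x - a) ^+ 2 / 2)))
    (expR (- ((x - a) ^+ 2 / 2)) * (x - a)).
  apply: der_comp.
  have -> : (fun a => - ((x - a) ^+ 2 / 2)) = fun a => - 2^-1 * ((x + - a) * (x + - a)).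
    by apply/funext => y; field.
  have da := der_add (der_cst x a) (der_opp (der_id a)).
  by apply: is_derive_eq (der_scale _ (der_mul da da)) _; field.
have E : (fun a => wpd1 j a xi x) = fun a => herm j (a%:C * (-1) + (x%:C + 'i * xi%:C)) *
    ((expR (- ((x - a) ^+ 2 / 2)))%:C * cis (- (x * xi))).
  by apply/funext => y; rewrite /wpd1 sE.
rewrite E.
apply: cder_eq (cder_mul (cder_herm j _ _ a) (cder_mul (cder_real dg) (cder_cst a _))) _.
rewrite /wpd1 hermS sE; set z := a%:C * -1 + _; rewrite mulr0 addr0 /wp1.
rewrite real_complexM; set w1 := (expR _)%:C; set w2 := cis _.
have -> : (x - a)%:C = z - 'i * xi%:C.
  by rewrite /z; apply: ceq; simpc => //=; ring.
by ring.
Qed.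

Lemma cder_wpd1_freq j a xi x : cder xi (fun xi => wpd1 j a xi x)
  ('i * (herm' j ((x - a) +i* xi) - x%:C * herm j ((x - a) +i* xi)) * wp1 a xi x).
Proof.
have sE (b : R) : (x - a) +i* b = b%:C * 'i + (x - a)%:C.
  by apply: ceq; simpc.
have dc : is_derive xi (1 : R) (fun xi => - (x * xi)) (- x).
  by apply: is_derive_eq (der_opp (der_scale x (der_id xi))) _; rewrite mulr1.
have E : (fun xi => wpd1 j a xi x) = fun xi => herm j (xi%:C * 'i + (x - a)%:C) *
    ((expR (- ((x - a) ^+ 2 / 2)))%:C * cis (- (x * xi))).
  by apply/funext => y; rewrite /wpd1 sE.
rewrite E.
apply: cder_eq (cder_mul (cder_herm j _ _ xi) (cder_mul (cder_cst xi _) (cder_cis dc))) _.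
rewrite sE; set z := xi%:C * 'i + _; rewrite mul0r add0r /wp1.
have -> : (- x)%:C = - x%:C :> R[i] by apply: ceq; rewrite //= oppr0.
by ring.
Qed.

(** Move a first and then xi. The derivatives are packets with an index shifted by one or with a
    factor x or xi; the shift and x cost a doubling of c, and [pw_between] controls intermediate
    points. *)
Lemma wpd1_lip k : 0 < k -> exists c C : R, [/\ 1 <= c, 0 < C & forall i j a a' xi xi' x,
  `|x| ^+ i * cabs (wpd1 j a xi x - wpd1 j a' xi' x) <=
  C * wt1 c i j * expR (k * (pw a + pw a' + pw xi + pw xi')) * (`|a - a'| + `|xi - xi'|)].
Proof.
move=> k0; have k20 : 0 < k / 2 by rewrite divr_gt0.
have [c [C [c1 C0 H]]] := wpd1_le k20.
have c0 : 0 <= c by lra.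
(* Half of the exponent k is reserved for the factor |xi|, which is at most K exp ((k / 2)
   |xi|^p). *)
pose K := 1 + (k / 2)^-1; have K0 : 0 < K by rewrite addr_gt0// invr_gt0.
pose M i j (s : R) := C * wt1 (2 * c) i j * expR (k * s) * (c + K + 1).
have abs_i : cabs ('i : R[i]) = 1 by rewrite cabsE expr0n expr1n add0r sqrtr1.
have pwxi xi : `|xi| <= K * expR (k / 2 * pw xi).
  apply: le_trans (poly_exp k20 (pw_ge0 p xi)); rewrite -lerBlDl; exact: pw_ge_norm.
have W i j : 0 <= C * wt1 (2 * c) i j.
  by rewrite mulr_ge0 ?wt1_ge0//; [exact: ltW|lra].
have Hs i j a xi x s : pw a + pw xi <= s ->
    `|x| ^+ i * cabs (wpd1 j a xi x) <= C * wt1 c i j * expR (k * s).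
  move=> as_; apply: le_trans (H i j a xi x) _; apply: ler_wpM2l.
    by rewrite mulr_ge0 ?wt1_ge0// ltW.
  rewrite ler_expR; have := pw_ge0 p a; have := pw_ge0 p xi; nra.
have da i j a xi x s : pw a + pw xi <= s ->
    `|x| ^+ i * cabs (- (wpd1 j.+1 a xi x + 'i * xi%:C * wpd1 j a xi x)) <= M i j s.
  move=> as_; rewrite cabsN.
  apply: (@le_trans _ _ (`|x| ^+ i * cabs (wpd1 j.+1 a xi x) + `|xi| * (`|x| ^+ i * cabs (wpd1 j a xi x)))).
    rewrite [X in _ <= _ + X]mulrCA -mulrDr ler_wpM2l ?exprn_ge0// (le_trans (cabsD _ _))// lerD//.
    by rewrite !cabsM abs_i mul1r cabsR.
  apply: (@le_trans _ _ (C * wt1 (2 * c) i j * expR (k * s) * c + C * wt1 (2 * c) i j * expR (k * s) * K)).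
    apply: lerD.
      apply: le_trans (Hs i j.+1 a xi x s as_) _.
      by rewrite [leRHS]mulrAC ler_wpM2r ?expR_ge0// -[leRHS]mulrA ler_pM2l// mulrC wt1Sr.
    apply: (@le_trans _ _ (K * expR (k / 2 * pw xi) * (C * wt1 c i j * expR (k / 2 * (pw a + pw xi))))).
      by rewrite ler_pM// mulr_ge0 ?exprn_ge0 ?cabs_ge0.
    have -> : K * expR (k / 2 * pw xi) * (C * wt1 c i j * expR (k / 2 * (pw a + pw xi))) =
       C * wt1 c i j * expR (k / 2 * pw xi + k / 2 * (pw a + pw xi)) * K by rewrite expRD; ring.
    rewrite ler_wpM2r//; first exact: ltW.
    apply: ler_pM; rewrite ?expR_ge0//.
    - by rewrite mulr_ge0 ?wt1_ge0// ltW.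
    - by rewrite ler_pM2l// wt1_mono.
    - rewrite ler_expR; have := pw_ge0 p a; have := pw_ge0 p xi; nra.
  rewrite -mulrDr; apply: ler_wpM2l.
    by apply: mulr_ge0; [exact: W|exact: expR_ge0].
  lra.
have dxi i j a xi x s : pw a + pw xi <= s ->
    `|x| ^+ i * cabs ('i * (herm' j ((x - a) +i* xi) - x%:C * herm j ((x - a) +i* xi)) * wp1 a xi x) <= M i j s.
  move=> as_.
  apply: (@le_trans _ _ (j%:R * (`|x| ^+ i * cabs (wpd1 j.-1 a xi x)) + `|x| ^+ i.+1 * cabs (wpd1 j a xi x))).
    set A := cabs (wpd1 j.-1 a xi x); set B := cabs (wpd1 j a xi x).
    have -> : j%:R * (`|x| ^+ i * A) + `|x| ^+ i.+1 * B = `|x| ^+ i * (j%:R * A + `|x| * B).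
      by rewrite exprS; ring.
    apply: ler_wpM2l; first exact: exprn_ge0.
    rewrite /A /B /wpd1; move: (wp1 a xi x) => w; rewrite !cabsM abs_i mul1r !mulrA -mulrDl.
    apply: ler_wpM2r; first exact: cabs_ge0.
    rewrite (le_trans (cabsB _ _))// lerD//; last by rewrite cabsM cabsR.
    by rewrite /herm' cabsM cabsN -(rmorph_nat (real_complex R)) cabsR ger0_norm.
  apply: (@le_trans _ _ (C * wt1 (2 * c) i j * expR (k * s) * 1 + C * wt1 (2 * c) i j * expR (k * s) * c)).
    apply: lerD.
      apply: (@le_trans _ _ (j%:R * (C * wt1 c i j.-1 * expR (k * s)))).
        by rewrite ler_wpM2l// Hs.
      rewrite mulr1 mulrA ler_wpM2r ?expR_ge0// mulrCA ler_pM2l//; exact: wt1P.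
    apply: le_trans (Hs i.+1 j a xi x s as_) _.
    by rewrite [leRHS]mulrAC ler_wpM2r ?expR_ge0// -[leRHS]mulrA ler_pM2l// mulrC wt1Sl.
  rewrite -mulrDr; apply: ler_wpM2l.
    by apply: mulr_ge0; [exact: W|exact: expR_ge0].
  by lra.
exists (2 * c), (2 * C * (c + K + 1)); split; [lra|by rewrite !mulr_gt0//; lra|].
move=> i j a a' xi xi' x.
set s := pw a + pw a' + pw xi + pw xi'.
have q1 := pw_ge0 p a; have q2 := pw_ge0 p a'; have q3 := pw_ge0 p xi; have q4 := pw_ge0 p xi'.
have -> : 2 * C * (c + K + 1) * wt1 (2 * c) i j * expR (k * s) * (`|a - a'| + `|xi - xi'|) =
    2 * M i j s * `|a - a'| + 2 * M i j s * `|xi - xi'| by rewrite /M; ring.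
have xi0 : cabs ((`|x| ^+ i)%:C : R[i]) = `|x| ^+ i by rewrite cabsR ger0_norm ?exprn_ge0.
have -> : wpd1 j a xi x - wpd1 j a' xi' x =
    (wpd1 j a xi x - wpd1 j a' xi x) + (wpd1 j a' xi x - wpd1 j a' xi' x) by rewrite addrA subrK.
apply: le_trans (ler_wpM2l _ (cabsD _ _)) _; first exact: exprn_ge0.
rewrite mulrDr -xi0 -!cabsM !mulrBr; apply: lerD.
  apply: (cmvt_le (f := fun a => (`|x| ^+ i)%:C * wpd1 j a xi x)
    (f' := fun a => (`|x| ^+ i)%:C * - (wpd1 j.+1 a xi x + 'i * xi%:C * wpd1 j a xi x))).
    move=> t; apply: cder_eq (cder_mul (cder_cst t _) (cder_wpd1_pos j t xi x)) _.
    by rewrite mul0r add0r.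
  move=> t /pw_between ht; rewrite cabsM xi0; apply: da; rewrite /s; lra.
apply: (cmvt_le (f := fun xi => (`|x| ^+ i)%:C * wpd1 j a' xi x)
  (f' := fun xi => (`|x| ^+ i)%:C *
     ('i * (herm' j ((x - a') +i* xi) - x%:C * herm j ((x - a') +i* xi)) * wp1 a' xi x))).
  move=> t; apply: cder_eq (cder_mul (cder_cst t _) (cder_wpd1_freq j a' t x)) _.
  by rewrite mul0r add0r.
move=> t /pw_between ht; rewrite cabsM xi0; apply: dxi; rewrite /s; lra.
Qed.

End packet_bounds.

Section wave_packet_tower.
Context {R : realType} (d : nat).
Local Notation phase := ('cV[R]_d * 'cV[R]_d)%type.
Implicit Types (z : phase) (x : 'cV[R]_d) (b : 'I_d -> nat).

Definition wpd b z x : R[i] := \prod_j wpd1 (b j) (z.1 j 0) (z.2 j 0) (x j 0).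

Lemma wave_packetE z x : wave_packet z x = wpd (fun=> 0%N) z x.
Proof.
have E j : wpd1 0 (z.1 j 0) (z.2 j 0) (x j 0) =
  (expR (- ((x j 0 - z.1 j 0) ^+ 2 / 2)))%:C * cis (- (x j 0 * z.2 j 0)).
  by rewrite /wpd1 mul1r.
rewrite /wpd; under eq_bigr do rewrite E.
rewrite big_split/= -(rmorph_prod (real_complex R)) -cis_sum.
have -> : \prod_j expR (- ((x j 0 - z.1 j 0) ^+ 2 / 2)) = expR (- (enorm (x - z.1) ^+ 2 / 2)).
  rewrite enorm_sqr -expR_sum; congr expR; rewrite sumrN mulr_suml.
  by congr (- _); apply: eq_bigr => j _; rewrite !mxE expr2.
have -> : \sum_j - (x j 0 * z.2 j 0) = - dotp x z.2 by rewrite sumrN.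
by rewrite /wave_packet/= /cis; apply: ceq; simpc.
Qed.

Lemma wpd_ctower z : ctower (fun b => wpd b z).
Proof.
have c1 k (a xi : R) : ccont (wpd1 k a xi).
  have D (f : R -> R) f' : (forall t, is_derive t (1 : R) f (f' t)) -> continuous f.
    move=> df t; apply: differentiable_continuous; apply/derivable1_diffP.
    exact: (@ex_derive _ _ _ _ _ _ _ (df t)).
  split; first by apply: D => t; exact: (cder_wpd1 k a xi t).1.
  by apply: D => t; exact: (cder_wpd1 k a xi t).2.
have cw b : ccont (wpd b z).
  by apply: ccont_prod => j; apply: ccont_comp (c1 _ _ _) _; exact: coord_continuous.
have dw b j x : is_derive x (delta_mx j 0 : 'cV[R]_d) (fun x => Re (wpd b z x)) (Re (wpd (mi_incr j b) z x)) /\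
    is_derive x (delta_mx j 0 : 'cV[R]_d) (fun x => Im (wpd b z x)) (Im (wpd (mi_incr j b) z x)).
  pose rest := \prod_(i | i != j) wpd1 (b i) (z.1 i 0) (z.2 i 0) (x i 0).
  have E : (fun k : R => wpd b z (x + k *: (delta_mx j 0 : 'cV[R]_d))) =
      fun k => wpd1 (b j) (z.1 j 0) (z.2 j 0) (x j 0 + k) * rest.
    apply/funext => k; rewrite /wpd (bigD1 j)//= !mxE !eqxx mulr1; congr (_ * _).
    by apply: eq_bigr => i ij; rewrite !mxE (negPf ij) /= mulr0 addr0.
  have D1 : cder 0 (fun k => wpd1 (b j) (z.1 j 0) (z.2 j 0) (x j 0 + k))
      (wpd1 (b j).+1 (z.1 j 0) (z.2 j 0) (x j 0)).
    have [h1 h2] := cder_wpd1 (b j) (z.1 j 0) (z.2 j 0) (x j 0 + 0).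
    have h0 := der_add (der_cst (x j 0) 0) (der_id (0 : R)).
    split.
      by apply: is_derive_eq (der_comp h1 h0) _; rewrite !(add0r, addr0, mulr1).
    by apply: is_derive_eq (der_comp h2 h0) _; rewrite !(add0r, addr0, mulr1).
  have D2 : cder 0 (fun k : R => wpd b z (x + k *: (delta_mx j 0 : 'cV[R]_d))) (wpd (mi_incr j b) z x).
    rewrite E; apply: cder_eq (cder_mul D1 (cder_cst 0 rest)) _.
    rewrite mulr0 addr0 /wpd (bigD1 j)//= /mi_incr eqxx addn1; congr (_ * _).
    by apply: eq_bigr => i ij; rewrite (negPf ij) addn0.
  by split; apply: is_derive_along; [exact: D2.1|exact: D2.2].
by split => b; split; [exact: (cw b).1|by move=> j x; exact: (dw b j x).1|
  exact: (cw b).2|by move=> j x; exact: (dw b j x).2].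
Qed.

Lemma wave_packet_cpartial z : csmooth (wave_packet z : 'cV[R]_d -> R[i]^o) /\
  forall b, cpartial b (wave_packet z : 'cV[R]_d -> R[i]^o) = wpd b z.
Proof. by apply: ctower_csmooth (wpd_ctower z) _ => x; exact: wave_packetE. Qed.

Definition zdist (z z' : phase) : R :=
  \sum_j (`|z.1 j 0 - z'.1 j 0| + `|z.2 j 0 - z'.2 j 0|).

Lemma zdist_ge0 z z' : 0 <= zdist z z'.
Proof. by apply: sumr_ge0 => j _; rewrite addr_ge0. Qed.

(** Telescoping: one factor at a time is exchanged, the others being bounded by M. *)
Lemma prod_diff_le (I : Type) (s : seq I) (A B : I -> R[i]) (M D : I -> R) :
  (forall i, 0 <= M i) -> (forall i, 0 <= D i) ->
  (forall i, cabs (A i) <= M i) -> (forall i, cabs (B i) <= M i) ->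
  (forall i, cabs (A i - B i) <= M i * D i) ->
  cabs (\prod_(i <- s) A i - \prod_(i <- s) B i) <= (\prod_(i <- s) M i) * \sum_(i <- s) D i.
Proof.
move=> M0 D0 AM BM AB; elim: s => [|i s IH]; first by rewrite !big_nil subrr cabs0 mulr0.
rewrite !big_cons; set PA := \prod_(j <- s) A j; set PB := \prod_(j <- s) B j.
set PM := \prod_(j <- s) M j; set SD := \sum_(j <- s) D j.
have PBM : cabs PB <= PM by rewrite cabs_prod; apply: ler_prod => j _; rewrite cabs_ge0 BM.
have -> : A i * PA - B i * PB = A i * (PA - PB) + (A i - B i) * PB by ring.
apply: le_trans (cabsD _ _) _; rewrite !cabsM.
have -> : M i * PM * (D i + SD) = M i * (PM * SD) + M i * D i * PM by ring.
by apply: lerD; apply: ler_pM; rewrite ?cabs_ge0.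
Qed.

End wave_packet_tower.

(** * Packets as elements of the Gelfand-Shilov space, and the transform *)

Section packet_gs.
Context {R : realType} (theta : R) (htheta : 2^-1 <= theta < 1) (d : nat).
Local Notation phase := ('cV[R]_d * 'cV[R]_d)%type.
Local Notation p := (theta^-1).
Implicit Types (z : phase) (x : 'cV[R]_d) (a b : 'I_d -> nat).

Let hp := inv_theta_bounds htheta.

Definition qz z : R := qv p z.1 + qv p z.2.

Lemma qz_ge0 z : 0 <= qz z.
Proof. by rewrite addr_ge0// qv_ge0. Qed.

Lemma prod_wt1 c a b : \prod_j wt1 theta c (a j) (b j) = gs_weight theta c a b.
Proof.
rewrite /wt1 big_split/= /gs_weight; congr (_ * _).
  by rewrite -(big_morph _ (exprD c) (expr0 c)) big_split.
rewrite /mi_fact -big_split/= natr_prod.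
pose P (u v : R) := 0 <= v /\ u = v `^ theta.
suff [] : P (\prod_j ((a j)`! * (b j)`!)%N%:R `^ theta) (\prod_j ((a j)`! * (b j)`!)%N%:R) by [].
elim/big_rec2 : _ => [|j y1 y2 _ [y10 ->]]; first by rewrite /P ler01 powR1.
by split; [rewrite mulr_ge0|rewrite (powRM _ (ler0n _ _) y10)].
Qed.

Lemma prod_abs_power a x : cabs ((mi_power x a)%:C : R[i]) = \prod_j `|x j 0| ^+ a j.
Proof.
by rewrite cabsR /mi_power normr_prod; apply: eq_bigr => j _; rewrite normrX.
Qed.

Lemma wpd_bounds (k : R) : 0 < k -> exists c C : R, [/\ 1 <= c, 0 < C,
  forall a b z x, cabs ((mi_power x a)%:C * wpd b z x) <=
    C * gs_weight theta c a b * expR (k * qz z) &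
  forall a b z z' x, cabs ((mi_power x a)%:C * (wpd b z x - wpd b z' x)) <=
    C * gs_weight theta c a b * expR (k * (qz z + qz z')) * zdist z z'].
Proof.
move=> k0; have [c1 [C1 [c11 C10 H1]]] := wpd1_le htheta k0.
have [c2 [C2 [c21 C20 H2]]] := wpd1_lip htheta k0.
pose c := Num.max c1 c2; pose C := Num.max C1 C2.
have cc1 : c1 <= c by rewrite le_max lexx.
have cc2 : c2 <= c by rewrite le_max lexx orbT.
have c10 : 0 <= c1 by lra.
have c20 : 0 <= c2 by lra.
have CC1 : C1 <= C by rewrite le_max lexx.
have CC2 : C2 <= C by rewrite le_max lexx orbT.
have C0 : 0 < C by exact: lt_le_trans C10 CC1.
have wm c' i j : 0 <= c' -> c' <= c -> wt1 theta c' i j <= wt1 theta c i j.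
  move=> c'0 cc'; rewrite ler_wpM2r ?powR_ge0// lerXn2r// nnegrE//.
  exact: le_trans cc'.
pose M (a b : nat) (s : R) := C * wt1 theta c a b * expR (k * s).
have M0 i j s : 0 <= M i j s.
  by rewrite !mulr_ge0 ?expR_ge0 ?exprn_ge0 ?powR_ge0//; [exact: ltW|exact: le_trans cc1].
have bM i j e xi t s : pw p e + pw p xi <= s ->
    `|t| ^+ i * cabs (wpd1 j e xi t) <= M i j s.
  move=> es; apply: le_trans (H1 i j e xi t) _; rewrite /M.
  apply: ler_pM; rewrite ?expR_ge0//.
  - by rewrite !mulr_ge0 ?exprn_ge0 ?powR_ge0//; exact: ltW.
  - apply: ler_pM => //; [exact: ltW| |exact: wm].
    by rewrite !mulr_ge0 ?exprn_ge0 ?powR_ge0.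
  - by rewrite ler_expR ler_pM2l.
have prodM a b (s : 'I_d -> R) : \prod_j M (a j) (b j) (s j) =
    C ^+ d * gs_weight theta c a b * expR (k * \sum_j s j).
  have -> : \prod_j M (a j) (b j) (s j) =
      \prod_(j < d) (C * wt1 theta c (a j) (b j)) * \prod_(j < d) expR (k * s j).
    by rewrite -big_split.
  have -> : \prod_(j < d) (C * wt1 theta c (a j) (b j)) =
      \prod_(j < d) C * \prod_(j < d) wt1 theta c (a j) (b j) by rewrite -big_split.
  by rewrite prodr_const card_ord prod_wt1 -expR_sum mulr_sumr.
exists c, (C ^+ d); split.
- exact: le_trans cc1.
- exact: exprn_gt0.
- move=> a b z x; rewrite cabsM prod_abs_power cabs_prod -big_split/=.
  apply: (@le_trans _ _ (\prod_j M (a j) (b j) (pw p (z.1 j 0) + pw p (z.2 j 0)))).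
    by apply: ler_prod => j _; rewrite bM// andbT mulr_ge0 ?exprn_ge0// cabs_ge0.
  by rewrite prodM /qz /qv big_split.
- move=> a b z z' x.
  pose s j := pw p (z.1 j 0) + pw p (z'.1 j 0) + pw p (z.2 j 0) + pw p (z'.2 j 0).
  have E : (mi_power x a)%:C * (wpd b z x - wpd b z' x) =
     \prod_j ((x j 0 ^+ a j)%:C * wpd1 (b j) (z.1 j 0) (z.2 j 0) (x j 0)) -
     \prod_j ((x j 0 ^+ a j)%:C * wpd1 (b j) (z'.1 j 0) (z'.2 j 0) (x j 0)).
    rewrite mulrBr /wpd /mi_power (rmorph_prod (real_complex R)).
    by congr (_ - _); rewrite -big_split.
  have xE j : cabs (x j 0 ^+ a j)%:C = `|x j 0| ^+ a j by rewrite cabsR normrX.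
  rewrite E; pose D j := `|z.1 j 0 - z'.1 j 0| + `|z.2 j 0 - z'.2 j 0|.
  apply: le_trans (@prod_diff_le R _ _ _ _ (fun j => M (a j) (b j) (s j)) D _ _ _ _ _) _ => //.
  + by move=> j; rewrite addr_ge0.
  + move=> j; rewrite cabsM xE; apply: bM; rewrite /s.
    have := pw_ge0 p (z'.1 j 0); have := pw_ge0 p (z'.2 j 0); lra.
  + move=> j; rewrite cabsM xE; apply: bM; rewrite /s.
    have := pw_ge0 p (z.1 j 0); have := pw_ge0 p (z.2 j 0); lra.
  + move=> j; rewrite -mulrBr cabsM xE; apply: le_trans (H2 _ _ _ _ _ _ _) _.
    apply: ler_wpM2r; first by rewrite addr_ge0.
    rewrite /M; apply: ler_wpM2r; first exact: expR_ge0.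
    apply: ler_pM => //; [exact: ltW| |exact: wm].
    by rewrite !mulr_ge0 ?exprn_ge0 ?powR_ge0.
  + rewrite prodM; have -> : \sum_j s j = qz z + qz z'; last by [].
    by rewrite /s !big_split/= /qz /qv; ring.
Qed.

Lemma wave_packet_gs_le (k : R) : 0 < k -> exists c C : R, [/\ 1 <= c, 0 < C,
  forall z, gs_le theta c (C * expR (k * qz z)) (wave_packet z : 'cV[R]_d -> R[i]^o) &
  forall z z' b, cpartial b (wave_packet z : 'cV[R]_d -> R[i]^o) = wpd b z /\
    forall a x, cabs ((mi_power x a)%:C * (wpd b z x - wpd b z' x)) <=
      C * expR (k * (qz z + qz z')) * zdist z z' * gs_weight theta c a b].
Proof.
move=> k0; have [c [C [c1 C0 H1 H2]]] := wpd_bounds k0; exists c, C; split => //.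
  move=> z a b x; rewrite (wave_packet_cpartial z).2 [leRHS]mulrAC; exact: H1.
move=> z z' b; split; first exact: (wave_packet_cpartial z).2.
move=> a x; apply: le_trans (H2 a b z z' x) _; rewrite le_eqVlt; apply/orP; left; apply/eqP; ring.
Qed.

Lemma wave_packet_mem z : (wave_packet z : 'cV[R]_d -> R[i]^o) \in gs_pred theta (d := d).
Proof.
have [c [C [c1 _ H _]]] := wave_packet_gs_le ltr01.
by apply: gs_mem (wave_packet_cpartial z).1 (H z); lra.
Qed.

Definition packet z : gs theta d := GS (wave_packet_mem z).

Definition transform (u : gs_dual theta d) z : R[i] := u (packet z).

Lemma pairing_packet (u : gs_dual theta d) z : pairing u (wave_packet z) = transform u z.
Proof. exact: pairingE. Qed.

(** The exponent k is arbitrary because u is bounded on every step: a smaller k only places the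
    packets in a larger step. The Lipschitz bound serves measurability and discretization. *)
Lemma transform_bounds (u : gs_dual theta d) (k : R) : 0 < k -> exists2 C : R, 0 <= C &
  (forall z, cabs (transform u z) <= C * expR (k * qz z)) /\
  forall z z', cabs (transform u z - transform u z') <= C * expR (k * (qz z + qz z')) * zdist z z'.
Proof.
move=> k0; have [c [C [c1 C0 H1 H2]]] := wave_packet_gs_le k0.
have c0 : 0 < c by lra.
have [M M0 HM] := gs_dual_bounded u c0.
exists (M * C); first by rewrite mulr_ge0// ltW.
split=> [z|z z']; first by rewrite -mulrA; apply: HM; exact: H1.
have -> : transform u z - transform u z' = u (packet z - packet z') by rewrite raddfB.
rewrite -!mulrA; apply: HM => a b x.
have -> : (packet z - packet z' : 'cV[R]_d -> R[i]^o) =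
    (-1 : R[i]) *: (wave_packet z' : 'cV[R]_d -> R[i]^o) + (wave_packet z : 'cV[R]_d -> R[i]^o).
  apply/funext => y; rewrite -[RHS]/(-1 * wave_packet z' y + wave_packet z y) mulN1r addrC.
  by [].
rewrite (csmooth_lin (-1) (wave_packet_cpartial z').1 (wave_packet_cpartial z).1).2.
rewrite (H2 z z' b).1 (H2 z' z b).1 mulN1r addrC.
by apply: le_trans ((H2 z z' b).2 a x) _; rewrite !mulrA.
Qed.

Lemma pw_le1 (t : R) : `|t| <= 1 -> pw p t <= 1.
Proof.
move=> t1; apply: (@le_trans _ _ (pw p 1)); last by rewrite /pw normr1 powR1.
by apply: pw_mono => //; rewrite normr1.
Qed.

Lemma qz_near z z' : (forall j, `|z.1 j 0 - z'.1 j 0| <= 1) ->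
  (forall j, `|z.2 j 0 - z'.2 j 0| <= 1) -> qz z' <= 4 * qz z + 8 * d%:R.
Proof.
move=> h1 h2.
have H (v w : 'cV[R]_d) : (forall j, `|v j 0 - w j 0| <= 1) -> qv p w <= 4 * qv p v + 4 * d%:R.
  move=> h; have := qv_sub hp v (v - w); rewrite opprB addrC subrK mulrDr => h3.
  apply: le_trans h3 _; rewrite lerD2l ler_pM2l// -[d in d%:R]card_ord -sum1_card natr_sum.
  by apply: ler_sum => j _; rewrite !mxE; exact: pw_le1.
have := H _ _ h1; have := H _ _ h2; rewrite /qz; lra.
Qed.

End packet_gs.

Section lipschitz.
Context {R : realType} (theta : R) (d : nat).
Local Notation phase := ('cV[R]_d * 'cV[R]_d)%type.

(** A phase space point is read as one vector of length d + d, the form in which continuity gives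
    measurability. *)
Lemma ccont_local_lip (f : phase -> R[i]) :
  (forall z, exists K : R, forall z', zdist z z' <= 1 -> cabs (f z - f z') <= K * zdist z z') ->
  ccont (fun y : 'cV[R]_(d + d) => f (usubmx y, dsubmx y)).
Proof.
move=> H; pose sp (y : 'cV[R]_(d + d)) := (usubmx y, dsubmx y) : phase.
have cz (y0 : 'cV[R]_(d + d)) : continuous (fun y => zdist (sp y0) (sp y)).
  apply: continuous_sum_real => j.
  apply: contD; apply: (cont_comp (@norm_continuous _ R)); apply: (contD (@cont_cst R _ _)); apply: contN.
    by rewrite (_ : (fun y => _) = (fun y : 'cV[R]_(d + d) => y (lshift d j) 0));
      [exact: coord_continuous|apply/funext => y; rewrite mxE].
  by rewrite (_ : (fun y => _) = (fun y : 'cV[R]_(d + d) => y (rshift d j) 0));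
    [exact: coord_continuous|apply/funext => y; rewrite mxE].
have key (y0 : 'cV[R]_(d + d)) (e : R) : 0 < e -> \forall y \near y0, cabs (f (sp y0) - f (sp y)) <= e.
  move=> e0; have [K HK] := H (sp y0).
  have z0 : zdist (sp y0) (sp y0) = 0.
    by rewrite /zdist big1// => j _; rewrite !subrr !normr0 addr0.
  pose e' := Num.min 1 (e / (`|K| + 1)).
  have e'0 : 0 < e' by rewrite lt_min ltr01 divr_gt0// ltr_wpDl.
  have := cz y0 y0 => /cvgrPdist_le/(_ _ e'0); apply: filterS => y.
  rewrite z0 sub0r normrN ger0_norm ?zdist_ge0// le_min => /andP[h1 h2].
  apply: le_trans (HK _ h1) _; apply: (@le_trans _ _ ((`|K| + 1) * zdist (sp y0) (sp y))).
    by rewrite ler_wpM2r ?zdist_ge0// (le_trans (ler_norm _))// lerDl.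
  by rewrite mulrC -ler_pdivlMr// ltr_wpDl.
split=> y0; apply: (proj2 (@cvgrPdist_le _ _ _ (nbhs y0) (nbhs_filter y0) _ _)) => e e0.
  apply: (@filterS _ (nbhs y0) (nbhs_filter y0) _ _ _ (key y0 e e0)) => y h.
  by rewrite -Re_opp -Re_add (le_trans (cabs_Re _)).
apply: (@filterS _ (nbhs y0) (nbhs_filter y0) _ _ _ (key y0 e e0)) => y h.
by rewrite -Im_opp -Im_add (le_trans (cabs_Im _)).
Qed.

End lipschitz.

(** * Differentiation of parameter integrals *)

Section derivation_under_integral.
Context {R : realType} {dX : measure_display} {X : measurableType dX}
  (mu : {measure set X -> \bar R}).

Lemma der_Rint (f f' : R -> X -> R) (w : X -> R) : (forall s, rintegrable mu (f s)) ->
  rintegrable mu w -> (forall s t, `|f' s t| <= w t) ->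
  (forall s t, is_derive s (1 : R) (fun s => f s t) (f' s t)) ->
  forall s, is_derive s (1 : R) (fun s => \int[mu]_(t in setT) f s t)
    (\int[mu]_(t in setT) f' s t).
Proof.
move=> fi wi f'w df s.
have w0 t : 0 <= w t by exact: le_trans (f'w 0 t).
have Is : `]s - 1, s + 1[%classic s by rewrite /= in_itv/=; apply/andP; split; lra.
have D1 u t : partial1of2 f u t = f' u t.
  by rewrite partial1of2E; exact: (@derive_val _ _ _ _ _ _ _ (df u t)).
have ub u t : `]s - 1, s + 1[%classic u -> setT t -> `|partial1of2 f u t| <= w t.
  by move=> _ _; rewrite D1.
have ex := @derivable_under_integral R _ _ mu f setT measurableT s _ _ Is (fun t _ => fi t)
  (fun u t _ _ => @ex_derive _ _ _ _ _ _ _ (df u t)) w w0 wi ub.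
have := @differentiation_under_integral R _ _ mu f setT measurableT s _ _ Is (fun t _ => fi t)
  (fun u t _ _ => @ex_derive _ _ _ _ _ _ _ (df u t)) w w0 wi ub.
under eq_Rintegral do rewrite D1.
by rewrite derive1E => <-; exact: DeriveDef.
Qed.

(** Dominated convergence speaks of sequences; this passes from them back to continuity. *)
Lemma continuous_seq n (f : 'cV[R]_n -> R) :
  (forall (x : 'cV[R]_n) (u : nat -> 'cV[R]_n), u k @[k --> \oo] --> x ->
    f (u k) @[k --> \oo] --> f x) -> continuous f.
Proof.
move=> H x; apply: (proj2 (@cvgrPdist_le _ _ _ (nbhs x) (nbhs_filter x) _ _)) => e e0.
apply: contrapT => nf.
have ex k : exists y : 'cV[R]_n, `|x - y| < k.+1%:R^-1 /\ e < `|f x - f y|.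
  apply: contrapT => /forallNP h; apply: nf; apply/nbhs_ballP.
  exists k.+1%:R^-1; first by rewrite /= invr_gt0.
  move=> y; rewrite -ball_normE /= => xy; rewrite leNgt; apply/negP => fy.
  by apply: (h y).
have [u Hu] := choice ex.
have ux : u k @[k --> \oo] --> x.
  apply/cvgrPdist_lt => e' e'0; near=> k.
  apply: lt_trans (Hu k).1 _; near: k; exact: near_infty_natSinv_lt (PosNum e'0).
have /cvgrPdist_lt/(_ _ e0)[k _ /(_ k (leqnn _))] := H x u ux.
by rewrite /= ltNge (ltW (Hu k).2).
Unshelve. all: by end_near.
Qed.

(** The majorants [w b] do not depend on x, so every level of the tower may be differentiated under
    the integral. *)
Lemma ctower_cint n (F : X -> ('I_n -> nat) -> 'cV[R]_n -> R[i])
    (w : ('I_n -> nat) -> X -> R) :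
  (forall t, ctower (F t)) -> (forall b x, cmeas (fun t => F t b x)) ->
  (forall b, rintegrable mu (w b)) -> (forall b t x, cabs (F t b x) <= w b t) ->
  ctower (fun b x => cint mu (fun t => F t b x)).
Proof.
move=> tF mF wi Fw.
have fi b x : cintegrable mu (fun t => F t b x) by exact: cintegrable_dom (mF b x) (wi b) _.
have cF b x (u : nat -> 'cV[R]_n) : u k @[k --> \oo] --> x ->
    cabs (cint mu (fun t => F t b (u k)) - cint mu (fun t => F t b x)) @[k --> \oo] --> (0 : R).
  move=> ux; apply: (cint_dct (fun k => mF b (u k)) (wi b)) => [k t|t]; first exact: Fw.
  apply: (@ccont_cvg _ _ (F t b)) ux.
  by split; [exact: ((tF t).1 b).1|exact: ((tF t).2 b).1].
have small (a c : nat -> R) (l : R) : (forall k, `|a k - l| <= c k) ->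
    c k @[k --> \oo] --> (0 : R) -> a k @[k --> \oo] --> l.
  move=> ac c0; apply/cvgrPdist_le => e e0.
  move/cvgr0Pnorm_le : c0 => /(_ _ e0); apply: filterS => k.
  by rewrite distrC; apply: le_trans; apply: le_trans (ac k) (ler_norm _).
split => b; split.
- apply: continuous_seq => x u ux; apply: small (cF b x u ux) => k.
  by rewrite -Re_opp -Re_add cabs_Re.
- move=> j x; apply: is_derive_along.
  have := @der_Rint (fun s t => Re (F t b (x + s *: (delta_mx j 0 : 'cV[R]_n))))
    (fun s t => Re (F t (mi_incr j b) (x + s *: (delta_mx j 0 : 'cV[R]_n)))) (w (mi_incr j b)).
  move=> /(_ _ _ _ _ 0); rewrite scale0r addr0; apply.
  + by move=> s; exact: (fi _ _).1.
  + exact: wi.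
  + by move=> s t; apply: le_trans (cabs_Re _) (Fw _ _ _).
  + by move=> s t; apply: (@is_derive_line _ _ _ _ _ _ s (((tF t).1 b).2 j _)).
- apply: continuous_seq => x u ux; apply: small (cF b x u ux) => k.
  by rewrite -Im_opp -Im_add cabs_Im.
- move=> j x; apply: is_derive_along.
  have := @der_Rint (fun s t => Im (F t b (x + s *: (delta_mx j 0 : 'cV[R]_n))))
    (fun s t => Im (F t (mi_incr j b) (x + s *: (delta_mx j 0 : 'cV[R]_n)))) (w (mi_incr j b)).
  move=> /(_ _ _ _ _ 0); rewrite scale0r addr0; apply.
  + by move=> s; exact: (fi _ _).2.
  + exact: wi.
  + by move=> s t; apply: le_trans (cabs_Im _) (Fw _ _ _).
  + by move=> s t; apply: (@is_derive_line _ _ _ _ _ _ s (((tF t).2 b).2 j _)).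
Qed.

End derivation_under_integral.

Lemma ctower_scale {R : realType} d (c : R[i]) (F : ('I_d -> nat) -> 'cV[R]_d -> R[i]) :
  ctower F -> ctower (fun b x => c * F b x).
Proof.
move=> [t1 t2].
have cF b : ccont (fun x => c * F b x).
  exact: (ccontM (ccont_cst _ c) (conj (t1 b).1 (t2 b).1)).
have D b j x : cder 0 (fun s : R => c * F b (x + s *: (delta_mx j 0 : 'cV[R]_d)))
    (c * F (mi_incr j b) x).
  have x0 : x = x + 0 *: (delta_mx j 0 : 'cV[R]_d) by rewrite scale0r addr0.
  have h1 := (t1 b).2 j x; rewrite x0 in h1.
  have h2 := (t2 b).2 j x; rewrite x0 in h2.
  have h : cder 0 (fun s : R => F b (x + s *: (delta_mx j 0 : 'cV[R]_d))) (F (mi_incr j b) x).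
    split; rewrite {2}x0; [exact: is_derive_line h1|exact: is_derive_line h2].
  by apply: cder_eq (cder_mul (cder_cst 0 c) h) _; rewrite mul0r add0r.
split=> b; split.
- exact: (cF b).1.
- by move=> j x; apply: is_derive_along; exact: (D b j x).1.
- exact: (cF b).2.
- by move=> j x; apply: is_derive_along; exact: (D b j x).2.
Qed.

(** * Superpositions of packets and their discretization *)

Section superposition.
Context {R : realType} (theta : R) (htheta : 2^-1 <= theta < 1) (d : nat)
  {dX : measure_display} {X : measurableType dX}.
Local Notation phase := ('cV[R]_d * 'cV[R]_d)%type.
Local Notation qz := (@qz R theta d).
Local Notation packet := (packet htheta).
Local Notation transform := (transform htheta).
Implicit Types (mu : {measure set X -> \bar R}) (phi : X -> R[i]) (z : X -> phase).

Definition mphase z := mcoord (fun t => (z t).1) /\ mcoord (fun t => (z t).2).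

Lemma mcoord_col_mx z : mphase z -> mcoord (fun t => col_mx (z t).1 (z t).2).
Proof.
move=> [m1 m2] j; case: (splitP j) => i ij.
  have -> : j = lshift d i by exact/val_inj.
  by under eq_fun do rewrite col_mxEu; exact: m1.
have -> : j = rshift d i by exact/val_inj.
by under eq_fun do rewrite col_mxEd; exact: m2.
Qed.

Lemma zdist_near (z z' : phase) : zdist z z' <= 1 -> qz z' <= 4 * qz z + 8 * d%:R.
Proof.
move=> h; have H j : `|z.1 j 0 - z'.1 j 0| + `|z.2 j 0 - z'.2 j 0| <= 1.
  apply: le_trans h; rewrite /zdist (bigD1 j)//= lerDl sumr_ge0// => i _; rewrite addr_ge0.
by apply: (qz_near htheta) => j; apply: le_trans (H j); rewrite (lerDl, lerDr).
Qed.

Lemma ccont_explip (f : phase -> R[i]) (C k : R) : 0 <= k ->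
  (forall z z' : phase, cabs (f z - f z') <= C * expR (k * (qz z + qz z')) * zdist z z') ->
  ccont (fun y : 'cV[R]_(d + d) => f (usubmx y, dsubmx y)).
Proof.
move=> k0 H; apply: ccont_local_lip => z.
exists (`|C| * expR (k * (qz z + (4 * qz z + 8 * d%:R)))) => z' zz'.
apply: le_trans (H z z') _; rewrite ler_wpM2r ?zdist_ge0//.
apply: (@le_trans _ _ (`|C| * expR (k * (qz z + qz z')))).
  by rewrite ler_wpM2r ?expR_ge0// ler_norm.
by rewrite ler_wpM2l ?normr_ge0// ler_expR ler_wpM2l// lerD2l zdist_near.
Qed.

Lemma cmeas_phase (f : phase -> R[i]) z : mphase z ->
  ccont (fun y : 'cV[R]_(d + d) => f (usubmx y, dsubmx y)) -> cmeas (fun t => f (z t)).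
Proof.
move=> mz cf; have := cmeas_ccont cf (mcoord_col_mx mz).
by under eq_fun do rewrite col_mxKu col_mxKd; under [in X in _ -> X]eq_fun do rewrite [z _]surjective_pairing.
Qed.

Lemma cmeas_transform (u : gs_dual theta d) z : mphase z -> cmeas (fun t => transform u (z t)).
Proof.
move=> mz; apply: cmeas_phase mz _; have [C _ [_ H]] := transform_bounds htheta u ltr01.
exact: ccont_explip ler01 H.
Qed.

Lemma measurable_qz z : mphase z -> measurable_fun setT (fun t => qz (z t)).
Proof.
move=> [m1 m2]; apply: measurable_funD; apply: measurable_sum => j; apply: measurableT_comp => //.
- exact: measurable_pw.
- exact: measurable_pw.
Qed.

Lemma cmeas_wpd (b : 'I_d -> nat) z (x : 'cV[R]_d) : mphase z -> cmeas (fun t => wpd b (z t) x).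
Proof.
move=> mz; apply: (@cmeas_phase (fun y => wpd b y x) _ mz).
have [c [C [c1 C0 _ H]]] := wpd_bounds htheta d (ltr01 : 0 < (1 : R)).
apply: (@ccont_explip (fun y => wpd b y x) (C * gs_weight theta c (fun=> 0%N) b) 1) => // z1 z2.
by have := H (fun=> 0%N) b z1 z2 x; rewrite {1}/mi_power big1 ?mul1r.
Qed.

(** All packets lie in one step c, with norm at most C exp (k q(z)). Integrability of phi against
    this weight therefore bounds every seminorm of the integral at once. *)
Lemma superposition mu phi z (k : R) : 0 < k -> cmeas phi -> mphase z ->
  rintegrable mu (fun t => cabs (phi t) * expR (k * qz (z t))) ->
  exists f : gs theta d, (forall x, f x = cint mu (fun t => phi t * wave_packet (z t) x)) /\
    forall b x, cpartial b f x = cint mu (fun t => phi t * wpd b (z t) x).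
Proof.
move=> k0 mphi mz phii; have [c [C [c1 C0 H _]]] := wpd_bounds htheta d k0.
pose w (a b : 'I_d -> nat) t := C * gs_weight theta c a b * (cabs (phi t) * expR (k * qz (z t))).
have wi a b : rintegrable mu (w a b) by exact: rintegrableZ.
have bnd (a b : 'I_d -> nat) t x : cabs ((mi_power x a)%:C * (phi t * wpd b (z t) x)) <= w a b t.
  rewrite mulrCA cabsM /w mulrCA ler_wpM2l ?cabs_ge0//; exact: H.
pose F t (b : 'I_d -> nat) x := phi t * wpd b (z t) x.
have Fw b t x : cabs (F t b x) <= w (fun=> 0%N) b t.
  by have := bnd (fun=> 0%N) b t x; rewrite {1}/mi_power big1 ?mul1r.
have mF b x : cmeas (fun t => F t b x) by exact: cmeasM mphi (cmeas_wpd b x mz).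
have tF t : ctower (F t) by apply: ctower_scale; exact: wpd_ctower.
have tow := ctower_cint tF mF (wi (fun=> 0%N)) Fw.
have E x : cint mu (fun t => phi t * wave_packet (z t) x) = cint mu (fun t => F t (fun=> 0%N) x).
  by apply: eq_cint => t; rewrite wave_packetE.
pose f0 x : R[i]^o := cint mu (fun t => phi t * wave_packet (z t) x).
have [sf pf] := ctower_csmooth (f := f0) tow E.
have f0le : gs_le theta c (C * \int[mu]_(t in setT) (cabs (phi t) * expR (k * qz (z t)))) f0.
  move=> a b x; rewrite pf -cintZ.
    apply: le_trans (cabs_cint_dom _ (wi a b) (fun t => bnd a b t x)) _.
      by apply: cmeasM (cmeas_cst _) _; exact: mF.
    rewrite mulrAC /w RintegralZl//.
  by apply: cintegrable_dom (mF b x) (wi (fun=> 0%N) b) _ => t; exact: Fw.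
have f0m := gs_mem (lt_le_trans ltr01 c1) sf f0le.
by exists (GS f0m); split => // b x; rewrite /= pf.
Qed.

End superposition.

Section discretization.
Context {R : realType} (d : nat) {dX : measure_display} {X : measurableType dX}.
Local Notation phase := ('cV[R]_d * 'cV[R]_d)%type.
Variable z : X -> phase.
Hypothesis mz : mphase z.

(** Numbering the grid cells by naturals allows truncation to the first K of them. The default of
    [cell_point] is never met by [discretize], which decodes only genuine codes. *)
Definition cell_index N t : nat := pickle (grid N (col_mx (z t).1 (z t).2)).

Definition cell_point N (i : nat) : phase :=
  if @unpickle 'cV[int]_(d + d) i is Some c
  then (usubmx (@ungrid R _ N c), dsubmx (@ungrid R _ N c)) else (0, 0).

Definition discretize N t : phase := cell_point N (cell_index N t).

Lemma discretizeE N t : discretize N t =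
  (usubmx (ungrid N (grid N (col_mx (z t).1 (z t).2))),
   dsubmx (ungrid N (grid N (col_mx (z t).1 (z t).2)))).
Proof. by rewrite /discretize /cell_point /cell_index pickleK. Qed.

Lemma measurable_cell N i : measurable [set t | cell_index N t = i].
Proof.
case E : (@unpickle 'cV[int]_(d + d) i) => [c|]; last first.
  rewrite (_ : [set t | _] = set0) ?measurable0//; apply/seteqP; split => t //= ti.
  by move: E; rewrite -ti /cell_index pickleK.
have [<-|ci] := eqVneq (pickle c) i.
  rewrite (_ : [set t | _] = [set t | grid N (col_mx (z t).1 (z t).2) = c]).
    by apply: (measurable_grid N c); exact: mcoord_col_mx.
  apply/seteqP; split => t /=; rewrite /cell_index; last by move=> ->.
  exact: (pcan_inj pickleK).
rewrite (_ : [set t | _] = set0) ?measurable0//; apply/seteqP; split => t //= ti.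
by move: E ci; rewrite -ti /cell_index pickleK => -[->]; rewrite eqxx.
Qed.

Lemma coord_discretize N t j : `|(z t).1 j 0 - (discretize N t).1 j 0| <= N.+1%:R^-1 /\
  `|(z t).2 j 0 - (discretize N t).2 j 0| <= N.+1%:R^-1.
Proof.
have := grid_dist N (col_mx (z t).1 (z t).2) (rshift d j).
have := grid_dist N (col_mx (z t).1 (z t).2) (lshift d j).
rewrite col_mxEu col_mxEd discretizeE /=.
by rewrite [usubmx _ j 0]mxE [dsubmx _ j 0]mxE.
Qed.

Lemma zdist_discretize N t : zdist (z t) (discretize N t) <= 2 * d%:R / N.+1%:R.
Proof.
have H j : `|(z t).1 j 0 - (discretize N t).1 j 0| <= N.+1%:R^-1 := (coord_discretize N t j).1.
have H' j : `|(z t).2 j 0 - (discretize N t).2 j 0| <= N.+1%:R^-1 := (coord_discretize N t j).2.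
apply: (@le_trans _ _ (\sum_(j < d) (N.+1%:R^-1 + N.+1%:R^-1))).
  by apply: ler_sum => j _; exact: lerD.
rewrite sumr_const card_ord -mulr_natl; set r := _^-1; lra.
Qed.

Lemma measurable_cell_fun N (g : nat -> R) :
  measurable_fun setT (fun t => g (cell_index N t)).
Proof.
move=> _ Y mY; rewrite setTI.
rewrite (_ : _ @^-1` _ = \bigcup_(i in [set i | Y (g i)]) [set t | cell_index N t = i]).
  by apply: bigcup_measurable => i _; exact: measurable_cell.
apply/seteqP; split=> t /=; first by move=> h; exists (cell_index N t).
by move=> [i /= h ti]; rewrite ti.
Qed.

Lemma mphase_discretize N : mphase (discretize N).
Proof.
by split=> j; [exact: (measurable_cell_fun N (fun i => (cell_point N i).1 j 0))|
  exact: (measurable_cell_fun N (fun i => (cell_point N i).2 j 0))].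
Qed.

End discretization.

Section real_dct.
Context {R : realType} {dX : measure_display} {X : measurableType dX}
  (mu : {measure set X -> \bar R}).

Lemma Rint_dct (f_ : nat -> X -> R) f w : (forall n, measurable_fun setT (f_ n)) ->
  rintegrable mu w -> (forall n t, `|f_ n t| <= w t) ->
  (forall t, f_ n t @[n --> \oo] --> f t) ->
  \int[mu]_(t in setT) f_ n t @[n --> \oo] --> \int[mu]_(t in setT) f t.
Proof.
move=> mf wi fw fc.
have := @cint_dct R _ _ mu (fun n t => (f_ n t)%:C) (fun t => (f t)%:C) w.
move=> /(_ (fun n => cmeas_real (mf n)) wi).
have h1 n t : cabs ((f_ n t)%:C : R[i]) <= w t by rewrite cabsR.
have h2 t : cabs ((f_ n t)%:C - (f t)%:C : R[i]) @[n --> \oo] --> (0 : R).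
  under eq_fun do rewrite -rmorphB cabsR.
  apply/cvgr0Pnorm_le => e e0; move/cvgrPdist_le : (fc t) => /(_ _ e0); apply: filterS => n.
  by rewrite distrC normr_id.
move=> /(_ h1 h2) h; apply/cvgrPdist_le => e e0.
move/cvgr0Pnorm_le : h => /(_ _ e0); apply: filterS => n.
rewrite ger0_norm ?cabs_ge0//; apply: le_trans.
by rewrite distrC; apply: le_trans (cabs_Re _); rewrite Re_add Re_opp.
Qed.

End real_dct.

(** * Functionals commute with superpositions *)

Section pairing_superposition.
Context {R : realType} (theta : R) (htheta : 2^-1 <= theta < 1) (d : nat)
  {dX : measure_display} {X : measurableType dX} (mu : {measure set X -> \bar R}).
Local Notation phase := ('cV[R]_d * 'cV[R]_d)%type.
Local Notation qz := (@qz R theta d).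
Local Notation packet := (packet htheta).
Local Notation transform := (transform htheta).
Variables (phi : X -> R[i]) (z : X -> phase) (k : R).
Hypotheses (k0 : 0 < k) (mphi : cmeas phi) (mz : mphase z)
  (phii : rintegrable mu (fun t => cabs (phi t) * expR (5 * k * qz (z t)))).

Let zt N := discretize z N.
Let idx N := cell_index z N.
Let chi N K t : R := (idx N t < K)%:R.
(** The discretized point satisfies q(z_N) <= 4 q(z) + 8 d, so k (q(z) + q(z_N)) is at most 5 k q(z)
    + 8 k d: this is the origin of the exponent 5 k. *)
Let E t := cabs (phi t) * expR (5 * k * qz (z t) + 8 * k * d%:R).

Let iE : rintegrable mu E.
Proof.
rewrite (_ : E = fun t => expR (8 * k * d%:R) * (cabs (phi t) * expR (5 * k * qz (z t)))).
  exact: rintegrableZ.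
by apply/funext => t; rewrite /E expRD; ring.
Qed.

Let mchi N K : measurable_fun setT (chi N K).
Proof. exact: (measurable_cell_fun mz N (fun i => (i < K)%:R)). Qed.

Let qzt N t : qz (zt N t) <= 4 * qz (z t) + 8 * d%:R.
Proof.
have N1 : (N.+1%:R^-1 : R) <= 1 by rewrite invf_le1// ler1n.
by apply: (qz_near htheta) => j; apply: le_trans N1;
  [exact: (coord_discretize z N t j).1|exact: (coord_discretize z N t j).2].
Qed.

Let phik N K t : R[i] := phi t * (chi N K t)%:C.

Let chi01 N K t : 0 <= chi N K t <= 1.
Proof. by rewrite /chi; case: (_ < _)%N; rewrite /= ?lexx ler01. Qed.

Let phik_le N K t : cabs (phik N K t) <= cabs (phi t).
Proof.
rewrite /phik cabsM ler_piMr ?cabs_ge0// cabsR.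
by have /andP[h1 h2] := chi01 N K t; rewrite ger0_norm.
Qed.

Let mphik N K : cmeas (phik N K).
Proof. by apply: cmeasM mphi (cmeas_real _); exact: mchi. Qed.

Let phikE N K t : cabs (phik N K t) * expR (k * qz (zt N t)) <= E t.
Proof.
apply: ler_pM; rewrite ?cabs_ge0 ?expR_ge0//.
rewrite ler_expR; have := qzt N t; have := qz_ge0 theta (z t); have := k0 => /ltW h0 h1 h2.
have := ler_wpM2l h0 h2; nra.
Qed.

Let iphik N K : rintegrable mu (fun t => cabs (phik N K t) * expR (k * qz (zt N t))).
Proof.
apply: (rintegrable_dom _ iE) => [|t]; last first.
  have h0 : 0 <= cabs (phik N K t) * expR (k * qz (zt N t)).
    exact: mulr_ge0 (cabs_ge0 _) (expR_ge0 _).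
  by rewrite (ger0_norm h0); exact: phikE.
apply: measurable_funM; first by apply: measurable_cabs; exact: mphik.
exact: (measurable_cell_fun mz N (fun i => expR (k * qz (cell_point _ N i)))).
Qed.

(** Shared by the transform of u and by the values and derivatives of packets at a fixed x, so one
    error estimate treats the functional and the function. *)
Let tame (B : R) (H : phase -> R[i]) := (forall y, cabs (H y) <= B * expR (k * qz y)) /\
  (forall y y', cabs (H y - H y') <= B * expR (k * (qz y + qz y')) * zdist y y').

Let tame_cmeas B H (y : X -> phase) : tame B H -> mphase y -> cmeas (fun t => H (y t)).
Proof. by move=> [_ h] my; apply: cmeas_phase my _; exact: ccont_explip (ltW k0) h. Qed.

Let tame_integrable B H N K : tame B H -> cintegrable mu (fun t => phik N K t * H (zt N t)).
Proof.
move=> tH; apply: (@cintegrable_dom _ _ _ _ _ (fun t => B * E t)).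
- by apply: cmeasM (mphik N K) (tame_cmeas tH _); exact: mphase_discretize.
- exact: rintegrableZ.
move=> t; rewrite cabsM; have B0 : 0 <= B.
  by have := le_trans (cabs_ge0 _) (tH.1 (0, 0)); rewrite pmulr_lge0 ?expR_gt0.
apply: le_trans (ler_wpM2l (cabs_ge0 _) (tH.1 _)) _.
by rewrite mulrCA; exact: (ler_wpM2l B0 (phikE N K t)).
Qed.

Let phi1 N K t : R[i] := phi t * ((idx N t == K)%:R)%:C.

Let phi1_integrable N K : cintegrable mu (phi1 N K).
Proof.
apply: cintegrable_dom iE _.
  by apply: cmeasM mphi (cmeas_real _); exact: (measurable_cell_fun mz N (fun i => (i == K)%:R)).
move=> t; rewrite /phi1 cabsM; apply: ler_pM; rewrite ?cabs_ge0// cabsR.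
apply: (@le_trans _ _ 1); first by case: (_ == _); rewrite ?normr1 ?normr0.
rewrite -expR0 ler_expR addr_ge0 ?mulr_ge0 ?qz_ge0//; exact: ltW.
Qed.

Let cint_phikS B H N K : tame B H -> cint mu (fun t => phik N K.+1 t * H (zt N t)) =
  cint mu (fun t => phik N K t * H (zt N t)) + cint mu (phi1 N K) * H (cell_point _ N K).
Proof.
move=> tH; rewrite [_ * H _]mulrC -cintZ// -cintD; last 2 first.
- exact: tame_integrable tH.
- exact: cintegrableZ.
apply: eq_cint => t; rewrite /phik /phi1 /chi ltnS leq_eqVlt orbC.
rewrite /zt /discretize -/(idx N t); have [->|iK] := eqVneq (idx N t) K.
  by rewrite ltnn /= rmorph0 rmorph1 !mulr0 mul0r add0r mulr1 mulrC.
by rewrite orbF rmorph0 !mulr0 addr0.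
Qed.

Let packet_tame x : exists B, tame B (fun y => wave_packet y x).
Proof.
have [c [C [_ _ h1 h2]]] := wpd_bounds htheta d k0.
exists (C * gs_weight theta c (fun _ : 'I_d => 0%N) (fun=> 0%N)); split=> [y|y y'].
  by have := h1 (fun=> 0%N) (fun=> 0%N) y x; rewrite wave_packetE {1}/mi_power big1 ?mul1r.
by have := h2 (fun=> 0%N) (fun=> 0%N) y y' x; rewrite !wave_packetE {1}/mi_power big1 ?mul1r.
Qed.

Let transform_tame (u : gs_dual theta d) : exists B, tame B (transform u).
Proof. by have [C C0 [h1 h2]] := transform_bounds htheta u k0; exists C. Qed.

Let cint_phik0 H N : cint mu (fun t => phik N 0 t * H (zt N t)) = 0.
Proof.
rewrite (@eq_cint _ _ _ _ _ (fun t => 0 * phi1 N 0 t)) ?cintZ ?mul0r//.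
by move=> t; rewrite /phik /chi ltn0 rmorph0 mulr0 !mul0r.
Qed.

(** Each further cell adds a scalar multiple of one packet, so linearity of u suffices. *)
Let finite_commute N K (u : gs_dual theta d) (f : gs theta d) :
  (forall x, f x = cint mu (fun t => phik N K t * wave_packet (zt N t) x)) ->
  u f = cint mu (fun t => phik N K t * transform u (zt N t)).
Proof.
elim: K f => [|K IH] f Hf.
  have -> : f = 0 by apply: gs_ext => x; rewrite Hf (cint_phik0 (fun y => wave_packet y x)).
  by rewrite raddf0 (cint_phik0 (transform u)).
have [g [Hg _]] := superposition htheta k0 (mphik N K) (mphase_discretize mz N) (iphik N K).
have -> : f = cint mu (phi1 N K) *: packet (cell_point _ N K) + g.
  apply: gs_ext => x; have [B tB] := packet_tame x.
  by rewrite Hf (cint_phikS N K tB) gs_addE gs_scaleE -Hg addrC.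
have [B tB] := transform_tame u.
by rewrite linearP (cint_phikS N K tB) (IH g Hg) addrC.
Qed.

(** The error density: the mesh width on the first K cells, plus the part lost by truncation. *)
Let D N K t := E t * (2 * d%:R / N.+1%:R + (1 - chi N K t)).

Let iD N K : rintegrable mu (D N K).
Proof.
apply: (@rintegrable_dom _ _ _ _ _ (fun t => (2 * d%:R / N.+1%:R + 1) * E t)).
- apply: measurable_funM; first by have /measurable_int/measurable_EFinP := iE.
  by apply: measurable_funD => //; apply: measurable_funB.
- exact: rintegrableZ.
move=> t; have /andP[h1 h2] := chi01 N K t.
have E0 : 0 <= E t by rewrite mulr_ge0 ?cabs_ge0 ?expR_ge0.
have r0 : 0 <= 2 * d%:R / N.+1%:R :> R by rewrite divr_ge0 ?mulr_ge0.
rewrite ger0_norm /D; last by rewrite mulr_ge0// addr_ge0// subr_ge0.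
by rewrite mulrC ler_wpM2r// lerD2l; lra.
Qed.

Let weight_le t : expR (k * qz (z t)) <= expR (5 * k * qz (z t) + 8 * k * d%:R).
Proof. by rewrite ler_expR; have := qz_ge0 theta (z t); have := ler0n R d; have := k0; nra. Qed.

Let tame_integrable0 B H : tame B H -> cintegrable mu (fun t => phi t * H (z t)).
Proof.
move=> tH; have B0 : 0 <= B.
  by have := le_trans (cabs_ge0 _) (tH.1 (0, 0)); rewrite pmulr_lge0 ?expR_gt0.
apply: cintegrable_dom (cmeasM mphi (tame_cmeas tH mz)) (rintegrableZ B iE) _ => t.
rewrite cabsM; apply: le_trans (ler_wpM2l (cabs_ge0 _) (tH.1 _)) _.
by rewrite mulrCA ler_wpM2l// ler_wpM2l ?cabs_ge0.
Qed.

Let tame_diff B H N K : tame B H ->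
  cabs (cint mu (fun t => phi t * H (z t)) - cint mu (fun t => phik N K t * H (zt N t))) <=
  B * \int[mu]_(t in setT) D N K t.
Proof.
move=> tH; have B0 : 0 <= B.
  by have := le_trans (cabs_ge0 _) (tH.1 (0, 0)); rewrite pmulr_lge0 ?expR_gt0.
have mH := cmeasM mphi (tame_cmeas tH mz).
rewrite -cintB; [|exact: tame_integrable0 tH|exact: tame_integrable tH].
rewrite -RintegralZl//; last exact: iD.
apply: cabs_cint_dom; first by apply: cmeasB mH (cintegrable_cmeas (tame_integrable N K tH)).
  by apply: rintegrableZ; exact: iD.
move=> t; rewrite /phik /D /chi; case: ltnP => _ /=.
  rewrite rmorph1 mulr1 -mulrBr subrr addr0 cabsM.
  apply: le_trans (ler_wpM2l (cabs_ge0 _) (tH.2 _ _)) _.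
  have -> : cabs (phi t) * (B * expR (k * (qz (z t) + qz (zt N t))) * zdist (z t) (zt N t)) =
    B * (cabs (phi t) * expR (k * (qz (z t) + qz (zt N t))) * zdist (z t) (zt N t)) by ring.
  rewrite ler_wpM2l//; apply: ler_pM; rewrite ?mulr_ge0 ?cabs_ge0 ?expR_ge0 ?zdist_ge0//.
    rewrite ler_wpM2l ?cabs_ge0// ler_expR; have := qzt N t; have := k0 => /ltW h0 h2.
    have := ler_wpM2l h0 h2; nra.
  exact: zdist_discretize.
rewrite rmorph0 mulr0 mul0r !subr0 cabsM.
apply: le_trans (ler_wpM2l (cabs_ge0 _) (tH.1 _)) _; rewrite mulrCA ler_wpM2l//.
rewrite -[leLHS]mulr1; apply: ler_pM; rewrite ?mulr_ge0 ?cabs_ge0 ?expR_ge0//.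
  by rewrite ler_wpM2l ?cabs_ge0.
by rewrite lerDr divr_ge0 ?mulr_ge0.
Qed.

Let phi_integrable : rintegrable mu (fun t => cabs (phi t) * expR (k * qz (z t))).
Proof.
apply: (rintegrable_dom _ phii) => [|t].
  apply: measurable_funM; first exact: measurable_cabs.
  apply: measurableT_comp => //; apply: measurable_funM => //.
  exact: measurable_qz.
rewrite ger0_norm ?mulr_ge0 ?cabs_ge0 ?expR_ge0// ler_wpM2l ?cabs_ge0// ler_expR.
rewrite ler_wpM2r ?qz_ge0//; have := k0; lra.
Qed.

(* Move z to the points of a fine grid, where the superposition becomes a countable sum of
   packets, and truncate that sum. *)
Lemma pairing_superposition (u : gs_dual theta d) (f : gs theta d) :
  (forall x, f x = cint mu (fun t => phi t * wave_packet (z t) x)) ->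
  u f = cint mu (fun t => phi t * transform u (z t)).
Proof.
move=> Hf; have [g [Hg pg]] := superposition htheta k0 mphi mz phi_integrable.
have {Hg} fg : f = g by apply: gs_ext => x; rewrite Hf Hg.
have {fg} pf : forall b x, cpartial b f x = cint mu (fun t => phi t * wpd b (z t) x).
  by move=> b x; rewrite fg.
have [c [C [c1 C0 h1 h2]]] := wpd_bounds htheta d k0.
have c0 : 0 < c by lra.
have [M M0 HM] := gs_dual_bounded u c0; have [C' tV] := transform_tame u.
have step N K : cabs (u f - cint mu (fun t => phi t * transform u (z t))) <=
    (M * C + C') * \int[mu]_(t in setT) D N K t.
  have [h [Hh ph]] := superposition htheta k0 (mphik N K) (mphase_discretize mz N) (iphik N K).
  apply: le_trans (cabs_trans (u h) _ _) _; rewrite mulrDl; apply: lerD; last first.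
    by rewrite (finite_commute u Hh) cabs_dist; exact: tame_diff.
  have -> : u f - u h = u (f - h) by rewrite raddfB.
  rewrite -mulrA; apply: HM => a b x.
  have -> : (f - h : 'cV[R]_d -> R[i]^o) = (-1 : R[i]) *: (h : 'cV[R]_d -> R[i]^o) + f.
    by apply/funext => y; rewrite -[RHS]/(-1 * h y + f y) mulN1r addrC.
  rewrite (csmooth_lin (-1) (gs_csmooth h) (gs_csmooth f)).2 mulN1r addrC pf ph.
  (* Every seminorm of f - h is a discretization error for a tame integrand whose constant is
     proportional to the weight of the seminorm; hence f - h is small in the step c. *)
  have tW : tame (C * gs_weight theta c a b) (fun y => (mi_power x a)%:C * wpd b y x).
    split=> [y|y y']; first exact: h1.
    by rewrite -mulrBr; exact: h2.
  rewrite -mulrA [_ * gs_weight _ _ _ _]mulrC mulrA.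
  apply: le_trans (tame_diff N K tW).
  have tW0 : tame (C * gs_weight theta c (fun=> 0%N) b) (fun y => wpd b y x).
    have E0 v : (mi_power x (fun=> 0%N))%:C * v = v.
      by rewrite /mi_power big1 ?mul1r.
    split=> [y|y y']; first by have := h1 (fun=> 0%N) b y x; rewrite E0.
    by have := h2 (fun=> 0%N) b y y' x; rewrite E0.
  rewrite mulrBr -(cintZ _ (tame_integrable0 tW0)) -(cintZ _ (tame_integrable N K tW0)).
  rewrite le_eqVlt; apply/orP; left; apply/eqP.
  by congr (cabs (_ - _)); apply: eq_cint => t; rewrite mulrCA.
(* For a fixed mesh, K tends to infinity first: each t lies in one of the first K cells eventually.
   Refining the mesh comes afterwards. *)
have lim1 N : cabs (u f - cint mu (fun t => phi t * transform u (z t))) <=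
    (M * C + C') * \int[mu]_(t in setT) (2 * d%:R / N.+1%:R * E t).
  pose w t := (2 * d%:R / N.+1%:R + 1) * E t.
  have wi : rintegrable mu w by exact: rintegrableZ.
  have E0 t : 0 <= E t by rewrite mulr_ge0 ?cabs_ge0 ?expR_ge0.
  have mE : measurable_fun setT E by have /measurable_int/measurable_EFinP := iE.
  have mD K : measurable_fun setT (D N K).
    by apply: measurable_funM => //; apply: measurable_funD => //; apply: measurable_funB.
  have r0 : 0 <= 2 * d%:R / N.+1%:R :> R by rewrite divr_ge0 ?mulr_ge0.
  have cD : \int[mu]_(t in setT) D N K t @[K --> \oo] -->
      \int[mu]_(t in setT) (2 * d%:R / N.+1%:R * E t).
    apply: (Rint_dct mD wi) => [K t|t].
      have /andP[h3 h4] := chi01 N K t.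
      rewrite ger0_norm /D; last by rewrite mulr_ge0// addr_ge0// subr_ge0.
      by rewrite mulrC ler_wpM2r// lerD2l; lra.
    apply/cvgrPdist_le => e e0; near=> K.
    have tK : (idx N t < K)%N by near: K; exact: nbhs_infty_gt.
    by rewrite /D /chi tK subrr addr0 mulrC subrr normr0 ltW.
  apply: (@ler_cvg_to nat eventually _ R
    (fun=> cabs (u f - cint mu (fun t => phi t * transform u (z t))))
    (fun K => (M * C + C') * \int[mu]_(t in setT) D N K t)).
  - exact: cvg_cst.
  - exact: cvgM (cvg_cst _) cD.
  - by apply: nearW => K; exact: step.
set x := cabs _ in lim1; have x0 : x = 0.
  apply/eqP; rewrite eq_le cabs_ge0 andbT.
  pose I := \int[mu]_(t in setT) E t.
  have le1 N : x <= (M * C + C') * (2 * d%:R) * I * N.+1%:R^-1.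
    apply: le_trans (lim1 N) _; rewrite RintegralZl// -/I.
    by rewrite le_eqVlt; apply/orP; left; apply/eqP; ring.
  apply: (@ler_cvg_to nat eventually _ R (fun=> x) (fun N => (M * C + C') * (2 * d%:R) * I * N.+1%:R^-1)).
  - exact: cvg_cst.
  - by rewrite -[X in _ --> X](mulr0 ((M * C + C') * (2 * d%:R) * I)); exact: cvgM (cvg_cst _) cvg_harmonic.
  - exact: nearW.
by apply/eqP; rewrite -subr_eq0; apply/eqP; exact: cabs_eq0.
Unshelve. all: by end_near.
Qed.

End pairing_superposition.

(** * Series as integrals for the counting measure *)

Section counting_integral.
Context {R : realType}.
Local Notation nu := (@counting nat R).

Lemma measurable_nat_fun (f : nat -> R) : measurable_fun setT f.
Proof. by move=> _ Y _. Qed.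

Lemma cmeas_nat (f : nat -> R[i]) : cmeas f.
Proof. by split; exact: measurable_nat_fun. Qed.

Lemma counting_le (w : nat -> R) (B : R) : (forall j, 0 <= w j) ->
  (forall N, \sum_(j < N) w j <= B) -> rintegrable nu w /\ \int[nu]_(j in setT) w j <= B.
Proof.
move=> w0 wB.
have h : (\int[nu]_(j in setT) (w j)%:E <= B%:E)%E.
  rewrite ge0_integral_count; last by move=> j; rewrite lee_fin.
  apply: lime_le; first by apply: is_cvg_nneseries => j _ _; rewrite lee_fin.
  by apply: nearW => N; rewrite sumEFin lee_fin big_mkord.
have i : rintegrable nu w.
  apply/integrableP; split; first by apply/measurable_EFinP; exact: measurable_nat_fun.
  rewrite (eq_integral (fun j => (w j)%:E)); first exact: le_lt_trans h (ltry _).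
  by move=> j _ /=; rewrite ger0_norm.
split=> //; rewrite -lee_fin /Rintegral fineK//.
exact: integrable_fin_num.
Qed.

Lemma cint_counting1 i (c : R[i]) : cintegrable nu (fun j => if j == i then c else 0) /\
  cint nu (fun j => if j == i then c else 0) = c.
Proof.
have H : rintegrable nu (fun j => (j == i)%:R) /\ \int[nu]_(j in setT) ((j == i)%:R) = 1 :> R.
  have E : (fun j => ((j == i)%:R : R)%:E) = (fun j => (\1_[set i] j)%:E).
    apply/funext => j; rewrite indicE (_ : (j \in [set i]) = (j == i))//.
    by apply/idP/eqP => [/set_mem//|->]; exact: mem_set.
  have I1 : (\int[nu]_(j in setT) ((j == i)%:R : R)%:E = 1)%E.
    rewrite E integral_indic// setIT /= /counting asboolT; last exact: finite_set1.
    by rewrite fset_set1 finmap.cardfs1.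
  split; last by rewrite /Rintegral I1.
  apply/integrableP; split; first by apply/measurable_EFinP; exact: measurable_nat_fun.
  rewrite (eq_integral (fun j => ((j == i)%:R : R)%:E)) ?I1 ?ltry//.
  by move=> j _ /=; rewrite ger0_norm.
have i1 : cintegrable nu (fun j => ((j == i)%:R)%:C).
  apply: (@cintegrable_dom _ _ _ _ _ (fun j => (j == i)%:R)) H.1 _; first exact: cmeas_nat.
  by move=> j; rewrite cabsR ger0_norm.
have E : (fun j => if j == i then c else 0) = (fun j => c * ((j == i)%:R)%:C).
  by apply/funext => j; case: (_ == _); rewrite ?mulr1 ?mulr0.
rewrite E; split; first exact: cintegrableZ.
rewrite cintZ// (_ : cint _ _ = 1) ?mulr1//.
rewrite /cint/= H.2; apply: ceq => //=.
by rewrite /Rintegral (eq_integral (cst 0%E)) ?integral0.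
Qed.

End counting_integral.

Section gliding_hump.
Context {R : realType} (E : lmodType R[i]) (u : nat -> {linear E -> R[i]^o}) (psi : nat -> E).

Let r i : R[i] := (3%:R ^- i)%:C.

(* Gliding hump: the sign of each step is chosen so that u i keeps the contribution of psi i. *)
Fixpoint hump i : E := if i is i'.+1 then
    if cabs (u i' (hump i' - r i' *: psi i')) <= cabs (u i' (hump i' + r i' *: psi i'))
    then hump i' + r i' *: psi i' else hump i' - r i' *: psi i'
  else 0.

Lemma hump_coeff : exists a : nat -> R[i], (forall i, cabs (a i) = 3%:R ^- i) /\
  (forall i, hump i.+1 = hump i + a i *: psi i).
Proof.
exists (fun i => if cabs (u i (hump i - r i *: psi i)) <= cabs (u i (hump i + r i *: psi i))
  then r i else - r i); split=> i; last by rewrite /=; case: ifP; rewrite ?scaleNr.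
by case: ifP; rewrite ?cabsN cabsR ger0_norm.
Qed.

(** Since 2 u(v) = u(x + v) - u(x - v), one of the two candidates has modulus at least |u(v)|. *)
Lemma hump_large i : 3%:R ^- i * cabs (u i (psi i)) <= cabs (u i (hump i.+1)).
Proof.
rewrite /=; set x := hump i; set v := r i *: psi i.
suff : cabs (u i v) <= Num.max (cabs (u i (x - v))) (cabs (u i (x + v))).
  have -> : cabs (u i v) = 3%:R ^- i * cabs (u i (psi i)).
    by rewrite /v linearZ cabsM cabsR ger0_norm.
  by case: ifPn => h; rewrite le_max => /orP[|] // h'; [exact: le_trans h' h|
    apply: (le_trans h'); rewrite leNgt; apply: contra h => /ltW].
have half (a b c : R[i]) : a - b = c *+ 2 -> c = (2^-1)%:C * (a - b).
  by move=> ->; rewrite mulr2n mulrDr -mulrDl -rmorphD (_ : 2^-1 + 2^-1 = 1) ?rmorph1 ?mul1r//; field.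
have h : u i v = (2^-1)%:C * (u i (x + v) - u i (x - v)).
  by apply: half; rewrite -raddfB opprB addrC addrA subrK -mulr2n raddfMn.
rewrite h cabsM cabsR ger0_norm// ler_pdivrMl//; apply: le_trans (cabsB _ _) _.
rewrite mulr_natl mulr2n addrC; apply: lerD; rewrite le_max ?lexx ?orbT//.
Qed.

End gliding_hump.

(** * Uniform growth of the transforms of a pointwise bounded sequence *)

Section uniform_growth.
Context {R : realType} (theta : R) (htheta : 2^-1 <= theta < 1) (d : nat).
Local Notation phase := ('cV[R]_d * 'cV[R]_d)%type.
Local Notation qz := (@qz R theta d).
Local Notation packet := (packet htheta).
Local Notation transform := (transform htheta).
Local Notation nu := (@counting nat R).

Lemma geometric3_sum N i : \sum_(j < N) (if (i < j)%N then 3%:R ^- j else 0 : R) <= 2^-1 * 3%:R ^- i.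
Proof.
have [Ni|iN] := leqP N i.
  rewrite big1 ?mulr_ge0// => j _; rewrite ifF//.
  by apply/negbTE; rewrite -leqNgt ltnW// (leq_trans (ltn_ord j)).
suff -> : \sum_(j < N) (if (i < j)%N then 3%:R ^- j else 0 : R) =
    2^-1 * (3%:R ^- i - 3%:R ^- N.-1).
  by rewrite ler_wpM2l// lerBlDr lerDl.
elim: N iN => // N IH; rewrite ltnS leq_eqVlt big_ord_recr /= => /orP[/eqP<-|iN].
  rewrite ltnn addr0 subrr mulr0 big1// => j _; rewrite ifF//.
  by apply/negbTE; rewrite -leqNgt ltnW.
rewrite iN (IH iN); case: N iN {IH} => // N _ /=.
by rewrite exprS invfM; set q := 3%:R ^- N; field.
Qed.

(** A uniform boundedness principle. For each n the supremum [S n] of |V u_n| exp (- k q) is finite;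
    if these were unbounded, a series of normalized packets with coefficients of modulus 3^-i would
    converge in the space to an f on which the u_n are unbounded. *)
Lemma transform_ubound (u : nat -> gs_dual theta d) :
  (forall f : gs theta d, exists B : R, forall n, cabs (u n f) <= B) ->
  forall k : R, 0 < k -> exists2 C : R, 0 <= C &
    forall n z, cabs (transform (u n) z) <= C * expR (k * qz z).
Proof.
move=> Hu k k0.
pose T n z := cabs (transform (u n) z) * expR (- (k * qz z)).
have T0 n z : 0 <= T n z by rewrite mulr_ge0 ?cabs_ge0 ?expR_ge0.
have Tub n : exists C, forall z, T n z <= C.
  have [C C0 [h _]] := transform_bounds htheta (u n) k0; exists C => z.
  by rewrite /T expRN ler_pdivrMr ?expR_gt0.
pose S n := sup (range (T n)).
have hS n : has_sup (range (T n)).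
  split; first by exists (T n (0, 0)), (0, 0).
  by have [C h] := Tub n; exists C => _ [z _ <-].
have TS n z : T n z <= S n by apply: (ub_le_sup (hS n).2); exists z.
have S0 n : 0 <= S n by apply: le_trans (T0 n (0, 0)) (TS n _).
have [[C HC]|unb] := pselect (exists C, forall n, S n <= C).
  exists C; first exact: le_trans (S0 0%N) (HC _).
  by move=> n z; rewrite -ler_pdivrMr ?expR_gt0// -expRN (le_trans (TS n z)).
exfalso.
(* The threshold 4 (i + 1) 3^i beats the coefficient 3^-i, and the fraction 3/4 of the supremum
   exceeds the fraction 1/2 that the tail of the series can destroy. *)
have ex i : exists nz : nat * phase, 4 * i.+1%:R * 3%:R ^+ i < S nz.1 /\ 3 / 4 * S nz.1 <= T nz.1 nz.2.
  apply: contrapT => /forallNP h; apply: unb; exists (4 * i.+1%:R * 3%:R ^+ i) => n.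
  rewrite leNgt; apply/negP => Sn.
  have Sn0 : 0 < S n by apply: le_lt_trans Sn; rewrite !mulr_ge0.
  have e0 : 0 < S n / 4 by rewrite divr_gt0.
  have [_ [z _ <-] hz] := sup_adherent e0 (hS n).
  by apply: (h (n, z)); split => //=; rewrite /S in hz *; lra.
have [nz Hnz] := choice ex.
pose n i := (nz i).1; pose z i := (nz i).2.
pose w i : R[i] := (expR (- (k * qz (z i))))%:C.
pose psi i := w i *: packet (z i).
have [a [a3 aS]] := hump_coeff (fun i => u (n i)) psi.
pose x := hump (fun i => u (n i)) psi.
pose phi i := a i * w i.
pose phiN N i := if (i < N)%N then phi i else 0.
have mz : mphase z by split=> j; exact: measurable_nat_fun.
pose kk := k / 5; have kk0 : 0 < kk by rewrite divr_gt0.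
have absphi i : cabs (phi i) * expR (5 * kk * qz (z i)) = 3%:R ^- i.
  rewrite cabsM a3 cabsR ger0_norm ?expR_ge0// -mulrA -expRD.
  by rewrite (_ : _ + _ = 0) ?expR0 ?mulr1// /kk; field.
have sum0 N : \sum_(j < N) (3%:R ^- j : R) <= 3 / 2.
  case: N => [|N]; first by rewrite big_ord0 divr_ge0.
  rewrite big_ord_recl expr0 invr1.
  have := geometric3_sum N.+1 0; rewrite big_ord_recl /= add0r expr0 invr1 mulr1.
  by under eq_bigr do rewrite /=; lra.
have g0 j : 0 <= 3%:R ^- j :> R by rewrite invr_ge0 exprn_ge0.
have i3 : rintegrable nu (fun j => 3%:R ^- j) := (counting_le g0 sum0).1.
have iphi : rintegrable nu (fun t => cabs (phi t) * expR (5 * kk * qz (z t))).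
  by rewrite (_ : (fun t => _) = (fun j => 3%:R ^- j))//; apply/funext.
have phiN_le N i : cabs (phiN N i) <= cabs (phi i).
  by rewrite /phiN; case: ifP => // _; rewrite cabs0 cabs_ge0.
have iphiN N : rintegrable nu (fun t => cabs (phiN N t) * expR (5 * kk * qz (z t))).
  apply: rintegrable_dom (measurable_nat_fun _) iphi _ => i.
  by rewrite ger0_norm ?mulr_ge0 ?cabs_ge0 ?expR_ge0// ler_wpM2r ?expR_ge0.
have weak (ph : nat -> R[i]) : rintegrable nu (fun t => cabs (ph t) * expR (5 * kk * qz (z t))) ->
    rintegrable nu (fun t => cabs (ph t) * expR (kk * qz (z t))).
  move=> h; apply: rintegrable_dom (measurable_nat_fun _) h _ => i.
  rewrite ger0_norm ?mulr_ge0 ?cabs_ge0 ?expR_ge0// ler_wpM2l ?cabs_ge0// ler_expR.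
  by rewrite ler_wpM2r ?qz_ge0//; lra.
have [f [Hf _]] := superposition htheta kk0 (cmeas_nat phi) mz (weak _ iphi).
have uf m : u m f = cint nu (fun t => phi t * transform (u m) (z t)).
  exact: (pairing_superposition htheta kk0 (cmeas_nat phi) mz iphi).
have split1 (h : nat -> R[i]) N : cintegrable nu (fun t => phiN N t * h t) ->
    cint nu (fun t => phiN N.+1 t * h t) = cint nu (fun t => phiN N t * h t) + phi N * h N.
  move=> ih; have [i1 e1] := cint_counting1 N (phi N * h N).
  rewrite -e1 -cintD//; apply: eq_cint => t; rewrite /phiN ltnS leq_eqVlt.
  by have [->|tN] := eqVneq t N; rewrite ?ltnn ?mul0r ?add0r ?addr0//.
have ih (h : nat -> R[i]) B : (forall t, cabs (h t) <= B * expR (k * qz (z t))) -> forall N,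
    cintegrable nu (fun t => phiN N t * h t).
  move=> hB N; apply: (@cintegrable_dom _ _ _ _ _ (fun t => B * 3%:R ^- t)) => [||t].
  - exact: cmeas_nat.
  - exact: rintegrableZ.
  rewrite cabsM -absphi (_ : 5 * kk = k); last by rewrite /kk; field.
  apply: le_trans (ler_wpM2l (cabs_ge0 _) (hB t)) _; rewrite mulrCA.
  have B0 : 0 <= B by have := le_trans (cabs_ge0 _) (hB t); rewrite pmulr_lge0 ?expR_gt0.
  by rewrite ler_wpM2l// ler_wpM2r ?expR_ge0.
have xN N : forall y, x N y = cint nu (fun t => phiN N t * wave_packet (z t) y).
  elim: N => [|N IH] y.
    rewrite -[LHS]/(0 : R[i]); have [_ e1] := cint_counting1 0%N (0 : R[i]).
    by rewrite -[LHS]e1; apply: eq_cint => t; rewrite /phiN ltn0 mul0r; case: ifP.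
  have [c [C [_ _ h1 _]]] := wpd_bounds htheta d k0.
  rewrite (split1 (fun t => wave_packet (z t) y)).
    by rewrite -IH /x aS gs_addE gs_scaleE /psi gs_scaleE mulrA.
  apply: (ih _ (C * gs_weight theta c (fun _ : 'I_d => 0%N) (fun=> 0%N))) => t.
  by have := h1 (fun=> 0%N) (fun=> 0%N) (z t) y; rewrite wave_packetE {1}/mi_power big1 ?mul1r.
have ux m N : u m (x N) = cint nu (fun t => phiN N t * transform (u m) (z t)).
  exact: (pairing_superposition htheta kk0 (cmeas_nat _) mz (iphiN N) _ (xN N)).
have [B HB] := Hu f; pose i := Num.bound `|B|.
have Bi : B < i.+1%:R.
  apply: le_lt_trans (ler_norm _) _; apply: lt_trans (archi_boundP (normr_ge0 B)) _.
  by rewrite ltr_nat.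
have [Si Ti] := Hnz i; rewrite -/(n i) -/(z i) in Si Ti.
have TE t : cabs (phi t * transform (u (n i)) (z t)) = 3%:R ^- t * T (n i) (z t).
  by rewrite !cabsM a3 cabsR ger0_norm ?expR_ge0// /T; ring.
have large : 3%:R ^- i * (3 / 4 * S (n i)) <= cabs (u (n i) (x i.+1)).
  apply: le_trans (hump_large (fun i => u (n i)) psi i); rewrite ler_wpM2l//.
  rewrite /psi linearZ cabsM cabsR (ger0_norm (expR_ge0 _)) [leRHS]mulrC; exact: Ti.
have tail : cabs (u (n i) f - u (n i) (x i.+1)) <= S (n i) * (2^-1 * 3%:R ^- i).
  pose v j : R := if (i < j)%N then 3%:R ^- j else 0.
  have v0 j : 0 <= v j by rewrite /v; case: ifP.
  have [iv vle] := counting_le v0 (fun N => geometric3_sum N i).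
  have iphiV : cintegrable nu (fun t => phi t * transform (u (n i)) (z t)).
    apply: cintegrable_dom (cmeas_nat _) (rintegrableZ (S (n i)) i3) _ => t.
    by rewrite TE mulrC ler_wpM2r.
  have iphiNV : cintegrable nu (fun t => phiN i.+1 t * transform (u (n i)) (z t)).
    by apply: (ih _ (S (n i))) => t; rewrite -ler_pdivrMr ?expR_gt0// -expRN; exact: TS.
  rewrite uf ux -cintB//.
  apply: (@le_trans _ _ (\int[nu]_(j in setT) (S (n i) * v j))).
    apply: cabs_cint_dom (cmeas_nat _) (rintegrableZ _ iv) _ => t.
    rewrite /phiN /v ltnS; case: leqP => _; first by rewrite subrr cabs0 mulr0.
    by rewrite mul0r subr0 TE mulrC ler_wpM2r.
  by rewrite RintegralZl// ler_wpM2l.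
have h1 : cabs (u (n i) (x i.+1)) <= cabs (u (n i) f) + cabs (u (n i) f - u (n i) (x i.+1)).
  by have := cabs_trans (u (n i) f) (u (n i) (x i.+1)) 0; rewrite !subr0 cabs_dist addrC.
have h2 := HB (n i).
(* The hump contributes 3/4 and the tail at most 1/2 of 3^-i S, so |u f| >= 3^-i S / 4 > i + 1 >
   B. *)
have h3 : 4 * i.+1%:R < 3%:R ^- i * S (n i) by rewrite [ltRHS]mulrC ltr_pdivlMr ?exprn_gt0.
set q := 3%:R ^- i in large tail h3; nra.
Qed.

End uniform_growth.

(** * Comparison of the weight with Euclidean norms *)

Section weight_comparison.
Context {R : realType} (theta : R) (htheta : 2^-1 <= theta < 1).
Local Notation p := (theta^-1).
Let hp := inv_theta_bounds htheta.
Let p0 : 0 < p.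
Proof. by have /andP[h _] := hp; lra. Qed.

Lemma enorm_ge0 n (x : 'cV[R]_n) : 0 <= enorm x.
Proof. exact: sqrtr_ge0. Qed.

Lemma coord_le_enorm n (x : 'cV[R]_n) j : `|x j 0| <= enorm x.
Proof.
rewrite -(@ler_pXn2r _ 2)// ?nnegrE ?enorm_ge0// enorm_sqr real_normK ?num_real//.
by rewrite /dotp (bigD1 j)//= expr2 lerDl sumr_ge0// => i _; rewrite -expr2 sqr_ge0.
Qed.

Lemma qv_le_enorm n (x : 'cV[R]_n) : qv p x <= n.+1%:R * enorm x `^ p.
Proof.
apply: (@le_trans _ _ (\sum_(j < n) enorm x `^ p)).
  by apply: ler_sum => j _; rewrite /pw ge0_ler_powR ?nnegrE ?enorm_ge0 ?coord_le_enorm// ltW.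
rewrite sumr_const card_ord -[leLHS]mulr_natl; apply: ler_wpM2r; first exact: powR_ge0.
by rewrite ler_nat.
Qed.

Lemma enorm_le_qv n (x : 'cV[R]_n) : enorm x `^ p <= n.+1%:R ^+ 2 * qv p x.
Proof.
have h1 : enorm x <= n.+1%:R * `|x|.
  have x0 : 0 <= n.+1%:R * `|x| by rewrite mulr_ge0.
  rewrite -(@ler_pXn2r _ 2)// ?nnegrE ?enorm_ge0// enorm_sqr.
  apply: (@le_trans _ _ (\sum_(j < n) `|x| ^+ 2)).
    apply: ler_sum => j _; rewrite -expr2 -real_normK ?num_real//.
    by rewrite lerXn2r ?nnegrE// mxnorm_coord.
  rewrite sumr_const card_ord -[leLHS]mulr_natl exprMn; apply: ler_wpM2r; first exact: sqr_ge0.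
  by rewrite -natrX ler_nat expnS expn1 (leq_trans (leqnSn n))// leq_pmulr.
have [->|/matrix0Pn[i [j xij]]] := eqVneq x 0.
  rewrite /enorm dotp0l sqrtr0 powR0 ?gt_eqF// mulr_ge0 ?qv_ge0// exprn_ge0//.
have [k xk] : exists k, `|x| = `|x k 0|.
  have [|[k l] /= h] := @mx_norm_neq0 R n 1 x.
    by apply: contraNneq xij => x0; rewrite -normr_le0 -x0 mxnorm_coord.
  by exists k; rewrite (ord1 l) in h.
apply: (@le_trans _ _ ((n.+1%:R * `|x|) `^ p)).
  by rewrite ge0_ler_powR ?nnegrE ?enorm_ge0// ltW.
rewrite powRM//; apply: ler_pM; rewrite ?powR_ge0//.
  rewrite -powR_mulrn// ler_powR ?ler1n//.
  by have /andP[_] := hp.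
by rewrite xk -/(pw p (x k 0)) pw_le_qv.
Qed.

End weight_comparison.

(** * The dichotomy between decay of the transform and decay of the kernel *)

Section cone_dichotomy.
Context {R : realType} (theta : R) (htheta : 2^-1 <= theta < 1) (m d : nat) (A : 'M[R]_(d, m))
  (I : Type).
Local Notation phase n := ('cV[R]_n * 'cV[R]_n)%type.
Local Notation qz := (@qz R theta d).
Variable V : I -> phase d -> R[i].

Definition decays (z0 : phase d) := exists L : set (phase d),
  [/\ conic L, nbhs z0 L & exists C e : R, [/\ 0 < C, 0 < e &
    forall n z, L z -> cabs (V n z) <= C * expR (- (e * qz z))]].

(** Decay along the whole ray through z. One integer encodes both the constant and the rate, so that
    failure for all constants gives a sequence. *)
Definition good (N : nat) (z : phase d) := forall n s, 0 < s ->
  cabs (V n (s *: z.1, s *: z.2)) <= N.+1%:R * expR (- (N.+1%:R^-1 * qz (s *: z.1, s *: z.2))).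

Lemma good_scale N z (s : R) : 0 < s -> good N (s *: z.1, s *: z.2) -> good N z.
Proof.
move=> s0 h n r r0; have := h n (r / s) (divr_gt0 r0 s0).
by rewrite /= !scalerA mulfVK ?gt_eqF.
Qed.

Lemma decays_good z0 : decays z0 -> exists (e : R) (K : nat), 0 < e /\
  forall N z, (K <= N)%N -> `|z.1 - z0.1| <= e -> `|z.2 - z0.2| <= e -> good N z.
Proof.
move=> [L [[_ cL] /nbhs_ballP[e /= e0 eL] [C [dl [C0 dl0 h]]]]].
exists (e / 2), (Num.bound (C + dl^-1)); split; first by rewrite divr_gt0.
move=> N z KN z1 z2 n s s0.
have Lz : L z.
  apply: eL; have e2 : e / 2 < e by lra.
  by split; rewrite -ball_normE /= distrC; [exact: le_lt_trans z1 e2|exact: le_lt_trans z2 e2].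
have CN : C + dl^-1 <= N.+1%:R.
  apply: le_trans (ltW (archi_boundP _)) _; first by rewrite addr_ge0 ?invr_ge0// ltW.
  by rewrite ler_nat (leq_trans KN).
have dlV : 0 < dl^-1 by rewrite invr_gt0.
apply: le_trans (h n _ (cL s z s0 Lz)) _; apply: ler_pM; rewrite ?expR_ge0 ?(ltW C0)//; first lra.
rewrite ler_expR lerN2 ler_wpM2r ?qz_ge0// -[leRHS]invrK lef_pV2 ?posrE//; lra.
Qed.

(** A cluster point is enough here, no subsequence is extracted; the transposes live among row
    vectors, where a product of segments is compact. *)
Lemma bolzano n (u : nat -> 'cV[R]_n) : (forall k, `|u k| <= 1) -> exists y,
  forall e K, 0 < e -> exists2 k, (K <= k)%N & `|u k - y| <= e.
Proof.
move=> u1.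
have cpt : compact [set v : 'rV[R]_n | forall i, `[(-1) : R, 1]%classic (v ord0 i)].
  by apply: (@rV_compact R n (fun=> `[(-1) : R, 1]%classic)) => i; exact: segment_compact.
have [|y [_ cy]] := cpt ((fun k => (u k)^T) @ \oo) _.
  exists 0%N => // k _ i /=; rewrite in_itv/= mxE -ler_norml.
  exact: le_trans (mxnorm_coord _ _ _) (u1 k).
exists y^T => e K e0.
have F1 : ((fun k => (u k)^T) @ \oo) [set v | exists2 k, (K <= k)%N & v = (u k)^T].
  by exists K => // k Kk; exists k.
have F2 : nbhs y (ball y e) by exact: nbhsx_ballx.
have [_ [[k Kk ->]]] := cy _ _ F1 F2; rewrite -ball_normE /= => yk.
exists k => //; apply: mxnorm_le => [|i j]; first exact: ltW.
have := ltW yk; rewrite (ord1 j) => /(le_trans (mxnorm_coord (y - (u k)^T) 0 i)).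
by rewrite !mxE distrC.
Qed.

Lemma mulmx_bound (a b : nat) (B : 'M[R]_(a, b)) : exists2 K : R, 0 <= K &
  forall v : 'cV[R]_b, `|B *m v| <= K * `|v|.
Proof.
exists (\sum_i \sum_j `|B i j|) => [|v].
  by apply: sumr_ge0 => i _; apply: sumr_ge0.
have s0 i : 0 <= \sum_j `|B i j| by exact: sumr_ge0.
apply: mxnorm_le => [|i j]; first by rewrite mulr_ge0// sumr_ge0.
rewrite mxE (le_trans (ler_norm_sum _ _ _))//.
apply: (@le_trans _ _ ((\sum_j `|B i j|) * `|v|)).
  rewrite mulr_suml; apply: ler_sum => k _; rewrite normrM ler_wpM2l// (ord1 j).
  exact: mxnorm_coord.
rewrite ler_wpM2r// [leRHS](bigD1 i)//= lerDl sumr_ge0// => k _; exact: s0.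
Qed.

Definition defect z t (w : phase m) : R :=
  `|z.1 - t *: (A *m w.1)| + `|A^T *m z.2 - t *: w.2|.

Definition radius (z : phase d) t : R := `|z.1| + `|z.2| + t.

(* A sequence of counterexamples, rescaled to radius 1, clusters at a zero of the defect,
   that is, at a direction in which V decays. *)
Lemma cone_dichotomy (G : set (phase d)) (w0 : phase m) (b : bool) :
  (forall z, z <> 0 -> ~ G z -> decays z) ->
  (forall z t, 0 <= t -> b || (t == 0) -> 0 < radius z t -> defect z t w0 = 0 -> z <> 0 /\ ~ G z) ->
  exists N, forall z t w, 0 <= t -> b || (t == 0) ->
    `|w.1 - w0.1| <= N.+1%:R^-1 -> `|w.2 - w0.2| <= N.+1%:R^-1 ->
    (good N z /\ t <= N.+1%:R * (`|z.1| + `|z.2|)) \/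
    radius z t <= N.+1%:R * defect z t w.
Proof.
move=> dec H; apply: contrapT => /forallNP nH.
have ex N : exists x : phase d * R * phase m, [/\ 0 <= x.1.2, b || (x.1.2 == 0),
    `|x.2.1 - w0.1| <= N.+1%:R^-1 /\ `|x.2.2 - w0.2| <= N.+1%:R^-1, 
    ~ (good N x.1.1 /\ x.1.2 <= N.+1%:R * (`|x.1.1.1| + `|x.1.1.2|)) &
    radius x.1.1 x.1.2 = 1 /\ defect x.1.1 x.1.2 x.2 <= N.+1%:R^-1].
  apply: contrapT => /forallNP h; apply: (nH N) => z t w t0 bt w1 w2.
  apply: contrapT => /not_orP[ng /negP]; rewrite -ltNge => rd.
  have D0 : 0 <= defect z t w by rewrite addr_ge0.
  have r0 : 0 < radius z t by apply: le_lt_trans rd; rewrite mulr_ge0.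
  set r := radius z t in rd r0; have rV0 : 0 < r^-1 by rewrite invr_gt0.
  apply: (h (((r^-1 *: z.1, r^-1 *: z.2), r^-1 * t), w)); split => /=.
  - by rewrite mulr_ge0// ltW.
  - by case/orP : bt => [->//|/eqP->]; rewrite mulr0 eqxx orbT.
  - by [].
  - move=> [/(good_scale rV0) gz tz]; apply: ng; split=> //.
    by move: tz; rewrite !normrZ !(ger0_norm (ltW rV0)) -mulrDr mulrCA ler_pM2l.
  - rewrite /radius /defect /= !normrZ !(ger0_norm (ltW rV0)) -!mulrDr mulVf ?gt_eqF//; split=> //.
    rewrite -!scalerA -!scalerBr -scalemxAr -scalerBr !normrZ !(ger0_norm (ltW rV0)) -mulrDr.
    by rewrite ler_pdivrMl// ler_pdivlMr// mulrC ltW.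
have [x Hx] := choice ex.
(* The scale t and both components of z are stacked into one vector, so that a single cluster point
   serves all of them. *)
pose y N := vcons (x N).1.2 (col_mx (x N).1.1.1 (x N).1.1.2).
have y1 N : `|y N| <= 1.
  have [t0 _ _ _ [rd _]] := Hx N; rewrite /radius in rd.
  have h1 := normr_ge0 (x N).1.1.1; have h2 := normr_ge0 (x N).1.1.2.
  apply: mxnorm_le => // i j; rewrite (ord1 j) vconsE; case: unliftP => [k _|_]; last first.
    by rewrite ger0_norm//; lra.
  case: (splitP k) => l kl.
    rewrite (_ : k = lshift d l) ?col_mxEu; last exact: val_inj.
    by apply: le_trans (mxnorm_coord _ _ _) _; lra.
  rewrite (_ : k = rshift d l) ?col_mxEd; last exact: val_inj.
  by apply: le_trans (mxnorm_coord _ _ _) _; lra.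
have [yy Hy] := bolzano y1.
pose tt := yy ord0 0.
pose zz : phase d := (\col_j yy (lift ord0 (lshift d j)) 0, \col_j yy (lift ord0 (rshift d j)) 0).
have near e K : 0 < e -> exists N, [/\ (K <= N)%N, `|(x N).1.2 - tt| <= e,
    `|(x N).1.1.1 - zz.1| <= e & `|(x N).1.1.2 - zz.2| <= e].
  move=> e0; have [N KN hN] := Hy e K e0; exists N; split => //.
  - have := le_trans (mxnorm_coord _ ord0 0) hN; by rewrite mxE vcons0 mxE.
  - apply: mxnorm_le => [|i j]; first exact: ltW.
    have := le_trans (mxnorm_coord _ (lift ord0 (lshift d i)) 0) hN.
    by rewrite mxE vconsS col_mxEu !mxE (ord1 j).
  - apply: mxnorm_le => [|i j]; first exact: ltW.
    have := le_trans (mxnorm_coord _ (lift ord0 (rshift d i)) 0) hN.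
    by rewrite mxE vconsS col_mxEd !mxE (ord1 j).
have small (r K : R) : 0 <= K -> (forall e, 0 < e -> r <= K * e) -> r <= 0.
  move=> K0 h; rewrite leNgt; apply/negP => r0.
  have K1 : 0 < K + 1 by lra.
  by have := h (r / (K + 1)) (divr_gt0 r0 K1); rewrite mulrA ler_pdivlMr// mulrC; nra.
have invN e : 0 < e -> exists K, forall N, (K <= N)%N -> (N.+1%:R^-1 : R) <= e.
  move=> e0; exists (Num.bound e^-1) => N KN.
  rewrite -[leRHS]invrK lef_pV2 ?posrE ?invr_gt0//.
  apply: le_trans (ltW (archi_boundP _)) _; first by rewrite invr_ge0 ltW.
  by rewrite ler_nat (leq_trans KN).
have tt0 : 0 <= tt.
  rewrite -oppr_le0; apply: (@small _ 1) => // e e0; have [N [_ h _ _]] := near e 0%N e0.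
  have [h1 _ _ _ _] := Hx N; move: h; rewrite ler_norml => /andP[_]; lra.
have btt : b || (tt == 0).
  case: b Hx {H nH ex} => //= Hx; rewrite eq_le tt0 andbT.
  apply: (@small _ 1) => // e e0; have [N [_ h _ _]] := near e 0%N e0.
  by have [_ /eqP h1 _ _ _] := Hx N; move: h; rewrite h1 sub0r normrN ger0_norm//; lra.
have rad : 0 < radius zz tt.
  suff : 1 - radius zz tt <= 0 by lra.
  apply: (@small _ 3) => // e e0; have [N [_ h1 h2 h3]] := near e 0%N e0.
  have [_ _ _ _ [rd _]] := Hx N; rewrite /radius in rd *.
  have k1 : `|(x N).1.1.1| <= `|(x N).1.1.1 - zz.1| + `|zz.1|.
    by apply: le_trans (ler_normD _ _); rewrite subrK.
  have k2 : `|(x N).1.1.2| <= `|(x N).1.1.2 - zz.2| + `|zz.2|.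
    by apply: le_trans (ler_normD _ _); rewrite subrK.
  move: h1; rewrite ler_norml => /andP[_]; lra.
have [a a0 Ha] := mulmx_bound A; have [a' a'0 Ha'] := mulmx_bound A^T.
have xt1 N : `|(x N).1.2| <= 1.
  have [t0 _ _ _ [rd _]] := Hx N; rewrite /radius in rd; rewrite ger0_norm//.
  have h1 := normr_ge0 (x N).1.1.1; have h2 := normr_ge0 (x N).1.1.2; lra.
have df1 : zz.1 - tt *: (A *m w0.1) = 0.
  apply/eqP; rewrite -normr_le0; apply: (@small _ (2 + a + `|A *m w0.1|)).
    by rewrite !addr_ge0.
  move=> e e0; have [K HK] := invN e e0; have [N [KN h1 h2 h3]] := near e K e0.
  have [_ _ [w1 w2] _ [_ df]] := Hx N; have eN := HK N KN; rewrite /defect in df.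
  set X := (x N) in h1 h2 h3 w1 w2 df *.
  have -> : zz.1 - tt *: (A *m w0.1) = (zz.1 - X.1.1.1) + (X.1.1.1 - X.1.2 *: (A *m X.2.1)) +
      X.1.2 *: (A *m (X.2.1 - w0.1)) + (X.1.2 - tt) *: (A *m w0.1).
    rewrite mulmxBr scalerBr scalerBl; set P := X.1.2 *: _; set Q := X.1.2 *: _.
    by rewrite !addrA !subrK.
  have n1 : `|zz.1 - X.1.1.1| <= e by rewrite distrC.
  have n2 : `|X.1.1.1 - X.1.2 *: (A *m X.2.1)| <= e.
    by apply: le_trans (le_trans df eN); rewrite lerDl.
  have n3 : `|X.1.2 *: (A *m (X.2.1 - w0.1))| <= a * e.
    rewrite normrZ; apply: le_trans (ler_piMl _ (xt1 N)) _ => //.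
    apply: le_trans (Ha _) _; rewrite ler_wpM2l//; exact: le_trans w1 eN.
  have n4 : `|(X.1.2 - tt) *: (A *m w0.1)| <= `|A *m w0.1| * e.
    by rewrite normrZ mulrC ler_wpM2l.
  apply: le_trans (ler_normD _ _) _; rewrite mulrDl lerD//.
  apply: le_trans (ler_normD _ _) _; rewrite mulrDl lerD//.
  by apply: le_trans (ler_normD _ _) _; rewrite mulrDl mul1r lerD.
have df2 : A^T *m zz.2 - tt *: w0.2 = 0.
  apply/eqP; rewrite -normr_le0; apply: (@small _ (a' + 1 + 1 + `|w0.2|)).
    by rewrite !addr_ge0.
  move=> e e0; have [K HK] := invN e e0; have [N [KN h1 h2 h3]] := near e K e0.
  have [_ _ [w1 w2] _ [_ df]] := Hx N; have eN := HK N KN; rewrite /defect in df.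
  set X := (x N) in h1 h2 h3 w1 w2 df *.
  have -> : A^T *m zz.2 - tt *: w0.2 = A^T *m (zz.2 - X.1.1.2) + (A^T *m X.1.1.2 - X.1.2 *: X.2.2) +
      X.1.2 *: (X.2.2 - w0.2) + (X.1.2 - tt) *: w0.2.
    rewrite mulmxBr scalerBr scalerBl; set P := X.1.2 *: _; set Q := X.1.2 *: _.
    by rewrite !addrA !subrK.
  have n1 : `|A^T *m (zz.2 - X.1.1.2)| <= a' * e.
    by apply: le_trans (Ha' _) _; rewrite ler_wpM2l// distrC.
  have n2 : `|A^T *m X.1.1.2 - X.1.2 *: X.2.2| <= 1 * e.
    by rewrite mul1r; apply: le_trans (le_trans df eN); rewrite lerDr.
  have n3 : `|X.1.2 *: (X.2.2 - w0.2)| <= 1 * e.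
    rewrite normrZ mul1r; apply: le_trans (ler_piMl _ (xt1 N)) _ => //.
    exact: le_trans w2 eN.
  have n4 : `|(X.1.2 - tt) *: w0.2| <= `|w0.2| * e.
    by rewrite normrZ mulrC ler_wpM2l.
  apply: le_trans (ler_normD _ _) _; rewrite mulrDl lerD//.
  apply: le_trans (ler_normD _ _) _; rewrite mulrDl lerD//.
  by apply: le_trans (ler_normD _ _) _; rewrite mulrDl lerD.
have df : defect zz tt w0 = 0 by rewrite /defect df1 df2 !normr0 addr0.
have [z0 nG] := H zz tt tt0 btt rad df.
have [e [K [e0 hg]]] := decays_good (dec zz z0 nG).
have zeta0 : 0 < `|zz.1| + `|zz.2|.
  have [n1|n1] := eqVneq zz.1 0; last by rewrite ltr_pwDl// normr_gt0.
  have [n2|n2] := eqVneq zz.2 0; last by rewrite ltr_wpDl// normr_gt0.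
  by case: z0; rewrite [zz]surjective_pairing n1 n2.
pose zeta := `|zz.1| + `|zz.2|; have zetaE : zeta = `|zz.1| + `|zz.2| by [].
rewrite -/zeta in zeta0; have z20 : 0 < zeta / 2 by rewrite divr_gt0.
(* Closeness zeta / 4 in each component keeps |z.1| + |z.2| >= zeta / 2. As t <= 1, a large N then
   also gives the bound on t, contradicting the choice of the sequence. *)
have e'0 : 0 < Num.min e (zeta / 4) by rewrite lt_min e0 divr_gt0.
have [K' HK'] := invN (zeta / 2) z20.
have [N [KN _ h2 h3]] := near _ (maxn K K') e'0.
have [_ _ _ ng [rd _]] := Hx N; apply: ng; split.
  by apply: hg; [exact: leq_trans (leq_maxl _ _) KN|apply: le_trans h2 _|apply: le_trans h3 _];
    rewrite ge_min lexx.
have {h2} h2 : `|(x N).1.1.1 - zz.1| <= zeta / 4 by apply: le_trans h2 _; rewrite ge_min lexx orbT.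
have {h3} h3 : `|(x N).1.1.2 - zz.2| <= zeta / 4 by apply: le_trans h3 _; rewrite ge_min lexx orbT.
have k1 : `|zz.1| <= `|(x N).1.1.1 - zz.1| + `|(x N).1.1.1|.
  by rewrite distrC; apply: le_trans (ler_normD _ _); rewrite subrK.
have k2 : `|zz.2| <= `|(x N).1.1.2 - zz.2| + `|(x N).1.1.2|.
  by rewrite distrC; apply: le_trans (ler_normD _ _); rewrite subrK.
apply: le_trans (le_trans (ler_norm _) (xt1 N)) _.
have h4 : 1 <= N.+1%:R * (zeta / 2).
  by rewrite -ler_pdivrMl// mulr1; exact: HK' (leq_trans (leq_maxr _ _) KN).
by apply: le_trans h4 _; rewrite ler_pM2l//; lra.
Qed.

End cone_dichotomy.

(** * Exponential decay from factorial bounds *)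

Section decay_from_factorials.
Context {R : realType} (theta : R) (htheta : 2^-1 <= theta < 1).
Local Notation p := (theta^-1).
Local Notation pw := (pw p).
Local Notation qv := (qv p).
Let hp := inv_theta_bounds htheta.
Let th0 : 0 < theta.
Proof. by case/andP: htheta; lra. Qed.

Lemma pw_norm t : pw `|t| = pw t.
Proof. by rewrite /pw normr_id. Qed.

Definition fact_rate (c : R) : R := (expR 1 * c) `^ (- p).

Lemma fact_rate_gt0 c : 0 < c -> 0 < fact_rate c.
Proof. by move=> c0; rewrite powR_gt0// mulr_gt0// expR_gt0. Qed.

(* Optimize over n: for n close to fact_rate c * r^p, one has c n^theta <= r / e. *)
Lemma fact_decay (c r v B : R) : 0 < c -> 0 <= r -> 0 <= B ->
  (forall n, r ^+ n * v <= B * (c ^+ n * n`!%:R `^ theta)) ->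
  v <= expR 1 * B * expR (- (fact_rate c * pw r)).
Proof.
move=> c0 r0 B0 H; have [->|rn0] := eqVneq r 0.
  rewrite (pw0 hp) mulr0 oppr0 expR0 mulr1.
  have := H 0%N; rewrite !expr0 !mul1r fact0 powR1 mulr1 => /le_trans; apply.
  by rewrite ler_peMl// -expR0 ler_expR.
have {rn0} r0 : 0 < r by rewrite lt_def rn0.
set l := fact_rate c; have l0 : 0 < l by exact: fact_rate_gt0.
have lr0 : 0 <= l * pw r by rewrite mulr_ge0 ?pw_ge0// ltW.
pose n := Num.truncn (l * pw r).
have /andP[n1 n2] : n%:R <= l * pw r < n.+1%:R by exact: truncn_itv.
have ec0 : 0 < expR 1 * c by rewrite mulr_gt0 ?expR_gt0.
have nth : n%:R `^ theta <= (expR 1 * c)^-1 * r.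
  apply: (@le_trans _ _ ((l * pw r) `^ theta)).
    by rewrite ge0_ler_powR ?nnegrE// ltW.
  rewrite powRM ?pw_ge0 ?(ltW l0)// /l /fact_rate /pw -!powRrM (gtr0_norm r0) mulNr mulVf ?gt_eqF//.
  by rewrite powRr1 ?(ltW r0)// powRN powRr1 ?(ltW ec0).
have fact_le : n`!%:R `^ theta <= (n%:R `^ theta) ^+ n.
  have -> : (n%:R `^ theta) ^+ n = (n ^ n)%:R `^ theta.
    by rewrite -(powR_mulrn n (powR_ge0 _ _)) -powRrM mulrC powRrM (powR_mulrn n (ler0n _ _)) -natrX.
  rewrite ge0_ler_powR ?nnegrE// ?(ltW th0)// ler_nat.
  elim: n {n1 n2 nth} => // k IH; rewrite factS expnS leq_mul//.
  by case: k IH => // k IH; rewrite (leq_trans IH)// leq_exp2r.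
have rn : 0 < r ^+ n by exact: exprn_gt0.
rewrite -(ler_pM2l rn); apply: le_trans (H n) _.
apply: (@le_trans _ _ (B * (c ^+ n * ((expR 1 * c)^-1 * r) ^+ n))).
  rewrite ler_wpM2l// ler_wpM2l ?exprn_ge0 ?(ltW c0)//; apply: le_trans fact_le _.
  by rewrite lerXn2r ?nnegrE ?powR_ge0// mulr_ge0 ?invr_ge0 ?(ltW ec0) ?(ltW r0).
have -> : c ^+ n * ((expR 1 * c)^-1 * r) ^+ n = r ^+ n * expR (- n%:R).
  have -> : - n%:R = n%:R * -1 :> R by rewrite mulrN1.
  rewrite expRM_natl expRN -!exprMn; congr (_ ^+ n); field.
  by rewrite !gt_eqF ?expR_gt0.
(* Rounding the optimal exponent down to the integer n costs at most a factor e. *)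
rewrite mulrCA ler_pM2l// [expR 1 * B]mulrC -mulrA ler_wpM2l// -expRD ler_expR.
by rewrite lerNl opprD opprK addrC lerBlDr natr1 ltW.
Qed.

(** The coordinate of largest modulus carries at least the fraction 1 / n of q x; n + 1 covers n = 0
    as well. *)
Lemma coord_decay n (x : 'cV[R]_n) (v M l : R) : 0 <= l -> v <= M ->
  (forall j, v <= M * expR (- (l * pw (x j 0)))) -> 0 <= M ->
  v <= M * expR (- (l / n.+1%:R * qv x)).
Proof.
move=> l0 vM H M0; have [x0|x0] := eqVneq (mx_norm x) 0.
  have -> : qv x = 0; last by rewrite mulr0 oppr0 expR0 mulr1.
  apply: big1 => j _; have := mxnorm_coord x j 0.
  by rewrite -[`|x|]/(mx_norm x) x0 normr_le0 => /eqP ->; exact: pw0.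
have [[j k] /= E] := mx_norm_neq0 x0; rewrite (ord1 k) in E.
apply: le_trans (H j) _; rewrite ler_wpM2l// ler_expR lerN2 mulrAC ler_pdivrMr//.
rewrite -mulrA ler_wpM2l//; apply: (@le_trans _ _ (\sum_(i < n) pw (x j 0))).
  apply: ler_sum => i _; apply: pw_mono => //.
  by rewrite -E; exact: mxnorm_coord.
rewrite sumr_const card_ord -[leLHS]mulr_natr; apply: ler_wpM2l; first exact: pw_ge0.
by rewrite ler_nat.
Qed.

End decay_from_factorials.

Section pure_partials.
Context {R : realType} (d : nat).

(** Powers and derivatives in a single coordinate are all that decay estimates made coordinate by
    coordinate require. *)
Definition mi_pure (j : 'I_d) k : 'I_d -> nat := fun i => if i == j then k else 0%N.

Lemma mi_seq_pure j k : mi_seq (mi_pure j k) = nseq k j.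
Proof.
have cnt i : count_mem i (mi_seq (mi_pure j k)) = mi_pure j k i.
  by rewrite -[LHS]/(mi_count (mi_seq (mi_pure j k)) i) mi_count_seq.
have allj : all (pred1 j) (mi_seq (mi_pure j k)).
  apply/allP => i; rewrite -has_pred1 has_count cnt /mi_pure /=.
  by case: eqVneq.
have := all_pred1P _ _ allj; rewrite (_ : size _ = k)//.
by move: allj; rewrite all_count => /eqP <-; rewrite cnt /mi_pure eqxx.
Qed.

Lemma mi_size_pure j k : mi_size (mi_pure j k) = k.
Proof.
rewrite /mi_size (bigD1 j)//= /mi_pure eqxx big1 ?addn0// => i ij.
by rewrite (negPf ij).
Qed.

Lemma mi_fact_pure j k : mi_fact (mi_pure j k) = k`!.
Proof.
rewrite /mi_fact (bigD1 j)//= /mi_pure eqxx big1 ?muln1// => i ij.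
by rewrite (negPf ij).
Qed.

Lemma mi_power_pure (x : 'cV[R]_d) j k : mi_power x (mi_pure j k) = x j 0 ^+ k.
Proof.
rewrite /mi_power (bigD1 j)//= /mi_pure eqxx big1 ?mulr1// => i ij.
by rewrite (negPf ij).
Qed.

End pure_partials.

(** * Decay of test functions and of their Fourier transforms *)

Section fourier_decay.
Context {R : realType} (theta : R) (htheta : 2^-1 <= theta < 1) (m : nat).
Local Notation p := (theta^-1).
Local Notation pw := (pw p).
Local Notation qv := (qv p).
Local Notation mu := (vs_mu (@lebv R m)).
Local Notation vec := (@vs_vec R m (lebv m)).
Local Notation crapid := (crapid p).
Let hp := inv_theta_bounds htheta.
Implicit Types (g : 'cV[R]_m -> R[i]^o).

Lemma cint_partial (v : 'cV[R]_m) (f f' : 'cV[R]_m -> R[i]) : ccont f -> crapid f ->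
  crapid f' -> (forall x, is_derive x v (fun x => Re (f x)) (Re (f' x)) /\
    is_derive x v (fun x => Im (f x)) (Im (f' x))) ->
  cint mu (fun x => f' (vec x)) = 0.
Proof.
move=> [c1 c2] /crapid_ReIm[r1 r2] /crapid_ReIm[r1' r2'] df.
apply: ceq; rewrite /cint /=.
  by apply: (Rint_partial hp c1 r1 r1') => x; exact: (df x).1.
by apply: (Rint_partial hp c2 r2 r2') => x; exact: (df x).2.
Qed.

Definition fourier g (eta : 'cV[R]_m) : R[i] :=
  cint mu (fun x => g (vec x) * cis (dotp (vec x) eta)).

Lemma csmooth_pure g (j : 'I_m) k : csmooth g -> ccont (cpartial (mi_pure j k) g) /\
  forall x, is_derive x (delta_mx j 0 : 'cV[R]_m) (fun x => Re (cpartial (mi_pure j k) g x))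
     (Re (cpartial (mi_pure j k.+1) g x)) /\
   is_derive x (delta_mx j 0 : 'cV[R]_m) (fun x => Im (cpartial (mi_pure j k) g x))
     (Im (cpartial (mi_pure j k.+1) g x)).
Proof.
move=> [s1 s2]; rewrite /cpartial !mi_seq_pure; split.
  by split; [exact: (s1 _).1|exact: (s2 _).1].
by move=> x; split; apply: DeriveDef => //=; [exact: (s1 _).2|exact: (s2 _).2].
Qed.

Lemma gs_le_pure g c B (j : 'I_m) k (i : 'I_m) n (x : 'cV[R]_m) : gs_le theta c B g ->
  `|x i 0| ^+ n * cabs (cpartial (mi_pure j k) g x) <=
  B * (c ^+ k * k`!%:R `^ theta) * (c ^+ n * n`!%:R `^ theta).
Proof.
move=> /(_ (mi_pure i n) (mi_pure j k) x); rewrite cabsM cabsR mi_power_pure normrX.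
rewrite /gs_weight !mi_size_pure !mi_fact_pure natrM (powRM _ (ler0n _ _) (ler0n _ _)) exprD.
by move/le_trans; apply; rewrite le_eqVlt; apply/orP; left; apply/eqP; ring.
Qed.

Section one_function.
Variables (g : 'cV[R]_m -> R[i]^o) (c B : R).
Hypotheses (c0 : 0 < c) (sg : csmooth g) (gB : gs_le theta c B g).
Let rate := fact_rate theta c / m.+1%:R.
Let B0 : 0 <= B := gs_le_ge0 c0 gB.
Let W k : R := c ^+ k * k`!%:R `^ theta.
Let W0 k : 0 <= W k. Proof. by rewrite mulr_ge0 ?powR_ge0// exprn_ge0// ltW. Qed.

Let rate_gt0 : 0 < rate.
Proof. by rewrite divr_gt0// fact_rate_gt0. Qed.

Lemma pure_decay j k x :
  cabs (cpartial (mi_pure j k) g x) <= expR 1 * (B * W k) * expR (- (rate * qv x)).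
Proof.
have BW : 0 <= B * W k by rewrite mulr_ge0.
apply: (coord_decay htheta); [exact/ltW/fact_rate_gt0| |move=> i|]; last by rewrite mulr_ge0 ?expR_ge0.
  have := gs_le_pure j k j 0 x gB; rewrite !expr0 fact0 powR1 !mulr1 mul1r => /le_trans; apply.
  by rewrite ler_peMl// -expR0 ler_expR.
rewrite -pw_norm; by apply: fact_decay => // n; exact: gs_le_pure.
Qed.

Lemma gs_decay x : cabs (g x) <= expR 1 * B * expR (- (rate * qv x)).
Proof.
have g0 : g x = cpartial (fun=> 0%N) g x.
  rewrite /cpartial (_ : mi_seq (fun=> 0%N) = [::]) ?[RHS]/=; last first.
    by rewrite /mi_seq; elim: (enum _).
  by rewrite /re_part /im_part; case: (g x).
have H i n : `|x i 0| ^+ n * cabs (g x) <= B * (c ^+ n * n`!%:R `^ theta).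
  rewrite g0; have := gB (mi_pure i n) (fun=> 0%N) x; rewrite cabsM cabsR mi_power_pure normrX.
  rewrite /gs_weight mi_size_pure mi_fact_pure (_ : mi_size _ = 0%N) ?addn0; last by rewrite /mi_size big1.
  by rewrite (_ : mi_fact (fun _ : 'I_m => 0%N) = 1%N) ?muln1// /mi_fact big1.
apply: (coord_decay htheta); [exact/ltW/fact_rate_gt0| |move=> i|]; last by rewrite mulr_ge0 ?expR_ge0.
  have := gB (fun=> 0%N) (fun=> 0%N) x; rewrite -g0 cabsM cabsR /mi_power big1// normr1 mul1r.
  rewrite /gs_weight (_ : mi_size _ = 0%N); last by rewrite /mi_size big1.
  rewrite (_ : mi_fact (fun _ : 'I_m => 0%N) = 1%N); last by rewrite /mi_fact big1.
  by rewrite expr0 powR1 !mulr1 => /le_trans; apply; rewrite ler_peMl// -expR0 ler_expR.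
rewrite -pw_norm; exact: fact_decay.
Qed.

Let mass := \int[mu]_(x in setT) expR (- (rate * qv (vec x))).

Lemma ccont_gs : ccont g.
Proof. by have [s1 s2] := sg; split; [exact: (s1 [::]).1|exact: (s2 [::]).1]. Qed.

Let phase_cont eta : ccont (fun x : 'cV[R]_m => cis (dotp x eta)).
Proof. by apply: ccont_cis; exact: (@continuous_dotpl _ _ eta). Qed.

Lemma fourier_pure j k eta : cabs (cint mu (fun x => cpartial (mi_pure j k) g (vec x) * cis (dotp (vec x) eta)))
   <= expR 1 * B * mass * W k.
Proof.
have cF : ccont (fun x : 'cV[R]_m => cpartial (mi_pure j k) g x * cis (dotp x eta)).
  exact: ccontM (csmooth_pure j k sg).1 (@phase_cont eta).
have wi := rintegrable_qv hp m rate_gt0.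
apply: le_trans (cabs_cint_dom _ (rintegrableZ (expR 1 * (B * W k)) wi) _) _.
- exact: cmeas_ccont cF (@mcoord_vec R m).
- by move=> x; rewrite cabsM cabs_cis mulr1; exact: pure_decay.
by rewrite RintegralZl// le_eqVlt; apply/orP; left; apply/eqP; rewrite /mass; ring.
Qed.

(** Integration by parts: the j-th derivative of (d_j^k g) exp (i x.eta) has integral zero. *)
Lemma fourier_pureS j k eta :
  cint mu (fun x => cpartial (mi_pure j k.+1) g (vec x) * cis (dotp (vec x) eta)) =
  - ('i * (eta j 0)%:C) * cint mu (fun x => cpartial (mi_pure j k) g (vec x) * cis (dotp (vec x) eta)).
Proof.
pose f k (x : 'cV[R]_m) : R[i] := cpartial (mi_pure j k) g x * cis (dotp x eta).
have cf l : ccont (f l) by exact: ccontM (csmooth_pure j l sg).1 (@phase_cont eta).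
have rf l : crapid (f l).
  exists (expR 1 * (B * W l)), rate; split=> //; first by apply: mulr_ge0 (expR_ge0 _) (mulr_ge0 B0 (W0 l)).
  by move=> x; rewrite cabsM cabs_cis mulr1; exact: pure_decay.
pose f' x := f k.+1 x + 'i * (eta j 0)%:C * f k x.
have cf' : ccont f' by exact: ccontD (cf k.+1) (ccontM (ccont_cst _ _) (cf k)).
have rf' : crapid f'.
  exists (expR 1 * (B * W k.+1) + `|eta j 0| * (expR 1 * (B * W k))), rate; split=> //.
    have P l : 0 <= expR 1 * (B * W l) by exact: mulr_ge0 (expR_ge0 _) (mulr_ge0 B0 (W0 l)).
    by rewrite addr_ge0 ?P// mulr_ge0 ?P.
  move=> x; apply: le_trans (cabsD _ _) _; rewrite mulrDl; apply: lerD.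
    by rewrite cabsM cabs_cis mulr1; exact: pure_decay.
  rewrite !cabsM cabs_cis mulr1 cabsR cabsE expr0n expr1n add0r sqrtr1 mul1r -mulrA.
  by rewrite ler_wpM2l//; exact: pure_decay.
have df x : is_derive x (delta_mx j 0 : 'cV[R]_m) (fun x => Re (f k x)) (Re (f' x)) /\
    is_derive x (delta_mx j 0 : 'cV[R]_m) (fun x => Im (f k x)) (Im (f' x)).
  have [d1 d2] := (csmooth_pure j k sg).2 x.
  have x0 : x = x + 0 *: (delta_mx j 0 : 'cV[R]_m) by rewrite scale0r addr0.
  rewrite x0 in d1 d2.
  have h : cder 0 (fun s : R => cpartial (mi_pure j k) g (x + s *: (delta_mx j 0 : 'cV[R]_m)))
      (cpartial (mi_pure j k.+1) g x).
    split; rewrite {2}x0; [exact: is_derive_line d1|exact: is_derive_line d2].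
  have dj : dotp (delta_mx j 0) eta = eta j 0.
    rewrite /dotp (bigD1 j)//= mxE !eqxx mul1r big1 ?addr0// => i ij.
    by rewrite mxE (negPf ij) mul0r.
  have hc : cder 0 (fun s : R => cis (dotp (x + s *: (delta_mx j 0 : 'cV[R]_m)) eta))
      ('i * (eta j 0)%:C * cis (dotp x eta)).
    have := cder_cis (der_lin (dotp x eta) (eta j 0) 0); rewrite mul0r addr0.
    congr cder; apply/funext => s; by rewrite dotpDl dotpZl dj.
  have := cder_mul h hc; rewrite !scale0r !addr0.
  rewrite (_ : _ + _ = f' x); last by rewrite /f' /f; ring.
  by move=> [h1 h2]; split; apply: is_derive_along.
have := cint_partial (cf k) (rf k) rf' df.
have i1 := cintegrable_crapid hp (cf k.+1) (rf k.+1).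
have i0 := cintegrable_crapid hp (cf k) (rf k).
rewrite /f' cintD//; last exact: cintegrableZ.
by rewrite cintZ// => /eqP; rewrite addr_eq0 => /eqP ->; rewrite mulNr.
Qed.

Lemma fourier_decay_le eta : cabs (fourier g eta) <=
  expR 1 * (expR 1 * B * mass) * expR (- (rate * qv eta)).
Proof.
have mass0 : 0 <= mass by apply: Rintegral_ge0 => x _; exact: expR_ge0.
have F0 : cabs (fourier g eta) <= expR 1 * B * mass.
  have wi := rintegrable_qv hp m rate_gt0.
  apply: le_trans (cabs_cint_dom _ (rintegrableZ (expR 1 * B) wi) _) _.
  - exact: cmeas_ccont (ccontM ccont_gs (@phase_cont eta)) (@mcoord_vec R m).
  - by move=> x; rewrite cabsM cabs_cis mulr1; exact: gs_decay.
  by rewrite RintegralZl.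
have M0 : 0 <= expR 1 * B * mass by rewrite !mulr_ge0 ?expR_ge0.
apply: (coord_decay htheta); [exact/ltW/fact_rate_gt0| |move=> j|]; last by rewrite mulr_ge0 ?expR_ge0.
  by apply: le_trans F0 _; rewrite ler_peMl// -expR0 ler_expR.
rewrite -pw_norm; apply: fact_decay => // k.
have <- : cabs (cint mu (fun x => cpartial (mi_pure j k) g (vec x) * cis (dotp (vec x) eta))) =
    `|eta j 0| ^+ k * cabs (fourier g eta).
  elim: k => [|k IH].
    rewrite expr0 mul1r /fourier; congr (cabs _); apply: eq_cint => x; congr (_ * _).
    by rewrite /cpartial mi_seq_pure /= /re_part /im_part; case: (g _).
  by rewrite fourier_pureS cabsM cabsN cabsM IH cabsE expr0n expr1n add0r sqrtr1 mul1r cabsR exprS mulrA.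
exact: fourier_pure.
Qed.

End one_function.

(** The constants depend on the step alone and the bounds are linear in B; this is what later makes
    the pull-back a bounded functional on each step. *)
Lemma gs_fourier_decay c : 0 < c -> exists C e : R, [/\ 0 < C, 0 < e &
  forall g B, csmooth g -> gs_le theta c B g ->
    (forall x, cabs (g x) <= C * B * expR (- (e * qv x))) /\
    (forall eta, cabs (fourier g eta) <= C * B * expR (- (e * qv eta)))].
Proof.
move=> c0; pose e := fact_rate theta c / m.+1%:R.
have e0 : 0 < e by rewrite divr_gt0// fact_rate_gt0.
pose M := \int[mu]_(x in setT) expR (- (e * qv (vec x))).
have M0 : 0 <= M by apply: Rintegral_ge0 => x _; exact: expR_ge0.
have E1 : 1 <= expR 1 :> R by rewrite -[leLHS]expR0 ler_expR.
pose C := expR 1 * (1 + expR 1 * M).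
have C1 : expR 1 <= C by rewrite /C ler_peMr ?expR_ge0// lerDl mulr_ge0// expR_ge0.
have C2 : expR 1 * (expR 1 * M) <= C by rewrite /C ler_pM2l ?expR_gt0// lerDr.
exists C, e; split=> // [|g B sg gB]; first by apply: lt_le_trans C1; exact: expR_gt0.
have B0 := gs_le_ge0 c0 gB.
split=> [x|eta].
  by apply: le_trans (gs_decay c0 gB x) _; rewrite ler_wpM2r ?expR_ge0// ler_wpM2r.
apply: le_trans (fourier_decay_le c0 sg gB eta) _; rewrite ler_wpM2r ?expR_ge0//.
by rewrite -/M (_ : _ * (_ * B * M) = expR 1 * (expR 1 * M) * B) ?ler_wpM2r//; ring.
Qed.

End fourier_decay.

Section linear_maps.
Context {R : realType} (p : R) (hp : 1 <= p <= 2).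
Local Notation pw := (pw p).
Local Notation qv := (qv p).

Lemma qv_le_norm n (x : 'cV[R]_n) : qv x <= n.+1%:R * pw `|x|.
Proof.
apply: (@le_trans _ _ (\sum_(i < n) pw `|x|)).
  by apply: ler_sum => i _; apply: pw_mono => //; rewrite normr_id; exact: mxnorm_coord.
rewrite sumr_const card_ord -[leLHS]mulr_natl; apply: ler_wpM2r; first exact: pw_ge0.
by rewrite ler_nat.
Qed.

Lemma norm_le_qv n (x : 'cV[R]_n) : pw `|x| <= qv x.
Proof.
have [x0|x0] := eqVneq (mx_norm x) 0.
  by rewrite -[`|x|]/(mx_norm x) x0 pw0// qv_ge0.
have [[j k] /= E] := mx_norm_neq0 x0; rewrite (ord1 k) in E.
rewrite -[`|x|]/(mx_norm x) E; apply: le_trans (pw_le_qv p x j).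
by apply: pw_mono => //; rewrite normr_id.
Qed.

Lemma qv_mulmx a b (A : 'M[R]_(a, b)) : exists2 K, 0 < K & forall x, qv (A *m x) <= K * qv x.
Proof.
have [k k0 H] := mulmx_bound A; exists (a.+1%:R * pw k + 1).
  by rewrite ltr_wpDl// mulr_ge0// pw_ge0.
move=> x; apply: le_trans (qv_le_norm _) _; rewrite mulrDl mul1r.
apply: (@le_trans _ _ (a.+1%:R * pw k * qv x)); last by rewrite lerDl qv_ge0.
rewrite -mulrA ler_wpM2l//; apply: (@le_trans _ _ (pw (k * `|x|))).
  by apply: pw_mono => //; rewrite !ger0_norm// mulr_ge0.
by rewrite pwM ler_wpM2l ?pw_ge0// norm_le_qv.
Qed.

Lemma dotp_mulmx a b (A : 'M[R]_(a, b)) x y : dotp (A *m x) y = dotp x (A^T *m y).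
Proof.
rewrite /dotp; under eq_bigr do rewrite mxE mulr_suml.
rewrite exchange_big/=; apply: eq_bigr => j _; rewrite mxE mulr_sumr; apply: eq_bigr => i _.
by rewrite mxE; ring.
Qed.

Lemma continuous_mulmx_sub a b (A : 'M[R]_(a, b)) (v : 'cV[R]_a) :
  continuous (fun x : 'cV[R]_b => A *m x - v).
Proof.
apply: continuous_mx => i j.
have -> : (fun x : 'cV[R]_b => (A *m x - v) i j) = (fun x : 'cV[R]_b => \sum_k A i k * x k j + - v i j).
  by apply/funext => x; rewrite !mxE.
apply: contD (@cont_cst _ _ _); apply: continuous_sum_real => k; apply: contM; first exact: cont_cst.
exact: coord_continuous.
Qed.

End linear_maps.

(** * The kernel of the pull-back and its decay in position and frequency *)

Section kernel.
Context {R : realType} (theta : R) (htheta : 2^-1 <= theta < 1) (m d : nat)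
  (A : 'M[R]_(d, m)).
Local Notation p := (theta^-1).
Local Notation pw := (pw p).
Local Notation qv := (qv p).
Local Notation mu n := (vs_mu (@lebv R n)).
Local Notation vec := (@vs_vec R _ (lebv _)).
Local Notation X := (@lebv R).
Local Notation phase n := ('cV[R]_n * 'cV[R]_n)%type.
Let hp := inv_theta_bounds htheta.
Implicit Types (g : 'cV[R]_m -> R[i]) (eta : 'cV[R]_m).

(* For A = 1 this is the pairing of g with the wave packet at (x', - eta). *)
Definition kern g (x' : 'cV[R]_d) eta : R[i] :=
  cint (mu m) (fun x => g (vec x) * (gauss (A *m vec x - x'))%:C * cis (dotp (vec x) eta)).

Lemma continuous_gauss_affine x' : continuous (fun x : 'cV[R]_m => gauss (A *m x - x')).
Proof.
exact: (continuous_comp2 (@continuous_mulmx_sub R _ _ A x') (@continuous_gauss R d)).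
Qed.

Lemma cabs_gauss n (x : 'cV[R]_n) : cabs (gauss x)%:C = gauss x.
Proof. by rewrite cabsR ger0_norm ?gauss_ge0. Qed.

Lemma ccont_kern g x' eta : ccont g ->
  ccont (fun x => g x * (gauss (A *m x - x'))%:C * cis (dotp x eta)).
Proof.
move=> cg; apply: ccontM; first by apply: ccontM cg (ccont_real _); exact: continuous_gauss_affine.
by apply: ccont_cis; exact: (@continuous_dotpl _ _ eta).
Qed.

Lemma kern_term_le g x' eta (x : 'cV[R]_m) :
  cabs (g x * (gauss (A *m x - x'))%:C * cis (dotp x eta)) <= cabs (g x).
Proof. by rewrite !cabsM cabs_cis mulr1 cabs_gauss ler_piMr ?cabs_ge0// gauss_le1. Qed.

(** g decays in x and the Gaussian in A x - x'. Since q(x') <= 4 (K q(x) + q(A x - x')), a large x'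
    makes one of them small. *)
Lemma kern_position_decay e : 0 < e -> exists C dl : R, [/\ 0 < C, 0 < dl &
  forall g M x' eta, ccont g -> (forall x, cabs (g x) <= M * expR (- (e * qv x))) ->
    cabs (kern g x' eta) <= C * M * expR (- (dl * qv x'))].
Proof.
move=> e0; have [K K0 HK] := qv_mulmx hp A.
(* Then dl q(x') is at most (e / 2) q(x) + (1/2) q(A x - x'): the Gaussian is spent, and the rate e
   / 2 in x remains for the integral. *)
pose dl := Num.min (8^-1) (e / (8 * K)).
have dl0 : 0 < dl by rewrite lt_min invr_gt0 divr_gt0 ?mulr_gt0// andbT.
have dl1 : dl <= 8^-1 by rewrite ge_min lexx.
have dl2 : dl * (8 * K) <= e by rewrite -ler_pdivlMr ?mulr_gt0// ge_min lexx orbT.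
have e20 : 0 < e / 2 by rewrite divr_gt0.
pose S := \int[mu m]_(x in setT) expR (- (e / 2 * qv (vec x))).
have S0 : 0 <= S by apply: Rintegral_ge0 => x _; exact: expR_ge0.
pose C0 := expR (d%:R / 2) : R.
exists (C0 * (S + 1)), dl; split=> //; first by rewrite mulr_gt0 ?expR_gt0// ltr_wpDl.
move=> g M x' eta cg gM; have wi := rintegrable_qv hp m e20.
have M0 : 0 <= M by have := le_trans (cabs_ge0 _) (gM 0); rewrite pmulr_lge0 ?expR_gt0.
apply: le_trans (cabs_cint_dom _ (rintegrableZ (M * C0 * expR (- (dl * qv x'))) wi) _) _.
- exact: cmeas_ccont (ccont_kern x' eta cg) (@mcoord_vec R m).
- move=> x; rewrite !cabsM cabs_cis mulr1 cabs_gauss.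
  apply: (@le_trans _ _ (M * expR (- (e * qv (vec x))) *
      (C0 * expR (- (2^-1 * qv (A *m vec x - x')))))).
    by apply: ler_pM; rewrite ?cabs_ge0 ?gauss_ge0//; exact: gauss_le_qv.
  rewrite mulrACA -!mulrA ler_wpM2l// ler_wpM2l ?expR_ge0// -!expRD ler_expR.
  have := qv_sub hp (A *m vec x) (A *m vec x - x'); rewrite subKr => h1.
  have := HK (vec x); have := qv_ge0 p (A *m vec x - x'); have := qv_ge0 p (vec x).
  set a := qv (vec x); set b := qv (A *m vec x - x') in h1 *; set c := qv x' in h1 *.
  set q := qv (A *m vec x) in h1 * => a0 b0 h2.
  have h3 : dl * c <= dl * (4 * (K * a + b)).
    by rewrite ler_pM2l//; lra.
  have h4 : dl * (8 * K) * a <= e * a by rewrite ler_wpM2r.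
  have h5 : dl * b <= 8^-1 * b by rewrite ler_wpM2r.
  by have : dl * (4 * (K * a + b)) = (dl * (8 * K) * a) / 2 + 4 * (dl * b); [field|]; lra.
rewrite RintegralZl// -/S.
have -> : C0 * (S + 1) * M * expR (- (dl * qv x')) = M * C0 * expR (- (dl * qv x')) * (S + 1) by ring.
by rewrite ler_wpM2l ?lerDl// !mulr_ge0 ?expR_ge0.
Qed.

(* Transfers the decay of the Fourier transform of g without differentiating the Gaussian. *)
Lemma kern_fourier g M e x' eta : 0 < e -> ccont g ->
  (forall x, cabs (g x) <= M * expR (- (e * qv x))) ->
  kern g x' eta = ((gauss_mass d)^-1)%:C * cint (mu d) (fun zt =>
    (gauss (vec zt))%:C * cis (- dotp (vec zt) x') * fourier g (eta + A^T *m vec zt)).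
Proof.
move=> e0 cg gM.
(* Up to its mass the Gaussian is its own Fourier transform. Writing gauss (A x - x') as an integral
   over zt and integrating in x first shifts the frequency of g by A^T zt. *)
pose F (y : X m * X d) : R[i] := g (vec y.1) * cis (dotp (vec y.1) eta) *
  ((gauss (vec y.2))%:C * cis (dotp (vec y.2) (A *m vec y.1 - x'))).
have m1 : mcoord (fun y : X m * X d => vec y.1) by apply: mcoord_comp (@mcoord_vec R m) _.
have m2 : mcoord (fun y : X m * X d => vec y.2) by apply: mcoord_comp (@mcoord_vec R d) _.
have m3 : mcoord (fun y : X m * X d => A *m vec y.1 - x').
  move=> j; apply: (measurable_continuous (f := fun v : 'cV[R]_m => (A *m v - x') j 0) _ m1).
  exact: (continuous_comp2 (@continuous_mulmx_sub R _ _ A x') (@coord_continuous _ _ _ j 0)).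
have mF : cmeas F.
  apply: cmeasM; apply: cmeasM.
  - exact: cmeas_ccont cg m1.
  - by apply: cmeas_cis; apply: measurable_dotp m1 _ => j; exact: measurable_cst.
  - by apply: cmeas_real; apply: measurable_continuous (@continuous_gauss R d) m2.
  - by apply: cmeas_cis; exact: measurable_dotp m2 m3.
have gi : rintegrable (mu m) (fun x => M * expR (- (e * qv (vec x)))).
  by apply: rintegrableZ; exact: rintegrable_qv.
have hi : rintegrable (mu d) (fun y => gauss (vec y)).
  exact: (rintegrable_rapid hp (@continuous_gauss R d) (rapid_gauss hp d)).
have Fle x y : cabs (F (x, y)) <= M * expR (- (e * qv (vec x))) * gauss (vec y).
  by rewrite !cabsM !cabs_cis !mulr1 cabs_gauss ler_wpM2r ?gauss_ge0.
have [_ E1 E2] := cint_fubini mF gi hi Fle.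
have gm0 := gauss_mass_gt0 hp d.
have kc := ccont_kern x' eta cg.
have ki : cintegrable (mu m) (fun x => g (vec x) * (gauss (A *m vec x - x'))%:C * cis (dotp (vec x) eta)).
  apply: cintegrable_dom (cmeas_ccont kc (@mcoord_vec R m)) gi _ => x.
  by apply: le_trans (kern_term_le _ _ _ _) _.
have I1 : cint (vs_mu (X m) \x vs_mu (X d))%E F = (gauss_mass d)%:C * kern g x' eta.
  rewrite E1 -cintZ//; apply: eq_cint => x; rewrite /F /= cintZ.
    by rewrite (gauss_fourier hp) real_complexM; ring.
  apply: cintegrable_dom (_ : cmeas _) hi _.
    apply: cmeasM; first by apply: cmeas_real; exact: measurable_continuous (@continuous_gauss R d) (@mcoord_vec R d).
    by apply: cmeas_cis; apply: measurable_dotp (@mcoord_vec R d) _ => j; exact: measurable_cst.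
  by move=> y; rewrite cabsM cabs_cis mulr1 cabs_gauss.
have -> : kern g x' eta = ((gauss_mass d)^-1)%:C * ((gauss_mass d)%:C * kern g x' eta).
  by rewrite mulrA -rmorphM mulVf ?gt_eqF// rmorph1 mul1r.
rewrite -I1 E2.
congr (_ * _); apply: eq_cint => y; rewrite /F /= /fourier -cintZ.
  apply: eq_cint => x; rewrite !dotpDr !dotpNr !cisD [dotp (vec y) (A *m _)]dotpC dotp_mulmx.
  by ring.
have cf : ccont (fun x : 'cV[R]_m => g x * cis (dotp x (eta + A^T *m vec y))).
  by apply: ccontM cg (ccont_cis _); exact: (@continuous_dotpl _ _ _).
apply: cintegrable_dom (cmeas_ccont cf (@mcoord_vec R m)) gi _ => x.
by rewrite cabsM cabs_cis mulr1.
Qed.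

(** The position argument on the Fourier side, with A^T for A: q(eta) is controlled by q(eta + A^T
    zt) and q(zt). Of the Gaussian rate 1/2 one half is kept for integrability in zt. *)
Lemma kern_frequency_decay e e' : 0 < e -> 0 < e' -> exists C dl : R, [/\ 0 < C, 0 < dl &
  forall g M M' x' eta, ccont g -> (forall x, cabs (g x) <= M' * expR (- (e' * qv x))) ->
    (forall xi, cabs (fourier g xi) <= M * expR (- (e * qv xi))) ->
    cabs (kern g x' eta) <= C * M * expR (- (dl * qv eta))].
Proof.
move=> e0 e'0; have [K K0 HK] := qv_mulmx hp A^T.
pose dl := Num.min (e / 4) (16 * K)^-1.
have dl0 : 0 < dl by rewrite lt_min divr_gt0//= invr_gt0 mulr_gt0.
have dl1 : dl <= e / 4 by rewrite ge_min lexx.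
have dl2 : dl * (16 * K) <= 1 by rewrite -ler_pdivlMr ?mulr_gt0// mul1r ge_min lexx orbT.
have q0 : 0 < 4^-1 :> R by [].
pose S := \int[mu d]_(x in setT) expR (- (4^-1 * qv (vec x))).
have S0 : 0 <= S by apply: Rintegral_ge0 => x _; exact: expR_ge0.
pose C0 := expR (d%:R / 2) : R.
have gm0 := gauss_mass_gt0 hp d.
exists ((gauss_mass d)^-1 * C0 * (S + 1)), dl; split=> //.
  by rewrite !mulr_gt0 ?expR_gt0 ?invr_gt0// ltr_wpDl.
move=> g M M' x' eta cg gM' fM; have wi := rintegrable_qv hp d q0.
have M0 : 0 <= M by have := le_trans (cabs_ge0 _) (fM 0); rewrite pmulr_lge0 ?expR_gt0.
rewrite (kern_fourier x' eta e'0 cg gM') cabsM cabsR ger0_norm ?invr_ge0 ?(ltW gm0)//.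
rewrite -!mulrA ler_wpM2l ?invr_ge0 ?(ltW gm0)//.
have bound (zt : X d) : cabs ((gauss (vec zt))%:C * cis (- dotp (vec zt) x') *
    fourier g (eta + A^T *m vec zt)) <= C0 * M * expR (- (dl * qv eta)) * expR (- (4^-1 * qv (vec zt))).
  rewrite !cabsM cabs_cis mulr1 cabs_gauss.
  apply: (@le_trans _ _ ((C0 * expR (- (2^-1 * qv (vec zt)))) *
      (M * expR (- (e * qv (eta + A^T *m vec zt)))))).
    by apply: ler_pM; rewrite ?cabs_ge0 ?gauss_ge0//; exact: gauss_le_qv.
  rewrite mulrACA -!mulrA ler_wpM2l ?expR_ge0// ler_wpM2l// -!expRD ler_expR.
  have := qv_sub hp (eta + A^T *m vec zt) (A^T *m vec zt); rewrite addrK => h1.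
  have := HK (vec zt); have := qv_ge0 p (eta + A^T *m vec zt); have := qv_ge0 p (vec zt).
  set a := qv (vec zt); set b := qv (eta + _) in h1 *; set c := qv eta in h1 *.
  set q := qv (A^T *m vec zt) in h1 * => a0 b0 h2.
  have h3 : dl * c <= dl * (4 * (b + K * a)) by rewrite ler_pM2l//; lra.
  have h4 : dl * (16 * K) * a <= 1 * a by rewrite ler_wpM2r.
  have h5 : dl * b <= e / 4 * b by rewrite ler_wpM2r.
  by have : dl * (4 * (b + K * a)) = (dl * (16 * K) * a) / 4 + 4 * (dl * b); [field|]; lra.
have cm : cmeas (fun zt : X d => (gauss (vec zt))%:C * cis (- dotp (vec zt) x') *
    fourier g (eta + A^T *m vec zt)).
  have mv : mcoord (fun zt : X d => A^T *m vec zt - - eta).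
    move=> j; apply: (measurable_continuous (f := fun v : 'cV[R]_d => (A^T *m v - - eta) j 0) _ (@mcoord_vec R d)).
    exact: (continuous_comp2 (@continuous_mulmx_sub R _ _ A^T (- eta)) (@coord_continuous _ _ _ j 0)).
  have m1 : mcoord (fun y : X d * X m => vec y.2) by apply: mcoord_comp (@mcoord_vec R m) _.
  apply: cmeasM.
    apply: cmeasM; first by apply: cmeas_real; exact: measurable_continuous (@continuous_gauss R d) (@mcoord_vec R d).
    apply: cmeas_cis; apply: measurableT_comp => //.
    by apply: measurable_dotp (@mcoord_vec R d) _ => j; exact: measurable_cst.
  apply: (cmeas_cint (nu := mu m) (f := fun y : X d * X m => g (vec y.2) * cis (dotp (vec y.2) (eta + A^T *m vec y.1)))).
    apply: cmeasM; first exact: cmeas_ccont cg m1.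
    apply: cmeas_cis; apply: measurable_dotp m1 _.
    have -> : (fun y : X d * X m => eta + A^T *m vec y.1) = (fun y => A^T *m vec y.1 - - eta).
      by apply/funext => y; rewrite opprK addrC.
    exact: mcoord_comp mv _.
  move=> zt; have cf : ccont (fun x : 'cV[R]_m => g x * cis (dotp x (eta + A^T *m vec zt))).
    by apply: ccontM cg (ccont_cis _); exact: (@continuous_dotpl _ _ _).
  apply: cintegrable_dom (cmeas_ccont cf (@mcoord_vec R m)) (rintegrableZ M' (rintegrable_qv hp m e'0)) _ => x.
  by rewrite /= cabsM cabs_cis mulr1.
apply: le_trans (cabs_cint_dom cm (rintegrableZ _ wi) bound) _.
rewrite RintegralZl// -/S -!mulrA ler_wpM2l ?expR_ge0//.
have -> : (S + 1) * (M * expR (- (dl * qv eta))) = M * (expR (- (dl * qv eta)) * (S + 1)) by ring.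
by rewrite ler_wpM2l// ler_wpM2l ?expR_ge0// lerDl.
Qed.

(** The larger of q(x') and q(eta) is at least half of their sum; the corresponding one of the two
    estimates is used. *)
Lemma kern_gs_decay c : 0 < c -> exists C e : R, [/\ 0 < C, 0 < e &
  forall (g : 'cV[R]_m -> R[i]^o) B x' eta, csmooth g -> gs_le theta c B g ->
    cabs (kern g x' eta) <= C * B * expR (- (e * (qv x' + qv eta)))].
Proof.
move=> c0; have [C [e [C0 e0 H]]] := gs_fourier_decay htheta m c0.
have [C1 [e1 [C10 e10 H1]]] := kern_position_decay e0.
have [C2 [e2 [C20 e20 H2]]] := kern_frequency_decay e0 e0.
pose e3 := Num.min e1 e2; have e30 : 0 < e3 by rewrite lt_min e10.
exists ((C1 + C2) * C), (e3 / 2); split; [by rewrite mulr_gt0// addr_gt0|by rewrite divr_gt0|].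
move=> g B x' eta sg gB; have B0 := gs_le_ge0 c0 gB; have [h1 h2] := H g B sg gB.
have cg := ccont_gs sg.
have k1 := H1 g _ x' eta cg h1; have k2 := H2 g _ _ x' eta cg h1 h2.
have CB0 : 0 <= C * B by rewrite mulr_ge0// ltW.
have q1 := qv_ge0 p x'; have q2 := qv_ge0 p eta.
rewrite -[(C1 + C2) * C * B]mulrA; have [le|/ltW le] := leP (qv x') (qv eta).
  apply: le_trans k2 _; apply: ler_pM; rewrite ?expR_ge0//.
  - by rewrite mulr_ge0// ltW.
  - by rewrite ler_wpM2r// lerDr ltW.
  - rewrite ler_expR lerN2; apply: (@le_trans _ _ (e3 * qv eta)).
      by rewrite -mulrA ler_wpM2l ?(ltW e30)//; lra.
    by rewrite ler_wpM2r// ge_min lexx orbT.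
apply: le_trans k1 _; apply: ler_pM; rewrite ?expR_ge0//.
- by rewrite mulr_ge0// ltW.
- by rewrite ler_wpM2r// lerDl ltW.
- rewrite ler_expR lerN2; apply: (@le_trans _ _ (e3 * qv x')).
    by rewrite -mulrA ler_wpM2l ?(ltW e30)//; lra.
  by rewrite ler_wpM2r// ge_min lexx.
Qed.

Lemma wave_packet_gauss n (w : phase n) x :
  wave_packet w x = (gauss (x - w.1))%:C * cis (- dotp x w.2) :> R[i].
Proof.
by rewrite /wave_packet/= enorm_sqr /gauss /cis; apply: ceq; simpc.
Qed.

(** Covariance under phase space translations: it reduces the bounds for all packets to the packet
    at 0, with constants uniform in w. *)
Lemma kern_packet (w : phase m) x' eta :
  kern (wave_packet w) x' eta =
  cis (dotp w.1 (eta - w.2)) * kern (wave_packet 0) (x' - A *m w.1) (eta - w.2).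
Proof.
pose f (x : 'cV[R]_m) : R[i] := wave_packet w x * (gauss (A *m x - x'))%:C * cis (dotp x eta).
have cw (y : phase m) : ccont (wave_packet y : _ -> R[i]) by exact: ccont_gs (wave_packet_cpartial y).1.
have cf : ccont f by exact: ccont_kern.
have rw : crapid p (wave_packet w : _ -> R[i]).
  have [c [B [c0 sg gB]]] := gs_bound (packet htheta w).
  have [C [e [C0 e0 H]]] := gs_fourier_decay htheta m c0.
  have B0 := gs_le_ge0 c0 gB.
  by exists (C * B), e; split; [rewrite mulr_ge0// ltW| |exact: (H _ _ sg gB).1].
have rf : crapid p f.
  have [C [e [C0 e0 H]]] := rw; exists C, e; split=> // x.
  exact: le_trans (kern_term_le _ _ _ _) (H x).
have := cint_affine hp w.1 ltr01 cf rf; rewrite expr1n invr1 mul1r => Ef.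
rewrite -[LHS]/(cint (mu m) (fun x => f (vec x))) -Ef {Ef}.
have cf0 : ccont (fun x : 'cV[R]_m => wave_packet 0 x * (gauss (A *m x - (x' - A *m w.1)))%:C * cis (dotp x (eta - w.2))).
  exact: ccont_kern.
rewrite /kern -cintZ; last first.
  apply: cintegrable_dom (cmeas_ccont cf0 (@mcoord_vec R m)) (rintegrable_rapid hp (@continuous_gauss R m) (rapid_gauss hp m)) _ => x.
  apply: le_trans (kern_term_le _ _ _ _) _.
  by rewrite wave_packet_gauss cabsM cabs_cis mulr1 cabs_gauss subr0.
apply: eq_cint => x; rewrite /f !wave_packet_gauss scale1r.
rewrite [w.1 + _ - w.1]addrC addKr /= subr0.
have -> : A *m (w.1 + vec x) - x' = A *m vec x - (x' - A *m w.1).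
  by rewrite mulmxDr opprB addrA [_ + A *m vec x]addrC.
rewrite (_ : dotp (vec x) 0 = 0) ?oppr0 ?cis0 ?mulr1; last by rewrite dotpC dotp0l.
have -> : cis (- dotp (w.1 + vec x) w.2) = cis (- dotp w.1 w.2) * cis (- dotp (vec x) w.2).
  by rewrite dotpDl opprD cisD.
by rewrite dotpDl !dotpDr !dotpNr !cisD; ring.
Qed.

Lemma kern_packet_decay : exists C e : R, [/\ 0 < C, 0 < e & forall (w : phase m) x' eta,
  cabs (kern (wave_packet w) x' eta) <= C * expR (- (e * (qv (x' - A *m w.1) + qv (eta - w.2))))].
Proof.
have [c [B [c0 sg gB]]] := gs_bound (packet htheta (0 : phase m)).
have [C [e [C0 e0 H]]] := kern_gs_decay c0; have B0 := gs_le_ge0 c0 gB.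
exists (C * (B + 1)), e; split=> //; first by rewrite mulr_gt0// ltr_wpDl.
move=> w x' eta; rewrite kern_packet cabsM cabs_cis mul1r.
apply: le_trans (H _ _ _ _ sg gB) _; rewrite ler_wpM2r ?expR_ge0// ler_wpM2l ?lerDl//.
exact: ltW.
Qed.

Lemma kern_integrable (g : 'cV[R]_m -> R[i]) x' eta : ccont g -> crapid p g ->
  cintegrable (mu m) (fun x => g (vec x) * (gauss (A *m vec x - x'))%:C * cis (dotp (vec x) eta)).
Proof.
move=> cg [C [e [C0 e0 gC]]].
apply: cintegrable_dom (cmeas_ccont (ccont_kern x' eta cg) (@mcoord_vec R m)) (rintegrableZ C (rintegrable_qv hp m e0)) _ => x.
exact: le_trans (kern_term_le _ _ _ _) (gC _).
Qed.

Lemma cmeas_kern_term dZ (Z : measurableType dZ) (g : 'cV[R]_m -> R[i])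
    (x' : Z -> 'cV[R]_d) (eta : Z -> 'cV[R]_m) : ccont g -> mcoord x' -> mcoord eta ->
  cmeas (fun y : Z * X m => g (vec y.2) * (gauss (A *m vec y.2 - x' y.1))%:C *
    cis (dotp (vec y.2) (eta y.1))).
Proof.
move=> cg mx me.
have m1 : mcoord (fun y : Z * X m => vec y.2) by apply: mcoord_comp (@mcoord_vec R m) _.
have m2 : mcoord (fun y : Z * X m => x' y.1) by apply: mcoord_comp mx _.
have m3 : mcoord (fun y : Z * X m => eta y.1) by apply: mcoord_comp me _.
apply: cmeasM; last by apply: cmeas_cis; exact: measurable_dotp m1 m3.
apply: cmeasM; first exact: cmeas_ccont cg m1.
apply: cmeas_real; apply: measurable_continuous (@continuous_gauss R d) _ => j.
have mA : measurable_fun setT (fun y : Z * X m => (A *m vec y.2 - 0) j 0).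
  apply: (measurable_continuous (f := fun v : 'cV[R]_m => (A *m v - 0) j 0) _ m1).
  exact: (continuous_comp2 (@continuous_mulmx_sub R _ _ A 0) (@coord_continuous _ _ _ j 0)).
under eq_fun do rewrite mxE [X in _ + X]mxE.
apply: measurable_funB (m2 j).
by under eq_fun do rewrite -[A *m _]subr0.
Qed.

Lemma cmeas_kern dZ (Z : measurableType dZ) (g : 'cV[R]_m -> R[i]) (x' : Z -> 'cV[R]_d) (eta : Z -> 'cV[R]_m) :
  ccont g -> crapid p g -> mcoord x' -> mcoord eta -> cmeas (fun t => kern g (x' t) (eta t)).
Proof.
move=> cg rg mx me.
apply: (cmeas_cint (nu := mu m) (f := fun y : Z * X m => g (vec y.2) *
  (gauss (A *m vec y.2 - x' y.1))%:C * cis (dotp (vec y.2) (eta y.1)))).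
  exact: cmeas_kern_term.
by move=> t; have := kern_integrable (x' t) (eta t) cg rg.
Qed.

Lemma kern_linear (k : R[i]) (g h : 'cV[R]_m -> R[i]) x' eta : ccont g -> crapid p g ->
  ccont h -> crapid p h ->
  kern (fun x => k * g x + h x) x' eta = k * kern g x' eta + kern h x' eta.
Proof.
move=> cg rg ch rh; have ig := kern_integrable x' eta cg rg; have ih := kern_integrable x' eta ch rh.
rewrite /kern -cintZ// -cintD//; last exact: cintegrableZ.
by apply: eq_cint => x; ring.
Qed.

End kernel.

(** * The pull-back functional and its wave front estimate *)

Section pull.
Context {R : realType} (theta : R) (htheta : 2^-1 <= theta < 1) (m d : nat)
  (A : 'M[R]_(d, m)) (G : set ('cV[R]_d * 'cV[R]_d)) (I : Type).
Local Notation p := (theta^-1).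
Local Notation pw := (pw p).
Local Notation qv := (qv p).
Local Notation mu n := (vs_mu (@lebv R n)).
Local Notation vec := (@vs_vec R _ (lebv _)).
Local Notation X := (@lebv R).
Local Notation phase n := ('cV[R]_n * 'cV[R]_n)%type.
Local Notation qz := (@qz R theta _).
Let hp := inv_theta_bounds htheta.

Definition phase_mu n := sfprod (mu n) (mu n).
Definition phase_vec n (t : X n * X n) : phase n := (vec t.1, vec t.2).

Lemma rintegrable_qz n e : 0 < e ->
  rintegrable (phase_mu n) (fun t => expR (- (e * qz (phase_vec t)))).
Proof.
move=> e0; have i := rintegrable_qv hp n e0.
have e1 (x : X n) : 0 <= expR (- (e * qv (vec x))) by exact: expR_ge0.
have := rintegrable_prod i i e1 e1; congr rintegrable; apply/funext => t.
by rewrite -expRD /qz mulrDr opprD.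
Qed.

Lemma mphase_vec n : mphase (@phase_vec n).
Proof. by split; apply: mcoord_comp (@mcoord_vec R n) _. Qed.

Definition gauss_sqr_mass n : R := \int[mu n]_(x in setT) gauss (vec x) ^+ 2.
(* Inverting the Fourier transform in the frequency gives gauss_mass ^ 2, and integrating the
   square of the window over the position gives gauss_sqr_mass. *)
Definition kappa n : R := (gauss_mass n ^+ 2 * gauss_sqr_mass n)^-1.

(* Expand u, with transform V, into conjugate wave packets, compose each of them with A, and
   integrate against g. *)
Definition pull (V : phase d -> R[i]) (g : 'cV[R]_m -> R[i]) : R[i] :=
  (kappa d)%:C * cint (phase_mu d) (fun t =>
    V (phase_vec t) * kern A g (phase_vec t).1 (A^T *m (phase_vec t).2)).

(** The hypotheses on the family are uniform in the index. It is taken over a one-point type for a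
    single functional and over the naturals for a sequence. *)
Variable V : I -> phase d -> R[i].
Hypothesis mV : forall n, cmeas (fun t => V n (@phase_vec d t)).
Hypothesis growth : forall k : R, 0 < k -> exists C : R,
  forall n z, cabs (V n z) <= C * expR (k * qz z).
Hypothesis decay : forall z, z <> 0 -> ~ G z -> decays theta V z.

(** In the first case of the dichotomy V decays and |z| controls t; in the second the defect
    controls |z| + t, and the kernel factor beats the growth of V. With b false only t = 0 is
    allowed, which is the convergence of the integral; with b true, t w is the place of a test
    packet. *)
Lemma cone_estimate (w0 : phase m) (b : bool) (e : R) : 0 < e ->
  (forall z t, 0 <= t -> b || (t == 0) -> 0 < radius z t -> defect A z t w0 = 0 -> z <> 0 /\ ~ G z) ->
  exists (N : nat) (C e' : R), [/\ 0 < C, 0 < e' & forall n z t w, 0 <= t -> b || (t == 0) ->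
    `|w.1 - w0.1| <= N.+1%:R^-1 -> `|w.2 - w0.2| <= N.+1%:R^-1 ->
    cabs (V n z) * expR (- (e * (qv (z.1 - t *: (A *m w.1)) + qv (A^T *m z.2 - t *: w.2)))) <=
    C * expR (- (e' * (qz z + pw t)))].
Proof.
move=> e0 H; have [N HN] := cone_dichotomy decay H; exists N.
pose P := pw N.+1%:R; have P0 : 0 < P by rewrite powR_gt0// gtr0_norm.
pose K1 := 4 * P; have K10 : 0 < K1 by rewrite mulr_gt0.
pose K3 := (2 * d.+1%:R + 1) * (4 * P) : R.
have K30 : 0 < K3 by rewrite mulr_gt0 ?mulr_gt0// ltr_wpDl.
(* As q(z) + |t|^p <= K3 S, the product k (q(z) + |t|^p) is at most half of e S: one half of the
   kernel decay pays for the growth of V, the other half remains. *)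
pose k := e / (2 * K3); have k0 : 0 < k by rewrite divr_gt0 ?mulr_gt0.
have [C HC] := growth k0.
pose e1 := (N.+1%:R * (1 + K1))^-1 : R.
have e10 : 0 < e1 by rewrite invr_gt0 mulr_gt0// addr_gt0.
exists (N.+1%:R + `|C|), (Num.min k e1); split; [by rewrite ltr_pwDl|by rewrite lt_min k0|].
move=> n z t w t0 bt w1 w2.
set S := qv _ + qv _; have S0 : 0 <= S by rewrite addr_ge0 ?qv_ge0.
have q0 := qz_ge0 theta z; have pt0 := pw_ge0 p t.
have sum0 : 0 <= qz z + pw t by exact: addr_ge0.
have [[gz tz]|rd] := HN z t w t0 bt w1 w2.
  have := gz n 1 ltr01; rewrite !scale1r -surjective_pairing => gz1.
  have pt : pw t <= K1 * qz z.
    apply: (@le_trans _ _ (pw (N.+1%:R * (`|z.1| + `|z.2|)))).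
      by apply: pw_mono => //; rewrite !ger0_norm// mulr_ge0// addr_ge0.
    rewrite pwM -/P /K1 [4 * P]mulrC -mulrA ler_pM2l//; apply: le_trans (pw_add hp _ _) _.
    by rewrite ler_pM2l// lerD ?norm_le_qv.
  apply: (@le_trans _ _ (N.+1%:R * expR (- (N.+1%:R^-1 * qz z)) * 1)).
    apply: ler_pM; rewrite ?cabs_ge0 ?expR_ge0//.
    by rewrite -expR0 ler_expR oppr_le0 mulr_ge0// ltW.
  rewrite mulr1; apply: ler_pM; rewrite ?expR_ge0//; first by rewrite lerDl.
  rewrite ler_expR lerN2; apply: (@le_trans _ _ (e1 * (qz z + pw t))).
    by rewrite ler_wpM2r// ge_min lexx orbT.
  rewrite /e1 invfM -mulrA ler_pM2l ?invr_gt0// ler_pdivrMl ?addr_gt0//; lra.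
have sumS : qz z + pw t <= K3 * S.
  have r0 : 0 <= radius z t by rewrite !addr_ge0.
  have h1 : qz z + pw t <= (2 * d.+1%:R + 1) * pw (radius z t).
    have n1 : qv z.1 <= d.+1%:R * pw (radius z t).
      apply: le_trans (qv_le_norm hp _) _; rewrite ler_pM2l//; apply: pw_mono => //.
      by rewrite normr_id ger0_norm// /radius -addrA lerDl addr_ge0.
    have n2 : qv z.2 <= d.+1%:R * pw (radius z t).
      apply: le_trans (qv_le_norm hp _) _; rewrite ler_pM2l//; apply: pw_mono => //.
      by rewrite normr_id ger0_norm// /radius addrAC lerDr addr_ge0.
    have n3 : pw t <= pw (radius z t).
      by apply: pw_mono => //; rewrite !ger0_norm// /radius lerDr addr_ge0.
    by rewrite /qz; lra.
  apply: le_trans h1 _; rewrite /K3 -mulrA ler_pM2l ?ltr_wpDl//.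
  apply: (@le_trans _ _ (pw (N.+1%:R * defect A z t w))).
    by apply: pw_mono => //; rewrite !ger0_norm// mulr_ge0// addr_ge0.
  rewrite pwM -/P [4 * P]mulrC -mulrA ler_pM2l//; apply: le_trans (pw_add hp _ _) _.
  by rewrite ler_pM2l// lerD ?norm_le_qv.
apply: (@le_trans _ _ (`|C| * expR (k * qz z) * expR (- (e * S)))).
  rewrite ler_wpM2r ?expR_ge0//; apply: le_trans (HC n z) _.
  by rewrite ler_wpM2r ?expR_ge0// ler_norm.
rewrite -mulrA -expRD; apply: ler_pM; rewrite ?expR_ge0//; first by rewrite lerDr.
rewrite ler_expR; have h2 : k * (qz z + pw t) <= e * S / 2.
  have -> : e * S / 2 = k * (K3 * S) by rewrite /k; field; rewrite gt_eqF.
  by rewrite ler_pM2l.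
have h3 : Num.min k e1 * (qz z + pw t) <= k * (qz z + pw t).
  by rewrite ler_wpM2r// ge_min lexx.
have : 0 <= k * pw t by rewrite mulr_ge0// ltW.
lra.
Qed.

Hypothesis hGA : G `&` [set z | z.1 = 0 /\ A^T *m z.2 = 0] = set0.

(** The case t = 0 of [cone_estimate]: zeros of the defect are the z with z.1 = 0 and A^T z.2 = 0,
    which [hGA] keeps out of G. *)
Lemma pull_term_le c : 0 < c -> exists M e : R, [/\ 0 < M, 0 < e &
  forall n (g : 'cV[R]_m -> R[i]^o) B z, csmooth g -> gs_le theta c B g ->
    cabs (V n z * kern A g z.1 (A^T *m z.2)) <= M * B * expR (- (e * qz z))].
Proof.
move=> c0; have [C1 [e1 [C10 e10 H1]]] := kern_gs_decay htheta A c0.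
have [|N [C [e [C0 e0 H]]]] := @cone_estimate 0 false e1 e10.
  move=> z t _ /= /eqP -> r0 df; split.
    by move=> z0; move: r0; rewrite z0 /radius !normr0 !addr0 ltxx.
  move=> Gz; have : (G `&` [set z | z.1 = 0 /\ A^T *m z.2 = 0]) z.
    split=> //=; move: df => /eqP; rewrite /defect paddr_eq0// !normr_eq0 !scale0r !subr0.
    by move=> /andP[/eqP -> /eqP ->].
  by rewrite hGA.
exists (C1 * C), e; split; [exact: mulr_gt0|by []|move=> n g B z sg gB].
have B0 := gs_le_ge0 c0 gB.
rewrite cabsM; apply: le_trans (ler_wpM2l (cabs_ge0 _) (H1 g B z.1 (A^T *m z.2) sg gB)) _.
have h0 (v : 'cV[R]_m) : `|v - v| <= N.+1%:R^-1 by rewrite subrr normr0 invr_ge0.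
have := H n z 0 0 (lexx 0) (eqxx 0) (h0 _) (h0 _).
rewrite !scale0r !subr0 pw0// addr0 => h.
have -> : C1 * C * B * expR (- (e * qz z)) = C1 * B * (C * expR (- (e * qz z))) by ring.
by rewrite mulrCA ler_wpM2l// mulr_ge0// ltW.
Qed.

Lemma pull_integrable n (g : gs theta m) : cintegrable (phase_mu d) (fun t =>
  V n (phase_vec t) * kern A g (phase_vec t).1 (A^T *m (phase_vec t).2)).
Proof.
have [c [B [c0 sg gB]]] := gs_bound g; have [M [e [M0 e0 H]]] := pull_term_le c0.
have [C [e1 [C0 e10 H1]]] := gs_fourier_decay htheta m c0.
have B0 := gs_le_ge0 c0 gB.
apply: (@cintegrable_dom _ _ _ _ _ (fun t => M * B * expR (- (e * qz (phase_vec t))))).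
- apply: cmeasM (mV n) _; apply: (cmeas_kern htheta A (ccont_gs sg)).
  + by exists (C * B), e1; split; [rewrite mulr_ge0// ltW| |exact: (H1 _ _ sg gB).1].
  + exact: (@mphase_vec d).1.
  + move=> j; have mj : measurable_fun setT (fun t : X d * X d => (A^T *m vec t.2 - 0) j 0).
      apply: (measurable_continuous (f := fun v : 'cV[R]_d => (A^T *m v - 0) j 0) _ (@mphase_vec d).2).
      exact: (continuous_comp2 (@continuous_mulmx_sub R _ _ A^T 0) (@coord_continuous _ _ _ j 0)).
    by under eq_fun do rewrite -[A^T *m _]subr0.
- by apply: rintegrableZ; exact: rintegrable_qz.
- by move=> t; exact: H.
Qed.

Lemma pull_bound n c : 0 < c -> exists M : R, forall (g : gs theta m) B, gs_le theta c B g ->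
  cabs (pull (V n) g) <= M * B.
Proof.
move=> c0; have [M [e [M0 e0 H]]] := pull_term_le c0.
have i := rintegrable_qz d e0.
exists (`|kappa d| * (M * \int[phase_mu d]_(t in setT) expR (- (e * qz (phase_vec t))))) => g B gB.
rewrite cabsM cabsR -[leRHS]mulrA ler_wpM2l//.
apply: le_trans (cabs_cint_dom (cintegrable_cmeas (pull_integrable n g)) (rintegrableZ (M * B) i) _) _.
  by move=> t; exact: H (gs_csmooth g) gB.
by rewrite RintegralZl// le_eqVlt; apply/orP; left; apply/eqP; ring.
Qed.

Lemma pull_linear n (k : R[i]) (g h : gs theta m) :
  pull (V n) (k *: g + h) = k * pull (V n) g + pull (V n) h.
Proof.
rewrite /pull mulrCA -mulrDr; congr (_ * _).
have ig := pull_integrable n g; have ih := pull_integrable n h.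
rewrite -cintZ// -cintD//; last exact: cintegrableZ.
apply: eq_cint => t; rewrite mulrCA -mulrDr; congr (_ * _).
have H (f : gs theta m) : ccont f /\ crapid p f.
  have [c [B [c0 sf fB]]] := gs_bound f; have [C [e1 [C0 e10 H1]]] := gs_fourier_decay htheta m c0.
  have B0 := gs_le_ge0 c0 fB; split; first exact: ccont_gs.
  by exists (C * B), e1; split; [rewrite mulr_ge0// ltW| |exact: (H1 _ _ sf fB).1].
have [cg rg] := H g; have [ch rh] := H h.
rewrite -(kern_linear htheta A k _ _ cg rg ch rh); congr kern; apply/funext => x.
Qed.

Lemma pull_dual n : exists u : gs_dual theta m, forall g, u g = pull (V n) g.
Proof.
pose T (g : gs theta m) : R[i]^o := pull (V n) g.
have lT : linear T by move=> k g h; exact: pull_linear.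
pose Tl : {linear gs theta m -> R[i]^o} := HB.pack T (GRing.isLinear.Build _ _ _ _ T lT).
by have [u Hu] := gs_dual_mk (T := Tl) (fun c c0 => pull_bound n c0); exists u.
Qed.

Hypothesis injA : forall x : 'cV[R]_m, A *m x = 0 -> x = 0.
Hypothesis conicG : conic G.

(** [cone_estimate] with b true, on the cone over a small ball around w0. Its hypothesis has three
    cases: z = 0 would give w0 = 0 by injectivity of A, t = 0 is excluded by [hGA], and t > 0 would
    put w0 into the pulled-back cone. *)
Lemma pull_packet (w0 : phase m) : w0 <> 0 -> ~ pullback_cone A G w0 ->
  exists L : set (phase m), [/\ open L, conic L, L w0 & exists C e : R, [/\ 0 < C, 0 < e &
    forall n w, L w -> cabs (pull (V n) (wave_packet w)) <= C * expR (- (e * qz w))]].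
Proof.
move=> w00 w0G; have [C1 [e1 [C10 e10 H1]]] := kern_packet_decay htheta A.
have [|N [C [e [C0 e0 H]]]] := @cone_estimate w0 true e1 e10.
  move=> z t t0 _ rd /eqP; rewrite /defect paddr_eq0// !normr_eq0 !subr_eq0 => /andP[/eqP z1 /eqP z2].
  split=> [z0|Gz].
    move: z1 z2 rd; rewrite z0 /radius /= mulmx0 !normr0 !add0r => z1 z2 t1.
    apply: w00; rewrite [w0]surjective_pairing; congr (_, _).
      by apply: injA; apply/eqP; have /esym/eqP := z1; rewrite scaler_eq0 gt_eqF.
    by apply/eqP; have /esym/eqP := z2; rewrite scaler_eq0 gt_eqF.
  (* For t > 0, conicity allows dividing z by t, and z / t lies over w0. *)
  have [t00|tn0] := eqVneq t 0.
    have : (G `&` [set z | z.1 = 0 /\ A^T *m z.2 = 0]) z by rewrite t00 !scale0r in z1 z2.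
    by rewrite hGA.
  have tp : 0 < t by rewrite lt_def tn0.
  apply: w0G; exists w0.1, (t^-1 *: z.2); split.
    have tV : 0 < t^-1 by rewrite invr_gt0.
    have := conicG.2 _ _ tV Gz; rewrite z1 scalerA mulVf ?scale1r//.
  by rewrite -scalemxAr z2 scalerA mulVf// scale1r -surjective_pairing.
pose s := `|w0.1| + `|w0.2|.
have s0 : 0 < s.
  have [n1|n1] := eqVneq w0.1 0; last by rewrite ltr_pwDl// normr_gt0.
  have [n2|n2] := eqVneq w0.2 0; last by rewrite ltr_wpDl// normr_gt0.
  by case: w00; rewrite [w0]surjective_pairing n1 n2.
pose r := Num.min (N.+1%:R^-1) (s / 2); have r0 : 0 < r by rewrite lt_min invr_gt0 ltr0Sn divr_gt0.
have rN : r <= N.+1%:R^-1 by rewrite ge_min lexx.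
have rs : r <= s / 2 by rewrite ge_min lexx orbT.
(* The cone over the ball of radius r about w0. The bound r <= s / 2 keeps 0 out of it, and r <= 1 /
   (N + 1) makes the estimate applicable to t w. *)
pose L := \bigcup_(t in [set t : R | 0 < t])
  [set w : phase m | `|t *: w.1 - w0.1| < r /\ `|t *: w.2 - w0.2| < r].
exists L; split.
- apply: bigcup_open => t _.
  have c1 : continuous (fun w : phase m => `|t *: w.1 - w0.1|).
    by move=> w; apply: cvg_norm; apply: cvgB; [apply: cvgZr; exact: cvg_fst|exact: cvg_cst].
  have c2 : continuous (fun w : phase m => `|t *: w.2 - w0.2|).
    by move=> w; apply: cvg_norm; apply: cvgB; [apply: cvgZr; exact: cvg_snd|exact: cvg_cst].
  apply: openI; [apply: (@open_comp _ _ _ [set x : R | x < r]) (@open_lt _ r) => w _; exact: c1|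
    apply: (@open_comp _ _ _ [set x : R | x < r]) (@open_lt _ r) => w _; exact: c2].
- split=> [[t /= t0]|a w a0 [t /= t0 [w1 w2]]].
    have n0 n (v : 'cV[R]_n) : `|t *: 0 - v| = `|v| by rewrite scaler0 sub0r normrN.
    rewrite !n0 => -[h1 h2]; have : s < r + r by exact: ltrD h1 h2.
    by rewrite ltNge => /negP; apply; lra.
  exists (t / a) => /=; first exact: divr_gt0.
  by rewrite !scalerA divfK ?gt_eqF.
- by exists 1 => //=; rewrite !scale1r !subrr !normr0.
(* Bounds q on the ball. For w = w' / t with w' in the ball, q(w) <= |1/t|^p K, so decay in |1/t|^p
   is decay in q(w). *)
pose K : R := m.+1%:R * pw (`|w0.1| + 1) + m.+1%:R * pw (`|w0.2| + 1) + 1.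
have K0 : 0 < K by rewrite ltr_wpDl// addr_ge0// mulr_ge0// pw_ge0.
pose S := \int[phase_mu d]_(t in setT) expR (- (e * qz (phase_vec t))).
have S0 : 0 <= S by apply: Rintegral_ge0 => x _; exact: expR_ge0.
exists (`|kappa d| * (C1 * C * S) + 1), (e / K); split.
- by rewrite ltr_wpDl// !mulr_ge0// ltW.
- exact: divr_gt0.
move=> n w [t /= t0 [w1 w2]].
have r1 : r <= 1 by apply: le_trans rN _; rewrite invf_le1// ler1n.
pose w' : phase m := (t *: w.1, t *: w.2).
have tV0 : 0 < t^-1 by rewrite invr_gt0.
have wE1 : w.1 = t^-1 *: w'.1 by rewrite scalerA mulVf ?gt_eqF// scale1r.
have wE2 : w.2 = t^-1 *: w'.2 by rewrite scalerA mulVf ?gt_eqF// scale1r.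
have qw : qz w <= pw t^-1 * K.
  rewrite /qz wE1 wE2 (qvZ p t^-1 w'.1) (qvZ p t^-1 w'.2) -mulrDr ler_wpM2l ?pw_ge0//.
  have b1 : qv w'.1 <= m.+1%:R * pw (`|w0.1| + 1).
    apply: le_trans (qv_le_norm hp _) _; rewrite ler_pM2l//; apply: pw_mono => //.
    rewrite normr_id ger0_norm; last by rewrite addr_ge0.
    rewrite -[w'.1](subrK w0.1) addrC (le_trans (ler_normD _ _))// lerD2l.
    exact: le_trans (ltW w1) r1.
  have b2 : qv w'.2 <= m.+1%:R * pw (`|w0.2| + 1).
    apply: le_trans (qv_le_norm hp _) _; rewrite ler_pM2l//; apply: pw_mono => //.
    rewrite normr_id ger0_norm; last by rewrite addr_ge0.
    rewrite -[w'.2](subrK w0.2) addrC (le_trans (ler_normD _ _))// lerD2l.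
    exact: le_trans (ltW w2) r1.
  by rewrite /K; lra.
have bound z : cabs (V n z * kern A (wave_packet w) z.1 (A^T *m z.2)) <=
    C1 * C * expR (- (e * pw t^-1)) * expR (- (e * qz z)).
  rewrite cabsM; apply: le_trans (ler_wpM2l (cabs_ge0 _) (H1 w z.1 (A^T *m z.2))) _.
  have := H n z t^-1 w' (ltW tV0) isT (le_trans (ltW w1) rN) (le_trans (ltW w2) rN).
  rewrite scalemxAr -wE1 -wE2 => h; rewrite mulrCA; apply: le_trans (ler_wpM2l (ltW C10) h) _.
  rewrite [e * (_ + _)]mulrDr opprD expRD le_eqVlt; apply/orP; left; apply/eqP; ring.
have i := rintegrable_qz d e0.
have ii := pull_integrable n (packet htheta w).
rewrite cabsM cabsR; apply: (@le_trans _ _ (`|kappa d| * (C1 * C * expR (- (e * pw t^-1)) * S))).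
  rewrite ler_wpM2l//; apply: le_trans (cabs_cint_dom (cintegrable_cmeas ii) (rintegrableZ _ i) (fun t => bound (phase_vec t))) _.
  by rewrite RintegralZl.
have -> : `|kappa d| * (C1 * C * expR (- (e * pw t^-1)) * S) =
  `|kappa d| * (C1 * C * S) * expR (- (e * pw t^-1)) by ring.
apply: ler_pM; rewrite ?expR_ge0 ?lerDl ?mulr_ge0 ?(ltW C10) ?(ltW C0)//.
rewrite ler_expR lerN2 mulrAC ler_pdivrMr// -mulrA ler_pM2l//.
Qed.

End pull.

Section pull_convergence.
Context {R : realType} (theta : R) (htheta : 2^-1 <= theta < 1) (m d : nat)
  (A : 'M[R]_(d, m)) (G : set ('cV[R]_d * 'cV[R]_d)).
Local Notation phase n := ('cV[R]_n * 'cV[R]_n)%type.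
Local Notation qz := (@qz R theta _).
Variable V : nat -> phase d -> R[i].
Hypothesis mV : forall n, cmeas (fun t => V n (@phase_vec R d t)).
Hypothesis growth : forall k : R, 0 < k -> exists C : R,
  forall n z, cabs (V n z) <= C * expR (k * qz z).
Hypothesis decay : forall z, z <> 0 -> ~ G z -> decays theta V z.
Hypothesis hGA : G `&` [set z | z.1 = 0 /\ A^T *m z.2 = 0] = set0.

(** Dominated convergence; [pull_term_le] supplies a majorant valid for all n. *)
Lemma pull_cvg0 (g : gs theta m) : (forall z, cabs (V n z) @[n --> \oo] --> (0 : R)) ->
  cabs (pull A (V n) g) @[n --> \oo] --> (0 : R).
Proof.
move=> V0; have [c [B [c0 sg gB]]] := gs_bound g.
have [M [e [M0 e0 H]]] := pull_term_le htheta growth decay hGA c0.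
have ii n := pull_integrable htheta mV growth decay hGA n g.
have i := rintegrable_qz htheta d e0.
have := @cint_dct _ _ _ (phase_mu d) (fun n t => V n (phase_vec t) *
  kern A g (phase_vec t).1 (A^T *m (phase_vec t).2)) (fun=> 0) _
  (fun n => cintegrable_cmeas (ii n)) (rintegrableZ (M * B) i) (fun n t => H n g B (phase_vec t) sg gB).
have h1 (t : lebv d * lebv d) : cabs (V n (phase_vec t) *
    kern A g (phase_vec t).1 (A^T *m (phase_vec t).2) - 0) @[n --> \oo] --> (0 : R).
  have := cvgM (cvg_cst (cabs (kern A g (phase_vec t).1 (A^T *m (phase_vec t).2)))) (V0 (phase_vec t)).
  by rewrite mulr0 => hh; under eq_fun do rewrite subr0 cabsM mulrC; exact: hh.
move=> /(_ h1) h.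
have c00 : cint (phase_mu d) (fun=> (0 : R[i])) = 0.
  by rewrite /cint/= /Rintegral !integral0.
rewrite (_ : (fun n => _) = (fun n => `|kappa d| * cabs (cint (phase_mu d) (fun t => V n (phase_vec t) *
  kern A g (phase_vec t).1 (A^T *m (phase_vec t).2)) - cint (phase_mu d) (fun=> (0 : R[i]))))).
  have := cvgM (cvg_cst `|kappa d|) h; rewrite mulr0 => hh; exact: hh.
by apply/funext => n; rewrite c00 subr0 /pull cabsM cabsR.
Qed.

End pull_convergence.

(** * Inversion of the packet transform *)

Section inversion.
Context {R : realType} (theta : R) (htheta : 2^-1 <= theta < 1) (d : nat).
Local Notation p := (theta^-1).
Local Notation qv := (qv p).
Local Notation mu n := (vs_mu (@lebv R n)).
Local Notation vec := (@vs_vec R _ (lebv _)).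
Local Notation X := (@lebv R).
Local Notation phase n := ('cV[R]_n * 'cV[R]_n)%type.
Local Notation qz := (@qz R theta _).
Local Notation crapid := (crapid p).
Local Notation phase_mu := (phase_mu (R := R)).
Local Notation phase_vec := (phase_vec (R := R)).
Let hp := inv_theta_bounds htheta.

Lemma conjcM (a b : R[i]) : conjc (a * b) = conjc a * conjc b.
Proof. exact: rmorphM. Qed.

Lemma conjcR (r : R) : conjc (r%:C : R[i]) = r%:C.
Proof. by apply: ceq; rewrite //= oppr0. Qed.

(** The squared Gaussian is the Gaussian dilated by sqrt 2. *)
Lemma gauss_sqr_mass_gt0 n : 0 < gauss_sqr_mass (R := R) n.
Proof.
have s0 : 0 < Num.sqrt 2 :> R by rewrite sqrtr_gt0.
have := Rint_affine hp 0 s0 (@continuous_gauss R n) (rapid_gauss hp n).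
have -> : gauss_sqr_mass n = \int[mu n]_(x in setT) gauss (0 + Num.sqrt 2 *: vec x).
  apply: eq_Rintegral => x _.
  rewrite add0r /gauss dotpZl dotpZr mulrA -expr2 sqr_sqrtr// -expRM_natl.
  by congr expR; rewrite -mulrA mulrN.
by move=> ->; rewrite mulr_gt0 ?(gauss_mass_gt0 hp)// invr_gt0 exprn_gt0.
Qed.

Lemma kappa_mul n : (kappa n)%:C * ((gauss_mass n ^+ 2 * gauss_sqr_mass (R := R) n)%:C : R[i]) = 1.
Proof.
rewrite -rmorphM /kappa mulVf ?rmorph1// gt_eqF// mulr_gt0 ?gauss_sqr_mass_gt0//.
by rewrite exprn_gt0// (gauss_mass_gt0 hp).
Qed.

Lemma gs_rapid n (g : gs theta n) : ccont g /\ crapid g.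
Proof.
have [c [B [c0 sg gB]]] := gs_bound g; have [C [e [C0 e0 H]]] := gs_fourier_decay htheta n c0.
have B0 := gs_le_ge0 c0 gB; split; first exact: ccont_gs.
by exists (C * B), e; split; [rewrite mulr_ge0// ltW| |exact: (H _ _ sg gB).1].
Qed.

(** Phrased for plain functions because it is also applied to complex conjugates of test
    functions. *)
Definition kern_rapid (f : 'cV[R]_d -> R[i]) := [/\ ccont f, crapid f & exists C e : R,
  [/\ 0 <= C, 0 < e & forall x' eta, cabs (kern 1%:M f x' eta) <= C * expR (- (e * (qv x' + qv eta)))]].

Lemma kern_rapid_gs (g : gs theta d) : kern_rapid g.
Proof.
have [cg rg] := gs_rapid g; split => //.
have [c [B [c0 sg gB]]] := gs_bound g; have [C [e [C0 e0 H]]] := kern_gs_decay htheta (1%:M : 'M[R]_d) c0.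
have B0 := gs_le_ge0 c0 gB; exists (C * B), e; split=> //; first by rewrite mulr_ge0// ltW.
by move=> x' eta; exact: H.
Qed.

Lemma kern_conj (f : 'cV[R]_d -> R[i]) x' eta : ccont f -> crapid f ->
  kern 1%:M (fun x => conjc (f x)) x' eta = conjc (kern 1%:M f x' (- eta)).
Proof.
move=> cf rf; rewrite /kern -cint_conj.
  by apply: eq_cint => x; rewrite !conjcM dotpNr cisN conjcK conjcR.
exact: (kern_integrable htheta).
Qed.

Lemma kern_rapid_conj (f : 'cV[R]_d -> R[i]) : kern_rapid f -> kern_rapid (fun x => conjc (f x)).
Proof.
move=> [cf rf [C [e [C0 e0 H]]]]; split; first exact: ccont_conj.
  have [C1 [e1 [C10 e10 H1]]] := rf; exists C1, e1; split=> // x.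
  by rewrite cabs_conj.
exists C, e; split=> // x' eta; rewrite kern_conj// cabs_conj.
by apply: le_trans (H _ _) _; rewrite qvN.
Qed.

Lemma wave_packet_le1 n (z : phase n) x : cabs (wave_packet z x) <= 1.
Proof. by rewrite wave_packet_gauss cabsM cabs_cis mulr1 cabs_gauss gauss_le1. Qed.

Lemma cmeas_wave_packet dZ (Z : measurableType dZ) n (z : Z -> phase n) x : mphase z ->
  cmeas (fun t => wave_packet (z t) x : R[i]).
Proof.
move=> mz; have := cmeas_wpd htheta (fun=> 0%N) x mz.
by under eq_fun do rewrite -wave_packetE.
Qed.

(** At a fixed position x' the frequency integral is Fourier inversion for f times the window at x'.
    It leaves f(y) gauss (y - x')^2, and the integral over x' gives the second factor of 1 /
    [kappa d]. *)
Lemma packet_inversion (f : 'cV[R]_d -> R[i]) y : kern_rapid f ->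
  (kappa d)%:C * cint (phase_mu d) (fun t =>
    kern 1%:M f (phase_vec t).1 (phase_vec t).2 * wave_packet (phase_vec t) y) = f y.
Proof.
move=> [cf rf [C [e [C0 e0 H]]]].
pose F (t : X d * X d) : R[i] := kern 1%:M f (vec t.1) (vec t.2) * wave_packet (phase_vec t) y.
have mF : cmeas F.
  apply: cmeasM; last exact: cmeas_wave_packet (@mphase_vec R d).
  exact: (cmeas_kern htheta 1%:M cf rf (@mphase_vec R d).1 (@mphase_vec R d).2).
have i := rintegrable_qv hp d e0.
have Fle x xi : cabs (F (x, xi)) <= (C * expR (- (e * qv (vec x)))) * expR (- (e * qv (vec xi))).
  rewrite cabsM -mulrA -expRD -opprD -mulrDr.
  by apply: le_trans (ler_piMr (cabs_ge0 _) (wave_packet_le1 _ _)) (H _ _).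
have [_ E1 _] := cint_fubini mF (rintegrableZ C i) i Fle.
rewrite -[cint _ _]/(cint (mu d \x mu d)%E F) E1.
have inner x' : cint (mu d) (fun xi => F (x', xi)) =
    ((gauss_mass d ^+ 2)%:C * f y) * ((gauss (y - vec x') ^+ 2)%:C).
  pose h (x : 'cV[R]_d) : R[i] := f x * (gauss (x - vec x'))%:C.
  have E0 (x : 'cV[R]_d) : gauss (x - vec x') = gauss (1%:M *m x - vec x') by rewrite mul1mx.
  have ch : ccont h.
    apply: ccontM cf (ccont_real _); have := @continuous_gauss_affine R d d 1%:M (vec x').
    have -> // : (fun x : 'cV[R]_d => gauss (1%:M *m x - vec x')) = (fun x => gauss (x - vec x')).
    by apply/funext => x; rewrite mul1mx.
  have rh : crapid h.
    have [C1 [e1 [C10 e10 H1]]] := rf; exists C1, e1; split=> // x.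
    by rewrite cabsM cabs_gauss; apply: le_trans (ler_piMr (cabs_ge0 _) (gauss_le1 _)) (H1 x).
  have mk : cmeas (fun xi : X d => kern 1%:M f (vec x') (vec xi)).
    apply: (cmeas_kern htheta 1%:M cf rf _ (@mcoord_vec R d)) => j; exact: measurable_cst.
  have rk : crapid (fun xi => kern 1%:M f (vec x') xi).
    exists C, e; split=> // xi; apply: le_trans (H _ _) _.
    by rewrite ler_wpM2l// ler_expR lerN2 ler_wpM2l ?(ltW e0)// lerDr qv_ge0.
  have hE xi : kern 1%:M f (vec x') xi = cint (mu d) (fun x => h (vec x) * cis (dotp (vec x) xi)).
    by apply: eq_cint => x; rewrite /h E0.
  have inv := fourier_inversion hp ch rh mk rk hE y.
  transitivity ((gauss (y - vec x'))%:C * cint (mu d) (fun xi => kern 1%:M f (vec x') (vec xi) * cis (- dotp y (vec xi)))).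
    rewrite -cintZ.
      by apply: eq_cint => xi; rewrite /F wave_packet_gauss /=; ring.
    apply: cintegrable_dom (_ : cmeas _) (rintegrableZ C i) _.
      apply: cmeasM mk _; apply: cmeas_cis; apply: measurableT_comp => //.
      apply: measurable_dotp (@mcoord_vec R d) => j; exact: measurable_cst.
    move=> xi; rewrite cabsM cabs_cis mulr1; apply: le_trans (H _ _) _.
    by rewrite ler_wpM2l// ler_expR lerN2 ler_wpM2l ?(ltW e0)// lerDr qv_ge0.
  by rewrite inv /h expr2 real_complexM; ring.
under eq_cint do rewrite inner.
pose g2 (x : 'cV[R]_d) := gauss x ^+ 2.
have cg2 : continuous g2.
  have := contM (@continuous_gauss R d) (@continuous_gauss R d).
  by rewrite (_ : (fun x : 'cV[R]_d => gauss x * gauss x) = g2).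
have rg2 : rapid p g2.
  have [C1 [e1 [e10 H1]]] := rapid_gauss hp d; exists C1, e1; split=> // x.
  apply: le_trans (H1 x); rewrite /g2 expr2 normrM ler_piMl//.
  by rewrite ger0_norm ?gauss_ge0// gauss_le1.
have g2E (x : X d) : gauss (y - vec x) ^+ 2 = g2 (- y + 1 *: vec x).
  by rewrite /g2 -gaussN opprB scale1r addrC.
have ig2 : rintegrable (mu d) (fun x => gauss (y - vec x) ^+ 2).
  have := rintegrable_rapid hp (continuous_comp2 (@continuous_affine _ _ (- y) 1) cg2) (rapid_affine hp (- y) ltr01 rg2).
  by congr rintegrable; apply/funext => x; rewrite g2E.
rewrite cintZ.
  have -> : cint (mu d) (fun x => (gauss (y - vec x) ^+ 2)%:C) = (gauss_sqr_mass d)%:C.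
    apply: ceq => /=; last by rewrite /Rintegral integral0.
    have := Rint_affine hp (- y) ltr01 cg2 rg2; rewrite expr1n invr1 mul1r => E2.
    rewrite -[RHS]/(\int[mu d]_(x in setT) g2 (vec x)) -E2.
    by apply: eq_Rintegral => x _; exact: g2E.
  by rewrite -[RHS](mul1r (f y)) -(kappa_mul d) !real_complexM; ring.
have mg2 : measurable_fun setT (fun x : X d => gauss (y - vec x) ^+ 2).
  by have /measurable_int/measurable_EFinP := ig2.
apply: (cintegrable_dom (cmeas_real mg2) ig2).
by move=> x; rewrite cabsR ger0_norm// exprn_ge0// gauss_ge0.
Qed.

(** For an integrable V, as for embedded or damped functionals, Fubini's theorem moves g outside:
    [pull A V] becomes integration against the superposition of conjugate packets evaluated at A
    x. *)
Lemma pull_swap m (A : 'M[R]_(d, m)) (V : phase d -> R[i]) (g : 'cV[R]_m -> R[i]) (w : X d * X d -> R) :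
  ccont g -> crapid g -> cmeas (fun t => V (phase_vec t)) -> rintegrable (phase_mu d) w ->
  (forall t, cabs (V (phase_vec t)) <= w t) ->
  pull A V g = (kappa d)%:C * cint (mu m) (fun x => g (vec x) *
    cint (phase_mu d) (fun t => V (phase_vec t) * conjc (wave_packet (phase_vec t) (A *m vec x)))).
Proof.
move=> cg [C [e [C0 e0 gC]]] mV iw Vw.
pose F (y : (X d * X d) * X m) : R[i] := V (phase_vec y.1) *
  (g (vec y.2) * (gauss (A *m vec y.2 - (phase_vec y.1).1))%:C *
   cis (dotp (vec y.2) (A^T *m (phase_vec y.1).2))).
have mA : mcoord (fun t : X d * X d => A^T *m (phase_vec t).2).
  move=> j; have mj : measurable_fun setT (fun t : X d * X d => (A^T *m vec t.2 - 0) j 0).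
    apply: (measurable_continuous (f := fun v : 'cV[R]_d => (A^T *m v - 0) j 0) _ (@mphase_vec R d).2).
    exact: (continuous_comp2 (@continuous_mulmx_sub R _ _ A^T 0) (@coord_continuous _ _ _ j 0)).
  by under eq_fun do rewrite -[A^T *m _]subr0.
have mF : cmeas F.
  apply: cmeasM; last exact: cmeas_kern_term cg (@mphase_vec R d).1 mA.
  by split; [exact: (measurableT_comp mV.1 measurable_fst)|exact: (measurableT_comp mV.2 measurable_fst)].
have ig := rintegrableZ C (rintegrable_qv hp m e0).
have Fle t x : cabs (F (t, x)) <= w t * (C * expR (- (e * qv (vec x)))).
  rewrite cabsM; apply: ler_pM; rewrite ?cabs_ge0//.
  exact: le_trans (kern_term_le _ _ _ _ _) (gC _).
have [_ E1 E2] := cint_fubini mF iw ig Fle.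
have iV : cintegrable (phase_mu d) (fun t => V (phase_vec t)) by exact: cintegrable_dom mV iw Vw.
rewrite /pull.
transitivity ((kappa d)%:C * cint (phase_mu d \x mu m)%E F).
  rewrite E1; congr (_ * _); apply: eq_cint => t; rewrite /F /= /kern cintZ//.
  by apply: (kern_integrable htheta) => //; exists C, e.
have inner x : cint (phase_mu d) (fun t => F (t, x)) = g (vec x) *
    cint (phase_mu d) (fun t => V (phase_vec t) * conjc (wave_packet (phase_vec t) (A *m vec x))).
  rewrite -cintZ.
    apply: eq_cint => t; rewrite wave_packet_gauss conjcM cisN conjcK conjcR dotp_mulmx /F /=; ring.
  apply: cintegrable_dom (_ : cmeas _) iw _.
    by apply: cmeasM mV (cmeas_conj _); exact: cmeas_wave_packet (@mphase_vec R d).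
  move=> t; rewrite cabsM cabs_conj; apply: le_trans (ler_piMr (cabs_ge0 _) (wave_packet_le1 _ _)) (Vw t).
by rewrite E2; under eq_cint do rewrite inner.
Qed.

End inversion.

(** * Embedded functions, reconstruction, and damping *)

Section embeddings.
Context {R : realType} (theta : R) (htheta : 2^-1 <= theta < 1) (d : nat).
Local Notation p := (theta^-1).
Local Notation qv := (qv p).
Local Notation mu n := (vs_mu (@lebv R n)).
Local Notation vec := (@vs_vec R _ (lebv _)).
Local Notation X := (@lebv R).
Local Notation phase n := ('cV[R]_n * 'cV[R]_n)%type.
Local Notation qz := (@qz R theta _).
Local Notation crapid := (crapid p).
Local Notation phase_mu := (phase_mu (R := R)).
Local Notation phase_vec := (phase_vec (R := R)).
Local Notation transform := (transform htheta).
Local Notation packet := (packet htheta).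
Let hp := inv_theta_bounds htheta.

Lemma gs_product n (f g : gs theta n) : ccont (fun x => f x * g x) /\ crapid (fun x => f x * g x).
Proof.
have [cf rf] := gs_rapid htheta f; have [cg rg] := gs_rapid htheta g.
split; first exact: ccontM.
have [C [e [C0 e0 fC]]] := rf; have [C1 [e1 [C10 e10 gC]]] := rg.
exists (C * C1), e; split; [exact: mulr_ge0|by []|move=> x].
rewrite cabsM -mulrA [C1 * _]mulrC mulrA; apply: ler_pM; rewrite ?cabs_ge0//.
apply: le_trans (gC x) _; rewrite ler_piMr// -expR0 ler_expR oppr_le0.
by rewrite mulr_ge0 ?qv_ge0// ltW.
Qed.

Lemma pull_embed m (A : 'M[R]_(d, m)) (V : phase d -> R[i]) (F g : gs theta m) (w : X d * X d -> R) :
  cmeas (fun t => V (phase_vec t)) -> rintegrable (phase_mu d) w ->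
  (forall t, cabs (V (phase_vec t)) <= w t) ->
  (forall x, F x = (kappa d)%:C * cint (phase_mu d)
     (fun t => V (phase_vec t) * conjc (wave_packet (phase_vec t) (A *m x)))) ->
  pull A V g = cintegralRd (fun x => F x * g x).
Proof.
move=> mV wi Vw HF; have [cg rg] := gs_rapid htheta g.
rewrite (pull_swap htheta A cg rg mV wi Vw).
have [cFg rFg] := gs_product F g.
rewrite (cintegralRd_lebv hp cFg rFg).
have i := cintegrable_crapid hp cFg rFg.
have kM := kappa_mul htheta d; set Mg : R[i] := (_ * _)%:C in kM.
rewrite -[RHS]mul1r -kM -mulrA -[X in _ = _ * X](cintZ _ i); congr (_ * _).
apply: eq_cint => x; rewrite HF; set J := cint _ _.
by transitivity (1 * (g (vec x) * J)); [rewrite mul1r|rewrite -kM; ring].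
Qed.

Lemma transform_embedding (f : gs theta d) (u : gs_dual theta d) z : is_embedding f u ->
  transform u z = kern 1%:M f z.1 (- z.2).
Proof.
move=> fu; rewrite -[LHS]/(u (packet z)) fu; have [cF rF] := gs_product f (packet z).
rewrite (cintegralRd_lebv hp cF rF); apply: eq_cint => x.
by rewrite /= wave_packet_gauss mul1mx mulrA dotpNr.
Qed.

(** The transform of f is [kern] of f at (z.1, - z.2), that is, the conjugate of [kern] of the
    conjugate of f. Conjugating the inversion formula at A x writes f (A x) as the superposition
    that [pull_embed] asks for. *)
Lemma pull_embedding m (A : 'M[R]_(d, m)) (f : gs theta d) (fA g : gs theta m) (u : gs_dual theta d) :
  is_embedding f u -> (forall x, fA x = f (A *m x)) ->
  pull A (transform u) g = cintegralRd (fun x => fA x * g x).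
Proof.
move=> fu HfA; have kf := kern_rapid_gs htheta f.
have [cf rf [C [e [C0 e0 H]]]] := kf.
have qE (z : phase d) : qv z.1 + qv (- z.2) = qz z by rewrite qvN.
apply: (@pull_embed _ A _ _ _ (fun t => C * expR (- (e * qz (phase_vec t))))).
- exact: cmeas_transform (@mphase_vec R d).
- by apply: rintegrableZ; exact: rintegrable_qz.
- by move=> t; rewrite (transform_embedding _ fu) -qE; exact: H.
move=> x; rewrite HfA -[LHS]conjcK -(packet_inversion htheta (A *m x) (kern_rapid_conj htheta kf)).
rewrite conjcM conjcR -cint_conj.
  congr (_ * _); apply: eq_cint => t; rewrite conjcM (kern_conj htheta _ _ cf rf) conjcK.
  by rewrite -(transform_embedding _ fu).
have [_ _ [C1 [e1 [C10 e10 H1]]]] := kern_rapid_conj htheta kf.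
apply: (cintegrable_dom _ (rintegrableZ C1 (rintegrable_qz htheta d e10))) => [|t].
  apply: cmeasM; last exact: (cmeas_wave_packet htheta _ (@mphase_vec R d)).
  apply: (cmeas_kern htheta 1%:M _ _ (@mphase_vec R d).1 (@mphase_vec R d).2).
    exact: ccont_conj.
  by have [_ r _] := kern_rapid_conj htheta kf.
rewrite cabsM; exact: le_trans (ler_piMr (cabs_ge0 _) (wave_packet_le1 _ _)) (H1 _ _).
Qed.

(** The inversion formula writes the test function g as a superposition of packets; u is applied
    under the integral. *)
Lemma reconstruction (u : gs_dual theta d) (g : gs theta d) :
  u g = pull 1%:M (transform u) g.
Proof.
have kg := kern_rapid_gs htheta g; have [cg rg [C [e [C0 e0 H]]]] := kg.
pose phi (t : X d * X d) := (kappa d)%:C * kern 1%:M g (phase_vec t).1 (phase_vec t).2.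
have mk : cmeas (fun t : X d * X d => kern 1%:M g (phase_vec t).1 (phase_vec t).2).
  exact: (cmeas_kern htheta 1%:M cg rg (@mphase_vec R d).1 (@mphase_vec R d).2).
have mphi : cmeas phi by exact: cmeasM (cmeas_cst _) mk.
(* The exponent 5 k required by [pairing_superposition] is then e / 2, half of the decay of the
   kernel. *)
pose k := e / 10; have k0 : 0 < k by rewrite divr_gt0.
have e20 : 0 < e / 2 by rewrite divr_gt0.
have phii : rintegrable (phase_mu d) (fun t => cabs (phi t) * expR (5 * k * qz (phase_vec t))).
  apply: (rintegrable_dom _ (rintegrableZ (`|kappa d| * C) (rintegrable_qz htheta d e20))) => [|t].
    apply: measurable_funM; first exact: measurable_cabs.
    apply: measurableT_comp => //; apply: measurable_funM => //.
    exact: measurable_qz (@mphase_vec R d).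
  rewrite ger0_norm ?mulr_ge0 ?cabs_ge0 ?expR_ge0// /phi cabsM cabsR -!mulrA ler_wpM2l//.
  apply: le_trans (ler_wpM2r (expR_ge0 _) (H _ _)) _.
  rewrite -mulrA ler_wpM2l// -expRD ler_expR -[qv _ + qv _]/(qz (phase_vec t)) /k.
  by rewrite le_eqVlt; apply/orP; left; apply/eqP; field.
have gphi x : g x = cint (phase_mu d) (fun t => phi t * wave_packet (phase_vec t) x).
  rewrite -[LHS](packet_inversion htheta x kg) -cintZ.
    by apply: eq_cint => t; rewrite mulrA.
  apply: (cintegrable_dom _ (rintegrableZ C (rintegrable_qz htheta d e0))) => [|t].
    by apply: cmeasM mk _; exact: (cmeas_wave_packet htheta _ (@mphase_vec R d)).
  by rewrite cabsM; exact: le_trans (ler_piMr (cabs_ge0 _) (wave_packet_le1 _ _)) (H _ _).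
rewrite (pairing_superposition htheta k0 mphi (@mphase_vec R d) phii u gphi) /pull -cintZ.
  by apply: eq_cint => t; rewrite trmx1 mul1mx /phi; ring.
have [C1 C10 [H1 _]] := transform_bounds htheta u e20.
apply: (cintegrable_dom _ (rintegrableZ (C1 * C) (rintegrable_qz htheta d e20))) => [|t].
  apply: cmeasM; first exact: cmeas_transform (@mphase_vec R d).
  by under [X in cmeas X]eq_fun do rewrite trmx1 mul1mx.
rewrite trmx1 mul1mx cabsM.
apply: le_trans (ler_pM (cabs_ge0 _) (cabs_ge0 _) (H1 _) (H _ _)) _.
rewrite mulrACA ler_wpM2l ?mulr_ge0// -expRD ler_expR -[qv _ + qv _]/(qz (phase_vec t)).
by rewrite le_eqVlt; apply/orP; left; apply/eqP; field.
Qed.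

Definition damped (u : gs_dual theta d) (k : nat) z : R[i] :=
  transform u z * (expR (- (k.+1%:R^-1 * qz z)))%:C.

Lemma cmeas_damped u k : cmeas (fun t => damped u k (phase_vec t)).
Proof.
apply: cmeasM; first exact: cmeas_transform (@mphase_vec R d).
apply: cmeas_real; apply: measurableT_comp => //; apply: measurableT_comp => //.
by apply: measurable_funM => //; exact: measurable_qz (@mphase_vec R d).
Qed.

Lemma damped_le u k z : cabs (damped u k z) <= cabs (transform u z).
Proof.
rewrite cabsM ler_piMr ?cabs_ge0// cabsR ger0_norm ?expR_ge0// -expR0 ler_expR oppr_le0.
by rewrite mulr_ge0 ?qz_ge0.
Qed.

Lemma damped_diff_le u k z : cabs (damped u k z - transform u z) <= cabs (transform u z).
Proof.
rewrite /damped -[X in _ - X]mulr1 -mulrBr cabsM ler_piMr ?cabs_ge0//.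
rewrite -(@rmorph1 _ _ (real_complex R)) -rmorphB cabsR.
have h : 0 <= k.+1%:R^-1 * qz z by rewrite mulr_ge0 ?qz_ge0.
have := expR_ge0 (- (k.+1%:R^-1 * qz z)).
have : expR (- (k.+1%:R^-1 * qz z)) <= 1 by rewrite -[leRHS]expR0 ler_expR oppr_le0.
by move=> h1 h2; rewrite ler_norml; apply/andP; split; lra.
Qed.

Lemma damped_cvg u z : cabs (damped u k z - transform u z) @[k --> \oo] --> (0 : R).
Proof.
have E k : cabs (damped u k z - transform u z) =
    cabs (transform u z) * `|expR (- (k.+1%:R^-1 * qz z)) - 1|.
  rewrite /damped -[X in _ - X]mulr1 -mulrBr cabsM.
  by rewrite -(@rmorph1 _ _ (real_complex R)) -rmorphB cabsR.
rewrite (_ : (fun k => _) = (fun k => cabs (transform u z) * `|expR (- (k.+1%:R^-1 * qz z)) - 1|)); last exact/funext.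
have h1 : - (k.+1%:R^-1 * qz z) @[k --> \oo] --> (- (0 * qz z) : R).
  by apply: cvgN; apply: cvgM; [exact: cvg_harmonic|exact: cvg_cst].
have h2 : expR (- (k.+1%:R^-1 * qz z)) @[k --> \oo] --> expR (- (0 * qz z)).
  exact: continuous_cvg (@continuous_expR R _) h1.
have h3 : `|expR (- (k.+1%:R^-1 * qz z)) - 1| @[k --> \oo] --> `|expR (- (0 * qz z)) - 1|.
  by apply: cvg_norm; apply: cvgB => //; exact: cvg_cst.
have := cvgM (cvg_cst (cabs (transform u z))) h3.
by rewrite mul0r oppr0 expR0 subrr normr0 mulr0 => h; exact: h.
Qed.

(** The conjugate of the packet at (x', xi) is the packet at (x', - xi). With damped, hence rapidly
    decreasing, coefficients the reconstruction is therefore itself a superposition in the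
    Gelfand-Shilov space. *)
Lemma damped_embedding u k : exists f : gs theta d, forall v : gs_dual theta d,
  (forall g, v g = pull 1%:M (damped u k) g) -> is_embedding f v.
Proof.
(* One half of the damping rate absorbs the growth of the transform; the other half is left as
   decay. *)
have [e [e0 eE]] : exists e : R, 0 < e /\ k.+1%:R^-1 = 2 * e.
  by exists (k.+1%:R^-1 / 2); split; [rewrite divr_gt0|field; rewrite nat1r].
have [C C0 [H _]] := transform_bounds htheta u e0.
have dl t : cabs (damped u k (phase_vec t)) <= C * expR (- (e * qz (phase_vec t))).
  rewrite cabsM cabsR ger0_norm ?expR_ge0//; apply: le_trans (ler_wpM2r (expR_ge0 _) (H _)) _.
  by rewrite -mulrA ler_wpM2l// -expRD ler_expR eE; lra.
pose phi (t : X d * X d) := (kappa d)%:C * damped u k (phase_vec t).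
pose z (t : X d * X d) : phase d := ((phase_vec t).1, - (phase_vec t).2).
have mz : mphase z.
  have [m1 m2] := @mphase_vec R d; split=> // j.
  by under eq_fun do rewrite mxE; apply: measurableT_comp => //; exact: m2.
have mphi : cmeas phi by exact: cmeasM (cmeas_cst _) (cmeas_damped u k).
have e20 : 0 < e / 2 by rewrite divr_gt0.
have qzE t : qz (z t) = qz (phase_vec t) by rewrite /qz qvN.
have phii : rintegrable (phase_mu d) (fun t => cabs (phi t) * expR (e / 2 * qz (z t))).
  apply: (rintegrable_dom _ (rintegrableZ (`|kappa d| * C) (rintegrable_qz htheta d e20))) => [|t].
    apply: measurable_funM; first exact: measurable_cabs.
    under eq_fun do rewrite qzE.
    by apply: measurableT_comp => //; apply: measurable_funM => //; exact: measurable_qz (@mphase_vec R d).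
  rewrite ger0_norm ?mulr_ge0 ?cabs_ge0 ?expR_ge0// /phi cabsM cabsR -!mulrA ler_wpM2l//.
  apply: le_trans (ler_wpM2r (expR_ge0 _) (dl _)) _.
  rewrite -mulrA ler_wpM2l// -expRD ler_expR qzE.
  by lra.
have [f [Hf _]] := superposition htheta e20 mphi mz phii.
exists f => v Hv g; rewrite Hv.
apply: (pull_embed _ (cmeas_damped u k) (rintegrableZ C (rintegrable_qz htheta d e0)) dl) => x.
rewrite Hf -cintZ.
  apply: eq_cint => t; rewrite /phi -mulrA mul1mx; congr (_ * (_ * _)).
  by rewrite !wave_packet_gauss conjcM conjcR -cisN opprK dotpNr opprK.
apply: (cintegrable_dom _ (rintegrableZ C (rintegrable_qz htheta d e0))) => [|t].
  apply: cmeasM (cmeas_damped u k) (cmeas_conj _).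
  exact: (cmeas_wave_packet htheta _ (@mphase_vec R d)).
by rewrite cabsM cabs_conj; exact: le_trans (ler_piMr (cabs_ge0 _) (wave_packet_le1 _ _)) (dl t).
Qed.

End embeddings.

(** * Wave front sets, continuity, density, and the theorem *)

Section wave_front_sets.
Context {R : realType} (theta : R) (htheta : 2^-1 <= theta < 1).
Local Notation p := (theta^-1).
Local Notation phase n := ('cV[R]_n * 'cV[R]_n)%type.
Local Notation qz := (@qz R theta _).
Local Notation packet := (packet htheta).
Local Notation transform := (transform htheta).
Let hp := inv_theta_bounds htheta.

Lemma decay_weight_le n (e : R) (z : phase n) : 0 < e ->
  decay_weight theta e z <= expR (- (e / n.+1%:R * qz z)).
Proof.
move=> e0; rewrite ler_expR lerN2 mulrAC ler_pdivrMr// -mulrA ler_pM2l// /qz mulrDl.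
by apply: lerD; rewrite mulrC; exact: qv_le_enorm.
Qed.

Lemma decay_weight_ge n (e : R) (z : phase n) : 0 < e ->
  expR (- (e * qz z)) <= decay_weight theta (e / n.+1%:R ^+ 2) z.
Proof.
move=> e0; rewrite ler_expR lerN2 mulrAC ler_pdivrMr ?exprn_gt0// -mulrA ler_pM2l// /qz mulrDl.
by apply: lerD; rewrite mulrC; exact: enorm_le_qv.
Qed.

Lemma transform_decays n (u : gs_dual theta n) (G : set (phase n)) : WF u `<=` G ->
  forall z, z <> 0 -> ~ G z -> decays theta (fun _ : unit => transform u) z.
Proof.
move=> uG z z0 nGz.
have [H|H] := pselect (exists G : set (phase n), [/\ open G, conic G, G z &
      exists C eps : R, [/\ 0 < C, 0 < eps & forall z, G z ->
        cabs (pairing u (wave_packet z)) <= C * decay_weight theta eps z]]); last first.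
  by case: nGz; apply: uG.
have [L [oL cL Lz [C [e [C0 e0 h]]]]] := H.
exists L; split=> //; first exact: open_nbhs_nbhs.
exists C, (e / n.+1%:R); split=> //; first exact: divr_gt0.
move=> _ w Lw; rewrite -pairing_packet; apply: le_trans (h w Lw) _.
by rewrite ler_pM2l// decay_weight_le.
Qed.

Lemma WF_sub n (u : gs_dual theta n) (G : set (phase n)) :
  (forall w, w <> 0 -> ~ G w -> exists L : set (phase n), [/\ open L, conic L, L w &
    exists C e : R, [/\ 0 < C, 0 < e &
      forall z, L z -> cabs (transform u z) <= C * expR (- (e * qz z))]]) -> WF u `<=` G.
Proof.
move=> H w [w0 nw]; apply: contrapT => nG; apply: nw.
have [L [oL cL Lw [C [e [C0 e0 h]]]]] := H w w0 nG.
exists L; split=> //; exists C, (e / n.+1%:R ^+ 2); split=> //; first by rewrite divr_gt0 ?exprn_gt0.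
move=> z Lz; rewrite pairing_packet; apply: le_trans (h z Lz) _.
by rewrite ler_pM2l// decay_weight_ge.
Qed.

Lemma cvg_bounded (a : nat -> R[i]) b : cabs (a n - b) @[n --> \oo] --> (0 : R) ->
  exists B : R, forall n, cabs (a n) <= B.
Proof.
move=> /cvgr0Pnorm_le/(_ _ ltr01)[N _ hN].
have s0 : 0 <= \sum_(i < N) cabs (a i) by apply: sumr_ge0 => i _; exact: cabs_ge0.
have b0 := cabs_ge0 b.
exists (\sum_(i < N) cabs (a i) + cabs b + 1) => n; have [nN|Nn] := ltnP n N.
  rewrite (bigD1 (Ordinal nN))//= -!addrA lerDl addr_ge0 ?addr_ge0//.
  by apply: sumr_ge0 => i _; exact: cabs_ge0.
have h : cabs (a n - b) <= 1 by have := hN n Nn; rewrite /= ger0_norm ?cabs_ge0.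
have h1 : cabs (a n) <= cabs (a n - b) + cabs b by have := cabs_trans b (a n) 0; rewrite !subr0.
lra.
Qed.

Section pull_back.
Variables (m d : nat) (A : 'M[R]_(d, m)) (G : set (phase d)).
Hypotheses (conicG : conic G) (injA : forall x : 'cV[R]_m, A *m x = 0 -> x = 0)
  (hGA : G `&` [set z | z.1 = 0 /\ A^T *m z.2 = 0] = set0).

Lemma pull_WF_exists (V : phase d -> R[i]) : cmeas (fun t => V (@phase_vec R d t)) ->
  (forall k : R, 0 < k -> exists C : R, forall z, cabs (V z) <= C * expR (k * qz z)) ->
  (forall z, z <> 0 -> ~ G z -> decays theta (fun _ : unit => V) z) ->
  exists v : gs_dual_WF theta (pullback_cone A G), forall g, sval v g = pull A V g.
Proof.
move=> mV gV dV.
have gV1 k : 0 < k -> exists C : R, forall (_ : unit) z, cabs (V z) <= C * expR (k * qz z).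
  by move=> /gV[C h]; exists C.
have [v Hv] := pull_dual htheta (fun _ : unit => mV) gV1 dV hGA tt.
have vWF : WF v `<=` pullback_cone A G.
  apply: WF_sub => w w0 nw.
  have [L [oL cL Lw [C [e [C0 e0 h]]]]] := pull_packet htheta (fun _ : unit => mV) gV1 dV hGA injA conicG w0 nw.
  exists L; split=> //; exists C, e; split=> // z Lz.
  by rewrite -[transform v z]/(v (packet z)) Hv; exact: h tt z Lz.
by exists (exist _ v vWF).
Qed.

(** [D n] stands for the difference of two transforms, undamped or damped; the lemma thus serves
    both continuity of the extension and density of embedded functions. *)
Lemma pull_WF_cvg (v_ : nat -> gs_dual_WF theta (pullback_cone A G))
    (v : gs_dual_WF theta (pullback_cone A G)) (D : nat -> phase d -> R[i]) :
  (forall n g, sval (v_ n) g - sval v g = pull A (D n) g) ->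
  (forall n, cmeas (fun t => D n (@phase_vec R d t))) ->
  (forall k : R, 0 < k -> exists C : R, forall n z, cabs (D n z) <= C * expR (k * qz z)) ->
  (forall z, z <> 0 -> ~ G z -> decays theta D z) ->
  (forall z, cabs (D n z) @[n --> \oo] --> (0 : R)) ->
  gs_dual_WF_cvg v_ v.
Proof.
move=> vD mD gD dD D0; split=> [g|w w0 nw].
  by under eq_fun do rewrite vD; exact: (pull_cvg0 htheta mD gD dD hGA g D0).
have [L [oL cL Lw [C [e [C0 e0 h]]]]] := pull_packet htheta mD gD dD hGA injA conicG w0 nw.
exists L; split=> //; first exact: open_nbhs_nbhs.
exists C, (e / m.+1%:R ^+ 2); split=> //; first by rewrite divr_gt0 ?exprn_gt0.
move=> n z Lz; rewrite !pairing_packet -[transform _ z]/(sval (v_ n) (packet z)).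
rewrite -[transform _ z]/(sval v (packet z)) vD; apply: le_trans (h n z Lz) _.
by rewrite ler_pM2l// decay_weight_ge.
Qed.

Lemma pull_sub (U V : phase d -> R[i]) (g : gs theta m) :
  cmeas (fun t => U (@phase_vec R d t)) -> cmeas (fun t => V (@phase_vec R d t)) ->
  (forall k : R, 0 < k -> exists C : R, forall z, cabs (U z) <= C * expR (k * qz z)) ->
  (forall k : R, 0 < k -> exists C : R, forall z, cabs (V z) <= C * expR (k * qz z)) ->
  (forall z, z <> 0 -> ~ G z -> decays theta (fun _ : unit => U) z) ->
  (forall z, z <> 0 -> ~ G z -> decays theta (fun _ : unit => V) z) ->
  pull A U g - pull A V g = pull A (fun z => U z - V z) g.
Proof.
move=> mU mV gU gV dU dV.
have gU1 k : 0 < k -> exists C : R, forall (_ : unit) z, cabs (U z) <= C * expR (k * qz z).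
  by move=> /gU[C h]; exists C.
have gV1 k : 0 < k -> exists C : R, forall (_ : unit) z, cabs (V z) <= C * expR (k * qz z).
  by move=> /gV[C h]; exists C.
have iU := pull_integrable htheta (fun _ : unit => mU) gU1 dU hGA tt g.
have iV := pull_integrable htheta (fun _ : unit => mV) gV1 dV hGA tt g.
rewrite /pull -mulrBr -cintB//; congr (_ * _); apply: eq_cint => t.
by rewrite mulrBl.
Qed.

Lemma transform_growth n (u : gs_dual theta n) k : 0 < k ->
  exists C : R, forall z, cabs (transform u z) <= C * expR (k * qz z).
Proof. by move=> k0; have [C _ [h _]] := transform_bounds htheta u k0; exists C. Qed.

(** Weak convergence makes the sequence pointwise bounded, so [transform_ubound] gives the uniform
    growth; decay off G is part of the notion of convergence, and pairing with packets gives
    pointwise convergence of the transforms. *)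
Lemma pull_transform_cvg (u_ : nat -> gs_dual_WF theta G) (u : gs_dual_WF theta G)
    (v_ : nat -> gs_dual_WF theta (pullback_cone A G)) (v : gs_dual_WF theta (pullback_cone A G)) :
  gs_dual_WF_cvg u_ u ->
  (forall n g, sval (v_ n) g = pull A (transform (sval (u_ n))) g) ->
  (forall g, sval v g = pull A (transform (sval u)) g) -> gs_dual_WF_cvg v_ v.
Proof.
move=> [uw uc] Hv_ Hv.
apply: (@pull_WF_cvg _ _ (fun n z => transform (sval (u_ n)) z - transform (sval u) z)).
- move=> n g; rewrite Hv_ Hv; apply: pull_sub.
  + exact: cmeas_transform (@mphase_vec R d).
  + exact: cmeas_transform (@mphase_vec R d).
  + exact: transform_growth.
  + exact: transform_growth.
  + exact: transform_decays (svalP (u_ n)).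
  + exact: transform_decays (svalP u).
- by move=> n; apply: cmeasB; exact: cmeas_transform (@mphase_vec R d).
- move=> k k0.
  have [C1 C10 h1] := transform_ubound htheta (fun f => cvg_bounded (uw f)) k0.
  have [C2 h2] := transform_growth (sval u) k0.
  exists (C1 + C2) => n z; apply: le_trans (cabsB _ _) _; rewrite mulrDl.
  by apply: lerD; [exact: h1|exact: h2].
- move=> z z0 nG; have [L [cL Lz [C [e [C0 e0 h]]]]] := uc z z0 nG.
  exists L; split=> //; exists C, (e / d.+1%:R); split=> //; first exact: divr_gt0.
  move=> n w Lw; rewrite -!pairing_packet; apply: le_trans (h n w Lw) _.
  by rewrite ler_pM2l// decay_weight_le.
- by move=> z; exact: uw (packet z).
Qed.

End pull_back.

Lemma pullback_cone1 n (G : set (phase n)) : pullback_cone 1%:M G = G.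
Proof.
apply/seteqP; split=> [_ [x [xi [Gx ->]]]|[x xi] Gx].
  by rewrite mul1mx in Gx; rewrite trmx1 mul1mx.
by exists x, xi; rewrite trmx1 !mul1mx.
Qed.

(** The damped transforms are pulled back along the identity matrix. Damping by a factor between 0
    and 1 keeps every bound of the transform, so growth and decay off G hold uniformly in the
    damping parameter. *)
Lemma embeddings_dense n (G : set (phase n)) (u : gs_dual_WF theta G) : conic G ->
  exists (f : nat -> gs theta n) (u_ : nat -> gs_dual_WF theta G),
    (forall k, is_embedding (f k) (sval (u_ k))) /\ gs_dual_WF_cvg u_ u.
Proof.
move=> cG; have inj1 (x : 'cV[R]_n) : (1%:M : 'M[R]_n) *m x = 0 -> x = 0 by rewrite mul1mx.
have hG1 : G `&` [set z | z.1 = 0 /\ (1%:M : 'M[R]_n)^T *m z.2 = 0] = set0.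
  apply/seteqP; split=> // -[x xi] [Gx /= []]; rewrite trmx1 mul1mx => x0 xi0.
  by apply: cG.1; rewrite x0 xi0 in Gx.
have gd k r : 0 < r -> exists C : R, forall z, cabs (damped htheta (sval u) k z) <= C * expR (r * qz z).
  move=> /(transform_growth (sval u))[C h]; exists C => z.
  exact: le_trans (damped_le _ _ _ _) (h z).
have dd k z : z <> 0 -> ~ G z -> decays theta (fun _ : unit => damped htheta (sval u) k) z.
  move=> z0 nG; have [L [cL Lz [C [e [C0 e0 h]]]]] := transform_decays (svalP u) z0 nG.
  exists L; split=> //; exists C, e; split=> // -[] w Lw.
  exact: le_trans (damped_le _ _ _ _) (h tt w Lw).
have [f Hf] := choice (damped_embedding htheta (sval u)).
have ex k : exists v : gs_dual_WF theta (pullback_cone 1%:M G),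
    forall g, sval v g = pull 1%:M (damped htheta (sval u) k) g.
  exact: (pull_WF_exists cG inj1 hG1 (cmeas_damped htheta (sval u) k) (gd k) (dd k)).
rewrite pullback_cone1 in ex.
have [u_ Hu] := choice ex; exists f, u_; split=> [k|]; first exact: Hf (Hu k).
(* The type of the sequence depends on the cone; generalizing G allows it to be replaced by its
   equal, the pull-back of G along the identity. *)
suff H (G' : set (phase n)) (w_ : nat -> gs_dual_WF theta G') (w : gs_dual_WF theta G') :
    G' = pullback_cone 1%:M G -> (forall k g, sval (w_ k) g = pull 1%:M (damped htheta (sval u) k) g) ->
    (forall g, sval w g = pull 1%:M (transform (sval u)) g) -> gs_dual_WF_cvg w_ w.
  apply: H Hu _; first by rewrite pullback_cone1.
  by move=> g; exact: reconstruction.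
move=> E; rewrite E in w_ w *; move=> Hw_ Hw.
apply: (pull_WF_cvg cG inj1 hG1 (D := fun k z => damped htheta (sval u) k z - transform (sval u) z)).
- move=> k g; rewrite Hw_ Hw; apply: (pull_sub hG1).
  + exact: cmeas_damped.
  + exact: cmeas_transform (@mphase_vec R n).
  + exact: gd.
  + exact: transform_growth.
  + exact: dd.
  + exact: transform_decays (svalP u).
- by move=> k; apply: cmeasB; [exact: cmeas_damped|exact: cmeas_transform (@mphase_vec R n)].
- move=> r /(transform_growth (sval u))[C h]; exists C => k z.
  exact: le_trans (damped_diff_le _ _ _ _) (h z).
- move=> z z0 nG; have [L [cL Lz [C [e [C0 e0 h]]]]] := transform_decays (svalP u) z0 nG.
  exists L; split=> //; exists C, e; split=> // k w' Lw.
  exact: le_trans (damped_diff_le _ _ _ _) (h tt w' Lw).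
- by move=> z; exact: damped_cvg.
Qed.

Lemma gs_dual_WF_ext n (G : set (phase n)) (v w : gs_dual_WF theta G) :
  (forall g, sval v g = sval w g) -> v = w.
Proof.
case: v w => [v pv] [w pw] /= /gs_dual_ext E; subst w.
by congr exist; exact: Prop_irrelevance.
Qed.

(* The wave packet at 0 composed with A is constant along the kernel of A, yet it decays. *)
Lemma pullback_injective m d (A : 'M[R]_(d, m)) (Astar : gs theta d -> gs theta m) :
  (forall (f : gs theta d) (x : 'cV[R]_m), Astar f x = f (A *m x)) ->
  forall x : 'cV[R]_m, A *m x = 0 -> x = 0.
Proof.
move=> hA x Ax0; apply: contrapT => /eqP x0.
pose g := Astar (packet 0).
have [_ [C [e [C0 e0 gC]]]] := gs_rapid htheta g.
have g1 (s : R) : 1 <= C * expR (- (e * (pw p s * qv p x))).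
  rewrite -qvZ; apply: le_trans (gC (s *: x)).
  rewrite hA /= wave_packet_gauss -scalemxAr Ax0 scaler0 subr0 cabsM cabs_cis mulr1 cabs_gauss.
  by rewrite /gauss dotp0l mul0r oppr0 expR0.
have q0 : 0 < qv p x.
  move: x0 => /matrix0Pn[i [j xij]]; rewrite (ord1 j) in xij.
  by apply: lt_le_trans (pw_le_qv p x i); rewrite /pw powR_gt0// normr_gt0.
(* Then e q(x) s = C + e q(x), so that 1 + e q(x) |s|^p exceeds C and contradicts [g1]. *)
pose s := C / (e * qv p x) + 1.
have s1 : 1 <= s by rewrite /s lerDr divr_ge0// mulr_ge0// ltW.
have := g1 s; rewrite expRN ler_pdivlMr ?expR_gt0// mul1r; apply/negP; rewrite -ltNge.
apply: lt_le_trans (expR_ge1Dx _).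
have ps : s <= pw p s.
  rewrite /pw ger0_norm; last lra.
  rewrite -[leLHS]powRr1; last lra.
  by apply: ler_powR => //; have /andP[] := hp.
have eq0 : 0 < e * qv p x by exact: mulr_gt0.
have : e * qv p x * s <= e * qv p x * pw p s by rewrite ler_pM2l.
rewrite {1}/s mulrDr mulrCA divff ?gt_eqF// !mulr1 => h.
by rewrite [pw p s * _]mulrC mulrA; lra.
Qed.

End wave_front_sets.

Unset Implicit Arguments.

Theorem theorem3p13 (R : realType) (theta : R)
  (htheta : 2^-1 <= theta < 1) (m d : nat) (A : 'M[R]_(d, m))
  (Astar : gs theta d -> gs theta m)
  (hAstar : forall (f : gs theta d) (x : 'cV[R]_m), Astar f x = f (A *m x))
  (G : set ('cV[R]_d * 'cV[R]_d)) (hG : closed_cone G)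
  (hGA : G `&` [set z | z.1 = 0 /\ A^T *m z.2 = 0] = set0) :
  exists! T : gs_dual_WF theta G -> gs_dual_WF theta (pullback_cone A G),
    WF_continuous T /\
    forall (f : gs theta d) (u : gs_dual_WF theta G),
      is_embedding f (sval u) -> is_embedding (Astar f) (sval (T u)).
Proof.
have cG := hG.1; have injA := pullback_injective htheta hAstar.
have exT (u : gs_dual_WF theta G) : exists v : gs_dual_WF theta (pullback_cone A G),
    forall g, sval v g = pull A (transform htheta (sval u)) g.
  apply: (pull_WF_exists htheta cG injA hGA).
  - exact: cmeas_transform (@mphase_vec R d).
  - exact: transform_growth.
  - exact: transform_decays (svalP u).
have [T HT] := choice exT.
(* An embedded function determines its functional, so any two extensions agree on embedded
   elements. *)
have emb_unique (f : gs theta m) (v w : gs_dual_WF theta (pullback_cone A G)) :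
    is_embedding f (sval v) -> is_embedding f (sval w) -> v = w.
  move=> fv fw; by apply: gs_dual_WF_ext => g; rewrite fv fw.
exists T; split.
  split=> [u_ u uc|f u fu g].
    exact: (pull_transform_cvg cG injA hGA uc (fun n => HT (u_ n)) (HT u)).
  by rewrite HT (pull_embedding htheta _ fu (hAstar f)).
move=> T' [cT' eT']; apply/funext => u.
(* Both maps agree along the approximating sequence and are continuous; uniqueness of weak limits
   gives agreement at u. *)
have [f [u_ [fu uc]]] := embeddings_dense htheta u cG.
have eqT k : T' (u_ k) = T (u_ k).
  apply: (emb_unique (Astar (f k))); first exact: eT'.
  by move=> g; rewrite HT (pull_embedding htheta _ (fu k) (hAstar (f k))).
have [c' _] := cT' _ _ uc.
have [c _] : gs_dual_WF_cvg (fun k => T (u_ k)) (T u).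
  exact: (pull_transform_cvg cG injA hGA uc (fun n => HT (u_ n)) (HT u)).
apply: gs_dual_WF_ext => g; apply: (ccvg_unique (c g)).
by have := c' g; under eq_fun do rewrite eqT.
Qed.
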